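(* Let $(\Omega,\mathscr{F},(\mathscr{F}_t)_{t\ge0},P)$ be a filtered probability space satisfying the usual conditions. Suppose $1\le p<\infty$ and $1\le q\le\infty$. Let $X\colon\mathbb{R}_+\times\Omega\to\mathbb{C}$ be an $L^p$ stochastic process (i.e. $X_t\in L^p(P)$ for all $t$), and write $x\colon\mathbb{R}_+\to L^p(P)$ for the map $t\mapsto X_t$. (i) If $x$ is a noncommutative $L^p$-integrator with respect to $\mathbb{M}^{q;q}$, then $X$ has a modification that is a classical $L^p$-integrator. (ii) If $X$ is a classical $L^p$-integrator such that $I_X^c[Y]=I_X^c[Z]$ whenever $Y,Z\in\mathscr{P}_{\mathrm{bct}}$ are modifications of each other, then $x$ is a noncommutative $L^p$-integrator with respect to $\mathbb{M}^{q;q}$. Furthermore, if $H\in\mathcal{I}_{\mathbb{M}^{q;q}}$, then there exists a $Y\in\mathscr{P}_{\mathrm{bct}}$ such that $H=H_Y$, and $I_x[H](t)=I_X^c[Y]_t$ for all $t\ge0$ and any such $Y$.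
   Context: Usual conditions: $(\mathscr{F}_t)$ is complete and right-continuous. A stochastic process is a map $X\colon\mathbb{R}_+\times\Omega\to\mathbb{C}$ with each $X_t$ $\mathscr{F}$-measurable. $X,Y$ are modifications of each other if $X_t=Y_t$ a.s. for each $t$; indistinguishable if a.s. $X_t=Y_t$ for all $t$. The predictable $\sigma$-algebra is generated by $\{\{0\}\times F:F\in\mathscr{F}_0\}\cup\{(s,t]\times F:0\le s<t,F\in\mathscr{F}_s\}$. $\mathscr{P}_{\mathrm{bct}}$ is the set of predictable processes $Y\colon\mathbb{R}_+\times\Omega\to\mathbb{C}$ bounded on $[0,t]\times\Omega$ for each $t$. RCLL means right-continuous with left limits. Classical $L^p$-integrator: an elementary predictable process is $Y=1_{\{0\}\times\Omega}f_0+\sum_{i=1}^k1_{(s_i,t_i]\times\Omega}f_i$ with $0\le s_i<t_i$ and $f_i$ bounded $\mathscr{F}_{s_i}$-measurable ($s_0:=0$); for it $\int_0^tY\,\mathrm{d}X:=\sum_if_i(X_{t_i\wedge t}-X_{s_i\wedge t})$. $\mathcal{R}_{a,p}$ is the space of indistinguishability classes of adapted RCLL processes $Y$ with $\big\|\sup_{s\le t}|Y_s|\big\|_{L^p(P)}<\infty$ for all $t$, with the topology of these seminorms. $X$ is a classical $L^p$-integrator if there is a (necessarily unique) map $I_X^c\colon\mathscr{P}_{\mathrm{bct}}\to\mathcal{R}_{a,p}$ with $I_X^c[Y]=\int_0^{\cdot}Y\,\mathrm{d}X$ for elementary predictable $Y$ and $I_X^c[Y^n]\to I_X^c[Y]$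 whenever $Y^n,Y\in\mathscr{P}_{\mathrm{bct}}$, $Y^n\to Y$ pointwise, and $\sup_n\sup_{[0,t]\times\Omega}|Y^n|<\infty$ for each $t$. Noncommutative side: for $y\in L^\infty(P)$, $M_y$ is multiplication by $y$. $\mathcal{M}_t^{q;q}=\{M_y:y\in L^\infty(\Omega,\mathscr{F}_t,P)\}$, $\mathbb{M}^{q;q}=(\mathcal{M}_t^{q;q})_{t\ge0}$, with norm $\|M_y\|_{q;q}=\|M_y\|_{L^q(P)\to L^q(P)}=\|y\|_\infty$; elements $M_y$ are also regarded as maps $L^p(P)\to L^p(P)\subseteq L^1(P)$. For a process $Y$ with $Y_t\in L^\infty(P)$, $H_Y(t):=M_{Y_t}$. An elementary $\mathbb{M}^{q;q}$-predictable process is $H=1_{\{0\}}T_0+\sum_{i=1}^k1_{(s_i,t_i]}T_i$ with $T_i\in\mathcal{M}_{s_i}^{q;q}$, and for it $\int_0^tH[\mathrm{d}x]:=\sum_iT_i[x(t_i\wedge t)-x(s_i\wedge t)]$. $H_n\to H$ locally boundedly if $H_n\to H$ pointwise in $\|\cdot\|_{q;q}$ and $\sup_n\sup_{s\le t}\|H_n(s)\|_{q;q}<\infty$ for all $t$. $\mathcal{I}_{\mathbb{M}^{q;q}}$ is the smallest set of locally bounded functions $\mathbb{R}_+\to\bigcup_t\mathcal{M}_t^{q;q}$ containing the elementary processes and closed under locally bounded convergence. $x$ is a noncommutative $L^p$-integrator with respect to $\mathbb{M}^{q;q}$ if there is a (necessarily unique) map $I_x\colon\mathcal{I}_{\mathbb{M}^{q;q}}\to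 R_{a,p}$ with $I_x[H]=\int_0^{\cdot}H[\mathrm{d}x]$ for elementary $H$ and $I_x[H_n]\to I_x[H]$ whenever $H_n\to H$ locally boundedly in $\mathcal{I}_{\mathbb{M}^{q;q}}$; here $R_{a,p}$ is the space of functions $Y\colon\mathbb{R}_+\to L^p(P)$ that are RCLL in $L^p$-norm with $Y(t)\in L^p(\Omega,\mathscr{F}_t,P)$, with the topology of uniform convergence on compact sets. *)

(* Defs.v *)
From HB Require Import structures.
From mathcomp Require Import all_boot all_order all_algebra.
From mathcomp Require Import complex.
From mathcomp Require Import all_classical all_reals all_analysis.
From mathcomp Require Import measurable_realfun.

Set Implicit Arguments.
Unset Strict Implicit.
Unset Printing Implicit Defensive.

Import Order.TTheory GRing.Theory Num.Theory numFieldNormedType.Exports.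

Local Open Scope classical_set_scope.
Local Open Scope ring_scope.
Local Open Scope quotient_scope.

HB.instance Definition _ (R : realType) :=
  NormedModule.copy R[i] (R[i] : numFieldType)^o.

Section complex_measurable.
Variable R : realType.

Definition ReIm (z : R[i]) : R * R := (complex.Re z, complex.Im z).

(* The Borel sets of [R[i]], transported from those of [R * R]. *)
HB.instance Definition _ :=
  Measurable.copy R[i] (g_sigma_algebra_preimageType ReIm).

Section sum_product.
Context d (T : measurableType d).
Implicit Types f g : T -> R[i].

Lemma measurable_ReIm f : measurable_fun setT f <->
  measurable_fun setT (fun w => complex.Re (f w)) /\
  measurable_fun setT (fun w => complex.Im (f w)).
Proof.
have mE : measurable_fun setT f <-> measurable_fun setT (ReIm \o f).
  split=> mf _ B mB.
    rewrite comp_preimage; apply: mf => //.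
    by exists B => //; rewrite setTI.
  case: mB => C mC <-; rewrite setTI -comp_preimage.
  exact: mf.
rewrite mE; split=> [mf|[mr mi]].
  by split; [apply: (measurableT_comp measurable_fst mf)
            |apply: (measurableT_comp measurable_snd mf)].
exact: measurable_fun_pair.
Qed.

Lemma measurable_cadd f g :
  measurable_fun setT f -> measurable_fun setT g -> measurable_fun setT (f \+ g).
Proof.
move=> /measurable_ReIm[fr fi] /measurable_ReIm[gr gi].
apply/measurable_ReIm; split.
  rewrite (_ : (fun _ => _) =
    (fun w => complex.Re (f w) + complex.Re (g w))); first exact: measurable_funD.
  by apply/funext => w /=; rewrite raddfD.
rewrite (_ : (fun _ => _) =
  (fun w => complex.Im (f w) + complex.Im (g w))); first exact: measurable_funD.
by apply/funext => w /=; rewrite raddfD.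
Qed.

Lemma measurable_copp f : measurable_fun setT f -> measurable_fun setT (\- f).
Proof.
move=> /measurable_ReIm[fr fi]; apply/measurable_ReIm; split.
  rewrite (_ : (fun _ => _) = (fun w => - complex.Re (f w))).
    exact: measurableT_comp.
  by apply/funext => w /=; rewrite raddfN.
rewrite (_ : (fun _ => _) = (fun w => - complex.Im (f w))).
  exact: measurableT_comp.
by apply/funext => w /=; rewrite raddfN.
Qed.

Lemma measurable_cmul f g :
  measurable_fun setT f -> measurable_fun setT g -> measurable_fun setT (f \* g).
Proof.
move=> /measurable_ReIm[fr fi] /measurable_ReIm[gr gi].
apply/measurable_ReIm; split.
  rewrite (_ : (fun _ => _) = (fun w => complex.Re (f w) * complex.Re (g w)
     - complex.Im (f w) * complex.Im (g w))).
    by apply: measurable_funB; apply: measurable_funM.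
  by apply/funext => w /=; case: (f w) (g w) => [a b] [c e].
rewrite (_ : (fun _ => _) = (fun w => complex.Re (f w) * complex.Im (g w)
   + complex.Im (f w) * complex.Re (g w))).
  by apply: measurable_funD; apply: measurable_funM.
by apply/funext => w /=; case: (f w) (g w) => [a b] [c e].
Qed.

End sum_product.
End complex_measurable.

Section random_variables.
Context d (T : measurableType d) (R : realType) (P : probability T R).

Definition rv_opp (f : {mfun T >-> R[i]}) : {mfun T >-> R[i]} :=
  mfun_Sub (mem_set (measurable_copp (@measurable_funPT _ _ _ _ f))).
Definition rv_add (f g : {mfun T >-> R[i]}) : {mfun T >-> R[i]} :=
  mfun_Sub (mem_set (measurable_cadd (@measurable_funPT _ _ _ _ f)
                                     (@measurable_funPT _ _ _ _ g))).
Definition rv_mul (f g : {mfun T >-> R[i]}) : {mfun T >-> R[i]} :=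
  mfun_Sub (mem_set (measurable_cmul (@measurable_funPT _ _ _ _ f)
                                     (@measurable_funPT _ _ _ _ g))).

(* Classes modulo a.s. equality of complex random variables; every [L^p(P)] is
   a subset of [L0]. *)
Definition L0 : Type := {mfun_ P, T >-> R[i]}.
HB.instance Definition _ := Choice.on L0.
HB.instance Definition _ := EqQuotient.on L0.

Definition L0_class (f : {mfun T >-> R[i]}) : L0 := \pi_L0 f.
Definition L0_zero : L0 := L0_class (cst 0).
Definition L0_opp (x : L0) : L0 := L0_class (rv_opp (repr x)).
Definition L0_add (x y : L0) : L0 := L0_class (rv_add (repr x) (repr y)).
Definition L0_mul (x y : L0) : L0 := L0_class (rv_mul (repr x) (repr y)).

Lemma L0_classP (f g : {mfun T >-> R[i]}) :
  L0_class f = L0_class g <-> {ae P, forall w, f w = g w}.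
Proof.
split=> [/eqP|fg].
  rewrite /L0_class eqmodE => /asboolP.
  by apply: filterS => w; apply.
apply/eqP; rewrite /L0_class eqmodE; apply/asboolP.
by apply: filterS fg => w ->.
Qed.

Lemma L0_reprK x : L0_class (repr x) = x. Proof. exact: reprK. Qed.

Lemma L0_repr_class f : {ae P, forall w, repr (L0_class f) w = f w}.
Proof. by apply/L0_classP; rewrite L0_reprK. Qed.

Lemma L0_addE f g : L0_add (L0_class f) (L0_class g) = L0_class (rv_add f g).
Proof.
apply/L0_classP; apply: filterS2 (L0_repr_class f) (L0_repr_class g) => w /=.
by move=> -> ->.
Qed.

Lemma L0_oppE f : L0_opp (L0_class f) = L0_class (rv_opp f).
Proof. by apply/L0_classP; apply: filterS (L0_repr_class f) => w /= ->. Qed.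

Lemma L0_mulE f g : L0_mul (L0_class f) (L0_class g) = L0_class (rv_mul f g).
Proof.
apply/L0_classP; apply: filterS2 (L0_repr_class f) (L0_repr_class g) => w /=.
by move=> -> ->.
Qed.

Let L0_addA : associative L0_add.
Proof.
move=> x y z; rewrite -(L0_reprK x) -(L0_reprK y) -(L0_reprK z) !L0_addE.
by congr L0_class; apply/mfuneqP => w /=; rewrite addrA.
Qed.

Let L0_addC : commutative L0_add.
Proof.
move=> x y; rewrite -(L0_reprK x) -(L0_reprK y) !L0_addE.
by congr L0_class; apply/mfuneqP => w /=; rewrite addrC.
Qed.

Let L0_add0 : left_id L0_zero L0_add.
Proof.
move=> x; rewrite -(L0_reprK x) L0_addE.
by congr L0_class; apply/mfuneqP => w /=; rewrite add0r.
Qed.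

Let L0_addN : left_inverse L0_zero L0_opp L0_add.
Proof.
move=> x; rewrite -(L0_reprK x) L0_oppE L0_addE.
by congr L0_class; apply/mfuneqP => w /=; rewrite addNr.
Qed.

HB.instance Definition _ :=
  GRing.isZmodule.Build L0 L0_addA L0_addC L0_add0 L0_addN.

End random_variables.

Section integrators.
Context d (T : measurableType d) (R : realType) (P : probability T R).
Variable F : {nonneg R} -> set (set T).

Local Notation time := {nonneg R}.
Local Notation L0 := (L0 P).
Local Notation normc := (@ComplexField.Normc.normc R).

Definition filtration : Prop :=
  [/\ forall t, sigma_algebra setT (F t),
      forall t, F t `<=` measurable &
      forall s t, s <= t -> F s `<=` F t].

(* [P.-negligible N] means that [N] is a subset of a measurable null set, so
   the first conjunct also makes [P] a complete measure. *)
Definition usual_conditions : Prop :=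
  [/\ filtration,
      P.-negligible `<=` F 0%:nng &
      forall t, F t = \bigcap_(s in [set s | t < s]) F s].

Definition measurable_wrt (U : Type) (G : set (set U)) (f : U -> R[i]) : Prop :=
  preimage_set_system setT f measurable `<=` <<s G>>.

Definition process := time -> {mfun T >-> R[i]}.

Definition modification (X Y : process) : Prop :=
  forall t, {ae P, forall w, X t w = Y t w}.

Definition indistinguishable (X Y : time -> T -> R[i]) : Prop :=
  {ae P, forall w, forall t, X t w = Y t w}.

Definition predictable_sets : set (set (time * T)) :=
  [set A | exists2 B, F 0%:nng B & A = [set 0%:nng] `*` B] `|`
  [set A | exists s t B,
    [/\ s < t, F s B & A = [set r | s < r <= t] `*` B]].

Definition predictable (Y : process) : Prop :=
  measurable_wrt predictable_sets (fun tw => Y tw.1 tw.2).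

Definition bounded_compact_time (Y : process) : Prop :=
  forall t, exists M : R, forall s w, s <= t -> normc (Y s w) <= M.

Definition Pbct (Y : process) : Prop :=
  predictable Y /\ bounded_compact_time Y.

(* [ef0] sits at time 0 and [ef i] on the interval ]es i, et i]. *)
Record step_data (V : Type) := StepData {
  esize : nat;
  ef0 : V;
  es : 'I_esize -> time;
  et : 'I_esize -> time;
  ef : 'I_esize -> V }.
Arguments es {V} s i : rename.
Arguments et {V} s i : rename.
Arguments ef {V} s i : rename.

(* [A t] is the set of coefficients allowed on an interval starting at [t]. *)
Definition step_admissible (V : Type) (A : time -> set V) (e : step_data V) :
    Prop :=
  A 0%:nng (ef0 e) /\
  forall i, es e i < et e i /\ A (es e i) (ef e i).

Definition step_fun (V : zmodType) (e : step_data V) (r : time) : V :=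
  (if r == 0%:nng then ef0 e else 0) +
  \sum_(i | es e i < r <= et e i) ef e i.

Definition bounded_rv (t : time) : set (T -> R[i]) :=
  [set f | measurable_wrt (F t) f /\ exists M : R, forall w, normc (f w) <= M].

Definition classical_step_integral (X : process) (e : step_data (T -> R[i]))
    (t : time) (w : T) : R[i] :=
  \sum_i ef e i w *
    (X (Num.min (et e i) t) w - X (Num.min (es e i) t) w).

(* For [s > t >= 0], or for [s] close to [t > 0], the real [s] is its own
   absolute value; [`|s|%:nng] only retypes it. *)
Definition rcll (f : time -> R[i]) : Prop :=
  (forall t : time, f (`|s|%:nng) @[s --> t%:num^'+] --> f t) /\
  (forall t : time, 0 < t%:num ->
     exists l : R[i], f (`|s|%:nng) @[s --> t%:num^'-] --> l).

Definition Lpnorm (p : \bar R) (x : L0) : \bar R :=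
  Lnorm P p (fun w => (normc (repr x w))%:E).

Definition running_sup (Y : time -> T -> R[i]) (t : time) (w : T) : \bar R :=
  ereal_sup [set (normc (Y s w))%:E | s in [set s | s <= t]].

(* The processes representing the elements of R_{a,p}, whose equality is
   [indistinguishable]. *)
Definition Rap_classical (p : \bar R) (Y : process) : Prop :=
  [/\ forall t, measurable_wrt (F t) (Y t),
      forall w, rcll (fun t => Y t w) &
      forall t, (Lnorm P p (running_sup Y t) < +oo)%E].

Definition cvg_Rap_classical (p : \bar R) (Yn : nat -> process) (Y : process) :
    Prop :=
  forall t, Lnorm P p (running_sup (fun s w => Yn n s w - Y s w) t)
    @[n --> \oo] --> 0%E.

Definition bounded_pointwise_cvg (Yn : nat -> process) (Y : process) : Prop :=
  (forall t w, Yn n t w @[n --> \oo] --> Y t w) /\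
  (forall t, exists M : R, forall n s w, s <= t -> normc (Yn n s w) <= M).

(* [I] represents the map I_X^c of the process [X]. *)
Definition classical_integral (p : \bar R) (X : process)
    (I : process -> process) : Prop :=
  [/\ forall Y, Pbct Y -> Rap_classical p (I Y),
      forall (Y : process) e, step_admissible bounded_rv e ->
        (forall t w, Y t w = step_fun e t w) ->
        indistinguishable (I Y) (classical_step_integral X e) &
      forall Yn Y, (forall n, Pbct (Yn n)) -> Pbct Y ->
        bounded_pointwise_cvg Yn Y ->
        cvg_Rap_classical p (fun n => I (Yn n)) (I Y)].

Definition classical_integrator (p : \bar R) (X : process) : Prop :=
  exists I, classical_integral p X I.

Definition Lp (p : \bar R) : set L0 := [set x | (Lpnorm p x < +oo)%E].

Definition Lp_at (p : \bar R) (t : time) : set L0 :=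
  Lp p `&` [set x | exists2 f : {mfun T >-> R[i]},
    measurable_wrt (F t) f & x = L0_class P f].

(* A multiplication operator [M_y] on L^q, and its version on L^p, are both
   restrictions of the multiplication by [y] on [L0]. *)
Definition operator : Type := L0 -> L0.

Definition mult_op (y : L0) : operator := fun x => L0_mul y x.

Definition mult_alg (t : time) : set operator := mult_op @` Lp_at +oo%E t.

Definition op_norm (q : \bar R) (A : operator) : \bar R :=
  ereal_sup [set Lpnorm q (A x) | x in [set x | (Lpnorm q x <= 1)%E]].

Definition locally_bounded_op (q : \bar R) : set (time -> operator) :=
  [set H | (forall s, exists t, mult_alg t (H s)) /\
    forall t, (ereal_sup [set op_norm q (H s) | s in [set s | s <= t]%R]
               < +oo)%E].

Definition elementary_op : set (time -> operator) :=
  [set H | exists2 e, step_admissible mult_alg e & H = step_fun e].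

Definition locally_bounded_cvg (q : \bar R) (Hn : nat -> time -> operator)
    (H : time -> operator) : Prop :=
  (forall t, op_norm q (Hn n t - H t) @[n --> \oo] --> 0%E) /\
  (forall t, (ereal_sup [set op_norm q (Hn ns.1 ns.2) |
     ns in [set ns | ns.2 <= t]%R] < +oo)%E).

Definition nc_integrands (q : \bar R) : set (time -> operator) :=
  smallest [set S | S `<=` locally_bounded_op q /\
    forall Hn H, (forall n, S (Hn n)) -> locally_bounded_op q H ->
      locally_bounded_cvg q Hn H -> S H] elementary_op.

Definition nc_step_integral (x : time -> L0) (e : step_data operator)
    (t : time) : L0 :=
  \sum_i ef e i (x (Num.min (et e i) t) - x (Num.min (es e i) t)).

Definition Rap_nc (p : \bar R) (Y : time -> L0) : Prop :=
  [/\ forall t, Lp_at p t (Y t),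
      forall t : time,
        Lpnorm p (Y (`|s|%:nng) - Y t) @[s --> t%:num^'+] --> 0%E &
      forall t : time, 0 < t%:num -> exists2 l, Lp p l &
        Lpnorm p (Y (`|s|%:nng) - l) @[s --> t%:num^'-] --> 0%E].

Definition cvg_Rap_nc (p : \bar R) (Yn : nat -> time -> L0) (Y : time -> L0) :
    Prop :=
  forall t, ereal_sup [set Lpnorm p (Yn n s - Y s) | s in [set s | s <= t]%R]
    @[n --> \oo] --> 0%E.

(* [J] represents the map I_x. *)
Definition nc_integral (p q : \bar R) (x : time -> L0)
    (J : (time -> operator) -> time -> L0) : Prop :=
  [/\ forall H, nc_integrands q H -> Rap_nc p (J H),
      forall e, step_admissible mult_alg e ->
        J (step_fun e) = nc_step_integral x e &
      forall Hn H, (forall n, nc_integrands q (Hn n)) -> nc_integrands q H ->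
        locally_bounded_cvg q Hn H ->
        cvg_Rap_nc p (fun n => J (Hn n)) (J H)].

Definition nc_integrator (p q : \bar R) (x : time -> L0) : Prop :=
  exists J, nc_integral p q x J.

Definition Lp_path (X : process) : time -> L0 := fun t => L0_class P (X t).

Definition mult_process (Y : process) : time -> operator :=
  fun t => mult_op (L0_class P (Y t)).

End integrators.

Arguments mult_process {d T R} P Y t _.

(* Main.v *)
Require Import Defs.
From HB Require Import structures.
From mathcomp Require Import all_boot all_order all_algebra.
From mathcomp Require Import complex.
From mathcomp Require Import all_classical all_reals all_analysis.
From mathcomp Require Import measurable_realfun ess_sup_inf.
From mathcomp Require Import ring lra.

Set Implicit Arguments.
Unset Strict Implicit.
Unset Printing Implicit Defensive.

Import Order.TTheory GRing.Theory Num.Theory numFieldNormedType.Exports.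

Local Open Scope classical_set_scope.
Local Open Scope ring_scope.

(** The two notions of integrator differ in the sense of convergence on each
    side: the classical one demands dominated convergence for pointwise limits
    of predictable integrands and controls the L^p norm of a running supremum,
    the noncommutative one only sees norm limits of multiplication operators
    and controls L^p norms at fixed times. The way from the second to the
    first leads through a condition that mentions elementary transforms only,
    the record [integrator]; the way back through representing operators by
    processes.

    Part (i). Let [x] be a noncommutative integrator. The integrals of
    deterministic steps show that [X - X 0] is adapted and right-continuous in
    L^p ([nc_increment]). Moreover the sums of [c_j * (X u_(j+1) - X u_j)]
    with [c_j] measurable with respect to [F (u_j)] and bounded by 1 stay
    bounded in L^p as long as the grid [u] stays in a bounded interval
    ([nc_transform_bound]): otherwise suitable multiples of the corresponding
    step operators would tend to 0 in norm while their integrals do not. Thus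
    real and imaginary part of [X - X 0] are integrators
    ([nc_real_integrator]). It remains to build from this boundedness alone a
    classical integral. Boundedness replaces sigma-additivity through
    Khintchine's inequality: if all signed sums of a sequence in L^p are
    bounded by one constant, then its square function is in L^p, so that the
    sequence tends to 0 ([pnorm_unconditional_cvg0]). For integrands that are
    adapted and Lipschitz in time the Riemann sums converge almost surely
    ([lint_cvg]), and a decreasing sequence of such integrands tending to 0
    does so uniformly on compact time intervals along each path ([dini]).
    These two facts make the Daniell extension work ([daniell]), which yields
    an integral of bounded predictable integrands with dominated convergence
    ([stochastic_integral_exists]), whose integral processes are integrators
    again ([integral_process_integrator]).

    Path regularity comes from Khintchine's inequality once more. Cutting a
    path greedily whenever it has moved by [e] splits its increments into
    blocks whose signs may be chosen adaptedly; hence the square function of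
    the blocks is bounded in L^p ([pnorm_blocks]). A fixed threshold shows
    that almost every path oscillates by more than [e] only finitely often on
    compact intervals, so that there is a modification with right-continuous
    paths that have left limits ([regularize_modification]). A threshold equal
    to the modulus of the last cutting value gives the bound of the running
    supremum ([maximal_inequality]). The resulting regular integrals for real
    and imaginary parts ([regular_integral_exists]) combine into a complex one
    ([complex_integrator]).

    Part (ii). The operator norm of a multiplication operator is the essential
    supremum of the multiplier ([op_norm_mult_bound]); so norm convergence at
    a fixed time is almost sure convergence with bounds. By induction over the
    smallest class, every noncommutative integrand is the family of
    multiplications by a process of [Pbct] ([nc_integrands_representation]).
    The integral of this process does not depend, up to a null set, on its
    choice, because modifications have indistinguishable integrals; its
    classes form the noncommutative integral ([classical_nc_integral]).
    Dominated convergence turns regular paths into regularity in L^p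
    ([Rap_classical_nc]), and a sequence of integrands converging locally
    boundedly has modifications that converge everywhere
    ([modified_sequence]), so that the classical convergence applies. The
    integral is determined by its values on elementary integrands
    ([nc_integral_unique]), which gives the formula for every noncommutative
    integral. *)

(** * Seminorms of L^p *)

Section Lp_seminorm.
Context {R : realType}.

Lemma cvg_powR (p : R) (u : nat -> R) (l : R) : 0 < p -> 0 <= l ->
  (forall n, 0 <= u n) -> u n @[n --> \oo] --> l ->
  u n `^ p @[n --> \oo] --> l `^ p.
Proof.
move=> p0 l0 u0 ul; move: l0; rewrite le_eqVlt => /predU1P[l0|l0].
  rewrite -l0 powR0 ?gt_eqF//; apply/cvgrPdist_lt => e e0.
  have e1 : 0 < e `^ p^-1 by rewrite powR_gt0.
  move/cvgrPdist_lt: ul => /(_ _ e1); apply: filterS => n.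
  rewrite -l0 !sub0r !normrN !ger0_norm ?powR_ge0// => h.
  have := gt0_ltr_powR p0 _ _ h.
  rewrite -powRrM mulVf ?gt_eqF// powRr1 ?(ltW e0)//; apply.
    by rewrite nnegrE.
  by rewrite nnegrE powR_ge0.
have cont : {for l, continuous (fun x : R => expR (p * ln x))}.
  apply: continuous_comp; last exact: continuous_expR.
  by apply: continuousM; [exact: cst_continuous|exact: continuous_ln].
have lim := cvg_comp _ _ ul cont.
have -> : l `^ p = expR (p * ln l) by rewrite /powR gt_eqF.
apply: cvg_trans lim; apply: near_eq_cvg.
move/cvgrPdist_lt: ul => /(_ _ l0); apply: filterS => n /=; rewrite /powR.
by have [->|//] := eqVneq (u n) 0; rewrite subr0 gtr0_norm// ltxx.
Qed.

Context d (T : measurableType d) (P : probability T R).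
Variable p : R.
Hypothesis hp : 1 <= p.
Implicit Types f g h : T -> R.
Local Open Scope ereal_scope.

Let p0 : (0 < p)%R. Proof. exact: lt_le_trans hp. Qed.

Definition pnorm f : \bar R := 'N[P]_p%:E[EFin \o f].

Lemma pnorm_ge0 f : 0 <= pnorm f. Proof. exact: Lnorm_ge0. Qed.
Hint Resolve pnorm_ge0 : core.

Lemma Lnorm_mono (r : R) (f g : T -> \bar R) : (0 < r)%R ->
  measurable_fun setT f -> measurable_fun setT g ->
  {ae P, forall w, `|f w| <= `|g w|} -> 'N[P]_r%:E[f] <= 'N[P]_r%:E[g].
Proof.
move=> r0 mf mg fg; rewrite unlock.
have mpow (h : T -> \bar R) : measurable_fun setT h ->
    measurable_fun setT (fun w => `|h w| `^ r).
  move=> mh; apply: (measurableT_comp (measurable_poweR r)).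
  exact: measurableT_comp.
apply: gt0_ler_poweR.
- by rewrite invr_ge0 ltW.
- by rewrite in_itv/= leey andbT; apply: integral_ge0 => w _; exact: poweR_ge0.
- by rewrite in_itv/= leey andbT; apply: integral_ge0 => w _; exact: poweR_ge0.
apply: ae_ge0_le_integral => //.
- by move=> w _; exact: poweR_ge0.
- exact: mpow.
- by move=> w _; exact: poweR_ge0.
- exact: mpow.
apply: filterS fg => w fgw _; apply: gt0_ler_poweR => //; first exact: ltW.
- by rewrite in_itv/= leey andbT.
- by rewrite in_itv/= leey andbT.
Qed.

Lemma pnorm_mono f g : measurable_fun setT f -> measurable_fun setT g ->
  {ae P, forall w, (`|f w| <= `|g w|)%R} -> pnorm f <= pnorm g.
Proof.
move=> mf mg fg; apply: Lnorm_mono => //; try exact/measurable_EFinP.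
Qed.

Lemma pnorm_ae f g : measurable_fun setT f -> measurable_fun setT g ->
  {ae P, forall w, f w = g w} -> pnorm f = pnorm g.
Proof.
move=> mf mg fg; apply/eqP; rewrite eq_le; apply/andP; split.
  by apply: pnorm_mono => //; apply: filterS fg => w ->.
by apply: pnorm_mono => //; apply: filterS fg => w ->.
Qed.

Lemma pnormD f g : measurable_fun setT f -> measurable_fun setT g ->
  pnorm (f \+ g)%R <= pnorm f + pnorm g.
Proof. by move=> mf mg; exact: minkowski_EFin. Qed.

Lemma pnormN f : pnorm (\- f)%R = pnorm f.
Proof. by rewrite /pnorm -[RHS]oppe_Lnorm. Qed.

Lemma pnorm0 : pnorm (fun=> 0%R) = 0.
Proof. by rewrite /pnorm (_ : _ \o _ = cst 0)// Lnorm0// eqe gt_eqF. Qed.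

Lemma pnorm_pow f : pnorm f `^ p = \int[P]_w (`|f w| `^ p)%:E.
Proof. by rewrite /pnorm poweR_Lnorm ?gt_eqF//. Qed.

Lemma pnorm_leP f (c : R) : (0 <= c)%R ->
  pnorm f <= c%:E <-> \int[P]_w (`|f w| `^ p)%:E <= (c `^ p)%:E.
Proof.
move=> c0; rewrite -pnorm_pow -poweR_EFin; split => h.
  apply: gt0_ler_poweR => //; first exact: ltW.
  - by rewrite in_itv/= leey andbT.
  - by rewrite in_itv/= leey andbT lee_fin.
have : (pnorm f `^ p) `^ p^-1 <= (c%:E `^ p) `^ p^-1.
  apply: gt0_ler_poweR => //; first by rewrite invr_ge0 ltW.
  - by rewrite in_itv/= leey andbT poweR_ge0.
  - by rewrite in_itv/= leey andbT lee_fin powR_ge0.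
by rewrite -!poweRrM mulfV ?gt_eqF// !poweRe1 ?lee_fin.
Qed.

Lemma pnorm_eq0 f : measurable_fun setT f -> pnorm f = 0 ->
  {ae P, forall w, f w = 0%R}.
Proof.
move=> mf f0; have := @Lnorm_eq0_eq0 _ _ _ P (EFin \o f) p%:E _ _ f0.
have mf' : measurable_fun setT (EFin \o f) by exact/measurable_EFinP.
by move=> /(_ mf' p0); apply: filterS => w /(_ I) [].
Qed.

Lemma measurable_normpow f : measurable_fun setT f ->
  measurable_fun setT (fun w => (`|f w| `^ p)%:E).
Proof.
move=> mg; apply/measurable_EFinP; apply: (measurableT_comp (measurable_powR p)).
exact: measurableT_comp.
Qed.

Lemma pnormZ (a : R) f : measurable_fun setT f ->
  pnorm (fun w => a * f w)%R = `|a|%:E * pnorm f.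
Proof.
move=> mf; rewrite /pnorm unlock /=.
under eq_integral => w _ do rewrite normrM powRM// EFinM.
rewrite ge0_integralZl_EFin//; last exact: measurable_normpow.
rewrite poweRM; last 2 first.
- by rewrite lee_fin powR_ge0.
- by apply: integral_ge0 => w _; rewrite lee_fin powR_ge0.
by rewrite poweR_EFin -powRrM mulfV ?gt_eqF// powRr1.
Qed.

Lemma pnorm_cst (c : R) : pnorm (fun=> c) = `|c|%:E.
Proof.
rewrite (_ : (fun=> c) = (fun w : T => c * 1)%R); last first.
  by apply/funext => w; rewrite mulr1.
rewrite pnormZ//.
have -> : pnorm (fun=> 1%R) = 1; last by rewrite mule1.
rewrite /pnorm -[EFin \o _]/(cst 1) Lnorm_cst1.
transitivity (1%:E `^ p^-1); last by rewrite poweR_EFin powR1.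
congr (_ `^ _); exact: probability_setT.
Qed.

Lemma limn_einf_le (u : nat -> \bar R) (c : \bar R) : (forall n, u n <= c) ->
  limn_einf u <= c.
Proof.
move=> uc; rewrite limn_einf_lim; apply: lime_le; first exact: is_cvg_einfs.
apply: nearW => n; apply: le_trans (uc n); apply: ereal_inf_lbound.
by exists n => /=.
Qed.

Lemma limn_einf_ge (u : nat -> \bar R) (c : \bar R) : (forall n, c <= u n) ->
  c <= limn_einf u.
Proof.
move=> uc; rewrite limn_einf_lim; apply: lime_ge; first exact: is_cvg_einfs.
by apply: nearW => n; apply: le_ereal_inf_tmp => _ [m _ <-].
Qed.

Lemma measurable_limn_einf (f_ : nat -> T -> \bar R) :
  (forall n, measurable_fun setT (f_ n)) ->
  measurable_fun setT (fun w => limn_einf (f_ ^~ w)).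
Proof.
move=> mf; rewrite /limn_einf; apply: measurableT_comp => //.
by apply: measurable_fun_limn_esup => n; exact: measurableT_comp.
Qed.

Lemma pnorm_fatou (f_ : nat -> T -> R) f (c : R) : (0 <= c)%R ->
  (forall n, measurable_fun setT (f_ n)) -> measurable_fun setT f ->
  {ae P, forall w, f_ n w @[n --> \oo] --> f w} ->
  (forall n, pnorm (f_ n) <= c%:E) -> pnorm f <= c%:E.
Proof.
move=> c0 mf_ mf f_f f_c; apply/pnorm_leP => //.
have pge0 g w : 0 <= (`|g w| `^ p)%:E by rewrite lee_fin powR_ge0.
have fat := fatou P measurableT (fun n => measurable_normpow (mf_ n))
  (fun n w _ => pge0 (f_ n) w).
apply: le_trans (le_trans fat _).
  apply: ae_ge0_le_integral => //.
  - exact: measurable_normpow.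
  - by move=> w _; exact: limn_einf_ge.
  - by apply: measurable_limn_einf => n; exact: measurable_normpow.
  apply: filterS f_f => w fw _.
  suff /cvg_limn_einf_sup[-> _//] :
    (`|f_ n w| `^ p)%:E @[n --> \oo] --> (`|f w| `^ p)%:E by [].
  apply: cvg_EFin; first exact: nearW.
  by apply: cvg_powR => //; exact: cvg_norm.
by apply: limn_einf_le => n; exact/pnorm_leP.
Qed.

(** Fatou's lemma: the lower limit of the p-th powers is integrable, hence
    finite almost everywhere. Only a subsequence depending on the point is
    bounded; for monotone sequences this suffices for convergence. *)
Lemma pnorm_liminf (f_ : nat -> T -> R) (c : R) : (0 <= c)%R ->
  (forall n, measurable_fun setT (f_ n)) ->
  (forall n, pnorm (f_ n) <= c%:E) ->
  {ae P, forall w, exists B : R, forall N, exists2 n, (N <= n)%N &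
    (`|f_ n w| <= B)%R}.
Proof.
move=> c0 mf_ f_c.
have pge0 g w : 0 <= (`|g w| `^ p)%:E by rewrite lee_fin powR_ge0.
have fat := fatou P measurableT (fun n => measurable_normpow (mf_ n))
  (fun n w _ => pge0 (f_ n) w).
have {}fat : \int[P]_x limn_einf (fun n => (`|f_ n x| `^ p)%:E) < +oo.
  apply: le_lt_trans fat _; apply: (@le_lt_trans _ _ (c `^ p)%:E).
    by apply: limn_einf_le => n; exact/pnorm_leP.
  exact: ltry.
have ml : measurable_fun setT (fun x => limn_einf (fun n => (`|f_ n x| `^ p)%:E)).
  by apply: measurable_limn_einf => n; exact: measurable_normpow.
have : P.-integrable setT (fun x => limn_einf (fun n => (`|f_ n x| `^ p)%:E)).
  apply/integrableP; split => //.
  under eq_integral do rewrite gee0_abs ?limn_einf_ge//.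
  exact: fat.
move=> /(integrable_ae measurableT); apply: filterS => w /(_ I) wfin.
have lge0 : 0 <= limn_einf (fun n => (`|f_ n w| `^ p)%:E) by exact: limn_einf_ge.
set l := limn_einf _ in wfin lge0.
have lf : l = (fine l)%:E by rewrite fineK.
exists ((fine l + 1) `^ p^-1)%R => N; apply: contrapT => /forall2NP nN.
have : ((fine l + 1)%:E <= l).
  have lE : l = limn (einfs (fun n => (`|f_ n w| `^ p)%:E)).
    exact: limn_einf_lim.
  rewrite [leRHS]lE; apply: lime_ge; first exact: is_cvg_einfs.
  exists N => // n /= Nn; apply: le_ereal_inf_tmp => _ [m /= nm <-].
  have [//|/negP] := nN m; first by rewrite (leq_trans Nn nm).
  rewrite -ltNge => /(gt0_ltr_powR p0); rewrite -powRrM mulVf ?gt_eqF//.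
  rewrite powRr1 ?addr_ge0 ?fine_ge0// -/l lee_fin => h; apply/ltW/h.
    by rewrite nnegrE powR_ge0.
  by rewrite nnegrE.
by rewrite {2}lf lee_fin leNgt ltrDl ltr01.
Qed.

Lemma pnorm_dct (f_ : nat -> T -> R) g :
  (forall n, measurable_fun setT (f_ n)) -> measurable_fun setT g ->
  pnorm g < +oo ->
  {ae P, forall w, f_ n w @[n --> \oo] --> (0 : R)%R} ->
  {ae P, forall w, forall n, (`|f_ n w| <= g w)%R} ->
  pnorm (f_ n) @[n --> \oo] --> 0.
Proof.
move=> mf_ mg goo f0 fg.
have gint : P.-integrable setT (fun w => (`|g w| `^ p)%:E).
  apply/integrableP; split; first exact: measurable_normpow.
  under eq_integral do rewrite gee0_abs ?lee_fin ?powR_ge0//.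
  by rewrite -pnorm_pow; exact: poweR_lty.
have [] := @dominated_convergence _ _ _ P _ measurableT
  (fun n w => (`|f_ n w| `^ p)%:E) (cst 0) (fun w => (`|g w| `^ p)%:E).
- by move=> n; exact: measurable_normpow.
- exact: measurable_cst.
- apply: filterS f0 => w fw _; apply: cvg_EFin; first exact: nearW.
  have -> : (0 : R)%R = (0 `^ p)%R by rewrite powR0// gt_eqF.
  by apply: cvg_powR => //; rewrite -(normr0 R); exact: cvg_norm.
- exact: gint.
- apply: filterS fg => w fgw n _.
  rewrite gee0_abs ?lee_fin ?powR_ge0//; apply: ge0_ler_powR => //.
  + exact: ltW.
  + by rewrite (le_trans (fgw n))// ler_norm.
move=> _ _; rewrite integral_cst// mul0e => H.
apply/fine_cvgP.
have lec (e : R) : (0 < e)%R -> \forall n \near \oo, pnorm (f_ n) <= e%:E.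
  move=> e0.
  have ep : (0 < e `^ p)%R by rewrite powR_gt0.
  move/fine_cvgP: H => [Hf /cvgrPdist_lt /(_ _ ep) H].
  apply: filterS2 Hf H => n /= Hf.
  rewrite sub0r normrN => h; apply/pnorm_leP; first exact: ltW.
  rewrite -(fineK Hf) lee_fin; apply: ltW; apply: le_lt_trans h.
  exact: ler_norm.
have fn (e : R) n : pnorm (f_ n) <= e%:E -> pnorm (f_ n) \is a fin_num.
  by move=> h; rewrite ge0_fin_numE// (le_lt_trans h)// ltry.
split; first by have := lec _ ltr01; apply: filterS => n; exact: fn.
apply/cvgrPdist_le => e e0; have := lec _ e0; apply: filterS => n h /=.
rewrite sub0r normrN ger0_norm ?fine_ge0//.
by rewrite -lee_fin fineK//; exact: fn h.
Qed.

Lemma pnormD_le f g (a b : R) : measurable_fun setT f -> measurable_fun setT g ->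
  pnorm f <= a%:E -> pnorm g <= b%:E -> pnorm (f \+ g)%R <= (a + b)%:E.
Proof.
by move=> mf mg fa gb; rewrite EFinD (le_trans (pnormD mf mg))// leeD.
Qed.

Lemma pnormB_le f g (a b : R) : measurable_fun setT f -> measurable_fun setT g ->
  pnorm f <= a%:E -> pnorm g <= b%:E -> pnorm (f \- g)%R <= (a + b)%:E.
Proof.
move=> mf mg fa gb; apply: pnormD_le => //; last by rewrite pnormN.
exact: measurable_funN.
Qed.

Lemma pnormB f g : pnorm (f \- g)%R = pnorm (g \- f)%R.
Proof.
by rewrite -pnormN; congr pnorm; apply/funext => w /=; rewrite opprB.
Qed.

Lemma pnorm_sub_le f g h (a b : R) : measurable_fun setT f ->
  measurable_fun setT g -> measurable_fun setT h ->
  pnorm (f \- g)%R <= a%:E -> pnorm (g \- h)%R <= b%:E ->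
  pnorm (f \- h)%R <= (a + b)%:E.
Proof.
move=> mf mg mh fa gb.
rewrite (_ : (f \- h)%R = ((f \- g) \+ (g \- h))%R); last first.
  by apply/funext => w /=; rewrite addrA subrK.
by apply: pnormD_le => //; exact: measurable_funB.
Qed.

Lemma pnormZ_le (k a : R) f : measurable_fun setT f -> pnorm f <= a%:E ->
  pnorm (fun w => k * f w)%R <= (`|k| * a)%:E.
Proof.
by move=> mf fa; rewrite pnormZ// EFinM; apply: lee_wpmul2l; rewrite ?lee_fin.
Qed.

Lemma pnorm_sum n (g : nat -> T -> R) (a : nat -> R) :
  (forall i, (i < n)%N -> measurable_fun setT (g i)) ->
  (forall i, (i < n)%N -> pnorm (g i) <= (a i)%:E) ->
  pnorm (fun w => \sum_(i < n) g i w)%R <= (\sum_(i < n) a i)%:E.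
Proof.
elim: n => [|n IH] mg ga.
  rewrite big_ord0 (_ : (fun _ => _) = fun=> 0%R) ?pnorm0//.
  by apply/funext => w; rewrite big_ord0.
rewrite (_ : (fun _ => _) = (fun w => \sum_(i < n) g i w)%R \+ g n)%R; last first.
  by apply/funext => w /=; rewrite big_ord_recr.
rewrite big_ord_recr; apply: pnormD_le.
- apply: measurable_sum => i; apply: mg; exact: (leq_trans (ltn_ord i)).
- exact: mg.
- by apply: IH => i ni; [apply: mg|apply: ga]; exact: leqW.
- exact: ga.
Qed.

(** The limit of a convergent sequence, extended to all sequences by the upper
    limit so that it is measurable in parameters; hence no convergence set has
    to be singled out when a limit function is defined. *)
Definition rlim (u : nat -> R) : R := fine (limn_esup (EFin \o u)).

Lemma rlimE (u : nat -> R) (l : R) : u n @[n --> \oo] --> l -> rlim u = l.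
Proof.
move=> ul; rewrite /rlim; suff /cvg_limn_einf_sup[_ ->] :
  (EFin \o u) n @[n --> \oo] --> l%:E by [].
by apply: cvg_EFin => //; exact: nearW.
Qed.

Lemma measurable_rlim d' (T' : measurableType d') (f_ : nat -> T' -> R) :
  (forall n, measurable_fun setT (f_ n)) ->
  measurable_fun setT (fun w => rlim (f_ ^~ w)).
Proof.
move=> mf; apply: (measurableT_comp (fine_measurable measurableT)).
by apply: measurable_fun_limn_esup => n; exact/measurable_EFinP.
Qed.

Lemma sum_half_le (c : R) n : (0 <= c)%R ->
  (\sum_(k < n) c / 2 ^+ k <= c * 2)%R.
Proof.
move=> c0; suff -> : (\sum_(k < n) c / 2 ^+ k = c * 2 - c * 2 / 2 ^+ n)%R.
  by rewrite lerBlDr lerDl divr_ge0// ?exprn_ge0// mulr_ge0.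
elim: n => [|n IH]; first by rewrite big_ord0 expr0 divr1 subrr.
rewrite big_ord_recr IH /= exprS; field.
by rewrite expf_neq0// pnatr_eq0.
Qed.

Lemma bounded_sum_cvg (u : nat -> R) (B : R) :
  (forall n, \sum_(k < n) `|u k.+1 - u k| <= B)%R -> cvgn u.
Proof.
move=> uB; pose v n := (u n.+1 - u n)%R.
have : cvgn (series (fun k => `|v k|)%R).
  apply: nondecreasing_is_cvgn.
    by apply/nondecreasing_seqP => n; rewrite seriesSr lerDl.
  by exists B => _ [n _ <-] /=; rewrite /series/= big_mkord.
move=> /normed_cvg cv.
have -> : u = (fun n => u 0%N + series v n)%R.
  apply/funext => n; rewrite /series/= /v telescope_sumr//.
  by rewrite addrC subrK.
by apply: is_cvgD => //; exact: is_cvg_cst.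
Qed.

(** The total variation of the sequence at a point is an increasing limit of
    functions bounded in L^p, hence finite almost everywhere. *)
Lemma pnorm_summable_cvg (f_ : nat -> T -> R) (c : R) : (0 <= c)%R ->
  (forall n, measurable_fun setT (f_ n)) ->
  (forall n, pnorm (f_ n.+1 \- f_ n)%R <= (c / 2 ^+ n)%:E) ->
  {ae P, forall w, f_ n w @[n --> \oo] --> rlim (f_ ^~ w)}.
Proof.
move=> c0 mf fc.
have mB k : measurable_fun setT (f_ k.+1 \- f_ k)%R by exact: measurable_funB.
pose G n w : R := (\sum_(k < n) `|f_ k.+1 w - f_ k w|)%R.
have mG n : measurable_fun setT (G n).
  by apply: measurable_sum => k; apply: measurableT_comp => //; exact: mB.
have Gc n : pnorm (G n) <= (c * 2)%:E.
  apply: (@le_trans _ _ (\sum_(k < n) c / 2 ^+ k)%:E).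
    apply: (@pnorm_sum n (fun k w => `|f_ k.+1 w - f_ k w|)%R
      (fun k => c / 2 ^+ k)%R) => k _.
      by apply: measurableT_comp => //; exact: mB.
    rewrite (le_trans _ (fc k))//; apply: pnorm_mono => //.
      by apply: measurableT_comp => //; exact: mB.
    by apply: nearW => w /=; rewrite normr_id.
  by rewrite lee_fin sum_half_le.
have := pnorm_liminf _ mG Gc; move=> /(_ (mulr_ge0 c0 (ler0n _ 2))).
apply: filterS => w [B GB].
suff cv : cvgn (f_ ^~ w) by rewrite (rlimE cv).
apply: (@bounded_sum_cvg _ B) => n; have [m nm] := GB n.
apply: le_trans; rewrite ger0_norm; last by apply: sumr_ge0.
rewrite /G -(subnKC nm) big_split_ord/= lerDl; exact: sumr_ge0.
Qed.

Lemma pnorm_tail (f_ : nat -> T -> R) (c : R) n m : (0 <= c)%R ->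
  (forall n, measurable_fun setT (f_ n)) ->
  (forall n, pnorm (f_ n.+1 \- f_ n)%R <= (c / 2 ^+ n)%:E) ->
  pnorm (f_ (m + n)%N \- f_ n)%R <= (c * 2 / 2 ^+ n)%:E.
Proof.
move=> c0 mf fc.
rewrite (_ : (_ \- _)%R =
    (fun w => \sum_(k < m) (f_ (k + n).+1 w - f_ (k + n)%N w))%R); last first.
  apply/funext => w /=.
  rewrite -(big_mkord xpredT (fun k => f_ (k + n).+1 w - f_ (k + n)%N w)%R).
  by rewrite (telescope_sumr (fun k => f_ (k + n)%N w)).
apply: (@le_trans _ _ (\sum_(k < m) (c / 2 ^+ n) / 2 ^+ k)%:E).
  apply: (@pnorm_sum m (fun k w => f_ (k + n).+1 w - f_ (k + n)%N w)%R
    (fun k => (c / 2 ^+ n) / 2 ^+ k)%R) => k _.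
    exact: measurable_funB.
  by rewrite (le_trans (fc _))// lee_fin exprD invfM mulrA mulrAC.
rewrite lee_fin (le_trans (sum_half_le _ _))// ?divr_ge0 ?exprn_ge0//.
by rewrite mulrAC.
Qed.

(** Completeness of L^p with a rate: the limit is the almost everywhere limit,
    and Fatou's lemma carries the geometric tail bound over. *)
Lemma pnorm_complete (f_ : nat -> T -> R) (c : R) n : (0 <= c)%R ->
  (forall n, measurable_fun setT (f_ n)) ->
  (forall n, pnorm (f_ n.+1 \- f_ n)%R <= (c / 2 ^+ n)%:E) ->
  pnorm (f_ n \- (fun w => rlim (f_ ^~ w)))%R <= (c * 2 / 2 ^+ n)%:E.
Proof.
move=> c0 mf fc.
apply: (@pnorm_fatou (fun m => f_ n \- f_ (m + n)%N)%R).
- by rewrite divr_ge0// ?exprn_ge0// mulr_ge0.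
- by move=> m; exact: measurable_funB.
- by apply: measurable_funB => //; exact: measurable_rlim.
- apply: filterS (pnorm_summable_cvg c0 mf fc) => w cv.
  apply: cvgB; first exact: cvg_cst.
  by rewrite (cvg_shiftn n (f_ ^~ w)).
- by move=> m; rewrite pnormB; exact: pnorm_tail.
Qed.

Lemma pnorm_subseq_ae (f_ : nat -> T -> R) f :
  (forall n, measurable_fun setT (f_ n)) -> measurable_fun setT f ->
  (forall n, pnorm (f_ n \- f)%R <= (1 / 2 ^+ n)%:E) ->
  {ae P, forall w, f_ n w @[n --> \oo] --> f w}.
Proof.
move=> mf_ mf fc.
have mG n : measurable_fun setT (fun w => \sum_(k < n) `|f_ k w - f w|)%R.
  by apply: measurable_sum => k; apply: measurableT_comp => //; exact: measurable_funB.
have Gc n : pnorm (fun w => \sum_(k < n) `|f_ k w - f w|)%R <= (1 * 2)%:E.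
  apply: (@le_trans _ _ (\sum_(k < n) 1 / 2 ^+ k)%:E); last first.
    by rewrite lee_fin sum_half_le.
  apply: (@pnorm_sum n (fun k w => `|f_ k w - f w|)%R
    (fun k => 1 / 2 ^+ k)%R) => k _.
    by apply: measurableT_comp => //; exact: measurable_funB.
  rewrite (le_trans _ (fc k))//; apply: pnorm_mono => //.
  - by apply: measurableT_comp => //; exact: measurable_funB.
  - exact: measurable_funB.
  - by apply: nearW => w /=; rewrite normr_id.
have := pnorm_liminf _ mG Gc; move=> /(_ (mulr_ge0 ler01 (ler0n _ 2))).
apply: filterS => w [B GB].
have cv : cvgn (series (fun k => `|f_ k w - f w|)%R).
  apply: nondecreasing_is_cvgn.
    by apply/nondecreasing_seqP => n; rewrite /series/= big_nat_recr//= lerDl.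
  exists B => _ [n _ <-] /=; rewrite /series/= big_mkord.
  have [m nm] := GB n; apply: le_trans; rewrite ger0_norm; last exact: sumr_ge0.
  by rewrite -(subnKC nm) big_split_ord/= lerDl; exact: sumr_ge0.
apply/subr_cvg0; apply/norm_cvg0P; exact: cvg_series_cvg_0.
Qed.

End Lp_seminorm.
Arguments pnorm {R d T} P p f%_R.
Local Notation "x <=e c" := (Order.le x (EFin c)) (at level 70, no associativity, only parsing).

(** * Khintchine's inequality *)

Section rademacher.
Context {R : realType}.
Implicit Types (phi psi : R -> R) (l : seq R) (s : R).

(** The average of [phi] over the end points of the random walk that starts at
    [s] and has the independent symmetric steps [+a], [-a] for the entries [a]
    of [l]. *)
Fixpoint rad phi l s : R :=
  if l is a :: l' then (rad phi l' (s + a) + rad phi l' (s - a)) / 2 else phi s.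

Lemma rad_mono phi psi l s : (forall x, phi x <= psi x) ->
  rad phi l s <= rad psi l s.
Proof.
move=> pp; elim: l s => [|a l IH] s //=.
by have := IH (s + a); have := IH (s - a); lra.
Qed.

Lemma rad_lin (k : R) phi psi l s :
  rad (fun x => phi x + k * psi x) l s = rad phi l s + k * rad psi l s.
Proof. by elim: l s => [|a l IH] s //=; rewrite !IH; field. Qed.

Lemma radZ (k : R) phi l s : rad (fun x => k * phi x) l s = k * rad phi l s.
Proof. by elim: l s => [|a l IH] s //=; rewrite !IH; field. Qed.

Lemma rad_sq l s : rad (fun x => x ^+ 2) l s = s ^+ 2 + \sum_(a <- l) a ^+ 2.
Proof.
elim: l s => [|a l IH] s /=; first by rewrite big_nil addr0.
by rewrite !IH big_cons; field.
Qed.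

(** In the Gaussian fourth moment [s^4 + 6 s^2 V + 3 V^2] each step of the
    walk uses [2 a^4] less than the bound grows by. *)
Lemma rad_fourth l s (V := \sum_(a <- l) a ^+ 2) :
  rad (fun x => x ^+ 4) l s <= s ^+ 4 + 6 * s ^+ 2 * V + 3 * V ^+ 2.
Proof.
rewrite {}/V; elim: l s => [|a l IH] s /=.
  by rewrite big_nil mulr0 expr0n/= mulr0 !addr0.
rewrite big_cons; set V := \sum_(_ <- l) _ in IH *.
have h1 := IH (s + a); have h2 := IH (s - a).
rewrite ler_pdivrMr//; apply: le_trans (lerD h1 h2) _.
rewrite -subr_ge0 [X in 0 <= X](_ : _ = 4 * (a ^+ 2) ^+ 2); last by ring.
by rewrite mulr_ge0// sqr_ge0.
Qed.

Lemma rad_ge0 phi l s : (forall x, 0 <= phi x) -> 0 <= rad phi l s.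
Proof.
move=> p0; elim: l s => [|a l IH] s //=.
by rewrite divr_ge0// addr_ge0.
Qed.

(** The first moment is bounded below by the second and the fourth ones. *)
Lemma khintchine l :
  Num.sqrt (\sum_(a <- l) a ^+ 2) <= 2 * rad (fun x => `|x|) l 0.
Proof.
set V := \sum_(_ <- l) _; have V0 : 0 <= V by apply: sumr_ge0 => a _; exact: sqr_ge0.
have r0 : 0 <= rad (fun x => `|x|) l 0 by exact: rad_ge0.
move: V0; rewrite le_eqVlt => /predU1P[<-|V0]; first by rewrite sqrtr0 mulr_ge0.
set K := Num.sqrt V; have K0 : 0 < K by rewrite sqrtr_gt0.
have KV : K ^+ 2 = V by rewrite sqr_sqrtr// ltW.
(* The difference of both sides is [y * (1 - 2y/(3K))^2 * (1 + y/(3K))] with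
   [y = `|x|]. At the fourth moment [3 K^4] of the walk the loss is [4/9 K],
   so that [5/9 K] remains. *)
have pw (x : R) : K^-1 * x ^+ 2 + (- (4 / 27) / K ^+ 3) * x ^+ 4 <= `|x|.
  have -> : x ^+ 2 = `|x| ^+ 2 by rewrite real_normK ?num_real.
  have -> : x ^+ 4 = `|x| ^+ 4.
    by rewrite (exprM _ 2 2) (exprM `|x| 2 2) real_normK ?num_real.
  set y := `|x|; have y0 : 0 <= y by exact: normr_ge0.
  rewrite -subr_ge0 [X in 0 <= X](_ : _ =
    y * ((1 - 2 / 3 * (y / K)) ^+ 2 * (1 + (y / K) / 3))); last first.
    by field; rewrite gt_eqF.
  rewrite mulr_ge0// mulr_ge0 ?sqr_ge0// addr_ge0// divr_ge0// divr_ge0//.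
  exact: ltW.
have := rad_mono l 0 pw; rewrite (rad_lin _ (fun x => K^-1 * x ^+ 2)) radZ rad_sq.
have r4 := rad_fourth l 0; rewrite expr0n/= add0r -/V -KV => h.
move: r4; rewrite !expr0n/= mulr0 mul0r !add0r -/V -KV => r4.
have : (4 / 27) / K ^+ 3 * rad (fun x => x ^+ 4) l 0 <=
    (4 / 27) / K ^+ 3 * (3 * (K ^+ 2) ^+ 2).
  by apply: ler_wpM2l => //; rewrite divr_ge0// exprn_ge0// ltW.
have -> : (4 / 27) / K ^+ 3 * (3 * (K ^+ 2) ^+ 2) = (4 / 9) * K.
  by field; rewrite gt_eqF.
have e : K^-1 * K ^+ 2 = K by field; rewrite gt_eqF.
by rewrite e in h; lra.
Qed.

Context d (T : measurableType d) (P : probability T R).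
Variable p : R.
Hypothesis hp : 1 <= p.

Lemma measurable_rad n (a : nat -> T -> R) (S : T -> R) :
  (forall i, measurable_fun setT (a i)) -> measurable_fun setT S ->
  measurable_fun setT (fun w => rad (fun x => `|x|) (mkseq (a ^~ w) n) (S w)).
Proof.
elim: n a S => [|n IH] a S ma mS; first exact: measurableT_comp.
rewrite /mkseq/=.
have e w : [seq a i w | i <- iota 1 n] = mkseq (fun i => a i.+1 w) n.
  by rewrite /mkseq (iotaDl 1 0 n) -map_comp.
under eq_fun do rewrite e.
apply: measurable_funM => //; apply: measurable_funD.
  by apply: (IH (fun i => a i.+1)) => //; exact: measurable_funD.
by apply: (IH (fun i => a i.+1)) => //; exact: measurable_funB.
Qed.

(** The triangle inequality, applied to the mean over all choices of signs. *)
Lemma pnorm_rad n (a : nat -> T -> R) (S : T -> R) (C : R) :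
  (forall i, measurable_fun setT (a i)) -> measurable_fun setT S ->
  (forall e : nat -> bool,
    (pnorm P p (fun w => S w + \sum_(i < n) (-1) ^+ e i * a i w) <=e C)) ->
  (pnorm P p (fun w => rad (fun x => `|x|) (mkseq (a ^~ w) n) (S w)) <=e C).
Proof.
elim: n a S => [|n IH] a S ma mS H.
  have := H (fun=> false); apply: le_trans; apply: pnorm_mono => //.
  - exact: measurableT_comp.
  - by under eq_fun do rewrite big_ord0 addr0.
  - by apply: nearW => w /=; rewrite big_ord0 addr0 normr_id.
have e w : [seq a i w | i <- iota 1 n] = mkseq (fun i => a i.+1 w) n.
  by rewrite /mkseq (iotaDl 1 0 n) -map_comp.
rewrite /mkseq/=; under eq_fun do rewrite e.
have m1 : measurable_fun setT (S \+ a 0%N) by exact: measurable_funD.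
have m2 : measurable_fun setT (S \- a 0%N) by exact: measurable_funB.
have h (b : bool) (S' : T -> R) : (forall w, S' w = S w + (-1) ^+ b * a 0%N w) ->
    measurable_fun setT S' -> (pnorm P p (fun w => rad (fun x => `|x|)
      (mkseq (fun i => a i.+1 w) n) (S' w)) <=e C).
  move=> SE mS'; apply: (IH (fun i => a i.+1)) => // ee.
  have := H (fun i => if i is j.+1 then ee j else b).
  congr (pnorm _ _ _ <=e _); apply/funext => w.
  by rewrite big_ord_recl SE addrA.
have C2 : C = `|2^-1| * (C + C) by rewrite ger0_norm//; field.
rewrite [in leRHS]C2.
rewrite (_ : (fun _ => _) = (fun w => 2^-1 *
   (((fun w => rad (fun x => `|x|) (mkseq (fun i => a i.+1 w) n) (S w + a 0%N w))
   \+ (fun w => rad (fun x => `|x|) (mkseq (fun i => a i.+1 w) n) (S w - a 0%N w)))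
   w))); last by apply/funext => w; rewrite mulrC.
have mr1 := measurable_rad n (fun i => ma i.+1) m1.
have mr2 := measurable_rad n (fun i => ma i.+1) m2.
apply: pnormZ_le => //; first exact: measurable_funD.
apply: pnormD_le => //.
  by apply: (h false (S \+ a 0%N)) => // w; rewrite expr0 mul1r.
by apply: (h true (S \- a 0%N)) => // w; rewrite expr1 mulN1r.
Qed.

Lemma pnorm_square_function n (a : nat -> T -> R) (C : R) :
  (forall i, measurable_fun setT (a i)) ->
  (forall e : nat -> bool,
    (pnorm P p (fun w => \sum_(i < n) (-1) ^+ e i * a i w) <=e C)) ->
  (pnorm P p (fun w => Num.sqrt (\sum_(i < n) a i w ^+ 2)) <=e 2 * C).
Proof.
move=> ma H.
have := @pnorm_rad n a (fun=> 0) C ma (measurable_cst _).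
have H' (e : nat -> bool) : (pnorm P p (fun w => 0 + \sum_(i < n) (-1) ^+ e i * a i w) <=e C).
  by under eq_fun do rewrite add0r; exact: H.
move=> /(_ H') h.
have mr := measurable_rad n ma (measurable_cst (0 : R)).
have := pnormZ_le hp 2 mr h; rewrite ger0_norm//; apply: le_trans.
apply: pnorm_mono => //.
- apply: (measurableT_comp (continuous_measurable_fun (@sqrt_continuous R))).
  by apply: measurable_sum => i; exact: measurable_funX.
- exact: measurable_funM.
apply: nearW => w /=; rewrite ger0_norm ?sqrtr_ge0//.
rewrite (le_trans _ (ler_norm _))//.
have := khintchine (mkseq (a ^~ w) n); congr (_ <= _).
by rewrite /mkseq big_map -(big_mkord xpredT (fun i => a i w ^+ 2)) /index_iota subn0.
Qed.

(** The square function of the sequence is in L^p by Khintchine's inequality.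
    It dominates every term and, being finite almost everywhere, makes the
    terms tend to 0; dominated convergence concludes. This holds for every [p
    >= 1] and takes the place of an orthogonality argument. *)
Lemma pnorm_unconditional_cvg0 (a : nat -> T -> R) (C : R) :
  (forall i, measurable_fun setT (a i)) ->
  (forall n (e : nat -> bool),
    (pnorm P p (fun w => \sum_(i < n) (-1) ^+ e i * a i w) <=e C)) ->
  pnorm P p (a n) @[n --> \oo] --> 0%E.
Proof.
move=> ma H.
have C0 : 0 <= C.
  rewrite -lee_fin; apply: le_trans (H 0%N (fun=> false)); exact: pnorm_ge0.
pose g n w : R := Num.sqrt (\sum_(i < n) a i w ^+ 2).
have mg n : measurable_fun setT (g n).
  apply: (measurableT_comp (continuous_measurable_fun (@sqrt_continuous R))).
  by apply: measurable_sum => i; exact: measurable_funX.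
have gC n : (pnorm P p (g n) <=e 2 * C) by exact: pnorm_square_function.
have gmono w : {homo g ^~ w : n m / (n <= m)%N >-> n <= m}.
  move=> n m nm; rewrite /g ler_sqrt; last by apply: sumr_ge0 => i _; exact: sqr_ge0.
  by rewrite -(subnKC nm) big_split_ord/= lerDl; apply: sumr_ge0 => i _; exact: sqr_ge0.
have C2 : 0 <= 2 * C by rewrite mulr_ge0.
have gb : {ae P, forall w, exists B : R, forall n, g n w <= B}.
  apply: filterS (pnorm_liminf hp C2 mg gC) => w [B BP].
  exists B => n; have [m nm] := BP n; apply: le_trans.
  by rewrite (le_trans (gmono w _ _ nm))// ler_norm.
pose G w := rlim (g ^~ w).
have mG : measurable_fun setT G by exact: measurable_rlim.
have gG : {ae P, forall w, g n w @[n --> \oo] --> G w}.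
  apply: filterS gb => w [B gB].
  have cv : cvgn (g ^~ w).
    by apply: nondecreasing_is_cvgn; [exact: gmono|exists B => _ [n _ <-]].
  by rewrite /G (rlimE cv).
have GC : (pnorm P p G <=e 2 * C) by exact: (pnorm_fatou hp C2 mg mG gG gC).
have ag n w : `|a n w| <= g n.+1 w.
  rewrite -sqrtr_sqr /g ler_sqrt; last by apply: sumr_ge0 => i _; exact: sqr_ge0.
  by rewrite big_ord_recr/= lerDr; apply: sumr_ge0 => i _; exact: sqr_ge0.
apply: (pnorm_dct hp ma mG).
- by rewrite (le_lt_trans GC)// ltry.
- apply: filterS gb => w [B gB].
  have cv : cvgn (series (fun i => a i w ^+ 2)).
    apply: nondecreasing_is_cvgn.
      by apply/nondecreasing_seqP => n; rewrite seriesSr lerDl sqr_ge0.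
    exists (B ^+ 2) => _ [n _ <-]; rewrite /series/= big_mkord.
    have s0 : 0 <= \sum_(i < n) a i w ^+ 2 by apply: sumr_ge0 => i _; exact: sqr_ge0.
    rewrite -[leLHS]sqr_sqrtr//; apply: lerXn2r; rewrite ?nnegrE ?sqrtr_ge0//.
    by rewrite (le_trans (sqrtr_ge0 _) (gB n)).
    exact: gB.
  have /cvgrPdist_lt h := cvg_series_cvg_0 cv.
  apply/cvgrPdist_lt => e e0; have := h _ (exprn_gt0 2 e0).
  apply: filterS => n; rewrite !sub0r !normrN normrX => h'.
  by rewrite -(ltr_pXn2r (n:=2))// nnegrE// ltW.
apply: filterS gG => w cv n; rewrite (le_trans (ag n w))//.
have -> : G w = limn (g ^~ w) by rewrite (cvg_lim _ cv).
by apply: nondecreasing_cvgn_le; [exact: gmono|apply/cvg_ex; exists (G w)].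
Qed.

End rademacher.

(** * A Daniell extension for integrals with values in L^p *)

Section clamp.
Context {R : realDomainType}.
Implicit Types x a b c : R.

Definition clamp x a := Num.max (Num.min x a) (- a).

Lemma norm_clamp x a : 0 <= a -> `|clamp x a| <= a.
Proof.
move=> a0; rewrite /clamp ler_norml le_max lexx orbT/= ge_max ge_min lexx orbT/=.
by rewrite (le_trans _ a0)// oppr_le0.
Qed.

Lemma dist_clamp x a b : 0 <= a -> 0 <= b -> `|x| <= a + b ->
  `|x - clamp x a| <= b.
Proof.
move=> a0 b0; rewrite /clamp !ler_norml => /andP[h1 h2].
case: (leP x a) => xa; [case: (leP x (- a))|case: (leP a (- a))] => xa';
  by apply/andP; split; lra.
Qed.

Lemma dist_clamp_le x y a : `|x| <= a -> `|x - clamp y a| <= `|x - y|.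
Proof.
have a1 := ler_norm (x - y); have a2 := ler_norm (- (x - y)).
rewrite normrN in a2; rewrite /clamp !ler_norml => /andP[h1 h2].
case: (leP y a) => ya; [case: (leP y (- a))|case: (leP a (- a))] => ya';
  by apply/andP; split; lra.
Qed.

Lemma norm_max_sub a b c x : `|Num.max a b - Num.max c x| <= `|a - c| + `|b - x|.
Proof.
have h1 := ler_norm (a - c); have h2 := ler_norm (b - x).
have h3 := ler_norm (- (a - c)); have h4 := ler_norm (- (b - x)).
rewrite !normrN in h3 h4.
have n1 := normr_ge0 (a - c); have n2 := normr_ge0 (b - x).
rewrite ler_norml; case: (leP a b) => ab; case: (leP c x) => cx;
  apply/andP; split; lra.
Qed.

End clamp.

Lemma ler_sum_prefix {R : realDomainType} (u : nat -> R) (m n : nat) :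
  (m <= n)%N -> (forall i, 0 <= u i) -> \sum_(i < m) u i <= \sum_(i < n) u i.
Proof.
by move=> mn u0; rewrite -(subnKC mn) big_split_ord/= lerDl sumr_ge0.
Qed.

Lemma exists_div_pow2_le {R : realType} (c e : R) : 0 < e ->
  exists n, c / 2 ^+ n <= e.
Proof.
move=> e0; have h : `|2^-1 : R| < 1 by rewrite ger0_norm// invf_lt1// ltr1n.
have /cvgrPdist_le /(_ _ e0)[N _ NP] := cvg_geometric c h; exists N.
have := NP N (leqnn N); rewrite sub0r normrN /= exprVn; apply: le_trans.
exact: ler_norm.
Qed.

Section daniell.
Context {R : realType} (S : Type) d (T : measurableType d) (P : probability T R).
Variable p : R.
Hypothesis hp : 1 <= p.
Implicit Types f g h : S -> R.

(** Integrands are bounded and include the constants, which stand in for the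
    truncation at level 1 in Stone's axioms. *)
Record stone_lattice (L : (S -> R) -> Prop) : Prop := StoneLattice {
  stone_cst : forall c, L (fun=> c);
  stone_add : forall f g, L f -> L g -> L (fun s => f s + g s);
  stone_scale : forall k f, L f -> L (fun s => k * f s);
  stone_max : forall f g, L f -> L g -> L (fun s => Num.max (f s) (g s));
  stone_bounded : forall f, L f -> exists M : R, forall s, `|f s| <= M }.

(** [eint_smooth] is the trace of sigma-additivity that can be verified path
    by path: the parts of a decreasing null sequence above a positive level
    integrate to 0 in the limit, as they do when convergence is uniform along
    each path. The bound [eint_bound] by the uniform norm does the rest. *)
Record elementary_integral (L : (S -> R) -> Prop) (I : (S -> R) -> T -> R)
    (C : R) : Prop := ElementaryIntegral {
  eint_measurable : forall f, L f -> measurable_fun setT (I f);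
  eint_add : forall f g, L f -> L g ->
    {ae P, forall w, I (fun s => f s + g s) w = I f w + I g w};
  eint_scale : forall k f, L f -> {ae P, forall w, I (fun s => k * f s) w = k * I f w};
  eint_bound : forall f M, L f -> (forall s, `|f s| <= M) ->
    pnorm P p (I f) <=e C * M;
  eint_smooth : forall (h : nat -> S -> R), (forall n, L (h n)) ->
    (forall n s, 0 <= h n.+1 s <= h n s) ->
    (forall s, h n s @[n --> \oo] --> 0) ->
    forall eta, 0 < eta -> {ae P, forall w,
      I (fun s => Num.max (h n s - eta) 0) w @[n --> \oo] --> 0} }.

Variables (L : (S -> R) -> Prop) (I : (S -> R) -> T -> R) (C : R).
Hypotheses (HL : stone_lattice L) (HI : elementary_integral L I C).

Let Lcst c : L (fun=> c). Proof. exact: stone_cst. Qed.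
Let Ladd f g : L f -> L g -> L (fun s => f s + g s).
Proof. exact: stone_add. Qed.
Let Lscale k f : L f -> L (fun s => k * f s). Proof. exact: stone_scale. Qed.
Let Lmax f g : L f -> L g -> L (fun s => Num.max (f s) (g s)).
Proof. exact: stone_max. Qed.
Let Lopp f : L f -> L (fun s => - f s).
Proof. by move=> /(Lscale (-1)); under eq_fun do rewrite mulN1r. Qed.
Let Lsub f g : L f -> L g -> L (fun s => f s - g s).
Proof. by move=> Lf /Lopp; exact: Ladd. Qed.
Let Lmin f g : L f -> L g -> L (fun s => Num.min (f s) (g s)).
Proof.
move=> /Lopp Lf /Lopp Lg; have := Lopp (Lmax Lf Lg).
by under eq_fun do rewrite -oppr_min opprK.
Qed.
Let Labs f : L f -> L (fun s => `|f s|).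
Proof.
move=> Lf; have := Lmax Lf (Lopp Lf).
congr (L _); apply/funext => s.
by case: (ger0P (f s)) => f0; [rewrite max_l|rewrite max_r]; lra.
Qed.
Let Lclamp f g : L f -> L g -> L (fun s => clamp (f s) (g s)).
Proof. by move=> Lf Lg; apply: Lmax; [exact: Lmin|exact: Lopp]. Qed.
Let Lsum n (f : nat -> S -> R) : (forall i, L (f i)) ->
  L (fun s => \sum_(i < n) f i s).
Proof.
move=> Lf; elim: n => [|n IH].
  by under eq_fun do rewrite big_ord0; exact: Lcst.
by under eq_fun do rewrite big_ord_recr/=; exact: Ladd.
Qed.

Let mI f : L f -> measurable_fun setT (I f). Proof. exact: (eint_measurable HI). Qed.

Let I_opp f : L f -> {ae P, forall w, I (fun s => - f s) w = - I f w}.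
Proof.
move=> Lf; apply: filterS (eint_scale HI (-1) Lf) => w; rewrite mulN1r => <-.
by congr I; apply/funext => s; rewrite mulN1r.
Qed.

Let I_sub f g : L f -> L g ->
  {ae P, forall w, I (fun s => f s - g s) w = I f w - I g w}.
Proof.
move=> Lf Lg.
by apply: filterS2 (eint_add HI Lf (Lopp Lg)) (I_opp Lg) => w -> ->.
Qed.

Let C0 : 0 <= C.
Proof.
have := eint_bound HI (Lcst 0) (M := 1) (fun s => ltac:(by rewrite normr0)).
by rewrite mulr1 -lee_fin; apply: le_trans; exact: pnorm_ge0.
Qed.

Let pnorm_I_sub f g : L f -> L g ->
  pnorm P p (I f \- I g) = pnorm P p (I (fun s => f s - g s)).
Proof.
move=> Lf Lg; apply: pnorm_ae => //.
- by apply: measurable_funB; exact: mI.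
- by apply: mI; exact: Lsub.
- by apply: filterS (I_sub Lf Lg) => w ->.
Qed.

Let I_signed_sum n (e : nat -> bool) (g : nat -> S -> R) : (forall i, L (g i)) ->
  {ae P, forall w, I (fun s => \sum_(i < n) (-1) ^+ e i * g i s) w =
    \sum_(i < n) (-1) ^+ e i * I (g i) w}.
Proof.
move=> Lg; elim: n => [|n IH].
  have := eint_scale HI 0 (Lcst 0); apply: filterS => w.
  move=> H; rewrite big_ord0 -[RHS](mul0r (I (fun=> 0) w)) -H; congr I.
  by apply/funext => s; rewrite big_ord0 mul0r.
have Ls : L (fun s => \sum_(i < n) (-1) ^+ e i * g i s).
  by apply: (Lsum n (f := fun i s => (-1) ^+ e i * g i s)) => i; exact: Lscale.
have H1 := eint_add HI Ls (Lscale ((-1) ^+ e n) (Lg n)).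
have H2 := eint_scale HI ((-1) ^+ e n) (Lg n).
apply: filterS3 IH H1 H2 => w IH HH Hs; rewrite big_ord_recr/= -IH -Hs -HH.
by congr I; apply/funext => s; rewrite big_ord_recr.
Qed.

(** All signed sums of the [g i] are bounded by [M], so that their integrals
    are bounded in L^p and Khintchine's inequality applies. *)
Lemma eint_exhaustive (g : nat -> S -> R) (M : R) : (forall i, L (g i)) ->
  (forall n s, \sum_(i < n) `|g i s| <= M) ->
  pnorm P p (I (g n)) @[n --> \oo] --> 0%E.
Proof.
move=> Lg gM; apply: (pnorm_unconditional_cvg0 (C := C * M) hp).
  by move=> i; exact: mI.
move=> n e.
have Ls : L (fun s => \sum_(i < n) (-1) ^+ e i * g i s).
  by apply: (Lsum n (f := fun i s => (-1) ^+ e i * g i s)) => i; exact: Lscale.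
rewrite (_ : pnorm P p _ = pnorm P p (I (fun s => \sum_(i < n) (-1) ^+ e i * g i s))).
  apply: (eint_bound HI) => // s; apply: le_trans (gM n s).
  apply: le_trans (ler_norm_sum _ _ _) _; apply: ler_sum => i _.
  by rewrite normrM normrX normrN1 expr1n mul1r.
apply: pnorm_ae => //.
- apply: measurable_sum => i; apply: measurable_funM => //; exact: mI.
- exact: mI.
- by apply: filterS (I_signed_sum n e Lg) => w ->.
Qed.

(** The integral has values in L^p and no sign; the size of a nonnegative
    function is therefore measured by the semivariation, of which [c] is a
    bound here. *)
Definition semivar_le (f : S -> R) (c : R) :=
  forall g, L g -> (forall s, `|g s| <= f s) -> pnorm P p (I g) <=e c.

Lemma semivar_mono f g (a b : R) : (forall s, f s <= g s) -> a <= b ->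
  semivar_le g a -> semivar_le f b.
Proof.
move=> fg ab ga h Lh hf; apply: le_trans (ga h Lh _) _; last by rewrite lee_fin.
by move=> s; rewrite (le_trans (hf s)).
Qed.

(** A function dominated by [f + g] splits into its truncation at [f] and a
    remainder dominated by [g]. *)
Lemma semivar_add f g (a b : R) : L f -> L g -> (forall s, 0 <= f s) ->
  (forall s, 0 <= g s) -> semivar_le f a -> semivar_le g b ->
  semivar_le (fun s => f s + g s) (a + b).
Proof.
move=> Lf Lg f0 g0 fa gb h Lh hfg.
have Lc := Lclamp Lh Lf; have Lr := Lsub Lh Lc.
have h1 : pnorm P p (I (fun s => clamp (h s) (f s))) <=e a.
  by apply: fa => // s; exact: norm_clamp.
have h2 : pnorm P p (I (fun s => h s - clamp (h s) (f s))) <=e b.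
  by apply: gb => // s; exact: dist_clamp.
have := pnormD_le hp (mI Lr) (mI Lc) h2 h1; rewrite addrC; apply: le_trans.
rewrite le_eqVlt; apply/orP; left; apply/eqP; apply: pnorm_ae => //.
- exact: mI.
- by apply: measurable_funD; exact: mI.
- by apply: filterS (I_sub Lh Lc) => w /= ->; rewrite subrK.
Qed.

(** Otherwise infinitely many successive increments of a bounded increasing
    sequence have large semivariation, and functions that witness it
    contradict [eint_exhaustive]. *)
Lemma semivar_incr_cauchy (f : nat -> S -> R) (M : R) : (forall n, L (f n)) ->
  (forall s, {homo f ^~ s : n m / (n <= m)%N >-> n <= m}) ->
  (forall n s, `|f n s| <= M) ->
  forall e : R, 0 < e -> exists n, forall m, (n <= m)%N ->
    semivar_le (fun s => f m s - f n s) e.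
Proof.
move=> Lf fnd fM e e0; apply: contrapT => /forallNP H.
have H1 (n : nat) : exists mg : nat * (S -> R), [/\ (n <= mg.1)%N, L mg.2,
    (forall s, `|mg.2 s| <= f mg.1 s - f n s) & ~ pnorm P p (I mg.2) <=e e].
  have /existsNP[m /not_implyP[nm /existsNP[g /not_implyP[Lg /not_implyP[gf ng]]]]]
    := H n.
  by exists (m, g).
have [k kP] := choice H1.
pose nn := fix nn i := if i is j.+1 then (k (nn j)).1 else 0%N.
pose gg i := (k (nn i)).2.
have : pnorm P p (I (gg n)) @[n --> \oo] --> 0%E.
  apply: (@eint_exhaustive _ (M + M)) => [i|n s].
    by rewrite /gg; case: (kP (nn i)).
  apply: (@le_trans _ _ (\sum_(i < n) (f (nn i.+1) s - f (nn i) s))).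
    by apply: ler_sum => i _; rewrite /gg; case: (kP (nn i)).
  rewrite -(big_mkord xpredT (fun i => f (nn i.+1) s - f (nn i) s)).
  rewrite (telescope_sumr (fun i => f (nn i) s))//.
  have := fM (nn n) s; have := fM (nn 0%N) s.
  by rewrite !ler_norml => /andP[? ?] /andP[? ?]; lra.
move=> /fine_cvgP[fin /cvgrPdist_lt /(_ _ e0) cv].
have [n [fn cn]] : exists n, pnorm P p (I (gg n)) \is a fin_num /\
    `|0 - fine (pnorm P p (I (gg n)))| < e.
  by have [N _ NP] := filterI fin cv; exists N; have [] := NP N (leqnn N).
have [_ _ _] := kP (nn n); apply; rewrite -/(gg n) -(fineK fn) lee_fin ltW//.
by apply: le_lt_trans cn; rewrite sub0r normrN ler_norm.
Qed.

Lemma semivar_decr_cauchy (f : nat -> S -> R) (M : R) : (forall n, L (f n)) ->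
  (forall s, {homo f ^~ s : n m / (n <= m)%N >-> m <= n}) ->
  (forall n s, `|f n s| <= M) ->
  forall e : R, 0 < e -> exists n, forall m, (n <= m)%N ->
    semivar_le (fun s => f n s - f m s) e.
Proof.
move=> Lf fnd fM e e0.
have [|||n nP] := @semivar_incr_cauchy (fun n s => - f n s) M _ _ _ _ e0.
- by move=> n; exact: Lopp.
- by move=> s n m nm; rewrite lerN2; exact: fnd.
- by move=> n s; rewrite normrN.
exists n => m nm; apply: semivar_mono (nP m nm) => // s.
by rewrite opprK addrC.
Qed.

Let decr_homo (f : nat -> S -> R) s :
  (forall n s, 0 <= f n.+1 s <= f n s) -> {homo f ^~ s : n m / (n <= m)%N >-> m <= n}.
Proof. by move=> fd; apply/nonincreasing_seqP => n; case/andP: (fd n s). Qed.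

(** Cut [h m] at a small level [eta]. The part below [eta] has a small
    integral by the uniform bound; the parts above form a Cauchy sequence by
    [semivar_decr_cauchy], whose integrals tend to 0 almost everywhere, so
    that Fatou's lemma makes them small in L^p. *)
Lemma eint_decr_cvg0 (h : nat -> S -> R) : (forall n, L (h n)) ->
  (forall n s, 0 <= h n.+1 s <= h n s) ->
  (forall s, h n s @[n --> \oo] --> 0) ->
  forall e : R, 0 < e -> exists n, forall m, (n <= m)%N -> pnorm P p (I (h m)) <=e e.
Proof.
move=> Lh hd h0 e e0.
have hge n s : 0 <= h n s by case/andP: (hd n s); exact: le_trans.
have [M hM] := stone_bounded HL (Lh 0%N).
(* The level is such that [C * eta <= e / 3]; the summand 1 covers the case [C
   = 0]. *)
pose eta := e / 3 / (C + 1).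
have C1 : 0 < C + 1 by rewrite ltr_wpDl.
have eta0 : 0 < eta by rewrite !divr_gt0.
pose k n s := Num.max (h n s - eta) 0.
have Lk n : L (k n) by apply: Lmax => //; exact: Lsub.
have e3 : 0 < e / 3 by rewrite divr_gt0.
have [|| n nP] := @semivar_decr_cauchy k M Lk _ _ _ e3.
- move=> s i j ij; rewrite /k ge_max !le_max lexx !orbT andbT lerD2r.
  by rewrite (decr_homo s hd ij).
- move=> i s; rewrite /k ger0_norm ?le_max ?lexx ?orbT//.
  have := hM s; rewrite ger0_norm// => h1.
  have h2 : h i s <= h 0%N s by apply: (decr_homo s hd).
  have h3 := hge i s; rewrite ge_max; apply/andP; split; lra.
have mk i : measurable_fun setT (I (k i)) by exact: mI.
exists n => m nm.
have kn : pnorm P p (I (k n)) <=e e / 3.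
  apply: (pnorm_fatou hp (f_ := fun j => I (k n) \- I (k (n + j)%N))).
  - exact: ltW.
  - by move=> j; exact: measurable_funB.
  - exact: mk.
  - have := eint_smooth HI Lh hd h0 eta0; apply: filterS => w cv.
    rewrite -[X in _ --> X]subr0; apply: cvgB; first exact: cvg_cst.
    have := cv; rewrite -(cvg_shiftn n) /= => cv'.
    by under eq_fun do rewrite addnC; exact: cv'.
  - move=> j; rewrite pnorm_I_sub//; apply: (nP (n + j)%N) => //.
      by rewrite leq_addr.
    by exact: Lsub.
    move=> s; rewrite ger0_norm// subr_ge0 /k ge_max !le_max lexx !orbT andbT lerD2r.
    by rewrite (decr_homo s hd)// leq_addr.
have km : pnorm P p (I (k m)) <=e e / 3 + e / 3.
  have h1 : pnorm P p (I (k n) \- I (k m)) <=e e / 3.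
    rewrite pnorm_I_sub//; apply: (nP m nm); first exact: Lsub.
    move=> s; rewrite ger0_norm// subr_ge0 /k ge_max !le_max lexx !orbT andbT lerD2r.
    by rewrite (decr_homo s hd).
  have := pnormB_le hp (mk n) (measurable_funB (mk n) (mk m)) kn h1.
  by congr (pnorm _ _ _ <=e _); apply/funext => w /=; rewrite opprB addrC subrK.
have Lr := Lsub (Lh m) (Lk m).
have rb : pnorm P p (I (fun s => h m s - k m s)) <=e e / 3.
  apply: le_trans (eint_bound HI (M := eta) Lr _) _.
    move=> s; rewrite /k; have := hge m s; have := ltW eta0.
    by case: (leP (h m s - eta) 0) => ? ? ?; rewrite ger0_norm//; lra.
  rewrite lee_fin /eta mulrCA ler_piMr// ?(ltW e3)//.
  by rewrite ler_pdivrMr// mul1r lerDl.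
have := pnormD_le hp (mI Lr) (mk m) rb km.
have -> : e / 3 + (e / 3 + e / 3) = e by field.
apply: le_trans; rewrite le_eqVlt; apply/orP; left; apply/eqP; apply: pnorm_ae => //.
- exact: mI.
- by apply: measurable_funD; exact: mI.
- by apply: filterS (I_sub (Lh m) (Lk m)) => w /= ->; rewrite subrK.
Qed.

(** Convergence of integrals becomes uniform over the functions dominated by
    [f n]: such a function, cut off at [f m] on both sides, loses a piece
    dominated by [f n - f m], which is small uniformly, and what is left
    decreases to 0 with [m]. *)
Lemma semivar_decr_cvg0 (f : nat -> S -> R) : (forall n, L (f n)) ->
  (forall n s, 0 <= f n.+1 s <= f n s) ->
  (forall s, f n s @[n --> \oo] --> 0) ->
  forall e : R, 0 < e -> exists n, semivar_le (f n) e.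
Proof.
move=> Lf fd f0 e e0.
have fge n s : 0 <= f n s by case/andP: (fd n s); exact: le_trans.
have [M fM] := stone_bounded HL (Lf 0%N).
have e3 : 0 < e / 3 by rewrite divr_gt0.
have [||n nP] := @semivar_decr_cauchy f M Lf _ _ _ e3.
- by move=> s; exact: decr_homo.
- move=> i s; rewrite ger0_norm// (le_trans _ (fM s))//.
  by rewrite (le_trans (decr_homo s fd (leq0n i)))// ler_norm.
exists n => g Lg gf.
(* [pos m - neg m] is the truncation of [g] at [f m]. *)
pose pos m s := Num.min (Num.max (g s) 0) (f m s).
pose neg m s := Num.min (Num.max (- g s) 0) (f m s).
have Lpos m : L (pos m) by apply: Lmin => //; exact: Lmax.
have Lneg m : L (neg m) by apply: Lmin => //; apply: Lmax => //; exact: Lopp.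
have dec (u : S -> R) m s : 0 <= Num.min (Num.max (u s) 0) (f m.+1 s) <=
    Num.min (Num.max (u s) 0) (f m s).
  rewrite le_min le_max lexx orbT fge/= le_min !ge_min lexx/=.
  by case/andP: (fd m s) => _ ->; rewrite orbT.
have cv (u : S -> R) s : Num.min (Num.max (u s) 0) (f m s) @[m --> \oo] --> 0.
  apply: (squeeze_cvgr (f := fun=> 0) (h := f ^~ s)) => //; last exact: cvg_cst.
  by apply: nearW => m; rewrite le_min ge_min lexx orbT/= le_max lexx orbT fge.
have [n1 n1P] := eint_decr_cvg0 Lpos (dec g) (cv g) e3.
have [n2 n2P] := eint_decr_cvg0 Lneg (dec (fun s => - g s)) (cv (fun s => - g s)) e3.
pose m := maxn n (maxn n1 n2).
have nm : (n <= m)%N by rewrite leq_maxl.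
have h1 := n1P m (leq_trans (leq_maxl n1 n2) (leq_maxr n _)).
have h2 := n2P m (leq_trans (leq_maxr n1 n2) (leq_maxr n _)).
have Lc := Lsub (Lpos m) (Lneg m); have Lr := Lsub Lg Lc.
have h3 : pnorm P p (I (fun s => g s - (pos m s - neg m s))) <=e e / 3.
  apply: (nP m nm) => // s; have := gf s; have := fge m s.
  have : f m s <= f n s by exact: (decr_homo s fd).
  rewrite /pos /neg ler_norml => a1 a2 /andP[a3 a4].
  rewrite ler_norml; case: (leP (g s) 0) => g0.
    rewrite (min_l (x := 0))//.
    case: (leP (- g s) 0) => g1; first by rewrite min_l// ; apply/andP; split; lra.
    by case: (leP (- g s) (f m s)) => g2; apply/andP; split; lra.
  rewrite [Num.max (- _) _]max_r; last by lra.
  rewrite (min_l (x := 0))//.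
  by case: (leP (g s) (f m s)) => g2; apply/andP; split; lra.
have h12 := pnormB_le hp (mI (Lpos m)) (mI (Lneg m)) h1 h2.
have := pnormD_le hp (mI Lr) (measurable_funB (mI (Lpos m)) (mI (Lneg m))) h3 h12.
have -> : e / 3 + (e / 3 + e / 3) = e by field.
apply: le_trans; rewrite le_eqVlt; apply/orP; left; apply/eqP; apply: pnorm_ae => //.
- exact: mI.
- by apply: measurable_funD; [exact: mI|apply: measurable_funB; exact: mI].
- apply: filterS2 (I_sub Lg Lc) (I_sub (Lpos m) (Lneg m)) => w /= -> ->.
  by rewrite subrK.
Qed.

(** The outer seminorm: [c] bounds the semivariation along an increasing
    sequence of elementary functions that dominates [G] in the limit. Slack
    [e] avoids suprema that may be infinite. *)
Definition covered (G : S -> R) (c : R) := exists f : nat -> S -> R,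
  [/\ forall n, [/\ L (f n), forall s, 0 <= f n s & semivar_le (f n) c],
      forall s, {homo f ^~ s : n m / (n <= m)%N >-> n <= m} &
      forall s (e : R), 0 < e -> exists n, G s <= f n s + e].

Lemma covered_mono (F G : S -> R) (a b : R) : (forall s, F s <= G s) -> a <= b ->
  covered G a -> covered F b.
Proof.
move=> FG ab [f [fP fnd fG]]; exists f; split=> //.
  by move=> n; have [? ? ?] := fP n; split=> //; exact: semivar_mono ab _.
by move=> s e e0; have [n ?] := fG s e e0; exists n; rewrite (le_trans (FG s)).
Qed.

Lemma semivar_covered f (c : R) : L f -> (forall s, 0 <= f s) -> semivar_le f c ->
  covered f c.
Proof.
move=> Lf f0 fc; exists (fun=> f); split=> [n|s n m _|s e e0].
- by split.
- exact: lexx.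
- by exists 0%N; rewrite lerDl ltW.
Qed.

(** On elementary functions the outer seminorm adds nothing: the excess of [f]
    over [F n] decreases to 0, hence so does its semivariation. *)
Lemma covered_semivar f (c : R) : L f -> (forall s, 0 <= f s) -> covered f c ->
  semivar_le f c.
Proof.
move=> Lf f0 [F [FP Fnd Ff]] g Lg gf.
apply/lee_addgt0Pr => e e0; rewrite -EFinD.
(* The part of [f] that is not yet covered by [F n]. *)
pose h n s := Num.max (f s - F n s) 0.
have LF n : L (F n) by case: (FP n).
have Lh n : L (h n) by apply: Lmax => //; exact: Lsub.
have [||n nP] := semivar_decr_cvg0 Lh _ _ e0.
- move=> n s; rewrite /h le_max lexx orbT/= ge_max !le_max lexx !orbT andbT.
  by rewrite lerD2l lerN2 Fnd.
- move=> s; apply/cvgrPdist_le => e' e'0; have [n nP] := Ff s e' e'0.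
  exists n => // m /= nm; rewrite sub0r normrN ger0_norm ?le_max ?lexx ?orbT//.
  by rewrite ge_max (ltW e'0) andbT lerBlDl (le_trans nP)// lerD2r Fnd.
have [_ F0 Fc] := FP n.
apply: (semivar_add (LF n) (Lh n)) Lg _ => //.
- by move=> s; rewrite /h le_max lexx orbT.
move=> s; rewrite (le_trans (gf s))// /h.
by case: (leP (f s - F n s) 0) => h'; lra.
Qed.

Lemma covered_add (F G : S -> R) (a b : R) : covered F a -> covered G b ->
  covered (fun s => F s + G s) (a + b).
Proof.
move=> [f [fP fnd fF]] [g [gP gnd gG]].
exists (fun n s => f n s + g n s); split.
- move=> n; have [Lf f0 fa] := fP n; have [Lg g0 gb] := gP n; split.
  + exact: Ladd.
  + by move=> s; rewrite addr_ge0.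
  + exact: semivar_add.
- by move=> s n m nm; rewrite lerD// ?fnd ?gnd.
- move=> s e e0; have e2 : 0 < e / 2 by rewrite divr_gt0.
  have [n nP] := fF s _ e2; have [m mP] := gG s _ e2.
  exists (maxn n m); have := fnd s _ _ (leq_maxl n m); have := gnd s _ _ (leq_maxr n m).
  by lra.
Qed.

Lemma semivar_sum n (f : nat -> S -> R) (c : nat -> R) :
  (forall i, [/\ L (f i), forall s, 0 <= f i s & semivar_le (f i) (c i)]) ->
  semivar_le (fun s => \sum_(i < n) f i s) (\sum_(i < n) c i).
Proof.
move=> fP; elim: n => [|n IH].
  rewrite big_ord0 => g Lg gf; have := eint_bound HI (M := 0) Lg.
  by rewrite mulr0; apply => s; rewrite (le_trans (gf s))// big_ord0.
rewrite big_ord_recr/= (_ : (fun _ => _) =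
  (fun s => \sum_(i < n) f i s + f n s)); last first.
  by apply/funext => s; rewrite big_ord_recr.
have [Lf f0 fc] := fP n; apply: semivar_add => //.
  by apply: Lsum => i; case: (fP i).
by move=> s; apply: sumr_ge0 => i _; case: (fP i).
Qed.

(** Countable subadditivity, obtained from the diagonal partial sums [f 0 n +
    ... + f (n-1) n]. *)
Lemma covered_sum (G : nat -> S -> R) (c : nat -> R) (F : S -> R) (a : R) :
  (forall i, covered (G i) (c i)) -> (forall n, \sum_(i < n) c i <= a) ->
  (forall s (e : R), 0 < e -> exists n, F s <= \sum_(i < n) G i s + e) ->
  covered F a.
Proof.
move=> /choice[f fP] ca FG.
have f0 i n s : 0 <= f i n s by case: (fP i) => /(_ n)[].
have fnd i s : {homo (f i) ^~ s : n m / (n <= m)%N >-> n <= m} by case: (fP i).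
exists (fun n s => \sum_(i < n) f i n s); split.
- move=> n; split.
  + by apply: (Lsum n (f := fun i => f i n)) => i; case: (fP i) => /(_ n)[].
  + by move=> s; apply: sumr_ge0.
  + apply: (semivar_mono (fun=> lexx _) (ca n)).
    by apply: (@semivar_sum n (fun i => f i n) c) => i; case: (fP i) => /(_ n).
- move=> s n m nm; rewrite -(subnKC nm) big_split_ord/=.
  rewrite -[leLHS]addr0 lerD//; last exact: sumr_ge0.
  by apply: ler_sum => i _; rewrite fnd// subnKC.
- move=> s e e0; have e2 : 0 < e / 2 by rewrite divr_gt0.
  have [n nP] := FG s _ e2.
  have d0 : 0 < e / 2 / n.+1%:R by rewrite divr_gt0.
  have /choice[m mP] : forall i, exists m, G i s <= f i m s + e / 2 / n.+1%:R.
    by move=> i; case: (fP i) => _ _; exact.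
  pose N := maxn n (\max_(i < n) m i).
  exists N; rewrite (le_trans nP)//.
  have h1 : \sum_(i < n) G i s <= \sum_(i < n) (f i N s + e / 2 / n.+1%:R).
    apply: ler_sum => i _; rewrite (le_trans (mP i))// lerD2r fnd//.
    by rewrite leq_max (leq_bigmax i) orbT.
  have h2 : \sum_(i < n) (f i N s + e / 2 / n.+1%:R) <= \sum_(i < N) f i N s + e / 2.
    rewrite big_split/= lerD//.
      by apply: (@ler_sum_prefix _ (fun i => f i N s)) => //; exact: leq_maxl.
    rewrite sumr_const card_ord -[leLHS]mulr_natr -mulrA ler_piMr ?(ltW e2)//.
    by rewrite ler_pdivrMl// mulr1 ler_nat.
  by lra.
Qed.

(** The closure of the elementary functions for the outer seminorm. *)
Definition lintegrable (f : S -> R) :=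
  forall e : R, 0 < e -> exists2 g, L g & covered (fun s => `|f s - g s|) e.

Let covered0 (e : R) : 0 <= e -> covered (fun=> 0) e.
Proof.
move=> e0; apply: semivar_covered => // g Lg g0.
have := eint_bound HI (M := 0) Lg; rewrite mulr0 => /(_ g0) h.
by rewrite (le_trans h)// lee_fin.
Qed.

Lemma lintegrableL f : L f -> lintegrable f.
Proof.
move=> Lf e e0; exists f => //.
by under eq_fun do rewrite subrr normr0; apply: covered0; exact: ltW.
Qed.

Lemma covered_scale (F : S -> R) (k a : R) : 0 < k -> covered F a ->
  covered (fun s => k * F s) (k * a).
Proof.
move=> k0 [f [fP fnd fF]]; exists (fun n s => k * f n s); split.
- move=> n; have [Lf f0 fa] := fP n; split; first exact: Lscale.
    by move=> s; rewrite mulr_ge0// ltW.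
  move=> g Lg gf; have Lh := Lscale k^-1 Lg.
  have := fa _ Lh => H.
  have {}H : pnorm P p (I (fun s => k^-1 * g s)) <=e a.
    apply: H => s; rewrite normrM gtr0_norm ?invr_gt0// ler_pdivrMl//.
  have := pnormZ_le hp k (mI Lh) H; rewrite gtr0_norm//; apply: le_trans.
  rewrite le_eqVlt; apply/orP; left; apply/eqP; apply: pnorm_ae => //.
  + exact: mI.
  + by apply: measurable_funM => //; exact: mI.
  + by apply: filterS (eint_scale HI k^-1 Lg) => w ->; rewrite mulrA mulfV ?mul1r ?gt_eqF.
- by move=> s n m nm; apply: ler_wpM2l; [exact: ltW|exact: fnd].
- move=> s e e0; have e2 : 0 < e / k by rewrite divr_gt0.
  have [n nP] := fF s _ e2; exists n.
  have := ler_wpM2l (ltW k0) nP; rewrite mulrDr; congr (_ <= _ + _).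
  by rewrite mulrC divfK// gt_eqF.
Qed.

Lemma lintegrable_lin f g (k : R) : lintegrable f -> lintegrable g ->
  lintegrable (fun s => f s + k * g s).
Proof.
move=> fi gi e e0; have e2 : 0 < e / 2 by rewrite divr_gt0.
pose k' := `|k| + 1; have k0 : 0 < k' by rewrite ltr_wpDl.
have [f1 Lf cf] := fi _ e2.
have [g1 Lg cg] := gi (e / 2 / k') (divr_gt0 e2 k0).
exists (fun s => f1 s + k * g1 s); first by apply: Ladd => //; exact: Lscale.
apply: covered_mono (covered_add cf (covered_scale k0 cg)).
  move=> s; rewrite (_ : _ - _ = (f s - f1 s) + k * (g s - g1 s)); last by ring.
  rewrite (le_trans (ler_normD _ _))// lerD2l normrM ler_wpM2r//.
  by rewrite /k' lerDl.
by rewrite [k' * _]mulrC divfK ?gt_eqF//; lra.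
Qed.

Lemma lintegrable_opp f : lintegrable f -> lintegrable (fun s => - f s).
Proof.
move=> fi; have := lintegrable_lin (-1) (lintegrableL (Lcst 0)) fi.
by under eq_fun do rewrite add0r mulN1r.
Qed.

Lemma lintegrable_max f g : lintegrable f -> lintegrable g ->
  lintegrable (fun s => Num.max (f s) (g s)).
Proof.
move=> fi gi e e0; have e2 : 0 < e / 2 by rewrite divr_gt0.
have [f1 Lf cf] := fi _ e2; have [g1 Lg cg] := gi _ e2.
exists (fun s => Num.max (f1 s) (g1 s)); first exact: Lmax.
apply: covered_mono (covered_add cf cg); last by lra.
by move=> s; exact: norm_max_sub.
Qed.

Let half_sum (e : R) n : 0 < e -> \sum_(i < n) e / 2 ^+ i.+1 <= e.
Proof.
move=> e0; have := sum_half_le n (ltW (divr_gt0 e0 (ltr0n _ 2))).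
rewrite divfK ?pnatr_eq0//; apply: le_trans; apply: ler_sum => i _.
by rewrite exprS invfM mulrA.
Qed.

(** Approximate [f n] by elementary [g n] with summable errors. The running
    maxima of the [g n] are increasing and, after truncation at the bound [M],
    bounded, and they are still close to [f n]; [semivar_incr_cauchy] applies
    to them. *)
Lemma lintegrable_incr_cauchy (f : nat -> S -> R) (M : R) :
  (forall n, lintegrable (f n)) ->
  (forall s, {homo f ^~ s : n m / (n <= m)%N >-> n <= m}) ->
  (forall n s, `|f n s| <= M) ->
  forall e : R, 0 < e -> exists n, forall m, (n <= m)%N ->
    covered (fun s => f m s - f n s) e.
Proof.
move=> fi fnd fM e e0; have e3 : 0 < e / 3 by rewrite divr_gt0.
have /choice[g gP] : forall n, exists g, L g /\
    covered (fun s => `|f n s - g s|) (e / 3 / 2 ^+ n.+1).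
  move=> n; have [|g Lg cg] := fi n (e / 3 / 2 ^+ n.+1); last by exists g.
  by rewrite divr_gt0// exprn_gt0.
pose G := fix G n s := if n is m.+1 then Num.max (G m s) (g n s) else g 0%N s.
have LG n : L (G n) by elim: n => [|n IH] /=; [case: (gP 0%N)|apply: Lmax => //; case: (gP n.+1)].
pose H n s := clamp (G n s) M.
have LH n : L (H n) by exact: Lclamp.
have HM n s : `|H n s| <= M
  by apply: norm_clamp; exact: le_trans (normr_ge0 _) (fM 0%N s).
have Gnd s : {homo G ^~ s : n m / (n <= m)%N >-> n <= m}.
  by apply/nondecreasing_seqP => n /=; rewrite le_max lexx.
have Hnd s : {homo H ^~ s : n m / (n <= m)%N >-> n <= m}.
  move=> n m nm; rewrite /H /clamp ge_max !le_max lexx orbT andbT.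
  by rewrite le_min !ge_min lexx orbT andbT (Gnd s _ _ nm).
have fG n s : `|f n s - G n s| <= \sum_(i < n.+1) `|f i s - g i s|.
  elim: n => [|n IH] /=; first by rewrite big_ord1.
  rewrite big_ord_recr/=.
  have -> : f n.+1 s = Num.max (f n s) (f n.+1 s) by rewrite max_r// fnd.
  apply: le_trans (norm_max_sub _ _ _ _) _; rewrite (max_r (x := f n s)) ?fnd//.
  by rewrite lerD2r.
have fH n s : `|f n s - H n s| <= `|f n s - G n s|.
  by apply: dist_clamp_le; exact: fM.
have cH n : covered (fun s => `|f n s - H n s|) (e / 3).
  apply: (@covered_sum (fun i s => `|f i s - g i s|) (fun i => e / 3 / 2 ^+ i.+1)).
  - by move=> i; case: (gP i).
  - by move=> m; exact: half_sum.
  - move=> s e' e'0; exists n.+1; rewrite (le_trans (fH n s))// (le_trans (fG n s))//.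
    by rewrite lerDl ltW.
have [n nP] := semivar_incr_cauchy LH Hnd HM e3.
exists n => m nm.
have c1 : covered (fun s => H m s - H n s) (e / 3).
  apply: semivar_covered; [exact: Lsub|by move=> s; rewrite subr_ge0 Hnd|exact: nP].
apply: covered_mono (covered_add (cH m) (covered_add c1 (cH n))); last by lra.
move=> s; have := ler_norm (f m s - H m s); have := ler_norm (- (f n s - H n s)).
by rewrite normrN; lra.
Qed.

(** Along a subsequence with summable increments, [F - f m] is dominated by
    the sum of the increments. *)
Lemma lintegrable_mct (f : nat -> S -> R) (F : S -> R) (M : R) :
  (forall n, lintegrable (f n)) ->
  (forall s, {homo f ^~ s : n m / (n <= m)%N >-> n <= m}) ->
  (forall n s, `|f n s| <= M) -> (forall s, f n s @[n --> \oo] --> F s) ->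
  forall e : R, 0 < e -> exists n, forall m, (n <= m)%N ->
    covered (fun s => F s - f m s) e.
Proof.
move=> fi fnd fM fF e e0.
have /choice[N NP] : forall k, exists n, forall m, (n <= m)%N ->
    covered (fun s => f m s - f n s) (e / 2 ^+ k.+1).
  move=> k; apply: (lintegrable_incr_cauchy fi fnd fM).
  by rewrite divr_gt0// exprn_gt0.
pose nn := fix nn k := if k is j.+1 then maxn (nn j).+1 (N k) else N 0%N.
have nnN k : (N k <= nn k)%N by case: k => //= k; rewrite leq_maxr.
have nnS k : (nn k < nn k.+1)%N by rewrite /= leq_maxl.
have nnk k : (k <= nn k)%N.
  by elim: k => // k IH; rewrite (leq_ltn_trans IH (nnS k)).
have FF s n : f n s <= F s.
  have -> : F s = limn (f ^~ s) by rewrite (cvg_lim _ (fF s)).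
  by apply: nondecreasing_cvgn_le; [exact: fnd|apply/cvg_ex; exists (F s)].
exists (nn 0%N) => m nm.
apply: (@covered_sum (fun k s => f (nn k.+1) s - f (nn k) s)
  (fun k => e / 2 ^+ k.+1)).
- move=> k; apply: covered_mono (NP k (nn k.+1) _) => //.
    by move=> s; rewrite lerD2l lerN2 fnd.
  by rewrite (leq_trans (nnN k))// ltnW.
- by move=> n; exact: half_sum.
- move=> s e' e'0; move/cvgrPdist_le: (fF s) => /(_ _ e'0)[K _ KP].
  exists K; rewrite -(big_mkord xpredT (fun k => f (nn k.+1) s - f (nn k) s)).
  rewrite (telescope_sumr (fun k => f (nn k) s))//.
  have := KP (nn K) (nnk K); rewrite ger0_norm ?subr_ge0//=.
  have := fnd s _ _ nm; lra.
Qed.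

Lemma lintegrable_lim (F : S -> R) :
  (forall e : R, 0 < e -> exists2 f, lintegrable f & covered (fun s => `|F s - f s|) e) ->
  lintegrable F.
Proof.
move=> H e e0; have e2 : 0 < e / 2 by rewrite divr_gt0.
have [f1 fi c1] := H _ e2; have [g Lg cg] := fi _ e2; exists g => //.
apply: covered_mono (covered_add c1 cg); last by lra.
by move=> s; rewrite -[F s - g s](subrKA (f1 s)); exact: ler_normD.
Qed.

Fixpoint running_max (f : nat -> S -> R) (k m : nat) (s : S) : R :=
  if m is j.+1 then Num.max (running_max f k j s) (f (k + m)%N s) else f k s.

(** The function [u k] is the supremum of the [f n] with [n >= k]: the last
    two properties say that it is an upper bound and the least one. *)
Lemma lintegrable_sup (f : nat -> S -> R) (M : R) :
  (forall n, lintegrable (f n)) -> (forall n s, `|f n s| <= M) ->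
  exists u : nat -> S -> R, [/\ forall k, lintegrable (u k),
    forall k s, u k.+1 s <= u k s, forall k n s, (k <= n)%N -> f n s <= u k s &
    forall k s a, (forall n, (k <= n)%N -> f n s <= a) -> u k s <= a].
Proof.
move=> fi fM.
have pub k m s a : (forall n, (k <= n)%N -> f n s <= a) -> running_max f k m s <= a.
  move=> fa; elim: m => [|m IH] /=; first exact: fa.
  by rewrite ge_max IH fa// leq_addr.
have pnd k s : {homo (running_max f k) ^~ s : n m / (n <= m)%N >-> n <= m}.
  by apply/nondecreasing_seqP => n /=; rewrite le_max lexx.
have pge k n s : (k <= n)%N -> f n s <= running_max f k (n - k) s.
  move=> kn; rewrite -{1}(subnKC kn); case: (n - k)%N => [|j] /=.
    by rewrite addn0.
  by rewrite le_max lexx orbT.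
have pM k m s : `|running_max f k m s| <= M.
  rewrite ler_norml; apply/andP; split.
    apply: le_trans (pnd k s _ _ (leq0n m)) => /=.
    by have := fM k s; rewrite ler_norml => /andP[].
  by apply: pub => n _; have := fM n s; rewrite ler_norml => /andP[].
have pi k m : lintegrable (running_max f k m).
  by elim: m => [|m IH] /=; [exact: fi|exact: lintegrable_max].
have pcv k s : cvgn ((running_max f k) ^~ s).
  apply: nondecreasing_is_cvgn; first exact: pnd.
  by exists M => _ [n _ <-]; have := pM k n s; rewrite ler_norml => /andP[].
pose u k s := limn ((running_max f k) ^~ s).
have pu k m s : running_max f k m s <= u k s by exact: nondecreasing_cvgn_le.
have uub k s a : (forall n, (k <= n)%N -> f n s <= a) -> u k s <= a.
  by move=> fa; apply: limr_le => //; apply: nearW => m; exact: pub.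
exists u; split=> //.
- move=> k; apply: lintegrable_lim => e e0.
  have [n nP] := lintegrable_mct (pi k) (pnd k) (pM k) (fun s => pcv k s) e0.
  exists (running_max f k n) => //; apply: covered_mono (nP n (leqnn n)) => // s.
  by rewrite ger0_norm ?subr_ge0.
- move=> k s; apply: uub => n kn; apply: le_trans (pge k n s (ltnW kn)) (pu _ _ _).
- by move=> k n s kn; apply: le_trans (pge k n s kn) (pu _ _ _).
Qed.

(** The distance of [F] and [f m] is at most the oscillation [sup f n - inf f
    n] over [n >= m], which decreases to 0; the monotone case applies to it.
    *)
Lemma lintegrable_dct (f : nat -> S -> R) (F : S -> R) (M : R) :
  (forall n, lintegrable (f n)) -> (forall n s, `|f n s| <= M) ->
  (forall s, f n s @[n --> \oo] --> F s) ->
  lintegrable F /\ forall e : R, 0 < e -> exists n, forall m, (n <= m)%N ->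
    covered (fun s => `|F s - f m s|) e.
Proof.
move=> fi fM fF.
suff H : forall e : R, 0 < e -> exists n, forall m, (n <= m)%N ->
    covered (fun s => `|F s - f m s|) e.
  split=> //; apply: lintegrable_lim => e e0; have [n nP] := H e e0.
  by exists (f n) => //; exact: nP.
have [u [ui ud uf uub]] := lintegrable_sup fi fM.
have [|v [vi vd vf vub]] := lintegrable_sup (fun n => lintegrable_opp (fi n)) (M := M).
  by move=> n s; rewrite normrN.
(* Minus the oscillation from index [k] on: [v k] is minus the infimum of the
   tail. *)
pose w k s := - (u k s + v k s).
have wi k : lintegrable (w k).
  have := lintegrable_lin 1 (ui k) (vi k).
  by move=> /lintegrable_opp; under eq_fun do rewrite mul1r.
have fu k s : F s <= u k s.
  have -> : F s = limn (f ^~ s) by rewrite (cvg_lim _ (fF s)).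
  apply: limr_le; first by apply/cvg_ex; exists (F s).
  by exists k => // n /= kn; exact: uf.
have fv k s : - F s <= v k s.
  have -> : F s = limn (f ^~ s) by rewrite (cvg_lim _ (fF s)).
  rewrite lerNl; apply: limr_ge; first by apply/cvg_ex; exists (F s).
  by exists k => // n /= kn; rewrite lerNl; exact: vf.
have wnd s : {homo w ^~ s : n m / (n <= m)%N >-> n <= m}.
  by apply/nondecreasing_seqP => n; rewrite /w lerN2 lerD.
have w0 s : w n s @[n --> \oo] --> 0.
  apply/cvgrPdist_le => e e0; have e2 : 0 < e / 2 by rewrite divr_gt0.
  move/cvgrPdist_le: (fF s) => /(_ _ e2)[K _ KP]; exists K => // k /= Kk.
  have h1 : u k s <= F s + e / 2.
    apply: uub => n kn; have := KP n (leq_trans Kk kn) => /=.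
    by rewrite ler_norml => /andP[]; lra.
  have h2 : v k s <= - F s + e / 2.
    apply: vub => n kn; have := KP n (leq_trans Kk kn) => /=.
    by rewrite ler_norml => /andP[]; lra.
  have a1 := fu k s; have a2 := fv k s.
  rewrite sub0r normrN /w normrN ger0_norm; lra.
have wM n s : `|w n s| <= M + M.
  have h1 : u n s <= M.
    by apply: uub => m _; have := fM m s; rewrite ler_norml => /andP[].
  have h2 : v n s <= M.
    by apply: vub => m _; have := fM m s; rewrite ler_norml => /andP[]; lra.
  have a1 := fu n s; have a2 := fv n s.
  by rewrite /w normrN ger0_norm; lra.
move=> e e0; have [n nP] := lintegrable_mct wi wnd wM w0 e0.
exists n => m nm; apply: covered_mono (nP m nm) => // s.
have := uf m m s (leqnn m); have := vf m m s (leqnn m).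
have := fu m s; have := fv m s; rewrite /w => a1 a2 a3 a4.
by rewrite ler_norml; apply/andP; split; lra.
Qed.

(** The values of the extended integral are singled out up to a null set by
    their distances to the integrals of all elementary functions, in
    accordance with the outer seminorm; no approximating sequence enters the
    definition. *)
Definition extended_integral (f : S -> R) (Z : T -> R) := measurable_fun setT Z /\
  forall g (c : R), L g -> covered (fun s => `|f s - g s|) c ->
    pnorm P p (Z \- I g) <=e c.

Lemma ext_exists f : lintegrable f -> exists Z, extended_integral f Z.
Proof.
move=> fi.
have /choice[g gP] : forall n : nat, exists g, L g /\
    covered (fun s => `|f s - g s|) (1 / 2 ^+ n.+1).
  move=> n; have [|g Lg cg] := fi (1 / 2 ^+ n.+1); last by exists g.
  by rewrite divr_gt0// exprn_gt0.
have Lg n : L (g n) by case: (gP n).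
have Idist f1 f2 a b : L f1 -> L f2 -> covered (fun s => `|f s - f1 s|) a ->
    covered (fun s => `|f s - f2 s|) b -> pnorm P p (I f1 \- I f2) <=e a + b.
  move=> L1 L2 c1 c2; rewrite pnorm_I_sub//.
  have Ld := Lsub L1 L2; apply: (covered_semivar (Labs Ld)) => //.
  apply: covered_mono (covered_add c1 c2) => // s.
  by rewrite -(subrKA (f s)) (le_trans (ler_normD _ _))// lerD2r distrC.
have mg n : measurable_fun setT (I (g n)) by exact: mI.
have cau n : pnorm P p (I (g n.+1) \- I (g n)) <=e 1 / 2 ^+ n.
  have [_ c1] := gP n; have [_ c2] := gP n.+1.
  apply: le_trans (Idist _ _ _ _ (Lg n.+1) (Lg n) c2 c1) _; rewrite lee_fin.
  rewrite !exprS -subr_ge0 [X in 0 <= X](_ : _ = 1 / 2 ^+ n / 4).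
    by rewrite !divr_ge0// exprn_ge0.
  by field; rewrite expf_neq0// pnatr_eq0.
exists (fun w => rlim ((fun n => I (g n)) ^~ w)); split.
  exact: (measurable_rlim mg).
move=> h c Lh ch; apply/lee_addgt0Pr => e e0; rewrite -EFinD.
(* The tail of the Cauchy sequence contributes at most [2 / 2^n], the error of
   its n-th term at most half of [1 / 2^n]. *)
have [n ne] : exists n, 3 / 2 ^+ n <= e.
  exact: exists_div_pow2_le.
have h1 := pnorm_complete hp n ler01 mg cau.
have [_ cn] := gP n; have h2 := Idist _ _ _ _ (Lg n) Lh cn ch.
rewrite pnormB in h1.
have mr := measurable_rlim mg.
apply: le_trans (pnorm_sub_le hp mr (mg n) (mI Lh) h1 h2) _; rewrite lee_fin.
rewrite addrA addrC lerD2l (le_trans _ ne)// exprS.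
rewrite -subr_ge0 [X in 0 <= X](_ : _ = 1 / 2 ^+ n / 2).
  by rewrite !divr_ge0// exprn_ge0.
by field; rewrite expf_neq0// pnatr_eq0.
Qed.

Lemma ext_dist f1 f2 Z1 Z2 (c : R) : lintegrable f1 ->
  extended_integral f1 Z1 -> extended_integral f2 Z2 -> covered (fun s => `|f1 s - f2 s|) c ->
  pnorm P p (Z1 \- Z2) <=e c.
Proof.
move=> fi [m1 H1] [m2 H2] cc; apply/lee_addgt0Pr => e e0; rewrite -EFinD.
have e2 : 0 < e / 2 by rewrite divr_gt0.
have [g Lg cg] := fi _ e2.
have h1 := H1 _ _ Lg cg.
have h2 : pnorm P p (Z2 \- I g) <=e c + e / 2.
  apply: H2 => //; apply: covered_mono (covered_add cc cg) => // s.
  by rewrite -[f2 s - g s](subrKA (f1 s)) (le_trans (ler_normD _ _))// lerD2r distrC.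
rewrite pnormB in h2.
apply: le_trans (pnorm_sub_le hp m1 (mI Lg) m2 h1 h2) _.
by rewrite lee_fin; lra.
Qed.

Lemma ext_lin f1 f2 Z1 Z2 (k : R) : lintegrable f1 -> lintegrable f2 ->
  extended_integral f1 Z1 -> extended_integral f2 Z2 ->
  extended_integral (fun s => f1 s + k * f2 s) (fun w => Z1 w + k * Z2 w).
Proof.
move=> i1 i2 [m1 H1] [m2 H2].
have mZ : measurable_fun setT (fun w => Z1 w + k * Z2 w).
  by apply: measurable_funD => //; exact: measurable_funM.
split=> // g c Lg cg; apply/lee_addgt0Pr => e e0; rewrite -EFinD.
pose k' := `|k| + 1; have k0 : 0 < k' by rewrite ltr_wpDl.
have e4 : 0 < e / 4 by rewrite divr_gt0.
have [g1 L1 c1] := i1 _ e4; have [g2 L2 c2] := i2 _ (divr_gt0 e4 k0).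
have h1 := H1 _ _ L1 c1; have h2 := H2 _ _ L2 c2.
have kle : `|k| * (e / 4 / k') <= e / 4.
  rewrite mulrCA ler_piMr ?(ltW e4)// ler_pdivrMr// mul1r /k' lerDl//.
have mm2 : measurable_fun setT (Z2 \- I g2) by apply: measurable_funB => //; exact: mI.
have h2' := pnormZ_le hp k mm2 h2.
have Lk := Lscale k L2; have Ls := Ladd L1 Lk; have Ld := Lsub Ls Lg.
have h3 : pnorm P p (I (fun s => (g1 s + k * g2 s) - g s)) <=e e / 4 + e / 4 + c.
  apply: (covered_semivar (Labs Ld)) => //.
  have c2' := covered_scale k0 c2.
  apply: covered_mono (covered_add (covered_add c1 c2') cg) => //.
    move=> s.
    rewrite (_ : _ - _ = - (f1 s - g1 s) + (- k) * (f2 s - g2 s)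
      + (f1 s + k * f2 s - g s)); last by ring.
    rewrite (le_trans (ler_normD _ _))// lerD2r (le_trans (ler_normD _ _))//.
    by rewrite normrN lerD2l normrM normrN ler_wpM2r// /k' lerDl.
  by rewrite [k' * _]mulrC divfK ?gt_eqF.
have mx : measurable_fun setT ((Z1 \- I g1) \+ (fun w => k * (Z2 \- I g2) w)).
  by apply: measurable_funD; [apply: measurable_funB => //; exact: mI|exact: measurable_funM].
have := pnormD_le hp mx (mI Ld) (pnormD_le hp _ _ h1 h2') h3.
move=> /(_ _ _) H; apply: le_trans (le_trans (H _ _) _).
- rewrite le_eqVlt; apply/orP; left; apply/eqP; apply: pnorm_ae => //.
  + by apply: measurable_funB => //; exact: mI.
  + by apply: measurable_funD => //; exact: mI.
  + apply: filterS3 (I_sub Ls Lg) (eint_add HI L1 Lk) (eint_scale HI k L2).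
    by move=> w /= -> -> ->; ring.
- by apply: measurable_funB => //; exact: mI.
- exact: measurable_funM.
- by rewrite lee_fin; lra.
Qed.

Lemma ext_elementary f : L f -> extended_integral f (I f).
Proof.
move=> Lf; split; first exact: mI.
move=> g c Lg cg; rewrite pnorm_I_sub//.
by apply: (covered_semivar (Labs (Lsub Lf Lg))) => //; exact: Lsub.
Qed.

Record daniell_extension (D : (S -> R) -> Prop) (J : (S -> R) -> T -> R) : Prop :=
  DaniellExtension {
  dext_elementary : forall f, L f ->
    D f /\ {ae P, forall w, J f w = I f w};
  dext_measurable : forall f, D f -> measurable_fun setT (J f);
  dext_linear : forall f g (k : R), D f -> D g -> D (fun s => f s + k * g s) /\
    {ae P, forall w, J (fun s => f s + k * g s) w = J f w + k * J g w};
  dext_dct : forall (f : nat -> S -> R) F (M : R), (forall n, D (f n)) ->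
    (forall n s, `|f n s| <= M) -> (forall s, f n s @[n --> \oo] --> F s) ->
    D F /\ forall e : R, 0 < e -> exists n, forall m, (n <= m)%N ->
      pnorm P p (J F \- J (f m)) <=e e }.

Theorem daniell : exists D J, daniell_extension D J.
Proof.
have /choice[J JP] : forall f, exists Z, lintegrable f -> extended_integral f Z.
  move=> f; have [fi|nfi] := pselect (lintegrable f).
    by have [Z ZP] := ext_exists fi; exists Z.
  by exists (fun=> 0).
have uniq f Z : lintegrable f -> extended_integral f Z -> {ae P, forall w, J f w = Z w}.
  move=> fi fZ; have h : pnorm P p (J f \- Z) <=e 0.
    apply: (ext_dist fi (JP f fi) fZ).
    under eq_fun do rewrite subrr normr0; exact: covered0.
  have m : measurable_fun setT (J f \- Z).
    by apply: measurable_funB; [case: (JP f fi)|case: fZ].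
  have h0 : pnorm P p (J f \- Z) = 0%E.
    by apply/eqP; rewrite eq_le h pnorm_ge0.
  by apply: filterS (pnorm_eq0 hp m h0) => w /eqP; rewrite /= subr_eq0 => /eqP.
exists lintegrable, J; split.
- move=> f Lf; split; first exact: lintegrableL.
  by apply: uniq; [exact: lintegrableL|exact: ext_elementary].
- by move=> f fi; case: (JP f fi).
- move=> f g k fi gi; have fgi := lintegrable_lin k fi gi; split=> //.
  by apply: uniq => //; apply: ext_lin => //; exact: JP.
- move=> f F M fi fM fF; have [Fi cF] := lintegrable_dct fi fM fF; split=> // e e0.
  have [n nP] := cF e e0; exists n => m nm.
  by apply: (ext_dist Fi (JP F Fi) (JP _ (fi m))); exact: nP.
Qed.

End daniell.

(** * Measurability with respect to a sub-sigma-algebra *)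

HB.instance Definition _ (R : realType) := Choice.on {nonneg R}.
HB.instance Definition _ (R : realType) := isPointed.Build {nonneg R} 0%:nng.

Section sub_measurability.
Context {R : realType} {U : pointedType}.
Implicit Types (G H : set (set U)) (f g : U -> R).

(** Measurability for the generated sigma-algebra, stated on the space
    [g_sigma_algebraType G] so that closure properties of measurable functions
    apply. *)
Definition rmeas G f :=
  measurable_fun [set: g_sigma_algebraType G] (f : g_sigma_algebraType G -> R).

Lemma rmeasP G f : rmeas G f <-> forall B, measurable B -> <<s G >> (f @^-1` B).
Proof.
split=> [mf B mB|mf _ B mB]; last by rewrite setTI; exact: mf.
by rewrite -[_ @^-1` _]setTI; exact: mf.
Qed.

Lemma rmeas_sub G H f : G `<=` <<s H >> -> rmeas G f -> rmeas H f.
Proof.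
move=> GH /rmeasP mf; apply/rmeasP => B mB.
apply: (smallest_sub _ GH) (mf B mB); exact: smallest_sigma_algebra.
Qed.

Lemma rmeas_measurable d (T : measurableType d) (G : set (set T)) (f : T -> R) :
  G `<=` measurable -> measurable_fun [set: g_sigma_algebraType G] (f : g_sigma_algebraType G -> R) ->
  measurable_fun setT f.
Proof.
move=> GT mf _ B mB; have := mf measurableT B mB; rewrite !setTI => h.
suff : <<s G >> `<=` (measurable : set (set T)) by apply.
by apply: smallest_sub => //; exact: sigma_algebra_measurable.
Qed.

End sub_measurability.

Section monotone_class.
Context {R : realType} {U : pointedType}.

(** An integer part, written as a sum of indicators of the levels passed. *)
Lemma count_levels (K : nat) (x : R) : 0 <= x <= K%:R ->
  `|x - \sum_(k < K) (k.+1%:R <= x)%R%:R| <= 1.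
Proof.
elim: K x => [|K IH] x /andP[x0 xK].
  by rewrite big_ord0 subr0 ger0_norm//; lra.
rewrite big_ord_recr/=; have [xK'|Kx] := leP x K%:R.
  have -> : (K.+1%:R <= x) = false by apply/negbTE; rewrite -ltNge (le_lt_trans xK')// ltr_nat.
  by rewrite addr0; apply: IH; rewrite x0.
have -> : \sum_(k < K) (k.+1%:R <= x)%R%:R = K%:R :> R.
  rewrite (eq_bigr (fun=> 1)) ?sumr_const ?card_ord// => i _.
  by rewrite (le_trans _ (ltW Kx))// ler_nat.
rewrite -natr1 in xK *; rewrite ler_norml.
by case: (leP (K%:R + 1) x) => h /=; apply/andP; split; rewrite ?mulr1n ?mulr0n; lra.
Qed.

(** By the pi-lambda theorem [H] contains the indicators of the generated
    sigma-algebra, and a bounded function is the uniform limit of its dyadic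
    approximations from below, which are combinations of indicators of level
    sets. *)
Lemma functional_monotone_class (G : set (set U)) (H : (U -> R) -> Prop) :
  setI_closed G ->
  H (fun=> 1) ->
  (forall f g (k : R), H f -> H g -> H (fun u => f u + k * g u)) ->
  (forall (f : nat -> U -> R) F (M : R), (forall n, H (f n)) ->
    (forall n u, `|f n u| <= M) -> (forall u, f n u @[n --> \oo] --> F u) -> H F) ->
  (forall A, G A -> H \1_A) ->
  forall f (M : R), rmeas G f -> (forall u, `|f u| <= M) -> H f.
Proof.
move=> GI H1 Hlin Hlim HG f M mf fM.
have H0 : H (fun=> 0).
  by have := Hlin _ _ (-1) H1 H1; under eq_fun do rewrite mulN1r subrr.
have HA A : <<s G >> A -> H \1_A.
  move=> GA; apply: (lambda_system_subset GI (H := [set A | H \1_A])) GA => //.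
  split=> //.
  - by rewrite /= (_ : \1_setT = fun=> 1)//; apply/funext => u; rewrite indicE in_setT.
  - move=> A1 A2 A21 h1 h2; have := Hlin _ _ (-1) h1 h2; congr H.
    apply/funext => u; rewrite !indicE in_setD.
    have [u2|u2] := boolP (u \in A2); last by rewrite andbT mulr0 addr0.
    by rewrite andbF mulN1r (mem_set (A21 _ (set_mem u2))) subrr.
  - move=> A1 nd hA; apply: (Hlim (fun n => \1_(A1 n)) _ 1) => //.
      by move=> n u; rewrite indicE ger0_norm//; case: (_ \in _).
    move=> u; have [[n _ An]|nA] := pselect ((\bigcup_k A1 k) u).
      apply: cvg_near_cst; exists n => // m /= nm.
      have /subsetPset h := nd _ _ nm.
      by rewrite !indicE !mem_set//; [exists n|exact: h].
    apply: cvg_near_cst; apply: nearW => m.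
    by rewrite !indicE !memNset// => h; apply: nA; exists m.
have Hsum n (g : nat -> U -> R) : (forall i, H (g i)) -> H (fun u => \sum_(i < n) g i u).
  move=> hg; elim: n => [|n IH].
    by under eq_fun do rewrite big_ord0.
  have := Hlin _ _ 1 IH (hg n); congr H; apply/funext => u.
  by rewrite big_ord_recr/= mul1r.
have [K MK] : exists K : nat, M + M <= K%:R.
  by exists (Num.truncn (M + M)).+1; rewrite ltW// truncnS_gt.
pose lev n k := [set u | k.+1%:R <= 2 ^+ n * (f u + M)].
have mlev n k : <<s G >> (lev n k).
  have m' : rmeas G (fun u => 2 ^+ n * (f u + M)).
    by apply: measurable_funM => //; apply: measurable_funD.
  have /rmeasP := m' => /(_ `[k.+1%:R, +oo[%classic (measurable_itv _)).
  by congr (<<s G >> _); apply/seteqP; split => u /=; rewrite in_itv/= andbT.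
(* The n-th dyadic approximation of [f + M] from below, counted in levels of
   height [2^-n]. *)
pose g n u : R := 0 + (2 ^+ n)^-1 * \sum_(k < K * 2 ^ n) \1_(lev n k) u.
have Hg n : H (g n).
  apply: Hlin => //; apply: (Hsum _ (fun k => \1_(lev n k))) => k; exact: HA.
have gf n u : `|f u + M - g n u| <= 1 / 2 ^+ n.
  have p2 : 0 < 2 ^+ n :> R by rewrite exprn_gt0.
  have := @count_levels (K * 2 ^ n) (2 ^+ n * (f u + M)) _.
  have fu := fM u; rewrite ler_norml in fu; case/andP: fu => fu1 fu2.
  have -> : 0 <= 2 ^+ n * (f u + M) <= (K * 2 ^ n)%:R.
    have q1 : 0 <= f u + M by lra.
    have q2 : f u + M <= K%:R by lra.
    by rewrite mulr_ge0 ?(ltW p2)//= natrM natrX mulrC ler_wpM2r// ltW.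
  move=> /(_ isT); rewrite ler_pdivlMr// => h.
  have E : \sum_(k < K * 2 ^ n) \1_(lev n k) u =
      \sum_(k < K * 2 ^ n) (k.+1%:R <= 2 ^+ n * (f u + M))%R%:R :> R.
    apply: eq_bigr => k _; rewrite indicE /lev; congr ((nat_of_bool _)%:R).
    by apply/idP/idP => hk; [exact: (set_mem hk)|exact: mem_set].
  rewrite -[X in _ * X](gtr0_norm p2) -normrM /g add0r E mulrBl.
  by rewrite [X in X - _]mulrC [X in _ - X]mulrAC mulVf ?gt_eqF// mul1r.
have HfM : H (fun u => f u + M).
  apply: (Hlim g _ (M + M + 1)) => //.
    move=> n u; have h1 := gf n u; have h2 := fM u.
    have h3 : 1 / 2 ^+ n <= 1 :> R.
      by rewrite ler_pdivrMr ?exprn_gt0// mul1r exprn_ege1// ler1n.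
    rewrite ler_norml in h1; rewrite ler_norml in h2; rewrite ler_norml.
    by case/andP: h1 => ? ?; case/andP: h2 => ? ?; apply/andP; split; lra.
  move=> u; apply/cvgrPdist_le => e e0.
  have h : `|2^-1 : R| < 1 by rewrite ger0_norm// invf_lt1// ltr1n.
  have /cvgrPdist_le /(_ _ e0) := cvg_geometric 1 h; apply: filterS => n.
  rewrite sub0r normrN /= exprVn ger0_norm ?divr_ge0 ?exprn_ge0//.
  exact: le_trans.
have := Hlin _ _ (- M) HfM H1; congr H; apply/funext => u.
by rewrite mulr1 addrK.
Qed.

End monotone_class.

Section filtrations.
Context d (T : measurableType d) (R : realType) (P : probability T R).
Variable F : {nonneg R} -> set (set T).
Hypothesis hF : usual_conditions P F.
Local Notation time := {nonneg R}.

Lemma filtration_sigma t : sigma_algebra setT (F t).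
Proof. by case: hF => -[]. Qed.

Lemma filtration_id t : <<s F t >> = F t.
Proof. by rewrite sigma_algebra_id//; exact: filtration_sigma. Qed.

Lemma filtration_sub (s t : time) : s <= t -> F s `<=` F t.
Proof. by case: hF => -[_ _ h] _ _ st; exact: h. Qed.

Lemma rmeasFP t (f : T -> R) : rmeas (F t) f <-> forall B, measurable B -> F t (f @^-1` B).
Proof.
by split=> [/rmeasP mf B mB|mf]; [rewrite -filtration_id; exact: mf|
  apply/rmeasP => B mB; rewrite filtration_id; exact: mf].
Qed.

Lemma rmeasF_le (s t : time) (f : T -> R) : s <= t -> rmeas (F s) f -> rmeas (F t) f.
Proof.
move=> st; apply: rmeas_sub; rewrite filtration_id; exact: filtration_sub.
Qed.

Lemma rmeasF_measurable t (f : T -> R) : rmeas (F t) f -> measurable_fun setT f.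
Proof. by apply: rmeas_measurable; case: hF => -[]. Qed.

Lemma filtrationU t (A B : set T) : F t A -> F t B -> F t (A `|` B).
Proof.
rewrite -(filtration_id t) => mA mB.
exact: (@measurableU _ (g_sigma_algebraType (F t))).
Qed.

Lemma filtrationI t (A B : set T) : F t A -> F t B -> F t (A `&` B).
Proof.
rewrite -(filtration_id t) => mA mB.
exact: (@measurableI _ (g_sigma_algebraType (F t))).
Qed.

Lemma filtrationC t (A : set T) : F t A -> F t (~` A).
Proof.
rewrite -(filtration_id t) => mA.
exact: (@measurableC _ (g_sigma_algebraType (F t))).
Qed.

Lemma filtration0 t : F t set0.
Proof. by case: (filtration_sigma t). Qed.

Lemma filtration_negligible t (N : set T) : P.-negligible N -> F t N.
Proof.
move=> nN; case: hF => _ h _.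
by apply: (filtration_sub (s := 0%:nng)); [rewrite -num_le/=|exact: h].
Qed.

(** The filtration contains all null sets, so that adaptedness does not depend
    on the choice of a version. *)
Lemma rmeasF_ae t (f g : T -> R) : {ae P, forall w, f w = g w} ->
  rmeas (F t) g -> rmeas (F t) f.
Proof.
move=> fg /rmeasFP mg; apply/rmeasFP => B mB.
have nN : P.-negligible [set w | ~ f w = g w] by exact: fg.
rewrite (_ : f @^-1` B = (g @^-1` B `&` ~` [set w | ~ f w = g w]) `|`
  (f @^-1` B `&` [set w | ~ f w = g w])).
  apply: filtrationU.
    by apply: filtrationI; [exact: mg|apply/filtrationC/filtration_negligible].
  apply: filtration_negligible; apply: negligibleS nN; exact: subIsetr.
apply/seteqP; split => w /=.
  by move=> fB; have [e|n] := pselect (f w = g w); [left; rewrite -e; split => //|right].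
by move=> [[gB /contrapT ->]|[]].
Qed.

Lemma predictable_setI_closed : setI_closed (predictable_sets F).
Proof.
have inj0 (A B : set T) (C : set time) : ~ C 0%:nng ->
    ([set 0%:nng] `*` A) `&` (C `*` B) = [set 0%:nng] `*` (set0 : set T).
  move=> nC; apply/seteqP; split => -[r w] /=.
    by move=> [[-> _] [/nC]].
  by move=> [].
move=> _ _ [[A FA ->]|[s [t [A [st FA ->]]]]] [[B FB ->]|[s' [t' [B [st' FB ->]]]]].
- left; exists (A `&` B); first exact: filtrationI.
  by rewrite -setXI setIid.
- left; exists set0; first exact: filtration0.
  by apply: inj0 => /=; rewrite le_gtF// -num_le/=.
- left; exists set0; first exact: filtration0.
  by rewrite setIC; apply: inj0 => /=; rewrite le_gtF// -num_le/=.
- have [h|h] := ltP (Num.max s s') (Num.min t t').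
    right; exists (Num.max s s'), (Num.min t t'), (A `&` B); split => //.
      apply: filtrationI; first by apply: filtration_sub FA; rewrite le_max lexx.
      by apply: filtration_sub FB; rewrite le_max lexx orbT.
    rewrite -setXI; congr (_ `*` _); apply/seteqP; split => r /=.
      by move=> [/andP[h1 h2] /andP[h3 h4]]; rewrite gt_max le_min h1 h2 h3 h4.
    by rewrite gt_max le_min => /andP[/andP[-> ->] /andP[-> ->]].
  left; exists set0; first exact: filtration0.
  apply/seteqP; split => -[r w] //=; last by case.
  move=> [[/andP[h1 h2] _] [/andP[h3 h4] _]].
  have : Num.max s s' < Num.min t t'.
    by apply: (@lt_le_trans _ _ r); rewrite ?gt_max ?le_min ?h1 ?h2 ?h3 ?h4.
  by rewrite ltNge h.
Qed.

End filtrations.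

(** * Integration of Lipschitz adapted integrands *)

Lemma norm_min_sub {R : realDomainType} (a b c x : R) :
  `|Num.min a b - Num.min c x| <= `|a - c| + `|b - x|.
Proof.
have h1 := ler_norm (a - c); have h2 := ler_norm (b - x).
have h3 := ler_norm (- (a - c)); have h4 := ler_norm (- (b - x)).
rewrite !normrN in h3 h4.
have n1 := normr_ge0 (a - c); have n2 := normr_ge0 (b - x).
rewrite ler_norml; case: (leP a b) => ab; case: (leP c x) => cx;
  apply/andP; split; lra.
Qed.

Section riemann_integral.
Context d (T : measurableType d) (R : realType) (P : probability T R).
Variable F : {nonneg R} -> set (set T).
Hypothesis hF : usual_conditions P F.
Variable p : R.
Hypothesis hp : 1 <= p.
Local Notation time := {nonneg R}.
Implicit Types (U : time -> T -> R) (g : time * T -> R).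

Definition grid (t : time) (n j : nat) : time := `|t%:num * (j%:R / 2 ^+ n)|%:nng.

Lemma gridE t n j : (grid t n j)%:num = t%:num * (j%:R / 2 ^+ n).
Proof. by rewrite /= ger0_norm// mulr_ge0// divr_ge0// exprn_ge0. Qed.

Lemma grid_le t n i j : (i <= j)%N -> grid t n i <= grid t n j.
Proof.
move=> ij; rewrite -num_le !gridE ler_wpM2l// ler_pM2r ?invr_gt0 ?exprn_gt0//.
by rewrite ler_nat.
Qed.

Lemma grid_double t n j : grid t n.+1 j.*2 = grid t n j.
Proof.
apply/val_inj; rewrite /= -muln2 natrM exprS; congr `|_ * _|.
by field; rewrite expf_neq0// pnatr_eq0.
Qed.

Lemma grid_last t n : grid t n (2 ^ n) = t.
Proof.
apply/val_inj; rewrite -[LHS]/((grid t n (2 ^ n))%:num) gridE natrX.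
by rewrite divff ?mulr1// expf_neq0// pnatr_eq0.
Qed.

Lemma grid0 t n : grid t n 0 = 0%:nng.
Proof.
by apply/val_inj; rewrite -[LHS]/((grid t n 0)%:num) gridE mul0r mulr0.
Qed.

(** Lipschitz continuity in time, uniformly in the sample point, gives Riemann
    sums that converge geometrically under dyadic refinement; the lattice is
    large enough to generate the predictable sigma-algebra. *)
Definition lipschitz_adapted g := [/\ forall r, rmeas (F r) (fun w => g (r, w)),
  exists M : R, forall rw, `|g rw| <= M &
  exists2 K : R, 0 <= K &
    forall r r' w, `|g (r, w) - g (r', w)| <= K * `|r%:num - r'%:num| ].

Lemma lipschitz_adapted_stone : stone_lattice lipschitz_adapted.
Proof.
split.
- move=> c; split; [by move=> r; exact: measurable_cst|by exists (`|c|)|].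
  exists 0 => //.
  by move=> r r' w; rewrite subrr normr0 mul0r.
- move=> f g [mf [M fM] [K K0 fK]] [mg [N gN] [L L0 gL]]; split.
  + by move=> r; apply: measurable_funD; [exact: mf|exact: mg].
  + by exists (M + N) => rw; rewrite (le_trans (ler_normD _ _))// lerD.
  + exists (K + L); first exact: addr_ge0.
    move=> r r' w; rewrite opprD addrACA (le_trans (ler_normD _ _))// mulrDl.
    by rewrite lerD.
- move=> k f [mf [M fM] [K K0 fK]]; split.
  + by move=> r; apply: measurable_funM; [exact: measurable_cst|exact: mf].
  + by exists (`|k| * M) => rw; rewrite normrM ler_wpM2l.
  + exists (`|k| * K); first exact: mulr_ge0.
    by move=> r r' w; rewrite -mulrBr normrM -mulrA ler_wpM2l.
- move=> f g [mf [M fM] [K K0 fK]] [mg [N gN] [L L0 gL]]; split.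
  + by move=> r; apply: measurable_maxr; [exact: mf|exact: mg].
  + exists (Num.max M N) => rw; have := fM rw; have := gN rw.
    rewrite le_max; case: (leP (f rw) (g rw)) => _ h1 h2; first by rewrite h1 orbT.
    by rewrite h2.
  + exists (K + L); first exact: addr_ge0.
    move=> r r' w; rewrite (le_trans (norm_max_sub _ _ _ _))// mulrDl.
    by rewrite lerD.
- by move=> f [].
Qed.

(** What the construction of a classical integral needs of a process:
    elementary transforms bounded in L^p, and right continuity in L^p. *)
Record integrator U : Prop := Integrator {
  int_adapted : forall t, rmeas (F t) (U t);
  int_zero : {ae P, forall w, U 0%:nng w = 0};
  int_right : forall t (e : R), 0 < e -> exists2 dlt : R, 0 < dlt &
    forall s : time, t <= s -> s%:num < t%:num + dlt ->
      pnorm P p (U s \- U t) <=e e;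
  int_bound : forall t, exists2 C : R, 0 <= C &
    forall n (u : nat -> time) (c : nat -> T -> R) (M : R),
      (forall j, u j <= u j.+1) -> u n <= t ->
      (forall j, rmeas (F (u j)) (c j)) -> (forall j w, `|c j w| <= M) ->
      pnorm P p (fun w => \sum_(j < n) c j w * (U (u j.+1) w - U (u j) w)) <=e C * M }.

Arguments int_adapted {U} _ t.

Definition riemann U t n g w :=
  \sum_(j < 2 ^ n) g (grid t n j, w) * (U (grid t n j.+1) w - U (grid t n j) w).

Definition lipschitz_integral U t g w := rlim (fun n => riemann U t n g w).

Lemma sum_pairs (a : nat -> R) m :
  \sum_(j < m.*2) a j = \sum_(j < m) (a j.*2 + a j.*2.+1).
Proof.
elim: m => [|m IH]; first by rewrite !big_ord0.
by rewrite doubleS !big_ord_recr/= IH addrA.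
Qed.

(** Halving the cells changes the integrand on the right halves only, by its
    increment over half a cell. *)
Lemma riemann_refine U t n g : riemann U t n.+1 g \- riemann U t n g = fun w =>
  \sum_(j < 2 ^ n.+1) (if odd j then g (grid t n.+1 j, w) - g (grid t n.+1 j.-1, w) else 0) *
    (U (grid t n.+1 j.+1) w - U (grid t n.+1 j) w).
Proof.
apply/funext => w; rewrite /= /riemann expnS mul2n.
rewrite (sum_pairs (fun j => g (grid t n.+1 j, w) * (U (grid t n.+1 j.+1) w - U (grid t n.+1 j) w))).
rewrite (sum_pairs (fun j => (if odd j then g (grid t n.+1 j, w) - g (grid t n.+1 j.-1, w) else 0) *
    (U (grid t n.+1 j.+1) w - U (grid t n.+1 j) w))).
rewrite -sumrB; apply: eq_bigr => j _; rewrite /= odd_double/= -!doubleS !grid_double.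
by ring.
Qed.

Section one_integrator.
Variables (U : time -> T -> R) (HU : integrator U).

Let mU t : measurable_fun setT (U t).
Proof. exact: (rmeasF_measurable hF (int_adapted HU t)). Qed.

Lemma measurable_riemann t n g : lipschitz_adapted g ->
  measurable_fun setT (riemann U t n g).
Proof.
move=> [mg _ _]; apply: measurable_sum => j; apply: measurable_funM.
  exact: (rmeasF_measurable hF (mg _)).
by apply: measurable_funB; exact: mU.
Qed.

(** By [riemann_refine] consecutive Riemann sums differ by a transform whose
    coefficients are of the order of the mesh. *)
Lemma riemann_cauchy t : exists2 C : R, 0 <= C & forall g, lipschitz_adapted g ->
  (forall M, (forall rw, `|g rw| <= M) -> forall n, pnorm P p (riemann U t n g) <=e C * M) /\
  exists2 c : R, 0 <= c & forall n,
    pnorm P p (riemann U t n.+1 g \- riemann U t n g) <=e c / 2 ^+ n.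
Proof.
have [C C0 CP] := int_bound HU t; exists C => // g [mg gM [K K0 gK]]; split.
  move=> M {}gM n; apply: (CP (2 ^ n)%N (grid t n) (fun j w => g (grid t n j, w))) => //.
  - by move=> j; rewrite grid_le.
  - by rewrite grid_last.
exists (C * (K * t%:num)); first by rewrite !mulr_ge0.
move=> n; rewrite riemann_refine.
rewrite -mulrA; apply: (CP (2 ^ n.+1)%N (grid t n.+1) (fun j w => if odd j then
  g (grid t n.+1 j, w) - g (grid t n.+1 j.-1, w) else 0)).
- by move=> j; rewrite grid_le.
- by rewrite grid_last.
- move=> j; case: (odd j); last exact: measurable_cst.
  apply: measurable_funB; first exact: mg.
  by apply: (rmeasF_le hF _ (mg _)); rewrite grid_le// leq_pred.
- move=> [|j] w /=.
    by rewrite normr0 divr_ge0 ?exprn_ge0// mulr_ge0.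
  case: (~~ odd j); last by rewrite normr0 divr_ge0 ?exprn_ge0// mulr_ge0.
  apply: le_trans (gK _ _ _) _; rewrite -mulrA ler_wpM2l// !gridE.
  rewrite -mulrBr -mulrBl -natr1 addrC addKr normrM ger0_norm// ler_wpM2l//.
  rewrite ger0_norm ?divr_ge0 ?exprn_ge0// div1r lef_pV2 ?posrE ?exprn_gt0//.
  by rewrite exprS ler_peMl ?exprn_ge0// ler1n.
Qed.

Lemma lint_cvg t g : lipschitz_adapted g ->
  {ae P, forall w, riemann U t n g w @[n --> \oo] --> lipschitz_integral U t g w}.
Proof.
move=> Lg; have [C C0 CP] := riemann_cauchy t; have [_ [c c0 cP]] := CP g Lg.
by apply: (pnorm_summable_cvg hp c0) => // n; exact: measurable_riemann.
Qed.

Lemma measurable_lint t g : lipschitz_adapted g -> measurable_fun setT (lipschitz_integral U t g).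
Proof. by move=> Lg; apply: measurable_rlim => n; exact: measurable_riemann. Qed.

Lemma lint_null t g w : (forall r, r <= t -> g (r, w) = 0) -> lipschitz_integral U t g w = 0.
Proof.
move=> g0; rewrite /lipschitz_integral (rlimE (l := 0))//; apply: cvg_near_cst; apply: nearW => n.
rewrite /riemann big1// => j _; rewrite g0 ?mul0r//.
by rewrite -[leRHS](grid_last t n) grid_le// ltnW.
Qed.

(** Points where the functions exceed [eta] accumulate in the compact interval
    [0, t], and by monotonicity the sequence stays above [eta / 2] at an
    accumulation point. The Lipschitz constants may depend on [n]. *)
Lemma dini (t : time) (h : nat -> time * T -> R) (w : T) (eta : R) :
  (forall n, lipschitz_adapted (h n)) ->
  (forall n s, 0 <= h n.+1 s <= h n s) ->
  (forall s, h n s @[n --> \oo] --> 0) -> 0 < eta ->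
  exists N, forall n, (N <= n)%N -> forall r, r <= t -> h n (r, w) <= eta.
Proof.
move=> Lh hd h0 eta0.
have hmono s : {homo h ^~ s : n m / (n <= m)%N >-> m <= n}.
  by apply/nonincreasing_seqP => n; case/andP: (hd n s).
suff [N NP] : exists N, forall r, r <= t -> h N (r, w) <= eta.
  by exists N => n Nn r rt; rewrite (le_trans (hmono _ _ _ Nn))// NP.
apply: contrapT => /forallNP H.
have /choice[r rP] : forall n, exists r : time, r <= t /\ eta < h n (r, w).
  move=> n; have /existsNP[r /not_implyP[rt /negP]] := H n.
  by rewrite -ltNge; exists r.
have := @segment_compact R 0 t%:num.
move=> /(_ (nbhs ((fun n => (r n)%:num) @ \oo)) _ _)[].
  by exists 0%N => // n _ /=; rewrite in_itv/= ge0 /=; case: (rP n).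
move=> x [/=]; rewrite in_itv/= => /andP[x0 xt] xcl.
pose xx : time := NngNum x0.
have hx m : eta / 2 <= h m (xx, w).
  have [_ _ [K K0 hK]] := Lh m.
  (* Within this distance [h m] varies by at most [eta / 2]. *)
  pose dl := eta / (2 * (K + 1)).
  have K1 : 0 < K + 1 by rewrite ltr_wpDl.
  have dl0 : 0 < dl by rewrite divr_gt0// mulr_gt0.
  have [y [/= [n nm <-] /= yb]] : [set (r n)%:num | n in [set n | (m <= n)%N]] `&` ball x dl !=set0.
    apply: xcl; last exact: nbhsx_ballx.
    by exists m => // n mn; exists n.
  have [_ rn] := rP n; have hmn := hmono (r n, w) _ _ nm.
  have := hK (r n) xx w; rewrite /= => hh.
  have : K * `|(r n)%:num - x| <= eta / 2.
    apply: (@le_trans _ _ (K * dl)).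
      by rewrite ler_wpM2l// distrC ltW.
    rewrite /dl mulrA ler_pdivrMr ?mulr_gt0// -subr_ge0.
    rewrite [X in 0 <= X](_ : _ = eta); first exact: ltW.
    by field.
  have := ler_norm (h m (r n, w) - h m (xx, w)).
  by move=> a1 a2; lra.
move/cvgrPdist_lt: (h0 (xx, w)) => /(_ _ (divr_gt0 eta0 (ltr0n _ 2)))[N _ NP].
have := NP N (leqnn N); rewrite sub0r normrN /= => a.
have := hx N; have := ler_norm (h N (xx, w)); lra.
Qed.

(** [dini] yields [eint_smooth] in the strong form that, path by path, the
    integrals are eventually equal to 0. *)
Lemma lint_elementary t : exists C, elementary_integral P p lipschitz_adapted (lipschitz_integral U t) C.
Proof.
have [C C0 CP] := riemann_cauchy t; exists C; split.
- by move=> f; exact: measurable_lint.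
- move=> f g Lf Lg; have Lfg := stone_add lipschitz_adapted_stone Lf Lg.
  apply: filterS2 (lint_cvg t Lf) (lint_cvg t Lg) => w cf cg.
  rewrite /lipschitz_integral; apply: rlimE.
  rewrite (_ : (fun n => _) = (fun n => riemann U t n f w + riemann U t n g w)).
    exact: cvgD.
  apply/funext => n; rewrite /riemann -big_split/=; apply: eq_bigr => j _.
  by rewrite mulrDl.
- move=> k f Lf; apply: filterS (lint_cvg t Lf) => w cf; rewrite /lipschitz_integral; apply: rlimE.
  rewrite (_ : (fun n => _) = (fun n => k * riemann U t n f w)).
    by apply: cvgM => //; exact: cvg_cst.
  apply/funext => n; rewrite /riemann mulr_sumr; apply: eq_bigr => j _.
  by rewrite mulrA.
- move=> f M Lf fM; have [h _] := CP f Lf.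
  have M0 : 0 <= M by exact: le_trans (normr_ge0 _) (fM (0%:nng, point)).
  apply: (pnorm_fatou hp (f_ := fun n => riemann U t n f)).
  + exact: mulr_ge0.
  + by move=> n; exact: measurable_riemann.
  + exact: measurable_lint.
  + exact: lint_cvg.
  + exact: h.
- move=> h Lh hd h0 eta eta0; apply: nearW => w.
  have [N NP] := dini t w Lh hd h0 eta0.
  apply: cvg_near_cst; exists N => // n /= Nn; apply: lint_null => r rt.
  by apply/max_idPr; rewrite subr_le0 NP.
Qed.

(** Lipschitz functions increasing to the indicator of the times after [s]. *)
Definition ramp (s : time) (n : nat) (r : time) : R :=
  Num.min 1 (n%:R * Num.max (r%:num - s%:num) 0).

Lemma ramp_ge0 s n r : 0 <= ramp s n r.
Proof. by rewrite /ramp le_min ler01 mulr_ge0// le_max lexx orbT. Qed.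

Lemma ramp_le1 s n r : ramp s n r <= 1.
Proof. by rewrite /ramp ge_min lexx. Qed.

Lemma ramp_le s n r r' : r <= r' -> ramp s n r <= ramp s n r'.
Proof.
move=> rr; rewrite /ramp le_min !ge_min lexx/=; apply/orP; right.
rewrite ler_wpM2l// ge_max !le_max lexx orbT andbT lerD2r.
by rewrite num_le rr.
Qed.

Lemma ramp_eq0 s n r : r <= s -> ramp s n r = 0.
Proof.
by move=> rs; rewrite /ramp (max_r (x := _ - _)) ?subr_le0 ?num_le// mulr0 min_r.
Qed.

Lemma ramp_eq1 s n r : 1 <= n%:R * (r%:num - s%:num) -> ramp s n r = 1.
Proof.
move=> h; rewrite /ramp min_l// (le_trans h)// ler_wpM2l// le_max lexx//.
Qed.

Lemma ramp_lip s n r r' : `|ramp s n r - ramp s n r'| <= n%:R * `|r%:num - r'%:num|.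
Proof.
rewrite /ramp.
rewrite (le_trans (norm_min_sub _ _ _ _))// subrr normr0 add0r.
rewrite -mulrBr normrM ger0_norm// ler_wpM2l//.
rewrite (le_trans (norm_max_sub _ _ _ _))// subrr normr0 addr0.
by rewrite opprB addrA subrK.
Qed.

Lemma ramp_cvg (s r : time) : ramp s n r @[n --> \oo] --> ((s < r)%R%:R : R).
Proof.
have [sr|rs] := ltP s r; last first.
  by apply: cvg_near_cst; apply: nearW => n; exact: ramp_eq0.
apply: cvg_near_cst; have rs0 : 0 < r%:num - s%:num by rewrite subr_gt0 num_lt.
exists (Num.truncn (r%:num - s%:num)^-1).+1 => // n /= Nn.
apply: ramp_eq1; rewrite -ler_pdivrMr// div1r.
apply: le_trans (ltW (truncnS_gt _)) _.
by rewrite ler_nat.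
Qed.

Lemma ramp_lipschitz s n (A : T -> R) (M : R) : rmeas (F s) A ->
  (forall w, `|A w| <= M) -> lipschitz_adapted (fun rw => A rw.2 * ramp s n rw.1).
Proof.
move=> mA AM; have M0 : 0 <= M by exact: le_trans (normr_ge0 _) (AM point).
split.
- move=> r /=; have [rs|sr] := leP r s.
    under eq_fun do rewrite ramp_eq0// mulr0; exact: measurable_cst.
  apply: measurable_funM; last exact: measurable_cst.
  by apply: (rmeasF_le hF (ltW sr)).
- exists M => -[r w] /=; rewrite normrM (ger0_norm (ramp_ge0 _ _ _)).
  by rewrite -[leRHS]mulr1 ler_pM// ?ramp_ge0 ?ramp_le1.
- exists (M * n%:R); first exact: mulr_ge0.
  move=> r r' w /=; rewrite -mulrBr normrM -mulrA ler_pM//.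
  exact: ramp_lip.
Qed.

Lemma abel_sum (a b : nat -> R) (N : nat) : a 0%N = 0 ->
  \sum_(j < N) a j * (b j.+1 - b j) = \sum_(j < N) (a j.+1 - a j) * (b N - b j.+1).
Proof.
move=> a0; elim: N => [|N IH]; first by rewrite !big_ord0.
rewrite big_ord_recr/= IH [RHS]big_ord_recr/= subrr mulr0 addr0.
have -> : \sum_(j < N) (a j.+1 - a j) * (b N.+1 - b j.+1) =
   \sum_(j < N) (a j.+1 - a j) * (b N - b j.+1) +
   (\sum_(j < N) (a j.+1 - a j)) * (b N.+1 - b N).
  by rewrite mulr_suml -big_split/=; apply: eq_bigr => j _; ring.
congr (_ + _ * _).
by rewrite -(big_mkord xpredT (fun j => a j.+1 - a j)) telescope_sumr// a0 subr0.
Qed.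

(** After Abel summation the Riemann sums are averages, with the increments of
    the ramp as weights, of the increments of [U] from points shortly after
    [s] to [t]; right continuity in L^p replaces these points by [s]. *)
Lemma lint_ramp s t (A : T -> R) (M : R) : s < t -> rmeas (F s) A ->
  (forall w, `|A w| <= M) -> forall e : R, 0 < e ->
  exists N, forall n, (N <= n)%N ->
    pnorm P p (lipschitz_integral U t (fun rw => A rw.2 * ramp s n rw.1) \-
      (fun w => A w * (U t w - U s w))) <=e e.
Proof.
move=> st mA AM e e0; have M0 : 0 <= M by exact: le_trans (normr_ge0 _) (AM point).
have M1 : 0 < M + 1 by rewrite ltr_wpDl.
have ts0 : 0 < t%:num - s%:num by rewrite subr_gt0 num_lt.
have [dl dl0 dlP] := int_right HU s (divr_gt0 e0 M1).
(* The ramp rises from 0 to 1 within [eps] after [s], hence before [t] and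
   within half the distance [dl] that right continuity allows; the mesh takes
   up at most another quarter. *)
pose eps := Num.min (dl / 2) (t%:num - s%:num).
have eps0 : 0 < eps by rewrite lt_min ts0 andbT divr_gt0.
exists (Num.truncn eps^-1).+1 => n Nn.
have n0 : 0 < n%:R :> R by rewrite ltr0n (leq_trans _ Nn).
have ne : 1 <= n%:R * eps.
  rewrite -ler_pdivrMr// div1r (le_trans (ltW (truncnS_gt _)))//.
  by rewrite ler_nat.
have [m0 m0P] := @exists_div_pow2_le R t%:num (dl / 4) (divr_gt0 dl0 (ltr0n _ 4)).
have mA' := rmeasF_measurable hF mA.
have Lr := ramp_lipschitz n mA AM.
have mt : measurable_fun setT (fun w => A w * (U t w - U s w)).
  by apply: measurable_funM => //; apply: measurable_funB; exact: mU.
apply: (pnorm_fatou hp (f_ := fun m => riemann U t (m + m0)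
  (fun rw => A rw.2 * ramp s n rw.1) \- (fun w => A w * (U t w - U s w)))).
- exact: ltW.
- by move=> m; apply: measurable_funB => //; exact: measurable_riemann.
- by apply: measurable_funB => //; exact: measurable_lint.
- apply: filterS (lint_cvg t Lr) => w cw; apply: cvgB; last exact: cvg_cst.
  by rewrite (cvg_shiftn m0 (fun m => riemann U t m (fun rw => A rw.2 * ramp s n rw.1) w)).
move=> m; set k := (m + m0)%N.
pose a j := ramp s n (grid t k j).
have a0 : a 0%N = 0 by rewrite /a grid0 ramp_eq0// -num_le/=.
have aN : a (2 ^ k)%N = 1.
  rewrite /a grid_last; apply: ramp_eq1; apply: le_trans ne _.
  by rewrite ler_wpM2l// ge_min lexx orbT.
have tel : \sum_(j < 2 ^ k) (a j.+1 - a j) = 1.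
  by rewrite -(big_mkord xpredT (fun j => a j.+1 - a j)) telescope_sumr// a0 subr0.
rewrite (_ : _ \- _ = (fun w => \sum_(j < 2 ^ k) (a j.+1 - a j) *
    (A w * (U s w - U (grid t k j.+1) w)))); last first.
  apply/funext => w /=; rewrite /riemann.
  rewrite (eq_bigr (fun j : 'I_(2 ^ k) => A w * (a j *
    (U (grid t k j.+1) w - U (grid t k j) w)))); last by move=> j _; rewrite mulrA.
  rewrite -mulr_sumr (abel_sum (fun j => U (grid t k j) w) (2 ^ k) a0) grid_last.
  rewrite -[U t w - U s w]mul1r -tel mulr_suml -mulrBr -sumrB mulr_sumr.
  by apply: eq_bigr => j _; ring.
have bnd j : pnorm P p (fun w => (a j.+1 - a j) * (A w * (U s w - U (grid t k j.+1) w)))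
    <=e (a j.+1 - a j) * e.
  have [->|aa] := eqVneq (a j.+1) (a j).
    rewrite subrr mul0r (_ : (fun _ => _) = (fun=> 0)) ?pnorm0//.
    by apply/funext => w; rewrite mul0r.
  have da0 : 0 <= a j.+1 - a j by rewrite subr_ge0 ramp_le// grid_le.
  have mj : measurable_fun setT (fun w => A w * (U s w - U (grid t k j.+1) w)).
    by apply: measurable_funM => //; apply: measurable_funB; exact: mU.
  rewrite -[X in _ <=e X * e](ger0_norm da0); apply: pnormZ_le => //.
  have sg : s <= grid t k j.+1.
    rewrite leNgt; apply/negP => h; move/eqP: aa; apply.
    rewrite /a !ramp_eq0// ?ltW//; apply: le_lt_trans h; exact: grid_le.
  have gd : (grid t k j.+1)%:num < s%:num + dl.
    have gj : (grid t k j)%:num < s%:num + dl / 2.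
      rewrite ltNge; apply/negP => h; move/eqP: aa; apply.
      have h' : 1 <= n%:R * ((grid t k j)%:num - s%:num).
        apply: (le_trans ne); rewrite ler_wpM2l// ge_min; apply/orP; left.
        by rewrite lerBrDl.
      rewrite /a (ramp_eq1 h') ramp_eq1// (le_trans h')// ler_wpM2l// lerD2r.
      by rewrite num_le grid_le.
    have -> : (grid t k j.+1)%:num = (grid t k j)%:num + t%:num / 2 ^+ k.
      by rewrite !gridE -natr1; field; rewrite expf_neq0// pnatr_eq0.
    have : t%:num / 2 ^+ k <= dl / 4.
      apply: le_trans m0P; rewrite ler_wpM2l// lef_pV2 ?posrE ?exprn_gt0//.
      by rewrite ler_eXn2l ?ltr1n// leq_addl.
    lra.
  have := dlP _ sg gd; rewrite pnormB => hU.
  have mB : measurable_fun setT (U s \- U (grid t k j.+1)) by apply: measurable_funB; exact: mU.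
  have := pnormZ_le hp M mB hU; rewrite ger0_norm// => hM.
  apply: (@le_trans _ _ (M * (e / (M + 1)))%:E).
    apply: le_trans hM; apply: pnorm_mono => //.
      by apply: measurable_funM.
    by apply: nearW => w /=; rewrite !normrM ler_wpM2r// (ger0_norm M0).
  by rewrite lee_fin mulrCA ler_piMr ?(ltW e0)// ler_pdivrMr// mul1r lerDl.
apply: le_trans (pnorm_sum hp (n := (2 ^ k)%N)
  (g := fun j w => (a j.+1 - a j) * (A w * (U s w - U (grid t k j.+1) w)))
  (a := fun j => (a j.+1 - a j) * e) _ _) _.
- move=> j _; apply: measurable_funM => //; apply: measurable_funM => //.
  by apply: measurable_funB; exact: mU.
- by move=> j _; exact: bnd.
- by rewrite -mulr_suml tel mul1r.
Qed.

End one_integrator.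
End riemann_integral.
Arguments int_adapted {d T R P F p U} _ t.

(** * The integral of bounded predictable integrands *)

Section stochastic_integral.
Context d (T : measurableType d) (R : realType) (P : probability T R).
Variable F : {nonneg R} -> set (set T).
Hypothesis hF : usual_conditions P F.
Variable p : R.
Hypothesis hp : 1 <= p.
Local Notation time := {nonneg R}.
Implicit Types (U : time -> T -> R) (Y Z : time * T -> R) (A B : T -> R).

Definition bounded_predictable Y := rmeas (predictable_sets F) Y /\
  exists M : R, forall rw, `|Y rw| <= M.

(** Half-lines in time are simpler than intervals: the step on ]s, t] is a
    difference of two of them. *)
Definition after (s : time) A : time * T -> R := fun rw => A rw.2 * (s < rw.1)%R%:R.
Definition at0 A : time * T -> R := fun rw => A rw.2 * (rw.1 == 0%:nng)%:R.
Definition upto (t : time) Y : time * T -> R := fun rw => Y rw * (rw.1 <= t)%R%:R.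

Lemma bool_norm_le1 (b : bool) : `|b%:R : R| <= 1.
Proof. by case: b; rewrite ?normr1 ?normr0 ?ler01. Qed.

(** The preimage of a set of values is a rectangle, together with the
    complement of [C * T] if the set contains 0. *)
Lemma predictable_rect (C : set time) t A :
  (forall E, F t E -> <<s predictable_sets F >> (C `*` E)) -> rmeas (F t) A ->
  rmeas (predictable_sets F) (fun rw => A rw.2 * \1_C rw.1).
Proof.
move=> HC /(rmeasFP hF) mA; apply/rmeasP => B mB.
have FT : F t setT by have := filtrationC hF (filtration0 hF t); rewrite setC0.
have -> : (fun rw : time * T => A rw.2 * \1_C rw.1) @^-1` B =
    (C `*` (A @^-1` B)) `|` (if 0 \in B then ~` (C `*` setT) else set0).
  apply/seteqP; split => -[r w] /=; rewrite indicE.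
    have [rC|rC] := boolP (r \in C); rewrite ?mulr1 ?mulr0 => h.
      by left; split => //; exact: set_mem.
    by right; rewrite (mem_set h) => -[/mem_set]; rewrite (negbTE rC).
  move=> [[rC h]|]; first by rewrite mem_set// mulr1.
  have [B0|//] := boolP (0 \in B); rewrite /= => h.
  by rewrite memNset ?mulr0; [exact: set_mem|move=> rC; apply: h].
have m1 : <<s predictable_sets F >> (C `*` (A @^-1` B)) by apply: HC; exact: mA.
have m2 : <<s predictable_sets F >> (if 0 \in B then ~` (C `*` setT) else set0).
  case: ifP => _; last exact: (@measurable0 _ (g_sigma_algebraType (predictable_sets F))).
  by apply: (@measurableC _ (g_sigma_algebraType (predictable_sets F))); exact: HC.
exact: (@measurableU _ (g_sigma_algebraType (predictable_sets F)) _ _ m1 m2).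
Qed.

Lemma predictable_gt s E : F s E -> <<s predictable_sets F >> ([set r | s < r] `*` E).
Proof.
move=> FE.
have -> : [set r : time | s < r] `*` E =
    \bigcup_n ([set r | s < r <= `|s%:num + n.+1%:R|%:nng] `*` E).
  apply/seteqP; split => -[r w] /=.
    move=> [sr Ew]; exists (Num.truncn r%:num) => //; split => //=.
    rewrite sr/= -num_le/= ger0_norm ?addr_ge0//.
    by rewrite (le_trans (ltW (truncnS_gt _)))// lerDr.
  by move=> [n _ [/= /andP[]]].
apply: (@bigcupT_measurable _ (g_sigma_algebraType (predictable_sets F))) => n.
apply: sub_sigma_algebra; right; exists s, `|s%:num + n.+1%:R|%:nng, E; split => //.
by rewrite -num_lt/= ger0_norm ?addr_ge0// ltrDl.
Qed.

Lemma bpred_after s A (M : R) : rmeas (F s) A -> (forall w, `|A w| <= M) ->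
  bounded_predictable (after s A).
Proof.
move=> mA AM; split.
  have := predictable_rect (@predictable_gt s) mA; congr (rmeas _ _).
  apply/funext => -[r w]; rewrite /after indicE/=; congr (_ * (nat_of_bool _)%:R).
  by apply/idP/idP => h; [exact: (set_mem h)|exact: mem_set].
have M0 : 0 <= M by exact: le_trans (normr_ge0 _) (AM point).
exists M => -[r w]; rewrite /after normrM -[leRHS]mulr1 ler_pM//; exact: bool_norm_le1.
Qed.

Lemma bpred_at0 A (M : R) : rmeas (F 0%:nng) A -> (forall w, `|A w| <= M) ->
  bounded_predictable (at0 A).
Proof.
move=> mA AM; split.
  have H E : F 0%:nng E -> <<s predictable_sets F >> ([set 0%:nng] `*` E).
    by move=> FE; apply: sub_sigma_algebra; left; exists E.
  have := @predictable_rect [set 0%:nng : time] (0%:nng : time) A H mA.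
  congr (rmeas _ _).
  apply/funext => -[r w]; rewrite /at0 indicE/=; congr (_ * (nat_of_bool _)%:R).
  by apply/idP/idP => h; [apply/eqP; exact: (set_mem h)|apply: mem_set; exact/eqP].
have M0 : 0 <= M by exact: le_trans (normr_ge0 _) (AM point).
exists M => -[r w]; rewrite /at0 normrM -[leRHS]mulr1 ler_pM//; exact: bool_norm_le1.
Qed.

Lemma bpred_lin Y Z (k : R) : bounded_predictable Y -> bounded_predictable Z -> bounded_predictable (fun rw => Y rw + k * Z rw).
Proof.
move=> [mY [M YM]] [mZ [N ZN]]; split.
  by apply: measurable_funD => //; apply: measurable_funM => //; exact: measurable_cst.
exists (M + `|k| * N) => rw; rewrite (le_trans (ler_normD _ _))// lerD//.
by rewrite normrM ler_wpM2l.
Qed.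

Lemma bpred_mul Y Z : bounded_predictable Y -> bounded_predictable Z -> bounded_predictable (fun rw => Y rw * Z rw).
Proof.
move=> [mY [M YM]] [mZ [N ZN]]; split; first exact: measurable_funM.
by exists (M * N) => rw; rewrite normrM ler_pM.
Qed.

Lemma bpred_lim (f : nat -> time * T -> R) Y (M : R) : (forall n, bounded_predictable (f n)) ->
  (forall n rw, `|f n rw| <= M) -> (forall rw, f n rw @[n --> \oo] --> Y rw) ->
  bounded_predictable Y.
Proof.
move=> bf fM fY; split.
  by apply: (@measurable_fun_cvg _ (g_sigma_algebraType (predictable_sets F)) R setT f) => // n; case: (bf n).
exists M => rw; rewrite ler_norml; apply/andP; split.
  have -> : Y rw = limn (f ^~ rw) by rewrite (cvg_lim _ (fY rw)).
  apply: limr_ge; first by apply/cvg_ex; exists (Y rw).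
  by apply: nearW => n; have := fM n rw; rewrite ler_norml => /andP[].
have -> : Y rw = limn (f ^~ rw) by rewrite (cvg_lim _ (fY rw)).
apply: limr_le; first by apply/cvg_ex; exists (Y rw).
by apply: nearW => n; have := fM n rw; rewrite ler_norml => /andP[].
Qed.

Lemma bpred1 : bounded_predictable (fun=> 1).
Proof. by split; [exact: measurable_cst|exists 1 => rw; rewrite normr1]. Qed.

Lemma rmeas_cst t (c : R) : rmeas (F t) (fun=> c).
Proof. exact: measurable_cst. Qed.
Arguments rmeas_cst : clear implicits.

Lemma bpred_upto t Y : bounded_predictable Y -> bounded_predictable (upto t Y).
Proof.
move=> bY; apply: bpred_mul => //.
have N1 (w : T) : `|1 : R| <= 1 by rewrite normr1.
have := bpred_lin (-1) bpred1 (bpred_after (rmeas_cst t 1) N1).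
congr bounded_predictable; apply/funext => -[r w]; rewrite /after/= mul1r mulN1r.
by case: (leP r t) => h /=; rewrite ?subr0 ?subrr.
Qed.

Lemma indic_after s (B : set T) : F s B -> rmeas (F s) (\1_B : T -> R).
Proof.
move=> FB; apply: (@measurable_indic _ (g_sigma_algebraType (F s))).
exact: sub_sigma_algebra.
Qed.

Lemma indic_norm (B : set T) w : `|\1_B w : R| <= 1.
Proof. by rewrite indicE; exact: bool_norm_le1. Qed.

(** The functional monotone class theorem for the generators of the
    predictable sigma-algebra, written through [after] and [at0]. *)
Lemma predictable_ind (Q : (time * T -> R) -> Prop) :
  (forall s A M, rmeas (F s) A -> (forall w, `|A w| <= M) -> Q (after s A)) ->
  (forall A M, rmeas (F 0%:nng) A -> (forall w, `|A w| <= M) -> Q (at0 A)) ->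
  (forall Y Z k, bounded_predictable Y -> bounded_predictable Z -> Q Y -> Q Z -> Q (fun rw => Y rw + k * Z rw)) ->
  (forall (f : nat -> time * T -> R) Y M, (forall n, bounded_predictable (f n)) -> bounded_predictable Y ->
    (forall n rw, `|f n rw| <= M) -> (forall rw, f n rw @[n --> \oo] --> Y rw) ->
    (forall n, Q (f n)) -> Q Y) ->
  forall Y, bounded_predictable Y -> Q Y.
Proof.
move=> Qa Q0 Ql Qm Y [mY [M YM]].
suff [] : bounded_predictable Y /\ Q Y by [].
pose H Y := bounded_predictable Y /\ Q Y.
have Ha s A N : rmeas (F s) A -> (forall w, `|A w| <= N) -> H (after s A).
  by move=> mA AN; split; [exact: bpred_after AN|exact: Qa AN].
have H0 A N : rmeas (F 0%:nng) A -> (forall w, `|A w| <= N) -> H (at0 A).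
  by move=> mA AN; split; [exact: bpred_at0 AN|exact: Q0 AN].
have Hl f g (k : R) : H f -> H g -> H (fun rw => f rw + k * g rw).
  by move=> [bf Qf] [bg Qg]; split; [exact: bpred_lin|exact: Ql].
apply: (functional_monotone_class (G := predictable_sets F) (H := H) _ _ Hl _ _ mY YM).
- exact: predictable_setI_closed hF.
- have N1 (w : T) : `|1 : R| <= 1 by rewrite normr1.
  have [z zE] : exists z : time, z = 0%:nng by exists 0%:nng.
  have := Hl _ _ 1 (H0 _ _ (rmeas_cst _ 1) N1) (Ha z _ _ (rmeas_cst _ 1) N1).
  congr H; apply/funext => -[r w]; rewrite /at0 /after zE/= !mul1r.
  have : 0%:nng <= r by rewrite -num_le/=.
  rewrite le_eqVlt => /predU1P[<-|h]; first by rewrite eqxx ltxx addr0.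
  by rewrite h gt_eqF// add0r.
- move=> f Z N Hf fN fZ; have bZ : bounded_predictable Z.
    by apply: (bpred_lim (f := f) (M := N)) => // n; case: (Hf n).
  by split=> //; apply: (Qm f Z N) => // n; case: (Hf n).
- move=> _ [[B FB ->]|[s [t [B [st FB ->]]]]].
    have := H0 _ _ (indic_after FB) (indic_norm B); congr H.
    apply/funext => -[r w]; rewrite /at0 !indicE in_setX/= -natrM mulnb andbC.
    by congr ((nat_of_bool (_ && _))%:R); apply/idP/idP => h;
      [exact: mem_set (eqP h)|apply/eqP; exact: (set_mem h)].
  have FtB := filtration_sub hF (ltW st) FB.
  have := Hl _ _ (-1) (Ha s _ _ (indic_after FB) (indic_norm B))
    (Ha t _ _ (indic_after FtB) (indic_norm B)).
  congr H; apply/funext => -[r w]; rewrite /after !indicE in_setX/=.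
  have -> : (r \in [set r | s < r <= t]) = (s < r <= t).
    by apply/idP/idP => h; [exact: (set_mem h)|exact: mem_set].
  case: (w \in B); rewrite ?andbF ?mul0r ?mulr0 ?addr0// andbT !mul1r mulN1r.
  case: (leP r t) => rt; first by rewrite andbT subr0.
  by rewrite (lt_trans st rt) andbF subrr.
Qed.

Record is_integral U (t : time) (J : (time * T -> R) -> T -> R) : Prop := IsIntegral {
  si_meas : forall Y, bounded_predictable Y -> measurable_fun setT (J Y);
  si_lin : forall Y Z (k : R), bounded_predictable Y -> bounded_predictable Z ->
    {ae P, forall w, J (fun rw => Y rw + k * Z rw) w = J Y w + k * J Z w};
  si_dct : forall (f : nat -> time * T -> R) Y (M : R), (forall n, bounded_predictable (f n)) ->
    (forall n rw, `|f n rw| <= M) -> (forall rw, f n rw @[n --> \oo] --> Y rw) ->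
    forall e : R, 0 < e -> exists N, forall n, (N <= n)%N -> pnorm P p (J Y \- J (f n)) <=e e;
  si_step : forall s A (M : R), rmeas (F s) A -> (forall w, `|A w| <= M) ->
    {ae P, forall w, J (after s A) w = A w * (U t w - U (Num.min s t) w)};
  si_at0 : forall A (M : R), rmeas (F 0%:nng) A -> (forall w, `|A w| <= M) ->
    {ae P, forall w, J (at0 A) w = 0} }.

Lemma pnorm_eps_ae (f g : T -> R) : measurable_fun setT f -> measurable_fun setT g ->
  (forall e : R, 0 < e -> pnorm P p (f \- g) <=e e) -> {ae P, forall w, f w = g w}.
Proof.
move=> mf mg fg; have m : measurable_fun setT (f \- g) by exact: measurable_funB.
have h0 : pnorm P p (f \- g) = 0%E.
  apply/eqP; rewrite eq_le pnorm_ge0 andbT; apply/lee_addgt0Pr => e e0.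
  by rewrite add0e fg.
by apply: filterS (pnorm_eq0 hp m h0) => w /eqP; rewrite subr_eq0 => /eqP.
Qed.

(** The Daniell extension of the integral on Lipschitz integrands. Its domain
    contains the generators, as limits of ramps, and is closed under bounded
    limits, so that it contains all bounded predictable integrands. *)
Theorem stochastic_integral_exists U t : integrator P F p U ->
  exists J, is_integral U t J.
Proof.
move=> HU; have [C HC] := lint_elementary hF hp HU t.
have [D [J DJ]] := daniell hp (lipschitz_adapted_stone F) HC.
have mU r : measurable_fun setT (U r) by exact: (rmeasF_measurable hF (int_adapted HU r)).
have lintE g w : (forall rw, rw.1 <= t -> g rw = 0) -> lipschitz_integral U t g w = 0.
  by move=> g0; apply: lint_null => r rt; exact: (g0 (r, w)).
(* The ramps converge to the half-line, and their integrals are known. *)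
have Dafter s A M : rmeas (F s) A -> (forall w, `|A w| <= M) -> D (after s A) /\
    {ae P, forall w, J (after s A) w = A w * (U t w - U (Num.min s t) w)}.
  move=> mA AM.
  have M0 : 0 <= M by exact: le_trans (normr_ge0 _) (AM point).
  pose f n (rw : time * T) := A rw.2 * ramp s n rw.1.
  have Lf n : lipschitz_adapted F (f n) by exact: (ramp_lipschitz hF n mA AM).
  have Df n : D (f n) by case: (dext_elementary DJ (Lf n)).
  have fM n rw : `|f n rw| <= M.
    rewrite /f normrM (ger0_norm (ramp_ge0 _ _ _)) -[leRHS]mulr1 ler_pM//.
      exact: ramp_ge0.
    exact: ramp_le1.
  have fY rw : f n rw @[n --> \oo] --> after s A rw.
    by apply: cvgM; [exact: cvg_cst|exact: ramp_cvg].
  have [DY cY] := dext_dct DJ Df fM fY; split=> //.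
  have mA' := rmeasF_measurable hF mA.
  have mJ := dext_measurable DJ DY.
  have mt : measurable_fun setT (fun w => A w * (U t w - U (Num.min s t) w)).
    by apply: measurable_funM => //; apply: measurable_funB.
  apply: pnorm_eps_ae => // e e0; have e2 : 0 < e / 2 by rewrite divr_gt0.
  have [N NP] := cY _ e2.
  suff [n Nn hn] : exists2 n, (N <= n)%N &
      pnorm P p (lipschitz_integral U t (f n) \- (fun w => A w * (U t w - U (Num.min s t) w))) <=e e / 2.
    have mJn := dext_measurable DJ (Df n).
    have ml := measurable_lint hF HU t (Lf n).
    rewrite [e]splitr; apply: (pnorm_sub_le hp mJ mJn mt (NP n Nn)).
    apply: le_trans hn.
    rewrite le_eqVlt; apply/orP; left; apply/eqP; apply: pnorm_ae => //.
    - exact: measurable_funB.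
    - exact: measurable_funB.
    - by case: (dext_elementary DJ (Lf n)) => _; apply: filterS => w /= ->.
  have [st|ts] := ltP s t.
    have [K KP] := lint_ramp hF hp HU st mA AM e2.
    by exists (maxn N K); rewrite ?leq_maxl// KP// leq_maxr.
  exists N => //; rewrite (_ : _ \- _ = fun=> 0).
    by rewrite (pnorm0 P hp) lee_fin ltW.
  apply/funext => w /=; rewrite subrr mulr0 subr0 lintE// => rw rt.
  by rewrite /f ramp_eq0 ?mulr0// (le_trans rt).
have Dat0 A M : rmeas (F 0%:nng) A -> (forall w, `|A w| <= M) -> D (at0 A) /\
    {ae P, forall w, J (at0 A) w = 0}.
  move=> mA AM; have [Da Ja] := Dafter _ _ _ mA AM.
  have LA : lipschitz_adapted F (fun rw => A rw.2).
    split; [|by exists M|by exists 0 => // r r' w; rewrite subrr normr0 mul0r].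
    by move=> r; apply: (rmeasF_le hF _ mA); rewrite -num_le/=.
  have [Dc Jc] := dext_elementary DJ LA.
  have [DD JJ] := dext_linear DJ (-1) Dc Da.
  (* The indicator of time 0 is the constant 1 minus the half-line after 0,
     and both have the integral [U t - U 0]. *)
  have e : (fun rw : time * T => A rw.2 + -1 * after 0%:nng A rw) = at0 A.
    apply/funext => -[r w]; rewrite /at0 /after/=.
    have : 0%:nng <= r by rewrite -num_le/=.
    rewrite le_eqVlt => /predU1P[<-|h]; first by rewrite eqxx ltxx mulr0 mulr1 mulr0 addr0.
    by rewrite h gt_eqF// mulr1 mulr0 mulN1r subrr.
  split; first by rewrite -e.
  rewrite -e; apply: filterS3 JJ Ja Jc => w -> -> ->.
  rewrite /lipschitz_integral (rlimE (l := A w * (U t w - U 0%:nng w))).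
    by rewrite min_l ?mulN1r ?subrr// -num_le/=.
  apply: cvg_near_cst; apply: nearW => n; rewrite /riemann/= -mulr_sumr.
  rewrite -(big_mkord xpredT (fun j => U (grid t n j.+1) w - U (grid t n j) w)).
  by rewrite (telescope_sumr (fun j => U (grid t n j) w))// grid_last grid0.
have Db Y : bounded_predictable Y -> D Y.
  apply: predictable_ind.
  - by move=> s A M mA AM; case: (Dafter s A M mA AM).
  - by move=> A M mA AM; case: (Dat0 A M mA AM).
  - by move=> Y1 Y2 k _ _ D1 D2; case: (dext_linear DJ k D1 D2).
  - by move=> f Z M _ _ fM fZ Df; case: (dext_dct DJ Df fM fZ).
exists J; split.
- by move=> Y /Db; exact: (dext_measurable DJ).
- by move=> Y Z k /Db DY /Db DZ; case: (dext_linear DJ k DY DZ).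
- by move=> f Y M bf fM fY; case: (dext_dct DJ (fun n => Db _ (bf n)) fM fY).
- by move=> s A M mA AM; case: (Dafter s A M mA AM).
- by move=> A M mA AM; case: (Dat0 A M mA AM).
Qed.

End stochastic_integral.

(** * The integral as a process *)

Section integral_process.
Context d (T : measurableType d) (R : realType) (P : probability T R).
Variable F : {nonneg R} -> set (set T).
Hypothesis hF : usual_conditions P F.
Variable p : R.
Hypothesis hp : 1 <= p.
Local Notation time := {nonneg R}.
Local Notation bounded_predictable := (bounded_predictable F).
Implicit Types (U : time -> T -> R) (Y Z W : time * T -> R) (A B : T -> R).

Lemma ae_and (Q1 Q2 : T -> Prop) : {ae P, forall w, Q1 w} -> {ae P, forall w, Q2 w} ->
  {ae P, forall w, Q1 w /\ Q2 w}.
Proof. by move=> h1 h2; apply: filterS2 h1 h2. Qed.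

(** What the integral, its products with bounded random variables and its
    restrictions in time have in common; an identity between two such maps
    needs checking on generators only. *)
Record functional (K : (time * T -> R) -> T -> R) : Prop := Functional {
  fn_meas : forall Y, bounded_predictable Y -> measurable_fun setT (K Y);
  fn_lin : forall Y Z (k : R), bounded_predictable Y -> bounded_predictable Z ->
    {ae P, forall w, K (fun rw => Y rw + k * Z rw) w = K Y w + k * K Z w};
  fn_dct : forall (f : nat -> time * T -> R) Y (M : R), (forall n, bounded_predictable (f n)) ->
    (forall n rw, `|f n rw| <= M) -> (forall rw, f n rw @[n --> \oo] --> Y rw) ->
    forall e : R, 0 < e -> exists N, forall n, (N <= n)%N -> pnorm P p (K Y \- K (f n)) <=e e }.

(** Monotone class argument: both sides are linear and satisfy dominated
    convergence. *)
Lemma functional_eq K1 K2 : functional K1 -> functional K2 ->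
  (forall s A (M : R), rmeas (F s) A -> (forall w, `|A w| <= M) ->
    {ae P, forall w, K1 (after s A) w = K2 (after s A) w}) ->
  (forall A (M : R), rmeas (F 0%:nng) A -> (forall w, `|A w| <= M) ->
    {ae P, forall w, K1 (at0 A) w = K2 (at0 A) w}) ->
  forall Y, bounded_predictable Y -> {ae P, forall w, K1 Y w = K2 Y w}.
Proof.
move=> H1 H2 Ha H0; apply: (predictable_ind hF) => //.
- move=> Y Z k bY bZ eY eZ.
  have l1 := fn_lin H1 k bY bZ; have l2 := fn_lin H2 k bY bZ.
  by apply: filterS2 (filterI l1 l2) (filterI eY eZ) => w [-> ->] [-> ->].
- move=> f Y M bf bY fM fY ef.
  have mK1 := fn_meas H1; have mK2 := fn_meas H2.
  apply: (pnorm_eps_ae hp (mK1 _ bY) (mK2 _ bY)) => e e0.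
  have e2 : 0 < e / 2 by rewrite divr_gt0.
  have [N1 N1P] := fn_dct H1 bf fM fY e2; have [N2 N2P] := fn_dct H2 bf fM fY e2.
  pose n := maxn N1 N2.
  have h1 := N1P n (leq_maxl _ _); have h2 := N2P n (leq_maxr _ _).
  rewrite [e]splitr; apply: (pnorm_sub_le hp (mK1 _ bY) (mK1 _ (bf n)) (mK2 _ bY) h1).
  rewrite pnormB; apply: le_trans h2.
  rewrite le_eqVlt; apply/orP; left; apply/eqP; apply: pnorm_ae => //.
  + by apply: measurable_funB; [exact: mK2|exact: mK1].
  + by apply: measurable_funB; exact: mK2.
  + by apply: filterS (ef n) => w /= ->.
Qed.

Section one_integrator.
Variables (U : time -> T -> R) (HU : integrator P F p U).
Variable J : time -> (time * T -> R) -> T -> R.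
Hypothesis HJ : forall t, is_integral P F p U t (J t).

Let mU t : measurable_fun setT (U t).
Proof. exact: (rmeasF_measurable hF (int_adapted HU t)). Qed.

Lemma integral_functional t : functional (J t).
Proof. by case: (HJ t). Qed.

Lemma functional_mul K Z : functional K -> bounded_predictable Z ->
  functional (fun Y => K (fun rw => Z rw * Y rw)).
Proof.
move=> HK bZ; split.
- by move=> Y bY; apply: (fn_meas HK); exact: bpred_mul.
- move=> Y1 Y2 k b1 b2; have := fn_lin HK k (bpred_mul bZ b1) (bpred_mul bZ b2).
  apply: filterS => w <-; congr (K _ w); apply/funext => rw.
  by rewrite mulrDr mulrCA.
- move=> f Y M bf fM fY e e0; have [_ [N ZN]] := bZ.
  apply: (fn_dct HK (M := N * M)) => //.
  + by move=> n; exact: bpred_mul.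
  + by move=> n rw; rewrite normrM ler_pM.
  + by move=> rw; apply: cvgM => //; exact: cvg_cst.
Qed.

Lemma functional_scale K B (M : R) : functional K -> measurable_fun setT B ->
  (forall w, `|B w| <= M) -> functional (fun Y w => B w * K Y w).
Proof.
move=> HK mB BM; have M0 : 0 <= M by exact: le_trans (normr_ge0 _) (BM point).
have mK := fn_meas HK; split.
- by move=> Y bY; apply: measurable_funM => //; exact: mK.
- move=> Y Z k bY bZ; apply: filterS (fn_lin HK k bY bZ) => w ->.
  by rewrite mulrDr mulrCA.
- move=> f Y N bf fN fY e e0.
  have bY := bpred_lim bf fN fY.
  have M1 : 0 < M + 1 by rewrite ltr_wpDl.
  have [n nP] := fn_dct HK bf fN fY (divr_gt0 e0 M1).
  exists n => m nm; have mm := measurable_funB (mK _ bY) (mK _ (bf m)).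
  have := pnormZ_le hp M mm (nP m nm); rewrite ger0_norm// => hM.
  apply: (@le_trans _ _ (M * (e / (M + 1)))%:E).
    apply: le_trans hM; apply: pnorm_mono => //.
    + by apply: measurable_funB; apply: measurable_funM => //; exact: mK.
    + by apply: measurable_funM.
    + by apply: nearW => w /=; rewrite -mulrBr !normrM ler_wpM2r// (ger0_norm M0).
  by rewrite lee_fin mulrCA ler_piMr ?(ltW e0)// ler_pdivrMr// mul1r lerDl.
Qed.

Lemma functional0 : functional (fun _ _ => 0).
Proof.
split=> //.
- by move=> Y Z k _ _; apply: nearW => w; rewrite mulr0 addr0.
- move=> f Y M _ _ _ e e0; exists 0%N => n _.
  rewrite (_ : _ \- _ = fun=> 0); first by rewrite (pnorm0 P hp) lee_fin ltW.
  by apply/funext => w /=; rewrite subr0.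
Qed.

Lemma functional_cst0 K : functional K -> {ae P, forall w, K (fun=> 0) w = 0}.
Proof.
move=> HK; have b0 : bounded_predictable (fun=> 0).
  by split; [exact: measurable_cst|exists 0 => rw; rewrite normr0].
have := fn_lin HK (-1) b0 b0; apply: filterS => w.
rewrite (_ : (fun rw => _) = (fun=> 0)); last first.
  by apply/funext => rw; rewrite mulN1r subrr.
by rewrite mulN1r subrr.
Qed.

Lemma functional_sum K n (W : nat -> time * T -> R) : functional K ->
  (forall j, bounded_predictable (W j)) -> bounded_predictable (fun rw => \sum_(j < n) W j rw) /\
  {ae P, forall w, K (fun rw => \sum_(j < n) W j rw) w = \sum_(j < n) K (W j) w}.
Proof.
move=> HK bW; elim: n => [|n [bs IH]].
  rewrite (_ : (fun rw => \sum_(j < 0) W j rw) = fun=> 0); last first.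
    by apply/funext => rw; rewrite big_ord0.
  split; first by split; [exact: measurable_cst|exists 0 => rw; rewrite normr0].
  by apply: filterS (functional_cst0 HK) => w ->; rewrite big_ord0.
have e : (fun rw => \sum_(j < n.+1) W j rw) = (fun rw => \sum_(j < n) W j rw + 1 * W n rw).
  by apply/funext => rw; rewrite big_ord_recr/= mul1r.
rewrite e; split; first exact: bpred_lin.
apply: filterS2 IH (fn_lin HK 1 bs (bW n)) => w IH ->.
by rewrite big_ord_recr/= IH mul1r.
Qed.

Lemma mul_after s u A B : (fun rw => after s B rw * after u A rw) =
  after (Num.max s u) (fun w => B w * A w) :> (time * T -> R).
Proof.
apply/funext => -[r w]; rewrite /after/= mulrACA -natrM mulnb.
by rewrite gt_max.
Qed.

Lemma mul_after_at0 s A B : (fun rw => after s B rw * at0 A rw) = fun=> 0 :> R.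
Proof.
apply/funext => -[r w]; rewrite /after /at0/= mulrACA -natrM mulnb.
have [->|_] := eqVneq r 0%:nng; last by rewrite andbF mulr0.
by rewrite le_gtF ?andFb ?mulr0// -num_le/=.
Qed.

Lemma rmeas_bounded_mul s u A B (M N : R) : rmeas (F s) B -> rmeas (F u) A ->
  (forall w, `|B w| <= M) -> (forall w, `|A w| <= N) ->
  rmeas (F (Num.max s u)) (fun w => B w * A w) /\ (forall w, `|B w * A w| <= M * N).
Proof.
move=> mB mA BM AN; split; last by move=> w; rewrite normrM ler_pM.
apply: measurable_funM.
  by apply: (rmeasF_le hF _ mB); rewrite le_max lexx.
by apply: (rmeasF_le hF _ mA); rewrite le_max lexx orbT.
Qed.

(** A coefficient that is known at time [s] can be pulled out of an integral
    over times after [s]. *)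
Lemma integral_module t s B (M : R) Y : rmeas (F s) B -> (forall w, `|B w| <= M) ->
  bounded_predictable Y -> {ae P, forall w, J t (fun rw => after s B rw * Y rw) w =
    B w * J t (fun rw => after s (fun=> 1) rw * Y rw) w}.
Proof.
move=> mB BM; have N1 (w : T) : `|1 : R| <= 1 by rewrite normr1.
have m1 : rmeas (F s) (fun=> 1 : R) by exact: measurable_cst.
apply: (@functional_eq (fun Y => J t (fun rw => after s B rw * Y rw))
  (fun Y w => B w * J t (fun rw => after s (fun=> 1) rw * Y rw) w)).
- by apply: functional_mul; [exact: integral_functional|exact: (bpred_after hF mB BM)].
- apply: functional_scale BM; last exact: (rmeasF_measurable hF mB).
  by apply: functional_mul; [exact: integral_functional|exact: (bpred_after hF m1 N1)].
- move=> u A N mA AN; rewrite !mul_after.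
  have [m2 b2] := rmeas_bounded_mul mB mA BM AN; have [m3 b3] := rmeas_bounded_mul m1 mA N1 AN.
  apply: filterS2 (si_step (HJ t) m2 b2) (si_step (HJ t) m3 b3) => w -> ->.
  by rewrite mul1r mulrA.
- move=> A N mA AN; rewrite !mul_after_at0.
  by apply: filterS (functional_cst0 (integral_functional t)) => w ->; rewrite mulr0.
Qed.

Lemma upto_after s u A : upto s (after u A) =
  fun rw => after u A rw + -1 * after (Num.max u s) A rw.
Proof.
apply/funext => -[r w]; rewrite /upto /after/= gt_max.
by case: (ltP u r) => ur; case: (leP r s) => rs /=; rewrite ?mulr1 ?mulr0 ?subr0; ring.
Qed.

Lemma upto_at0 s A : upto s (at0 A) = at0 A.
Proof.
apply/funext => -[r w]; rewrite /upto /at0/=.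
have [->|_] := eqVneq r 0%:nng; last by rewrite mulr0 mul0r.
have h (z : time) : z%:num = 0 -> (z <= s) = true.
  by move=> z0; apply/idP; rewrite -num_le z0.
by rewrite h// mulr1.
Qed.

Lemma functional_upto K s : functional K -> functional (fun Y => K (upto s Y)).
Proof.
move=> HK; have b1 := bpred_upto hF s (bpred1 F).
have := functional_mul HK b1; congr functional; apply/funext => Y; congr K.
by apply/funext => rw; rewrite /upto mul1r mulrC.
Qed.

(** Integrals up to different horizons agree on integrands that vanish after
    the earlier one. *)
Lemma integral_consistent s t Y : s <= t -> bounded_predictable Y ->
  {ae P, forall w, J s (upto s Y) w = J t (upto s Y) w}.
Proof.
move=> st; apply: (@functional_eq (fun Y => J s (upto s Y)) (fun Y => J t (upto s Y))).
- by apply: functional_upto; exact: integral_functional.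
- by apply: functional_upto; exact: integral_functional.
- move=> u A M mA AM; rewrite upto_after.
  have mA' : rmeas (F (Num.max u s)) A by apply: (rmeasF_le hF _ mA); rewrite le_max lexx.
  have b1 := bpred_after hF mA AM; have b2 := bpred_after hF mA' AM.
  have l1 := ae_and (si_lin (HJ s) (-1) b1 b2) (si_lin (HJ t) (-1) b1 b2).
  have l2 := ae_and (si_step (HJ s) mA AM) (si_step (HJ s) mA' AM).
  have l3 := ae_and (si_step (HJ t) mA AM) (si_step (HJ t) mA' AM).
  apply: filterS3 l1 l2 l3 => w [-> ->] [-> ->] [-> ->].
  rewrite (min_r (x := Num.max u s)) ?le_max ?lexx ?orbT//.
  have [us|su] := leP u s.
    by rewrite (min_l (le_trans us st)) (min_l st); ring.
  by ring.
- move=> A M mA AM; rewrite upto_at0.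
  by apply: filterS2 (si_at0 (HJ s) mA AM) (si_at0 (HJ t) mA AM) => w -> ->.
Qed.

Lemma integral_time0 Y : bounded_predictable Y -> {ae P, forall w, J 0%:nng Y w = 0}.
Proof.
apply: (@functional_eq (J 0%:nng) (fun _ _ => 0)).
- exact: integral_functional.
- exact: functional0.
- move=> u A M mA AM; apply: filterS (si_step (HJ 0%:nng) mA AM) => w ->.
  by rewrite min_r ?subrr ?mulr0// -num_le/=.
- by move=> A M mA AM; exact: (si_at0 (HJ 0%:nng) mA AM).
Qed.

(** A subsequence converges almost everywhere, and null sets belong to the
    filtration. *)
Lemma pnorm_limit_rmeas t (f : nat -> T -> R) (g : T -> R) : (forall n, rmeas (F t) (f n)) ->
  measurable_fun setT g ->
  (forall e : R, 0 < e -> exists N, forall n, (N <= n)%N -> pnorm P p (g \- f n) <=e e) ->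
  rmeas (F t) g.
Proof.
move=> mf mg fg.
have /choice[k kP] : forall n : nat, exists N, pnorm P p (g \- f N) <=e 1 / 2 ^+ n.
  move=> n; have [|N NP] := fg (1 / 2 ^+ n); last by exists N; exact: NP.
  by rewrite divr_gt0// exprn_gt0.
have mk n : measurable_fun setT (f (k n)) by exact: (rmeasF_measurable hF (mf _)).
have cv : {ae P, forall w, f (k n) w @[n --> \oo] --> g w}.
  by apply: (pnorm_subseq_ae hp) => // n; rewrite pnormB.
apply: (@rmeasF_ae _ _ _ _ _ hF t g (fun w => rlim (fun n => f (k n) w))).
  by apply: filterS cv => w c; rewrite (rlimE c).
by apply: (@measurable_rlim R _ (g_sigma_algebraType (F t))) => n; exact: mf.
Qed.

Lemma integral_adapted (t : time) Y : bounded_predictable Y -> rmeas (F t) (J t Y).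
Proof.
apply: (@predictable_ind _ _ _ _ _ hF (fun Y => rmeas (F t) (J t Y))).
- move=> s A M mA AM; apply: (rmeasF_ae hF (si_step (HJ t) mA AM)).
  have [st|ts] := leP s t; last first.
    by under eq_fun do rewrite subrr mulr0; exact: measurable_cst.
  apply: measurable_funM; first exact: (rmeasF_le hF st mA).
  by apply: measurable_funB; [exact: (int_adapted HU t)|exact: (rmeasF_le hF st (int_adapted HU s))].
- move=> A M mA AM; apply: (rmeasF_ae hF (si_at0 (HJ t) mA AM)); exact: measurable_cst.
- move=> Y1 Y2 k b1 b2 m1 m2; apply: (rmeasF_ae hF (si_lin (HJ t) k b1 b2)).
  by apply: measurable_funD => //; apply: measurable_funM => //; exact: measurable_cst.
- move=> f Z M bf bZ fM fZ mf; apply: (pnorm_limit_rmeas mf).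
    exact: si_meas (HJ t) _ bZ.
  exact: si_dct (HJ t) _ _ _ bf fM fZ.
Qed.

(** Dominated convergence holds uniformly over all integrands below [f n]:
    otherwise counterexamples, one for each [N], would form a sequence that
    violates it. *)
Lemma integral_unif_small (t : time) (f : nat -> time * T -> R) (M : R) :
  (forall n rw, `|f n rw| <= M) -> (forall rw, f n rw @[n --> \oo] --> 0) ->
  forall e : R, 0 < e -> exists N, forall n, (N <= n)%N -> forall W, bounded_predictable W ->
    (forall rw, `|W rw| <= `|f n rw|) -> pnorm P p (J t W) <=e e.
Proof.
move=> fM f0 e e0; apply: contrapT => /forallNP H.
have /choice[kW kWP] : forall N : nat, exists kW : nat * (time * T -> R),
    [/\ (N <= kW.1)%N, bounded_predictable kW.2, forall rw, `|kW.2 rw| <= `|f kW.1 rw| &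
      ~ pnorm P p (J t kW.2) <=e e].
  move=> N; have /existsNP[n /not_implyP[Nn /existsNP[W /not_implyP[bW
    /not_implyP[Wf nW]]]]] := H N.
  by exists (n, W).
have bW n : bounded_predictable (kW n).2 by case: (kWP n).
have WM n rw : `|(kW n).2 rw| <= M by case: (kWP n) => _ _ h _; exact: le_trans (h rw) _.
have W0 rw : (kW n).2 rw @[n --> \oo] --> 0.
  apply/cvgrPdist_le => e' e'0.
  move/cvgrPdist_le: (f0 rw) => /(_ _ e'0)[N _ NP]; exists N => // n /= Nn.
  have [nk _ h _] := kWP n; have := NP _ (leq_trans Nn nk).
  by rewrite !sub0r !normrN; apply: le_trans.
have [N NP] := si_dct (HJ t) bW WM W0 e0.
have [_ _ _] := kWP N; apply; apply: le_trans (NP N (leqnn N)).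
have b0 : bounded_predictable (fun=> 0).
  by split; [exact: measurable_cst|exists 0 => rw; rewrite normr0].
rewrite pnormB le_eqVlt; apply/orP; left; apply/eqP; apply: pnorm_ae => //.
- exact: (si_meas (HJ t)).
- by apply: measurable_funB; exact: (si_meas (HJ t)).
- by apply: filterS (functional_cst0 (integral_functional t)) => w /= ->; rewrite subr0.
Qed.

(** Boundedness follows from continuity at 0 by homogeneity. *)
Lemma integral_bounded (t : time) : exists2 C : R, 0 <= C & forall W (M : R), bounded_predictable W ->
  (forall rw, `|W rw| <= M) -> pnorm P p (J t W) <=e C * M.
Proof.
pose f (n : nat) (rw : time * T) : R := 1 / 2 ^+ n.
have f1 n rw : `|f n rw| <= 1.
  rewrite /f ger0_norm ?divr_ge0 ?exprn_ge0// ler_pdivrMr ?exprn_gt0// mul1r.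
  by rewrite exprn_ege1// ler1n.
have f0 rw : f n rw @[n --> \oo] --> 0.
  have h : `|2^-1 : R| < 1 by rewrite ger0_norm// invf_lt1// ltr1n.
  have := cvg_geometric 1 h; apply: cvg_trans; apply: near_eq_cvg.
  by apply: nearW => n; rewrite /f /= exprVn.
have [N NP] := integral_unif_small t f1 f0 ltr01.
have p2 : 0 < 2 ^+ N :> R by rewrite exprn_gt0.
exists (2 ^+ N); first exact: ltW.
move=> W M bW WM.
have M0 : 0 <= M by exact: le_trans (normr_ge0 _) (WM (0%:nng, point)).
have b0 : bounded_predictable (fun=> 0).
  by split; [exact: measurable_cst|exists 0 => rw; rewrite normr0].
apply/lee_addgt0Pr => e e0; rewrite -EFinD.
(* Scaled by [k^-1] the integrand is below [f N]. The term with [e] keeps [k]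
   positive when [M] is 0. *)
pose k := (M + e / 2 ^+ N) * 2 ^+ N.
have k0 : 0 < k by rewrite mulr_gt0// ltr_wpDl// divr_gt0.
have bk := bpred_lin k^-1 b0 bW.
have := NP N (leqnn N) _ bk; move=> /(_ _) H.
have {}H : pnorm P p (J t (fun rw => 0 + k^-1 * W rw)) <=e 1.
  apply: H => rw; rewrite add0r /f normrM gtr0_norm ?invr_gt0//.
  rewrite [leRHS]ger0_norm ?divr_ge0 ?exprn_ge0// ler_pdivrMl// /k.
  rewrite mul1r -mulrA mulfV ?gt_eqF// mulr1 (le_trans (WM rw))// lerDl divr_ge0 ?(ltW e0)//.
have mW := si_meas (HJ t) bW; have mk := si_meas (HJ t) bk.
have := pnormZ_le hp k mk H; rewrite mulr1 gtr0_norm//.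
have -> : 2 ^+ N * M + e = k by rewrite /k mulrDl divfK ?gt_eqF// [M * _]mulrC.
apply: le_trans.
rewrite le_eqVlt; apply/orP; left; apply/eqP; apply: pnorm_ae => //.
- exact: measurable_funM.
- apply: filterS2 (si_lin (HJ t) k^-1 b0 bW) (functional_cst0 (integral_functional t)).
  by move=> w -> ->; rewrite add0r mulrA mulfV ?mul1r ?gt_eqF.
Qed.

Definition loc_bounded_predictable Y := forall t, bounded_predictable (upto t Y).

Definition integral_process Y (t : time) : T -> R := J t (upto t Y).

Lemma upto_upto s t Y : s <= t -> upto s (upto t Y) = upto s Y.
Proof.
move=> st; apply/funext => -[r w]; rewrite /upto/= -mulrA; congr (_ * _).
case: (leP r s) => rs; last by rewrite mulr0.
by rewrite (le_trans rs st) mulr1.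
Qed.

(** All values up to time [t] may be computed with the single integral [J t],
    so that linearity and convergence of that integral apply to the process.
    *)
Lemma integral_process_horizon Y s t : loc_bounded_predictable Y -> s <= t ->
  {ae P, forall w, integral_process Y s w = J t (upto s Y) w}.
Proof.
move=> lY st; rewrite /integral_process -(upto_upto Y st).
exact: integral_consistent.
Qed.

(** An elementary transform of the integral process of [Y] is the integral of
    the product of [Y] with the transforming step process; at most one cell
    contributes at each time, hence the bound by [M]. *)
Lemma integral_process_transform Y (t : time) n (u : nat -> time) (c : nat -> T -> R) (M : R) :
  loc_bounded_predictable Y -> (forall j, u j <= u j.+1) -> u n <= t ->
  (forall j, rmeas (F (u j)) (c j)) -> (forall j w, `|c j w| <= M) ->
  exists W, [/\ bounded_predictable W, forall rw, `|W rw| <= M * `|upto t Y rw| &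
    {ae P, forall w, \sum_(j < n) c j w *
      (integral_process Y (u j.+1) w - integral_process Y (u j) w) = J t W w}].
Proof.
move=> lY und unt mc cM.
have M0 : 0 <= M by exact: le_trans (normr_ge0 _) (cM 0%N point).
have umono : {homo u : i j / (i <= j)%N >-> i <= j} by exact/nondecreasing_seqP.
(* The cell ]u_j, u_(j+1)] of the transforming step process, times the
   integrand. *)
pose W j rw := after (u j) (c j) rw * (upto (u j.+1) (upto t Y) rw).
have bW j : bounded_predictable (W j).
  by apply: bpred_mul; [exact: (bpred_after hF (mc j) (cM j))|apply: (bpred_upto hF); exact: lY].
have [bS eS] := functional_sum n (integral_functional t) bW.
exists (fun rw => \sum_(j < n) W j rw); split => //.
- move=> -[r w].
  have h : \sum_(j < n) ((u j < r)%R%:R - (u j.+1 < r)%R%:R) <= 1 :> R.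
    have -> : \sum_(j < n) ((u j < r)%R%:R - (u j.+1 < r)%R%:R) =
        (u 0%N < r)%R%:R - (u n < r)%R%:R :> R.
      elim: n {unt bS eS} => [|n IH]; first by rewrite big_ord0 subrr.
      by rewrite big_ord_recr/= IH addrA subrK.
    by case: (_ < r); case: (_ < r); rewrite ?subr0 ?subrr ?sub0r ?lerr ?ler01//; lra.
  apply: le_trans (ler_norm_sum _ _ _) _.
  apply: (@le_trans _ _ (\sum_(j < n) ((u j < r)%R%:R - (u j.+1 < r)%R%:R) *
     (M * `|upto t Y (r, w)|))); last first.
    by rewrite -mulr_suml ler_piMl// mulr_ge0.
  apply: ler_sum => j _; rewrite /W /after /upto/= !normrM !normr_nat.
  have uj := und j.
  have [ur|ru] := ltP (u j) r; last first.
    by rewrite (le_gtF (le_trans ru uj)) subrr mulr0 !mul0r.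
  have [ur1|ru1] := ltP (u j.+1) r; first by rewrite !mulr0 subrr mul0r.
  by rewrite !mulr1 subr0 mul1r ler_wpM2r// mulr_ge0.
have N1 (w : T) : `|1 : R| <= 1 by rewrite normr1.
have K j : {ae P, forall w, (j < n)%N -> c j w * (integral_process Y (u j.+1) w - integral_process Y (u j) w) =
    J t (W j) w}.
  have [jn|nj] := ltnP j n; last by apply: nearW => w.
  have ujt : u j.+1 <= t by apply: le_trans unt; exact: umono.
  have bU := bpred_upto hF (u j.+1) (lY t).
  have bU' := bpred_upto hF (u j) (lY t).
  have e1 := integral_process_horizon lY ujt.
  have e2 := integral_process_horizon lY (le_trans (und j) ujt).
  have e3 := integral_module t (mc j) (cM j) bU.
  rewrite -(upto_upto Y ujt) in e1; rewrite -(upto_upto Y (le_trans (und j) ujt)) in e2.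
  have e4 := si_lin (HJ t) (-1) bU bU'.
  have e : (fun rw : time * T => upto (u j.+1) (upto t Y) rw + -1 * upto (u j) (upto t Y) rw) =
     (fun rw => after (u j) (fun=> 1) rw * upto (u j.+1) (upto t Y) rw).
    apply/funext => -[r w]; rewrite /upto /after/= mul1r.
    case: (leP r (u j)) => h; first by rewrite (le_trans h (und j)) /=; ring.
    by rewrite /=; ring.
  rewrite e in e4.
  apply: filterS3 (ae_and e1 e2) e3 e4 => w [-> ->] -> ->.
  by rewrite mulN1r.
apply: filterS2 eS (ae_foralln K) => w -> Kw.
by apply: eq_bigr => j _; rewrite Kw.
Qed.

(** Boundedness of transforms comes from [integral_process_transform] and
    [integral_bounded]; right continuity in L^p holds because the integrands
    on ]t, s] tend to 0 pointwise as [s] decreases to [t]. *)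
Theorem integral_process_integrator Y : loc_bounded_predictable Y ->
  integrator P F p (integral_process Y).
Proof.
move=> lY; split.
- by move=> t; exact: integral_adapted (lY t).
- exact: integral_time0 (lY _).
- move=> t e e0; apply: contrapT => /forall2NP H.
  have [t1 t1E] : exists t1 : time, t1%:num = t%:num + 1.
    by exists `|t%:num + 1|%:nng; rewrite /= ger0_norm// addr_ge0.
  have [_ [M YM]] := lY t1.
  have /choice[s sP] : forall n : nat, exists s : time, [/\ t <= s,
      s%:num < t%:num + n.+1%:R^-1 &
      ~ pnorm P p (integral_process Y s \- integral_process Y t) <=e e].
    move=> n; have := H n.+1%:R^-1; rewrite invr_gt0 ltr0n => -[//|].
    by move=> /existsNP[s /not_implyP[ts /not_implyP[sn nh]]]; exists s.
  have st1 n : s n <= t1.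
    have [_ h _] := sP n; rewrite -num_le t1E (le_trans (ltW h))// lerD2l.
    by rewrite invf_le1// ler1n.
  have tt1 : t <= t1 by rewrite -num_le t1E lerDl.
  (* The integrand on ]t, s n]. *)
  pose f n (rw : time * T) := upto (s n) (upto t1 Y) rw + -1 * upto t (upto t1 Y) rw.
  have bf n : bounded_predictable (f n) by apply: bpred_lin; apply: (bpred_upto hF); exact: lY.
  have fE n r w : f n (r, w) = upto t1 Y (r, w) * (t < r <= s n)%R%:R.
    rewrite /f /upto/=; have [ts _ _] := sP n.
    case: (leP r t) => rt; first by rewrite (le_trans rt ts) /=; ring.
    by rewrite /=; ring.
  have fM n rw : `|f n rw| <= M.
    case: rw => r w; rewrite fE normrM normr_nat -[leRHS]mulr1 ler_pM//.
    by case: (_ && _).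
  have f0 rw : f n rw @[n --> \oo] --> 0.
    case: rw => r w; have [rt|tr] := leP r t.
      apply: cvg_near_cst; apply: nearW => n.
      by rewrite fE le_gtF// andFb mulr0.
    have d0 : 0 < r%:num - t%:num by rewrite subr_gt0 num_lt.
    apply: cvg_near_cst; exists (Num.truncn (r%:num - t%:num)^-1) => // n /= Nn.
    rewrite fE tr/= (_ : (r <= s n) = false) ?mulr0//.
    apply/negbTE; rewrite -ltNge -num_lt; have [_ h _] := sP n.
    apply: lt_le_trans h _; rewrite -lerBrDl -[leRHS]invrK lef_pV2 ?posrE ?invr_gt0//.
    by rewrite (le_trans (ltW (truncnS_gt _)))// ler_nat.
  have [N NP] := integral_unif_small t1 fM f0 e0.
  have [ts _] := sP N; apply; apply: le_trans (NP N (leqnn N) _ (bf N) _) => //.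
  have bS := bpred_upto hF (s N) (lY t1); have bT := bpred_upto hF t (lY t1).
  rewrite le_eqVlt; apply/orP; left; apply/eqP; apply: pnorm_ae => //.
  + by apply: measurable_funB; apply: (si_meas (HJ _)); exact: lY.
  + exact: (si_meas (HJ _)).
  have e1 := integral_process_horizon lY (st1 N).
  have e2 := integral_process_horizon lY tt1.
  rewrite -(upto_upto Y (st1 N)) in e1; rewrite -(upto_upto Y tt1) in e2.
  by apply: filterS3 e1 e2 (si_lin (HJ t1) (-1) bS bT) => w /= -> -> ->; rewrite mulN1r.
- move=> t; have [C C0 CP] := integral_bounded t.
  have [_ [N YN]] := lY t.
  have N0 : 0 <= N by exact: le_trans (normr_ge0 _) (YN (0%:nng, point)).
  exists (C * N); first exact: mulr_ge0.
  move=> n u c M und unt mc cM.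
  have M0 : 0 <= M by exact: le_trans (normr_ge0 _) (cM 0%N point).
  have [W [bW WY eW]] := integral_process_transform lY und unt mc cM.
  have WM rw : `|W rw| <= N * M.
    by rewrite (le_trans (WY rw))// mulrC ler_wpM2r.
  rewrite -mulrA; apply: le_trans (CP _ _ bW WM).
  rewrite le_eqVlt; apply/orP; left; apply/eqP; apply: pnorm_ae => //.
  + apply: measurable_sum => j; apply: measurable_funM.
      exact: (rmeasF_measurable hF (mc j)).
    by apply: measurable_funB; apply: (si_meas (HJ _)); exact: lY.
  + exact: (si_meas (HJ _)).
Qed.

End one_integrator.
End integral_process.

(** * Greedy partitions of a path *)

Section greedy_partition.
Context {R : realType}.
Implicit Types (phi : R -> R) (z : nat -> R).

(** Greedy rule: the reference value stays where it is until the sequence has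
    moved away from it by more than the value of [phi] there, and then jumps
    to the current value. A constant [phi] counts oscillations, and [phi]
    equal to the modulus controls the maximum. *)
Fixpoint pivot phi z j : R := if j is j'.+1 then
  if phi (pivot phi z j') < `|z j - pivot phi z j'| then z j else pivot phi z j'
  else z 0%N.

Definition moves phi z j := phi (pivot phi z j) < `|z j.+1 - pivot phi z j|.

Fixpoint count_moves phi z j : nat := if j is j'.+1 then
  (count_moves phi z j' + moves phi z j')%N else 0%N.

(** The total increment of the sequence between its moves number [k] and [k +
    1], up to index [m]. Whether an increment belongs to the block is known
    when it begins. *)
Definition block phi z k m : R :=
  \sum_(j < m) (count_moves phi z j == k)%:R * (z j.+1 - z j).

Lemma count_moves_le phi z j : (count_moves phi z j <= j)%N.
Proof. by elim: j => //= j IH; case: (moves _ _ _); rewrite ?addn1 ?addn0// leqW. Qed.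

Lemma count_moves_homo phi z i j : (i <= j)%N -> (count_moves phi z i <= count_moves phi z j)%N.
Proof.
by apply: (homo_leq (leqnn) leq_trans) => k /=; exact: leq_addr.
Qed.

Lemma pivot_near phi z j : (forall x, 0 <= phi x) ->
  `|z j - pivot phi z j| <= phi (pivot phi z j).
Proof.
move=> phi0; case: j => [|j] /=; first by rewrite subrr normr0.
by case: ltP => //; rewrite subrr normr0.
Qed.

Lemma block_future phi z k m : (count_moves phi z m < k)%N -> block phi z k m = 0.
Proof.
move=> h; rewrite /block big1// => j _.
have := count_moves_homo phi z (ltnW (ltn_ord j)) => hj.
by rewrite ltn_eqF ?mul0r// (leq_ltn_trans hj).
Qed.

Lemma blockS phi z k m : block phi z k m.+1 =
  block phi z k m + (count_moves phi z m == k)%:R * (z m.+1 - z m).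
Proof. by rewrite /block big_ord_recr. Qed.

(** Increments since the last move telescope. *)
Lemma block_current phi z m : block phi z (count_moves phi z m) m = z m - pivot phi z m.
Proof.
elim: m => [|m IH]; first by rewrite /block big_ord0 subrr.
rewrite blockS /= -/(moves phi z m); case: ifPn => mv.
  by rewrite addn1 block_future// ltn_eqF// mul0r addr0 subrr.
by rewrite addn0 IH eqxx mul1r addrC subrKA.
Qed.

Lemma block_past phi z k i m : (k < count_moves phi z i)%N -> (i <= m)%N ->
  block phi z k m = block phi z k i.
Proof.
move=> ki; elim: m => [|m IH]; first by rewrite leqn0 => /eqP ->.
rewrite leq_eqVlt => /predU1P[->//|]; rewrite ltnS => im.
rewrite blockS IH// gtn_eqF ?mul0r ?addr0//.
by rewrite (leq_trans ki)// count_moves_homo.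
Qed.

Lemma block_closing phi z m : moves phi z m ->
  block phi z (count_moves phi z m) m.+1 = z m.+1 - pivot phi z m.
Proof. by move=> mv; rewrite blockS block_current eqxx mul1r addrC subrKA. Qed.

(** A completed block leads from one reference value [r] to the next one; by
    the greedy rule it is larger than [phi r]. *)
Lemma block_closed phi z k m : (k < count_moves phi z m)%N ->
  exists2 r, phi r < `|block phi z k m| &
    (k.+1 = count_moves phi z m -> pivot phi z m = r + block phi z k m).
Proof.
elim: m => [//|m IH]; rewrite /= -/(moves phi z m); case: ifPn => mv.
  rewrite addn1 ltnS leq_eqVlt => /predU1P[->|km].
    by exists (pivot phi z m); rewrite block_closing// addrC subrK.
  have [r h _] := IH km; exists r; first by rewrite (block_past km).
  by move=> [] e; rewrite e ltnn in km.
rewrite addn0 => km; have [r h hk] := IH km.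
by exists r => //; rewrite (block_past km).
Qed.

Lemma count_moves_square (e : R) z m : 0 <= e ->
  e ^+ 2 * (count_moves (fun=> e) z m)%:R <=
    \sum_(k < m) (block (fun=> e) z k m) ^+ 2.
Proof.
move=> e0; set c := count_moves _ _ _.
have cm : (c <= m)%N by exact: count_moves_le.
rewrite -(big_mkord xpredT (fun k => block (fun=> e) z k m ^+ 2)) (big_cat_nat (n := c))//=.
rewrite -[leLHS]addr0 lerD//; last by apply: sumr_ge0 => k _; exact: sqr_ge0.
rewrite big_mkord mulr_natr -[X in _ *+ X](card_ord c) -sumr_const.
apply: ler_sum => k _; have [r h _] := block_closed (ltn_ord k).
by rewrite -[leRHS]real_normK ?num_real// lerXn2r ?nnegrE// ltW.
Qed.

(** At the last move before [j] the increment exceeded the former reference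
    value in modulus, so that the new one is at most twice the last block; and
    [z j] is at most twice the reference value. *)
Lemma block_dominates z m j : z 0%N = 0 -> (j <= m)%N ->
  `|z j| <= 4 * Num.sqrt (\sum_(k < m) (block (fun x => `|x|) z k m) ^+ 2).
Proof.
move=> z0 jm; set phi := fun x : R => `|x|.
have h1 : `|z j| <= 2 * `|pivot phi z j|.
  have := pivot_near z j (phi := phi) (fun x => normr_ge0 x).
  rewrite /phi => h; have := ler_normD (z j - pivot phi z j) (pivot phi z j).
  by rewrite subrK => h'; rewrite (le_trans h')// mulr_natl mulr2n lerD2r.
(* Without any move the reference value is still [z 0 = 0], and so is [z j].
   *)
have [c0|c0] := posnP (count_moves phi z j).
  have -> : `|z j| = 0.
    apply/eqP; rewrite eq_le normr_ge0 andbT (le_trans h1)//.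
    suff -> : pivot phi z j = z 0%N by rewrite z0 normr0 mulr0.
    elim: j {jm h1} c0 => //= j IH; rewrite -/(moves phi z j).
    by case: (moves _ _ _) => //; rewrite ?addn1// addn0.
  by rewrite mulr_ge0// sqrtr_ge0.
have kc : ((count_moves phi z j).-1 < count_moves phi z j)%N by rewrite prednK.
have [r hr] := block_closed kc; rewrite prednK// => /(_ erefl) pE.
rewrite (le_trans h1)// -[4]/((2 * 2)%:R) natrM -mulrA ler_wpM2l//.
set k := (count_moves phi z j).-1 in kc hr pE *.
have h2 : `|pivot phi z j| <= 2 * `|block phi z k j|.
  rewrite pE (le_trans (ler_normD _ _))// mulr_natl mulr2n lerD2r; exact: ltW.
rewrite (le_trans h2)// ler_wpM2l//.
rewrite -(block_past kc jm) -sqrtr_sqr ler_wsqrtr//.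
have km : (k < m)%N by apply: leq_trans kc (leq_trans (count_moves_le _ _ _) jm).
rewrite (bigD1 (Ordinal km))//= lerDl; apply: sumr_ge0 => i _; exact: sqr_ge0.
Qed.

(** Without a move both values are within [e] of the same reference value. *)
Lemma count_moves_jump (e : R) z i j : (i <= j)%N -> 0 <= e ->
  2 * e < `|z i - z j| ->
  (count_moves (fun=> e) z i < count_moves (fun=> e) z j)%N.
Proof.
move=> ij e0 h; rewrite ltn_neqAle count_moves_homo// andbT; apply/eqP => cij.
have pij : pivot (fun=> e) z i = pivot (fun=> e) z j.
  elim: j ij cij {h} => [|j IH]; first by rewrite leqn0 => /eqP ->.
  rewrite leq_eqVlt => /predU1P[->//|]; rewrite ltnS => ij /=.
  rewrite -/(moves (fun=> e) z j); case: (moves _ _ _) => /=.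
    rewrite addn1 => c; have := count_moves_homo (fun=> e) z ij.
    by rewrite c ltnn.
  by rewrite addn0 => /(IH ij) ->.
have h1 := pivot_near z i (phi := fun=> e) (fun=> e0).
have h2 := pivot_near z j (phi := fun=> e) (fun=> e0).
move: h; rewrite ltNge => /negP; apply.
rewrite pij in h1; rewrite -(subrKA (pivot (fun=> e) z j)) (le_trans (ler_normD _ _))//.
by rewrite mulr_natl mulr2n lerD// distrC.
Qed.

End greedy_partition.

Section measurable_greedy.
Context d (T : measurableType d) (R : realType).
Variables (phi : R -> R) (z : nat -> T -> R).
Hypothesis mphi : measurable_fun setT phi.

Lemma measurable_ltR (f g : T -> R) : measurable_fun setT f -> measurable_fun setT g ->
  measurable_fun setT (fun w => (f w < g w)%R%:R : R).
Proof.
move=> mf mg; rewrite (_ : (fun _ => _) = (fun w => if f w < g w then 1 else 0)); last first.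
  by apply/funext => w; case: (_ < _).
by apply: measurable_fun_ifT => //; exact: measurable_fun_ltr.
Qed.

Lemma measurable_pivot j : (forall i, (i <= j)%N -> measurable_fun setT (z i)) ->
  measurable_fun setT (fun w => pivot phi (z ^~ w) j).
Proof.
elim: j => [|j IH] mz /=; first exact: mz.
have mp : measurable_fun setT (fun w => pivot phi (z ^~ w) j).
  by apply: IH => i ij; apply: mz; exact: leqW.
apply: measurable_fun_ifT => //; last exact: mz.
apply: measurable_fun_ltr; first exact: measurableT_comp mphi mp.
by apply: measurableT_comp => //; apply: measurable_funB => //; exact: mz.
Qed.

Lemma measurable_moves j : (forall i, (i <= j.+1)%N -> measurable_fun setT (z i)) ->
  measurable_fun setT (fun w => (moves phi (z ^~ w) j)%:R : R).
Proof.
move=> mz; have mp : measurable_fun setT (fun w => pivot phi (z ^~ w) j).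
  by apply: measurable_pivot => i ij; apply: mz; exact: leqW.
apply: measurable_ltR; first exact: measurableT_comp mphi mp.
by apply: measurableT_comp => //; apply: measurable_funB => //; exact: mz.
Qed.

Lemma measurable_count_moves j k : (forall i, (i <= j)%N -> measurable_fun setT (z i)) ->
  measurable_fun setT (fun w => (count_moves phi (z ^~ w) j == k)%:R : R).
Proof.
elim: j k => [|j IH] k mz; first exact: measurable_cst.
have mz' i : (i <= j)%N -> measurable_fun setT (z i) by move=> ij; apply: mz; exact: leqW.
rewrite (_ : (fun _ => _) = (fun w =>
  (count_moves phi (z ^~ w) j == k)%:R * (1 - (moves phi (z ^~ w) j)%:R) +
  ((count_moves phi (z ^~ w) j == k.-1) && (0 < k)%N)%:R * (moves phi (z ^~ w) j)%:R)); last first.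
  apply/funext => w /=; case: (moves _ _ _).
    rewrite addn1 subrr mulr0 add0r mulr1.
    by case: k => [|k] //=; rewrite ?andbF ?andbT.
  by rewrite addn0 subr0 mulr1 mulr0 addr0.
have mm := measurable_moves mz.
apply: measurable_funD; apply: measurable_funM => //.
- exact: IH.
- exact: measurable_funB.
- case: k => [|k] /=; first by under eq_fun do rewrite andbF; exact: measurable_cst.
  by under eq_fun do rewrite andbT; exact: IH.
Qed.

Lemma measurable_block k m : (forall i, measurable_fun setT (z i)) ->
  measurable_fun setT (fun w => block phi (z ^~ w) k m).
Proof.
move=> mz; apply: measurable_sum => j; apply: measurable_funM.
  exact: measurable_count_moves.
exact: measurable_funB.
Qed.

End measurable_greedy.

(** * Right limits along dyadic times *)

Section time_limits.
Context {R : realType}.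
Local Notation time := {nonneg R}.

Lemma nneg_absK (s : time) : `|s%:num|%:nng = s.
Proof. by apply/val_inj; rewrite /= ger0_norm. Qed.

(** Translates limits from the right in the reals into statements on times. *)
Lemma near_right_time (t : time) (Q : time -> Prop) :
  (\forall r \near t%:num^'+, Q `|r|%:nng) <->
  exists2 dlt : R, 0 < dlt & forall s : time, t < s -> s%:num < t%:num + dlt -> Q s.
Proof.
split=> [/nbhs_ballP[e /= e0 H]|[e e0 H]].
  exists e => // s ts se; rewrite -(nneg_absK s); apply: H => //.
  by rewrite /ball/= ltr_distlC -num_lt in ts *; rewrite se andbT; lra.
apply/nbhs_ballP; exists e => //= r; rewrite /ball/= ltr_distlC => /andP[_ re] tr.
have r0 : 0 <= r by apply: le_trans (ltW tr); exact: ge0.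
by apply: H; rewrite -?num_lt/= ger0_norm.
Qed.

Lemma near_left_time (t : time) (Q : time -> Prop) : 0 < t%:num ->
  (\forall r \near t%:num^'-, Q `|r|%:nng) <->
  exists2 s : time, s < t & forall r, s < r -> r < t -> Q r.
Proof.
move=> t0; split=> [/nbhs_ballP[e /= e0 H]|[s st H]].
  have [s [s0 st]] : exists s : time, s < t /\ t%:num - e <= s%:num.
    exists `|Num.max 0 (t%:num - e)|%:nng.
    have m0 : 0 <= Num.max 0 (t%:num - e) by rewrite le_max lexx.
    rewrite -num_lt/= ger0_norm// gt_max t0 le_max lexx orbT; split=> //.
    by rewrite ltrBlDr ltrDl.
  exists s => // r sr rt; rewrite -(nneg_absK r); apply: H; last by rewrite num_lt.
  by rewrite /ball/= ltr_distlC -!num_lt in sr rt *; apply/andP; split; lra.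
apply/nbhs_ballP; exists (t%:num - s%:num); first by rewrite /= subr_gt0 num_lt.
move=> r; rewrite /ball/= ltr_distlC => /andP[h _] rt.
have sr : s%:num < r by lra.
have r0 : 0 <= r by apply: le_trans (ltW sr); exact: ge0.
by apply: H; rewrite -num_lt/= ger0_norm.
Qed.

Lemma grid_between (t s : time) (dlt : R) : s < t -> 0 < dlt ->
  exists n j, [/\ (j <= 2 ^ n)%N, s < grid t n j & (grid t n j)%:num < s%:num + dlt].
Proof.
move=> st d0; have t0 : 0 < t%:num by rewrite -num_lt in st; apply: le_lt_trans st; exact: ge0.
have [n nP] := exists_div_pow2_le t%:num (divr_gt0 d0 (ltr0n R 2)).
exists n, (Num.truncn (s%:num * 2 ^+ n / t%:num)).+1.
have p2 : 0 < 2 ^+ n :> R by rewrite exprn_gt0.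
have x0 : 0 <= s%:num * 2 ^+ n / t%:num by rewrite divr_ge0// mulr_ge0// ltW.
have := truncn_itv x0; set k := Num.truncn _ => /andP[k1 k2].
split.
- rewrite -(ltr_nat R) natrX; apply: (le_lt_trans k1).
  by rewrite ltr_pdivrMr// mulrC ltr_pM2l// num_lt.
- rewrite -num_lt gridE; move: k2; rewrite ltr_pdivrMr//.
  by rewrite mulrA ltr_pdivlMr// [_ * t%:num]mulrC.
- rewrite gridE -natr1 mulrA mulrDr mulr1 mulrDl.
  have h : t%:num * k%:R / 2 ^+ n <= s%:num.
    by rewrite ler_pdivrMr//; move: k1; rewrite ler_pdivlMr// mulrC.
  have : t%:num / 2 ^+ n < dlt by apply: le_lt_trans nP _; lra.
  by lra.
Qed.

(** Grid points are dense, and right continuity carries a closed bound over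
    from them to all times of the interval. *)
Lemma right_dense (v : time -> R) (t s : time) (c : R) : s <= t ->
  v `|r|%:nng @[r --> s%:num^'+] --> v s ->
  (forall n j, (j <= 2 ^ n)%N -> v (grid t n j) <= c) -> v s <= c.
Proof.
move=> st vs vc; move: st; rewrite le_eqVlt => /predU1P[->|st].
  by rewrite -(grid_last t 0); exact: vc.
apply/ler_addgt0Pr => e e0.
move/cvgrPdist_le: vs => /(_ _ e0) h.
have /(near_right_time s (fun r => `|v s - v r| <= e))[dlt d0 H] := h.
have [n [j [jn sj js]]] := grid_between st d0.
have := H _ sj js; rewrite ler_distl => /andP[_ {}h].
by apply: le_trans h _; rewrite lerD2r; exact: vc.
Qed.

Definition dyadic n j : time := grid (1%:nng : time) n j.
Definition slot n (s : time) : nat := Num.truncn (s%:num * 2 ^+ n).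
Definition is_dyadic (s : time) := exists m, forall n, (m <= n)%N -> dyadic n (slot n s) = s.

Lemma dyadicE n j : (dyadic n j)%:num = j%:R / 2 ^+ n.
Proof. by rewrite /dyadic gridE mul1r. Qed.

Lemma dyadic_le n i j : (i <= j)%N -> dyadic n i <= dyadic n j.
Proof. exact: grid_le. Qed.

Lemma slot_itv n s : (slot n s)%:R <= s%:num * 2 ^+ n < (slot n s).+1%:R.
Proof. by apply: truncn_itv; rewrite mulr_ge0// exprn_ge0. Qed.

Lemma slot_homo n s t : s <= t -> (slot n s <= slot n t)%N.
Proof. by move=> st; apply: le_truncn; rewrite ler_wpM2r// exprn_ge0. Qed.

Lemma slot_nat n N (s : time) : s%:num <= N%:R -> (slot n s <= N * 2 ^ n)%N.
Proof.
move=> sN; rewrite /slot -[leqRHS](@natrK R) natrM natrX.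
by apply: le_truncn; rewrite ler_wpM2r// exprn_ge0.
Qed.

Lemma dyadic_slotS n s : s < dyadic n (slot n s).+1.
Proof.
have /andP[_ h] := slot_itv n s.
by rewrite -num_lt dyadicE ltr_pdivlMr// exprn_gt0.
Qed.

Lemma dyadic_slotS_le n s : (dyadic n (slot n s).+1)%:num <= s%:num + 1 / 2 ^+ n.
Proof.
have /andP[h _] := slot_itv n s.
by rewrite dyadicE -natr1 mulrDl lerD2r ler_pdivrMr// exprn_gt0.
Qed.

Lemma dyadic_is_dyadic n j : is_dyadic (dyadic n j).
Proof.
exists n => m nm; apply/val_inj; rewrite -[LHS]/((dyadic _ _)%:num) -[RHS]/((dyadic _ _)%:num).
rewrite dyadicE /slot dyadicE.
have -> : j%:R / 2 ^+ n * 2 ^+ m = (j * 2 ^ (m - n))%:R :> R.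
  rewrite natrM natrX -[in 2 ^+ m](subnK nm) exprD; field.
  by rewrite expf_neq0// pnatr_eq0.
rewrite natrK natrM natrX -[in X in _ / X](subnK nm) exprD; field.
by rewrite !expf_neq0// pnatr_eq0.
Qed.

Lemma dyadic_between (s t : time) : s < t -> exists q, [/\ is_dyadic q, s < q & q < t].
Proof.
move=> st; have d0 : 0 < (t%:num - s%:num) / 2 by rewrite divr_gt0// subr_gt0 num_lt.
have [n nP] := exists_div_pow2_le 1 d0.
exists (dyadic n (slot n s).+1); split; [exact: dyadic_is_dyadic|exact: dyadic_slotS|].
rewrite -num_lt (le_lt_trans (dyadic_slotS_le n s))//.
by rewrite -num_lt in st; lra.
Qed.

Lemma dyadic_slotS_near (s t : time) : s < t ->
  \forall n \near \oo, dyadic n (slot n s).+1 < t.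
Proof.
move=> st; have d0 : 0 < (t%:num - s%:num) / 2 by rewrite divr_gt0// subr_gt0 num_lt.
have [m mP] := exists_div_pow2_le 1 d0.
exists m => // n /= mn; rewrite -num_lt (le_lt_trans (dyadic_slotS_le n s))//.
have : 1 / 2 ^+ n <= 1 / 2 ^+ m :> R.
  by rewrite !div1r lef_pV2 ?posrE ?exprn_gt0// ler_eXn2l ?ltr1n.
by rewrite -num_lt in st; lra.
Qed.

Definition cadlag (v : time -> R) :=
  (forall t : time, v `|s|%:nng @[s --> t%:num^'+] --> v t) /\
  (forall t : time, 0 < t%:num -> cvg (v `|s|%:nng @[s --> t%:num^'-])).

End time_limits.

Section path_regularization.
Context {R : realType}.
Local Notation time := {nonneg R}.
Variable v : time -> R.

(** The number of greedy moves along dyadic grids of [0, N] stays bounded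
    along a subsequence of the grids. A subsequence suffices, since a finite
    set of dyadic times lies in all fine grids; and it is all that Fatou's
    lemma gives. *)
Definition finitely_oscillating := forall N k : nat, exists K : nat, forall M,
  exists2 n, (M <= n)%N &
    (count_moves (fun=> k.+1%:R^-1) (fun j => v (dyadic n j)) (N * 2 ^ n) <= K)%N.

Hypothesis hv : finitely_oscillating.

(** The intervals of [I] shrink towards a limit from the left or from the
    right. If [v] oscillated on each of them, then, each time, one of the two
    points of a jump would bound a smaller interval that lies beyond it;
    iterating, there would be arbitrarily many disjoint jumps, and by
    [count_moves_jump] arbitrarily many moves on all fine grids. *)
Lemma small_oscillation (I : set (set time)) (N k : nat) :
  (exists i, I i) ->
  (forall i (s : time), I i -> i s -> s%:num <= N%:R) ->
  (forall i, I i -> exists2 q, is_dyadic q & i q) ->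
  (forall i a b, I i -> i a -> i b -> a < b -> exists i', [/\ I i', i' `<=` i &
    (forall s, i' s -> s <= a) \/ (forall s, i' s -> b <= s)]) ->
  exists2 i, I i & forall a b, is_dyadic a -> is_dyadic b -> i a -> i b ->
    `|v a - v b| <= 2 * k.+1%:R^-1.
Proof.
move=> [i0 Ii0] IN Id Is; apply: contrapT => /forall2NP H.
set e : R := k.+1%:R^-1 in H *; have e0 : 0 <= e by rewrite invr_ge0.
pose cnt n (s : time) := count_moves (fun=> e) (fun j => v (dyadic n j)) (slot n s).
have cnt_homo n s t : s <= t -> (cnt n s <= cnt n t)%N.
  by move=> st; apply: count_moves_homo; exact: slot_homo.
have jump i : I i -> exists a b, [/\ i a, i b, a < b &
    exists m, forall n, (m <= n)%N -> (cnt n a < cnt n b)%N].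
  move=> Ii; have [//|] := H i => /existsNP[a /existsNP[b]].
  move=> /not_implyP[[ma ha] /not_implyP[[mb hb] /not_implyP[ia /not_implyP[ib /negP]]]].
  rewrite -ltNge => h.
  have key (x y : time) mx my : 2 * e < `|v x - v y| -> x <= y ->
      (forall n, (mx <= n)%N -> dyadic n (slot n x) = x) ->
      (forall n, (my <= n)%N -> dyadic n (slot n y) = y) ->
      exists m, forall n, (m <= n)%N -> (cnt n x < cnt n y)%N.
    move=> vxy xy hx hy; exists (maxn mx my) => n; rewrite geq_max => /andP[nx ny].
    by apply: count_moves_jump => //; [exact: slot_homo|rewrite hx// hy].
  have [ab|ba|ab] := ltgtP a b.
  - by exists a, b; split => //; apply: key h _ ha hb; exact: ltW.
  - by exists b, a; split => //; apply: key _ _ hb ha; [rewrite distrC|exact: ltW].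
  - by move: h; rewrite ab subrr normr0 ltNge mulr_ge0.
(* Within every interval of [I] the number of moves between two of its points
   is eventually at least [L]. The smaller interval lies on one side of the
   jump, so that moves add up. *)
have chain L i : I i -> exists x y, [/\ i x, i y & exists m, forall n, (m <= n)%N ->
    (cnt n x + L <= cnt n y)%N].
  elim: L i => [|L IH] i Ii.
    by have [q _ iq] := Id _ Ii; exists q, q; split => //; exists 0%N => n _; rewrite addn0.
  have [a [b [ia ib ab [m1 h1]]]] := jump i Ii.
  have [i' [Ii' i'i side]] := Is _ _ _ Ii ia ib ab.
  have [x [y [i'x i'y [m2 h2]]]] := IH _ Ii'.
  case: side => side.
    exists x, b; split => //; first exact: i'i.
    exists (maxn m1 m2) => n; rewrite geq_max => /andP[n1 n2].
    rewrite addnS (leq_ltn_trans (h2 _ n2))// (leq_ltn_trans _ (h1 _ n1))//.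
    exact/cnt_homo/side.
  exists a, y; split => //; first exact: i'i.
  exists (maxn m1 m2) => n; rewrite geq_max => /andP[n1 n2].
  rewrite -addSnnS (leq_trans _ (h2 _ n2))// leq_add2r (leq_trans (h1 _ n1))//.
  exact/cnt_homo/side.
have [K KP] := hv N k; have [x [y [_ iy [m h]]]] := chain K.+1 i0 Ii0.
have [n mn nK] := KP m; have := h n mn; rewrite leqNgt => /negP; apply.
have : (cnt n y <= K)%N.
  by apply: leq_trans nK; apply: count_moves_homo; apply: slot_nat; exact: IN iy.
by rewrite addnS ltnS => /leq_trans; apply; exact: leq_addl.
Qed.

Lemma inv_le_half (e : R) : 0 < e -> exists k : nat, 2 * k.+1%:R^-1 <= e.
Proof.
move=> e0; exists (Num.truncn (2 / e)).
rewrite ler_pdivrMr ?ltr0n// -ler_pdivrMl// mulrC ltW//; exact: truncnS_gt.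
Qed.

Lemma oscillation_right (t : time) (e : R) : 0 < e -> exists2 s, t < s &
  forall a b, is_dyadic a -> is_dyadic b -> t < a < s -> t < b < s -> `|v a - v b| <= e.
Proof.
move=> /inv_le_half[k ke].
pose N := (Num.truncn t%:num).+1.
have tN : t%:num < N%:R by exact: truncnS_gt.
pose I := [set i | exists2 s, (t < s /\ s%:num <= N%:R) & i = [set r | t < r < s]].
have [||||_ [s [ts _] ->] H] := @small_oscillation I N k.
- have [z zE] : exists z : time, z%:num = N%:R by exists N%:R%:nng.
  by exists [set r | t < r < z], z; rewrite // -num_lt zE; split => //; rewrite lexx.
- move=> _ r [s [_ sN] ->] /= /andP[_ rs]; apply: le_trans sN; exact: ltW.
- move=> _ [s [ts _] ->]; have [q [dq tq qs]] := dyadic_between ts.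
  by exists q; rewrite //= tq.
- move=> _ a b [s [ts sN] ->] /= /andP[ta as_] _ _.
  exists [set r | t < r < a]; split.
  + by exists a => //; split => //; apply: le_trans sN; exact: ltW.
  + by move=> r /= /andP[-> /lt_trans]; apply.
  + by left => r /= /andP[_ /ltW].
- by exists s => // a b da db ia ib; apply: le_trans ke; exact: H.
Qed.

Lemma oscillation_left (t : time) (e : R) : 0 < t%:num -> 0 < e -> exists2 s, s < t &
  forall a b, is_dyadic a -> is_dyadic b -> s < a < t -> s < b < t -> `|v a - v b| <= e.
Proof.
move=> t0 /inv_le_half[k ke].
pose N := (Num.truncn t%:num).+1.
have tN : t%:num < N%:R by exact: truncnS_gt.
pose I := [set i | exists2 s, s < t & i = [set r | s < r < t]].
have [||||_ [s st ->] H] := @small_oscillation I N k.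
- have [z zE] : exists z : time, z%:num = 0 by exists 0%:nng.
  by exists [set r | z < r < t], z; rewrite // -num_lt zE.
- move=> _ r [s _ ->] /= /andP[_ rt]; apply: le_trans (ltW tN); exact: ltW.
- move=> _ [s st ->]; have [q [dq sq qt]] := dyadic_between st.
  by exists q; rewrite //= sq.
- move=> _ a b [s st ->] _ /= /andP[sb bt] _.
  exists [set r | b < r < t]; split.
  + by exists b.
  + by move=> r /= /andP[/(lt_trans sb) -> ->].
  + by right => r /= /andP[/ltW].
- by exists s => // a b da db ia ib; apply: le_trans ke; exact: H.
Qed.

(** Evaluated at the dyadic times just after [t]. They lie strictly to the
    right of [t], so that the result depends on one-sided behaviour only. *)
Definition right_limit (t : time) : R := rlim (fun n => v (dyadic n (slot n t).+1)).

Lemma right_limit_cvg t : v (dyadic n (slot n t).+1) @[n --> \oo] --> right_limit t.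
Proof.
suff : cvgn (fun n => v (dyadic n (slot n t).+1)).
  by move=> /cvg_ex[l h]; rewrite /right_limit (rlimE h).
apply: cauchy_cvg; apply: cauchy_exP => e e0.
have e2 : 0 < e / 2 by rewrite divr_gt0.
have [s ts H] := oscillation_right t e2; have [q [dq tq qs]] := dyadic_between ts.
exists (v q); have := dyadic_slotS_near ts; apply: filterS => n ns.
apply: le_lt_trans (_ : e / 2 < e); last by lra.
by apply: H => //; [exact: dyadic_is_dyadic|rewrite tq|rewrite dyadic_slotS].
Qed.

(** The right limit inherits closed bounds from dyadic times nearby. *)
Lemma right_limit_near (x y s a : time) (e : R) :
  (forall a b, is_dyadic a -> is_dyadic b -> x < a < y -> x < b < y -> `|v a - v b| <= e) ->
  is_dyadic a -> x < a < y -> x <= s < y -> `|right_limit s - v a| <= e.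
Proof.
move=> H da xay /andP[xs sy].
apply: (@closed_cvg _ _ \oo _ (fun n => v (dyadic n (slot n s).+1)) [set r | `|r - v a| <= e]).
- have -> : [set r | `|r - v a| <= e] = closed_ball_ Num.norm (v a) e.
    by apply/seteqP; split => r /=; rewrite distrC.
  exact: closed_closed_ball_.
- have := dyadic_slotS_near sy; apply: filterS => n ny.
  by apply: H => //; [exact: dyadic_is_dyadic|rewrite ny andbT (le_lt_trans xs)// dyadic_slotS].
- exact: right_limit_cvg.
Qed.

Lemma right_limit_cadlag : cadlag right_limit.
Proof.
split=> t.
  apply/cvgrPdist_le => e e0; have e2 : 0 < e / 2 by rewrite divr_gt0.
  have [s ts H] := oscillation_right t e2; have [q [dq tq qs]] := dyadic_between ts.
  have tqs : t < q < s by rewrite tq.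
  apply/(near_right_time t (fun r => `|right_limit t - right_limit r| <= e)); exists (s%:num - t%:num); first by rewrite subr_gt0 num_lt.
  move=> r tr; rewrite addrC subrK num_lt => rs.
  rewrite -(subrKA (v q)) (le_trans (ler_normD _ _))// [leRHS]splitr lerD//.
    by apply: (right_limit_near H) => //; rewrite lexx.
  by rewrite distrC; apply: (right_limit_near H) => //; rewrite ltW.
move=> t0; apply: cauchy_cvg; apply: cauchy_exP => e e0.
have e2 : 0 < e / 2 by rewrite divr_gt0.
have [s st H] := oscillation_left t0 e2; have [q [dq sq qt]] := dyadic_between st.
exists (v q).
apply/(@near_left_time R t (fun r => ball (v q) e (right_limit r)) t0); exists s => // r sr rt.
apply: le_lt_trans (_ : e / 2 < e); last by lra.
by rewrite distrC; apply: (right_limit_near H); rewrite ?sq// ltW.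
Qed.

End path_regularization.

(** * Regular modifications and the maximal inequality *)

Section regular_modification.
Context d (T : measurableType d) (R : realType) (P : probability T R).
Variable F : {nonneg R} -> set (set T).
Hypothesis hF : usual_conditions P F.
Variable p : R.
Hypothesis hp : 1 <= p.
Local Notation time := {nonneg R}.
Implicit Types (U V : time -> T -> R).

(** The boundedness of [integrator] with normalised coefficients, for a fixed
    horizon and with an explicit constant, as needed to make integral
    processes small. *)
Definition transform_bound V (t : time) (C : R) :=
  forall n (u : nat -> time) (c : nat -> T -> R),
    (forall j, u j <= u j.+1) -> u n <= t ->
    (forall j, rmeas (F (u j)) (c j)) -> (forall j w, `|c j w| <= 1) ->
    pnorm P p (fun w => \sum_(j < n) c j w * (V (u j.+1) w - V (u j) w)) <=e C.

Lemma sum_indic (n c : nat) (f : nat -> R) : (c < n)%N ->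
  \sum_(k < n) f k * (c == k)%:R = f c.
Proof.
move=> cn; rewrite (bigD1 (Ordinal cn))//= eqxx mulr1 big1 ?addr0// => k kc.
by rewrite (negbTE (_ : c != k)) ?mulr0// eq_sym; exact: kc.
Qed.

Lemma measurable_bigmax m (f : nat -> T -> R) : (forall j, measurable_fun setT (f j)) ->
  measurable_fun setT (fun w => \big[Num.max/0]_(j < m) f j w).
Proof.
elim: m f => [|m IH] f mf; first by under eq_fun do rewrite big_ord0; exact: measurable_cst.
under eq_fun do rewrite big_ord_recl; apply: measurable_maxr => //.
exact: (IH (fun j => f j.+1)).
Qed.

Lemma measurable_block_norm phi m (z : nat -> T -> R) : measurable_fun setT phi ->
  (forall j, measurable_fun setT (z j)) ->
  measurable_fun setT (fun w => Num.sqrt (\sum_(k < m) block phi (z ^~ w) k m ^+ 2)).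
Proof.
move=> mphi mz.
have ms : measurable_fun setT (fun w => \sum_(k < m) block phi (z ^~ w) k m ^+ 2).
  apply: measurable_sum => k; apply: measurable_funX.
  exact: (measurable_block (z := z)).
exact: (measurableT_comp (continuous_measurable_fun (@sqrt_continuous R)) ms).
Qed.

(** A signed sum of blocks is an elementary transform: the sign attached to an
    increment depends on the number of moves so far, which is known at the
    beginning of the increment. So Khintchine's inequality applies. *)
Lemma pnorm_blocks V t (C : R) phi m (u : nat -> time) :
  (forall r, rmeas (F r) (V r)) -> transform_bound V t C ->
  (forall j, u j <= u j.+1) -> u m <= t -> measurable_fun setT phi ->
  pnorm P p (fun w => Num.sqrt
    (\sum_(k < m) block phi (fun j => V (u j) w) k m ^+ 2)) <=e 2 * C.
Proof.
move=> mV bV und umt mphi.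
have umono : {homo u : i j / (i <= j)%N >-> i <= j} by exact/nondecreasing_seqP.
have mVT r : measurable_fun setT (V r) by exact: (rmeasF_measurable hF (mV r)).
apply: (pnorm_square_function hp (a := fun k w => block phi (fun j => V (u j) w) k m)).
  by move=> k; apply: (measurable_block (z := fun j => V (u j))).
(* The signs are indexed by the number of moves made so far. *)
move=> e; pose c j w : R := (-1) ^+ e (count_moves phi (fun i => V (u i) w) j).
rewrite (_ : (fun _ => _) = (fun w => \sum_(j < m) c j w * (V (u j.+1) w - V (u j) w))).
  apply: bV => //.
    move=> j; rewrite (_ : c j = fun w => \sum_(k < j.+1)
       (-1) ^+ e k * (count_moves phi (fun i => V (u i) w) j == k)%:R); last first.
      apply/funext => w; rewrite (sum_indic (fun k => (-1) ^+ e k))//.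
      by rewrite ltnS count_moves_le.
    apply: measurable_sum => k; apply: measurable_funM; first exact: measurable_cst.
    apply: (@measurable_count_moves _ (g_sigma_algebraType (F (u j))) R phi
      (fun i => V (u i)) mphi) => i ij.
    exact: (rmeasF_le hF (umono _ _ ij) (mV (u i))).
  by move=> j w; rewrite normrX normrN1 expr1n.
apply/funext => w; rewrite /block; under eq_bigr do rewrite mulr_sumr.
rewrite exchange_big/=; apply: eq_bigr => j _.
rewrite /c -(@sum_indic m _ (fun k => (-1) ^+ e k)).
  by rewrite mulr_suml; apply: eq_bigr => k _; rewrite mulrA.
by apply: leq_ltn_trans (count_moves_le _ _ _) _.
Qed.

(** By [count_moves_square] the number of moves is at most the squared square
    function over [e^2], and the square functions are bounded in L^p. *)
Lemma finitely_oscillating_ae V :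
  (forall r, rmeas (F r) (V r)) ->
  (forall t, exists2 C : R, 0 <= C & transform_bound V t C) ->
  {ae P, forall w, finitely_oscillating (V ^~ w)}.
Proof.
move=> mV bV.
have mVT r : measurable_fun setT (V r) by exact: (rmeasF_measurable hF (mV r)).
apply: ae_foralln => N; apply: ae_foralln => k.
have [t tE] : exists t : time, t%:num = N%:R by exists N%:R%:nng.
have [C C0 bC] := bV t.
pose e : R := k.+1%:R^-1; have e0 : 0 < e by rewrite invr_gt0.
(* The [N * 2^n] first steps of the n-th dyadic grid lead to time [N]. *)
pose f n w := Num.sqrt (\sum_(i < (N * 2 ^ n)%N)
  block (fun=> e) (fun j => V (dyadic n j) w) i (N * 2 ^ n)%N ^+ 2).
have mf n : measurable_fun setT (f n).
  by apply: (measurable_block_norm _ (z := fun j => V (dyadic n j))) => //; exact: measurable_cst.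
have fC n : pnorm P p (f n) <=e 2 * C.
  apply: (pnorm_blocks (t := t)) => //.
  - by move=> j; exact: dyadic_le.
  - by rewrite -num_le dyadicE tE natrM natrX mulfK// expf_neq0.
have C2 : 0 <= 2 * C by rewrite mulr_ge0.
apply: filterS (pnorm_liminf hp C2 mf fC) => w [B HB].
exists (Num.truncn (B ^+ 2 / e ^+ 2)) => M; have [n Mn fB] := HB M; exists n => //.
have B0 : 0 <= B by exact: le_trans fB.
rewrite -(@natrK R (count_moves _ _ _)); apply: le_truncn.
rewrite ler_pdivlMr ?exprn_gt0// mulrC.
apply: le_trans (count_moves_square _ _ (ltW e0)) _.
have S0 : 0 <= \sum_(i < (N * 2 ^ n)%N)
    block (fun=> e) (fun j => V (dyadic n j) w) i (N * 2 ^ n)%N ^+ 2.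
  by apply: sumr_ge0 => i _; exact: sqr_ge0.
by rewrite -(sqr_sqrtr S0) lerXn2r ?nnegrE ?sqrtr_ge0// (le_trans (ler_norm _)).
Qed.

(** The value 0 off the good set keeps every path, and not just almost every
    one, right-continuous with left limits. *)
Definition regularize V (t : time) (w : T) : R :=
  if pselect (finitely_oscillating (V ^~ w)) then right_limit (V ^~ w) t else 0.

Lemma cadlag_cst (c : R) : cadlag (fun=> c).
Proof.
by split=> t; [exact: cvg_cst|move=> _; apply/cvg_ex; exists c; exact: cvg_cst].
Qed.

Lemma regularize_cadlag V w : cadlag (regularize V ^~ w).
Proof.
rewrite /regularize; case: pselect => h; last exact: cadlag_cst.
exact: right_limit_cadlag.
Qed.

Lemma cvg_subseq_ge (f : nat -> R) (l : R) (k : nat -> nat) : (forall n, (n <= k n)%N) ->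
  f n @[n --> \oo] --> l -> f (k n) @[n --> \oo] --> l.
Proof.
move=> nk /cvgrPdist_le fl; apply/cvgrPdist_le => e e0.
have [N _ NP] := fl e e0; exists N => // n /= Nn.
by apply: NP; exact: leq_trans Nn (nk n).
Qed.

(** Right continuity in L^p identifies the right limit along dyadic times with
    the value, almost surely at each fixed time. *)
Lemma regularize_modification V (t : time) :
  (forall r, rmeas (F r) (V r)) ->
  (forall t, exists2 C : R, 0 <= C & transform_bound V t C) ->
  (forall t (e : R), 0 < e -> exists2 dlt : R, 0 < dlt &
    forall s : time, t <= s -> s%:num < t%:num + dlt -> pnorm P p (V s \- V t) <=e e) ->
  {ae P, forall w, regularize V t w = V t w}.
Proof.
move=> mV bV rV.
have mVT r : measurable_fun setT (V r) by exact: (rmeasF_measurable hF (mV r)).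
have /choice[k kP] : forall n, exists k, (n <= k)%N /\
    pnorm P p (V (dyadic k (slot k t).+1) \- V t) <=e 1 / 2 ^+ n.
  move=> n; have p2 : 0 < 1 / 2 ^+ n :> R by rewrite divr_gt0// exprn_gt0.
  have [dlt d0 H] := rV t _ p2; have d2 : 0 < dlt / 2 by rewrite divr_gt0.
  have [m mP] := exists_div_pow2_le 1 d2; exists (maxn n m); split; first exact: leq_maxl.
  apply: H; first by rewrite ltW// dyadic_slotS.
  apply: le_lt_trans (dyadic_slotS_le _ _) _; rewrite ltrD2l.
  apply: (@le_lt_trans _ _ (dlt / 2)); last by lra.
  apply: le_trans mP; rewrite !div1r lef_pV2 ?posrE ?exprn_gt0//.
  by rewrite ler_eXn2l ?ltr1n// leq_maxr.
have cv : {ae P, forall w, V (dyadic (k n) (slot (k n) t).+1) w @[n --> \oo] --> V t w}.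
  by apply: (pnorm_subseq_ae hp) => // n; have [] := kP n.
apply: filterS2 cv (finitely_oscillating_ae mV bV) => w cw gw.
rewrite /regularize; case: pselect => // gw'.
have cl : V (dyadic (k n) (slot (k n) t).+1) w @[n --> \oo] --> right_limit (V ^~ w) t.
  by apply: cvg_subseq_ge (right_limit_cvg gw' (t := t)) => n; have [] := kP n.
exact: (cvg_unique _ cl cw).
Qed.

Lemma transform_bound_modification V V' t (C : R) :
  (forall r, rmeas (F r) (V r)) -> (forall r, rmeas (F r) (V' r)) ->
  (forall r, {ae P, forall w, V' r w = V r w}) -> transform_bound V t C ->
  transform_bound V' t C.
Proof.
move=> mV mV' VV' bV n u c und unt mc c1; have := bV n u c und unt mc c1.
have mVT r : measurable_fun setT (V r) by exact: (rmeasF_measurable hF (mV r)).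
have mVT' r : measurable_fun setT (V' r) by exact: (rmeasF_measurable hF (mV' r)).
have mcT j : measurable_fun setT (c j) by exact: (rmeasF_measurable hF (mc j)).
apply: le_trans; rewrite le_eqVlt; apply/orP; left; apply/eqP; apply: pnorm_ae => //.
- by apply: measurable_sum => j; apply: measurable_funM => //; exact: measurable_funB.
- by apply: measurable_sum => j; apply: measurable_funM => //; exact: measurable_funB.
- apply: filterS (ae_foralln (fun j => VV' (u j))) => w h.
  by apply: eq_bigr => j _; rewrite !h.
Qed.

(** On each dyadic grid the maximum is dominated by the square function of the
    greedy blocks with [phi] the modulus. The grid maxima increase, and right
    continuity makes their limit dominate the whole path. *)
Lemma maximal_inequality V t (C : R) : 0 <= C -> (forall r, rmeas (F r) (V r)) ->
  {ae P, forall w, V 0%:nng w = 0} ->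
  (forall w (s : time), V `|r|%:nng w @[r --> s%:num^'+] --> V s w) ->
  transform_bound V t C ->
  exists S : T -> R, [/\ measurable_fun setT S, pnorm P p S <=e 8 * C &
    {ae P, forall w, forall s, s <= t -> `|V s w| <= S w}].
Proof.
move=> C0 mV V0 rV bV.
have mVT r : measurable_fun setT (V r) by exact: (rmeasF_measurable hF (mV r)).
pose M n w := \big[Num.max/0]_(j < (2 ^ n).+1) `|V (grid t n j) w|.
have M0 n w : 0 <= M n w by apply: bigmax_ge_id.
have mM n : measurable_fun setT (M n).
  apply: (@measurable_bigmax _ (fun j w => `|V (grid t n j) w|)) => j.
  exact: measurableT_comp.
have Mle n j w : (j <= 2 ^ n)%N -> `|V (grid t n j) w| <= M n w.
  move=> jn; have jn' : (j < (2 ^ n).+1)%N by rewrite ltnS.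
  exact: (le_bigmax _ (fun j : 'I_(2 ^ n).+1 => `|V (grid t n j) w|) (Ordinal jn')).
have Mhomo w : nondecreasing_seq (M ^~ w).
  apply/nondecreasing_seqP => n; apply/bigmax_leP; split => // j _.
  rewrite -grid_double; apply: Mle.
  by rewrite expnS mul2n leq_double -ltnS.
pose f n w := 4 * Num.sqrt (\sum_(k < (2 ^ n)%N)
  block (fun x => `|x|) (fun j => V (grid t n j) w) k (2 ^ n)%N ^+ 2).
have mf n : measurable_fun setT (f n).
  apply: measurable_funM => //.
  exact: (measurable_block_norm _ (z := fun j => V (grid t n j))).
(* The constant is 4 from [block_dominates] times 2 from Khintchine's
   inequality. *)
have fC n : pnorm P p (f n) <=e 8 * C.
  rewrite (_ : 8 * C = `|4| * (2 * C)); last by rewrite ger0_norm//; ring.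
  apply: pnormZ_le => //; last first.
    apply: (pnorm_blocks (t := t)) => //.
    - by move=> j; exact: grid_le.
    - by rewrite grid_last.
  exact: (measurable_block_norm _ (z := fun j => V (grid t n j))).
have Mf : {ae P, forall w, forall n, M n w <= f n w}.
  apply: filterS V0 => w V0 n; apply/bigmax_leP; split.
    by rewrite mulr_ge0// sqrtr_ge0.
  move=> j _; apply: (block_dominates (z := fun j => V (grid t n j) w)).
    by rewrite grid0.
  by rewrite -ltnS.
have C8 : 0 <= 8 * C by rewrite mulr_ge0.
have MC n : pnorm P p (M n) <=e 8 * C.
  apply: le_trans (fC n); apply: pnorm_mono => //; apply: filterS Mf => w h.
  by rewrite (ger0_norm (M0 _ _)) (le_trans (h n))// ler_norm.
have cM : {ae P, forall w, M n w @[n --> \oo] --> rlim (M ^~ w)}.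
  apply: filterS (pnorm_liminf hp C8 mM MC) => w [B HB].
  have : cvgn (M ^~ w).
    apply: nondecreasing_is_cvgn => //; exists B => _ [n _ <-].
    have [m nm MB] := HB n; apply: le_trans (Mhomo w _ _ nm) _.
    by apply: le_trans MB; exact: ler_norm.
  by move=> /cvg_ex[l h]; rewrite (rlimE h).
exists (fun w => rlim (M ^~ w)); split.
- exact: measurable_rlim.
- apply: (pnorm_fatou hp C8 mM _ cM MC); exact: measurable_rlim.
- apply: filterS cM => w cw s st.
  apply: (right_dense (v := fun s => `|V s w|) st).
    by apply: cvg_norm; exact: rV.
  move=> n j jn; apply: le_trans (Mle _ _ w jn) _.
  rewrite -(cvg_lim _ cw)//; apply: nondecreasing_cvgn_le => //.
  by apply/cvg_ex; eexists; exact: cw.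
Qed.

End regular_modification.

(** * Regular versions of stochastic integrals *)

Section regular_integral.
Context d (T : measurableType d) (R : realType) (P : probability T R).
Variable F : {nonneg R} -> set (set T).
Hypothesis hF : usual_conditions P F.
Variable p : R.
Hypothesis hp : 1 <= p.
Local Notation time := {nonneg R}.
Local Notation loc_bounded_predictable := (loc_bounded_predictable F).
Implicit Types (U : time -> T -> R) (Y Z : time * T -> R).

(** The bound is on a measurable majorant, so that measurability of the
    supremum over uncountably many times is no concern. *)
Definition sup_norm_le (V : time -> T -> R) (t : time) (e : R) :=
  exists S : T -> R, [/\ measurable_fun setT S, pnorm P p S <=e e &
    {ae P, forall w, forall s : time, s <= t -> `|V s w| <= S w}].

Record is_regular_integral U (I : (time * T -> R) -> time -> T -> R) : Prop :=
  IsRegularIntegral {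
  ri_adapted : forall Y t, loc_bounded_predictable Y -> rmeas (F t) (I Y t);
  ri_cadlag : forall Y w, cadlag (I Y ^~ w);
  ri_sup : forall Y t, loc_bounded_predictable Y -> exists2 C : R, 0 <= C & sup_norm_le (I Y) t C;
  ri_lin : forall Y Z (k : R) t, loc_bounded_predictable Y -> loc_bounded_predictable Z ->
    {ae P, forall w, I (fun rw => Y rw + k * Z rw) t w = I Y t w + k * I Z t w};
  ri_dct : forall (f : nat -> time * T -> R) Y, (forall n, loc_bounded_predictable (f n)) -> loc_bounded_predictable Y ->
    (forall t : time, exists M : R, forall n (rw : time * T), rw.1 <= t -> `|f n rw| <= M) ->
    (forall rw, f n rw @[n --> \oo] --> Y rw) ->
    forall t (e : R), 0 < e -> exists N, forall n, (N <= n)%N ->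
      sup_norm_le (fun s w => I (f n) s w - I Y s w) t e;
  ri_step : forall s A (M : R) t, rmeas (F s) A -> (forall w, `|A w| <= M) ->
    {ae P, forall w, I (after s A) t w = A w * (U t w - U (Num.min s t) w)};
  ri_at0 : forall A (M : R) t, rmeas (F 0%:nng) A -> (forall w, `|A w| <= M) ->
    {ae P, forall w, I (at0 A) t w = 0} }.

Lemma lpred_lin Y Z (k : R) : loc_bounded_predictable Y -> loc_bounded_predictable Z -> loc_bounded_predictable (fun rw => Y rw + k * Z rw).
Proof.
move=> lY lZ t; have := bpred_lin k (lY t) (lZ t); congr bounded_predictable; apply/funext => rw.
by rewrite /upto mulrDl mulrA.
Qed.

Lemma bpred_lpred Y : bounded_predictable F Y -> loc_bounded_predictable Y.
Proof. by move=> bY t; exact: (bpred_upto hF). Qed.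

(** Regularise the integral processes. Convergence in the supremum norm
    follows from the maximal inequality, because transforms of an integral
    process with small integrand are integrals of integrands that are small
    uniformly. *)
Theorem regular_integral_exists U : integrator P F p U -> exists I, is_regular_integral U I.
Proof.
move=> HU.
have [J HJ] : exists J, forall t, is_integral P F p U t (J t).
  have /choice[J JP] := fun t => stochastic_integral_exists hF hp t HU.
  by exists J.
pose V := integral_process J.
have iV Y : loc_bounded_predictable Y -> integrator P F p (V Y) by exact: (integral_process_integrator hF hp HU HJ).
have mV Y : loc_bounded_predictable Y -> forall r, rmeas (F r) (V Y r).
  by move=> lY r; exact: int_adapted (iV Y lY) r.
have bV Y : loc_bounded_predictable Y -> forall t, exists2 C : R, 0 <= C & transform_bound P F p (V Y) t C.
  move=> lY t; have [C C0 CP] := int_bound (iV Y lY) t; exists C => //.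
  move=> n u c und unt mc c1; rewrite -[C]mulr1; exact: CP.
have IV Y t : loc_bounded_predictable Y -> {ae P, forall w, regularize (V Y) t w = V Y t w}.
  move=> lY; apply: (regularize_modification hF hp); [exact: mV|exact: bV|].
  exact: (int_right (iV Y lY)).
have aI Y t : loc_bounded_predictable Y -> rmeas (F t) (regularize (V Y) t).
  by move=> lY; exact: (rmeasF_ae hF (IV Y t lY) (mV _ lY t)).
have Vlin Y Z (k : R) t : loc_bounded_predictable Y -> loc_bounded_predictable Z ->
    {ae P, forall w, V (fun rw => Y rw + k * Z rw) t w = V Y t w + k * V Z t w}.
  move=> lY lZ; have := si_lin (HJ t) k (lY t) (lZ t); apply: filterS => w <-.
  rewrite /V /integral_process; congr (J t _ w); apply/funext => rw.
  by rewrite /upto mulrDl mulrA.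
have Ilin Y Z (k : R) t : loc_bounded_predictable Y -> loc_bounded_predictable Z -> {ae P, forall w,
    regularize (V (fun rw => Y rw + k * Z rw)) t w =
    regularize (V Y) t w + k * regularize (V Z) t w}.
  move=> lY lZ; apply: filterS3 (Vlin Y Z k t lY lZ) (IV _ t (lpred_lin k lY lZ))
    (ae_and (IV Y t lY) (IV Z t lZ)).
  by move=> w h -> [-> ->].
have V0 Y : loc_bounded_predictable Y -> {ae P, forall w, regularize (V Y) 0%:nng w = 0}.
  move=> lY; apply: filterS2 (IV Y 0%:nng lY) (int_zero (iV Y lY)) => w -> ->; done.
exists (fun Y => regularize (V Y)); split.
- by move=> Y t; exact: aI.
- by move=> Y w; exact: regularize_cadlag.
- move=> Y t lY; have [C C0 CP] := bV Y lY t; exists (8 * C); first by rewrite mulr_ge0.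
  apply: (maximal_inequality hF hp C0); [by move=> r; exact: aI|exact: V0| |].
    by move=> w s; have [h _] := regularize_cadlag (V Y) w; exact: h.
  apply: (transform_bound_modification hF hp _ _ _ CP); [exact: mV|by move=> r; exact: aI|].
  by move=> r; exact: IV.
- exact: Ilin.
- move=> f Y lf lY fM fY t e e0.
  have [M MP] := fM t.
  have ld n : loc_bounded_predictable (fun rw => f n rw + -1 * Y rw) by exact: lpred_lin.
  pose g n := upto t (fun rw => f n rw + -1 * Y rw).
  have YM rw : rw.1 <= t -> `|Y rw| <= M.
    move=> rt; apply: (@closed_cvg _ _ \oo _ (f ^~ rw) [set x | `|x| <= M]) (fY rw).
      have -> : [set x : R | `|x| <= M] = closed_ball_ Num.norm 0 M.
        by apply/seteqP; split => x; rewrite /closed_ball_ /= sub0r normrN.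
      exact: closed_closed_ball_.
    by apply: nearW => n; exact: MP.
  have gM n rw : `|g n rw| <= M + M.
    have M0 : 0 <= M.
      by apply: le_trans (normr_ge0 _) (MP 0%N (t, point) _).
    rewrite /g /upto; case: (leP rw.1 t) => h; last by rewrite /= mulr0 normr0 addr_ge0.
    rewrite mulr1 mulN1r (le_trans (ler_normB _ _))// lerD//; [exact: MP|exact: YM].
  have g0 rw : g n rw @[n --> \oo] --> 0.
    rewrite -(mul0r ((rw.1 <= t)%R%:R)); apply: cvgM; last exact: cvg_cst.
    rewrite -(subrr (Y rw)); under eq_fun do rewrite mulN1r.
    by apply: cvgB; [exact: fY|exact: cvg_cst].
  have e8 : 0 < e / 8 by rewrite divr_gt0.
  (* Uniform smallness on all integrands below [f n - Y], which includes those
     of the transforms. *)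
  have [N NP] := integral_unif_small hp HJ t gM g0 e8.
  exists N => n Nn; rewrite (_ : e = 8 * (e / 8)); last by field.
  have dE r : {ae P, forall w, regularize (V (f n)) r w - regularize (V Y) r w =
      V (fun rw => f n rw + -1 * Y rw) r w}.
    apply: filterS3 (Vlin _ _ (-1) r (lf n) lY) (IV _ r (lf n)) (IV _ r lY).
    by move=> w -> -> ->; rewrite mulN1r.
  have ad r : rmeas (F r) (fun w => regularize (V (f n)) r w - regularize (V Y) r w).
    by apply: measurable_funB; exact: aI.
  apply: (maximal_inequality hF hp (ltW e8) ad).
  + by apply: filterS2 (V0 _ (lf n)) (V0 _ lY) => w -> ->; rewrite subrr.
  + move=> w s; have [h _] := regularize_cadlag (V (f n)) w.
    have [h' _] := regularize_cadlag (V Y) w.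
    by apply: cvgB; [exact: h|exact: h'].
  apply: (transform_bound_modification hF hp _ ad dE); first exact: mV.
  move=> m u c und umt mc c1.
  have [W [bW WY eW]] := integral_process_transform hF hp HJ (ld n) und umt mc c1.
  have mcT j : measurable_fun setT (c j) by exact: (rmeasF_measurable hF (mc j)).
  have mVT r : measurable_fun setT (V (fun rw => f n rw + -1 * Y rw) r).
    by exact: (rmeasF_measurable hF (mV _ (ld n) r)).
  apply: le_trans (NP n Nn W bW _); last by move=> rw; rewrite -[leRHS]mul1r; exact: WY.
  rewrite le_eqVlt; apply/orP; left; apply/eqP; apply: pnorm_ae => //.
  + by apply: measurable_sum => j; apply: measurable_funM => //; exact: measurable_funB.
  + exact: (si_meas (HJ t)).
- move=> s A M t mA AM; have bA := bpred_after hF mA AM.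
  have lA := bpred_lpred bA.
  have mA' : rmeas (F (Num.max s t)) A by apply: (rmeasF_le hF _ mA); rewrite le_max lexx.
  have bA' := bpred_after hF mA' AM.
  apply: filterS3 (IV _ t lA) (si_lin (HJ t) (-1) bA bA')
    (ae_and (si_step (HJ t) mA AM) (si_step (HJ t) mA' AM)) => w -> + [h1 h2].
  rewrite /V /integral_process upto_after h1 h2 => ->.
  by rewrite (min_r (x := Num.max s t)) ?le_max ?lexx ?orbT// subrr mulr0 mulr0 addr0.
- move=> A M t mA AM; have lA := bpred_lpred (bpred_at0 hF mA AM).
  apply: filterS2 (IV _ t lA) (si_at0 (HJ t) mA AM) => w -> h.
  by rewrite /V /integral_process upto_at0.
Qed.

End regular_integral.

(** * Complex-valued functions *)

Local Notation normc := ComplexField.Normc.normc.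
Local Notation Re := complex.Re.
Local Notation Im := complex.Im.

Section complex_modulus.
Context {R : realType}.
Implicit Types z : R[i].

Lemma normcE z : normc z = Num.sqrt (Re z ^+ 2 + Im z ^+ 2).
Proof. by case: z. Qed.

Lemma norm_normc z : `|z| = (normc z)%:C%C.
Proof. by rewrite normc_def normcE. Qed.

Lemma normc_ge0 z : 0 <= normc z.
Proof. by rewrite normcE sqrtr_ge0. Qed.

Lemma normcD z1 z2 : normc (z1 + z2) <= normc z1 + normc z2.
Proof. by rewrite -lecR rmorphD/= -!norm_normc ler_normD. Qed.

Lemma normcM z1 z2 : normc (z1 * z2) = normc z1 * normc z2.
Proof. exact: ComplexField.Normc.normcM. Qed.

Lemma normcN z : normc (- z) = normc z.
Proof. by apply: (@complexI R); rewrite -!norm_normc normrN. Qed.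

Lemma normcB z1 z2 : normc (z1 - z2) = normc (z2 - z1).
Proof. by rewrite -normcN opprB. Qed.

Lemma dist_normc z1 z2 : `|normc z1 - normc z2| <= normc (z1 - z2).
Proof.
rewrite ler_distl; apply/andP; split; last first.
  by have := normcD (z1 - z2) z2; rewrite subrK addrC.
by have := normcD (z2 - z1) z1; rewrite subrK lerBlDl normcB.
Qed.

Lemma normc0 : normc (0 : R[i]) = 0. Proof. exact: ComplexField.Normc.normc0. Qed.

Lemma Re_le_normc z : `|Re z| <= normc z.
Proof. by rewrite normcE -sqrtr_sqr ler_wsqrtr// lerDl sqr_ge0. Qed.

Lemma Im_le_normc z : `|Im z| <= normc z.
Proof. by rewrite normcE -sqrtr_sqr ler_wsqrtr// lerDr sqr_ge0. Qed.

Lemma normc_le_ReIm z : normc z <= `|Re z| + `|Im z|.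
Proof.
rewrite normcE -[leRHS]ger0_norm ?addr_ge0// -sqrtr_sqr ler_wsqrtr//.
rewrite sqrrD !real_normK ?num_real// lerD2r lerDl mulrn_wge0// mulr_ge0//.
Qed.

Lemma ReM z1 z2 : Re (z1 * z2) = Re z1 * Re z2 - Im z1 * Im z2.
Proof. by case: z1 z2 => [a b] [c e]. Qed.

Lemma ImM z1 z2 : Im (z1 * z2) = Re z1 * Im z2 + Im z1 * Re z2.
Proof. by case: z1 z2 => [a b] [c e]. Qed.

Lemma ReB z1 z2 : Re (z1 - z2) = Re z1 - Re z2.
Proof. by case: z1 z2 => [a b] [c e]. Qed.

Lemma ImB z1 z2 : Im (z1 - z2) = Im z1 - Im z2.
Proof. by case: z1 z2 => [a b] [c e]. Qed.

Lemma ReD z1 z2 : Re (z1 + z2) = Re z1 + Re z2.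
Proof. by case: z1 z2 => [a b] [c e]. Qed.

Lemma ImD z1 z2 : Im (z1 + z2) = Im z1 + Im z2.
Proof. by case: z1 z2 => [a b] [c e]. Qed.

Lemma Re_sum (I : Type) (r : seq I) (Q : pred I) (f : I -> R[i]) :
  Re (\sum_(i <- r | Q i) f i) = \sum_(i <- r | Q i) Re (f i).
Proof. by apply: (big_morph _ ReD). Qed.

Lemma Im_sum (I : Type) (r : seq I) (Q : pred I) (f : I -> R[i]) :
  Im (\sum_(i <- r | Q i) f i) = \sum_(i <- r | Q i) Im (f i).
Proof. by apply: (big_morph _ ImD). Qed.

Lemma complex_eq z1 z2 : Re z1 = Re z2 -> Im z1 = Im z2 -> z1 = z2.
Proof. by case: z1 z2 => [a b] [c e] /= -> ->. Qed.

Lemma cvg_normcP (U : Type) (G : set_system U) (f : U -> R[i]) (l : R[i]) : Filter G ->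
  (f x @[x --> G] --> l) <-> (forall e : R, 0 < e -> \forall x \near G, normc (f x - l) <= e).
Proof.
move=> FG; split=> [/cvgrPdist_le h e e0|h].
  have e0' : 0 < e%:C%C by rewrite ltcR.
  by apply: filterS (h _ e0') => x; rewrite distrC norm_normc lecR.
apply/cvgrPdist_le => -[a b]; rewrite ltcE/= => /andP[/eqP -> a0].
by apply: filterS (h _ a0) => x; rewrite distrC norm_normc lecR.
Qed.

Lemma cvg_ReIm (U : Type) (G : set_system U) (f : U -> R[i]) (l : R[i]) : Filter G ->
  (f x @[x --> G] --> l) <->
  (Re (f x) @[x --> G] --> Re l) /\ (Im (f x) @[x --> G] --> Im l).
Proof.
move=> FG; split=> [/cvg_normcP h|[/cvgrPdist_le hr /cvgrPdist_le hi]].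
  split; apply/cvgrPdist_le => e e0; apply: filterS (h _ e0) => x; apply: le_trans;
    rewrite distrC.
    by rewrite -ReB Re_le_normc.
  by rewrite -ImB Im_le_normc.
apply/cvg_normcP => e e0; have e2 : 0 < e / 2 by rewrite divr_gt0.
apply: filterS2 (hr _ e2) (hi _ e2) => x h1 h2.
rewrite (le_trans (normc_le_ReIm _))// ReB ImB [leRHS]splitr.
by rewrite lerD// distrC.
Qed.

Local Notation time := {nonneg R}.

Lemma rcllP (f : time -> R[i]) : rcll f <->
  cadlag (fun t => Re (f t)) /\ cadlag (fun t => Im (f t)).
Proof.
split=> [[h1 h2]|[[h1 h2] [k1 k2]]].
  split; split.
  - by move=> t; have /cvg_ReIm[] := h1 t.
  - move=> t t0; have [l /cvg_ReIm[h _]] := h2 t t0; apply/cvg_ex; eexists; exact: h.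
  - by move=> t; have /cvg_ReIm[] := h1 t.
  - move=> t t0; have [l /cvg_ReIm[_ h]] := h2 t t0; apply/cvg_ex; eexists; exact: h.
split=> t; first by apply/cvg_ReIm; split; [exact: h1|exact: k1].
move=> t0; have /cvg_ex[/= a ha] := h2 t t0; have /cvg_ex[/= b hb] := k2 t t0.
by exists (a +i* b)%C; apply/cvg_ReIm.
Qed.

Lemma measurable_wrtP (U : pointedType) (G : set (set U)) (f : U -> R[i]) :
  measurable_wrt G f <-> rmeas G (fun w => Re (f w)) /\ rmeas G (fun w => Im (f w)).
Proof.
rewrite -(@measurable_ReIm R _ (g_sigma_algebraType G) f); split=> h.
  by move=> _ B mB; apply: h; exists B.
by move=> _ [B mB <-]; exact: h.
Qed.

End complex_modulus.

Section running_sup.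
Context d (T : measurableType d) (R : realType) (P : probability T R).
Local Notation time := {nonneg R}.
Variables (p : R) (hp : 1 <= p).
Implicit Types Y : time -> T -> R[i].

Lemma measurable_normc (f : T -> R[i]) :
  measurable_fun setT (fun w => Re (f w)) -> measurable_fun setT (fun w => Im (f w)) ->
  measurable_fun setT (fun w => normc (f w)).
Proof.
move=> mr mi; under eq_fun do rewrite normcE.
apply: (measurableT_comp (continuous_measurable_fun (@sqrt_continuous R))).
by apply: measurable_funD; exact: measurable_funX.
Qed.

(** By right continuity the supremum is taken over dyadic fractions of [t];
    written as a countable supremum it is measurable. *)
Lemma running_sup_grid Y t w : rcll (Y ^~ w) ->
  running_sup Y t w = esups (fun n => esups (fun j =>
    (normc (Y (grid t n (minn j (2 ^ n))) w))%:E) 0) 0.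
Proof.
move=> [rY _]; apply/eqP; rewrite eq_le; apply/andP; split; last first.
  apply: ge_ereal_sup => _ [n _ <-]; apply: ge_ereal_sup => _ [j _ <-].
  apply: ereal_sup_ubound; exists (grid t n (minn j (2 ^ n))) => //=.
  by rewrite -[leRHS](grid_last t n); apply: grid_le; exact: geq_minr.
apply: ge_ereal_sup => _ [s st <-].
set E := esups _ 0.
have gE n j : (j <= 2 ^ n)%N -> ((normc (Y (grid t n j) w))%:E <= E)%E.
  move=> jn; apply: (@le_trans _ _ (esups (fun j =>
    (normc (Y (grid t n (minn j (2 ^ n))) w))%:E) 0)).
    by apply: ereal_sup_ubound; exists j => //=; rewrite (minn_idPl jn).
  by apply: ereal_sup_ubound; exists n.
have E0 : (0 <= E)%E by apply: le_trans (gE 0%N 0%N isT); rewrite lee_fin normc_ge0.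
case: (E) gE E0 => [c|_ _|//]; last exact: leey.
move=> gE _; rewrite lee_fin; apply: (right_dense (v := fun s => normc (Y s w)) st).
  have /cvg_normcP h := rY s; apply/cvgrPdist_le => e e0; apply: filterS (h _ e0) => x.
  by apply: le_trans; rewrite distrC dist_normc.
by move=> n j jn; have := gE n j jn; rewrite lee_fin.
Qed.

Lemma measurable_running_sup Y t : (forall w, rcll (Y ^~ w)) ->
  (forall s, measurable_fun setT (fun w => Re (Y s w)) /\
    measurable_fun setT (fun w => Im (Y s w))) ->
  measurable_fun setT (running_sup Y t).
Proof.
move=> rY mY; under [running_sup Y t]funext => w do rewrite running_sup_grid//.
apply: measurable_fun_esups => n; apply: measurable_fun_esups => j.
apply/measurable_EFinP; apply: measurable_normc; by have [] := mY (grid t n (minn j (2 ^ n))).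
Qed.

Lemma Lnorm_running_sup Y (t : time) (a b : R) : (forall w, rcll (Y ^~ w)) ->
  (forall s, measurable_fun setT (fun w => Re (Y s w)) /\
    measurable_fun setT (fun w => Im (Y s w))) ->
  sup_norm_le P p (fun s w => Re (Y s w)) t a -> sup_norm_le P p (fun s w => Im (Y s w)) t b ->
  (Lnorm P p%:E (running_sup Y t) <= (a + b)%:E)%E.
Proof.
move=> rY mY [S [mS Sa Sh]] [S' [mS' Sb Sh']].
apply: le_trans (pnormD_le hp mS mS' Sa Sb); apply: Lnorm_mono.
- exact: lt_le_trans hp.
- exact: measurable_running_sup.
- by apply/measurable_EFinP; exact: measurable_funD.
apply: filterS2 Sh Sh' => w h h'; rewrite gee0_abs.
  apply: ge_ereal_sup => _ [s st <-]; rewrite /= lee_fin.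
  rewrite (le_trans (normc_le_ReIm _))// (le_trans _ (ler_norm _))// lerD//; [exact: h|exact: h'].
apply: (@le_trans _ _ (normc (Y t w))%:E); first by rewrite lee_fin normc_ge0.
by apply: ereal_sup_ubound; exists t => //=.
Qed.

End running_sup.

(** * Right-continuous paths and step integrands *)

Lemma cvge0_near {R : realType} (U : Type) (G : set_system U) {FG : Filter G}
  (f : U -> \bar R) (e : R) :
  0 < e -> f x @[x --> G] --> 0%E -> \forall x \near G, f x <=e e.
Proof.
move=> e0 /fine_cvgP[fa /cvgrPdist_le h]; apply: filterS2 fa (h _ e0) => x fx.
rewrite sub0r normrN => hx.
by rewrite -(fineK fx) lee_fin; apply: le_trans hx; exact: ler_norm.
Qed.

Lemma near_cvge0 {R : realType} (U : Type) (G : set_system U) {FG : Filter G}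
  (f : U -> \bar R) : (forall x, (0 <= f x)%E) ->
  (forall e : R, 0 < e -> \forall x \near G, f x <=e e) -> f x @[x --> G] --> 0%E.
Proof.
move=> f0 h; apply/fine_cvgP; split.
  by apply: filterS (h 1 ltr01) => x fx; rewrite ge0_fin_numE// (le_lt_trans fx)// ltry.
apply/cvgrPdist_le => e e0; apply: filterS (h e e0) => x fx.
have ffin : f x \is a fin_num by rewrite ge0_fin_numE// (le_lt_trans fx)// ltry.
by rewrite sub0r normrN ger0_norm ?fine_ge0// -lee_fin fineK.
Qed.

Lemma cvge0P {R : realType} (a : nat -> \bar R) : (forall n, (0 <= a n)%E) ->
  (a n @[n --> \oo] --> 0%E) <->
  (forall e : R, 0 < e -> exists N, forall n, (N <= n)%N -> a n <=e e).
Proof.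
move=> a0; split=> [h e e0|h].
  by have [N _ NP] := cvge0_near e0 h; exists N => n; exact: NP.
by apply: near_cvge0 => // e e0; have [N NP] := h e e0; exists N.
Qed.

Section right_continuity.
Context {R : realType}.
Local Notation time := {nonneg R}.

Definition right_continuous (v : time -> R) :=
  forall t : time, v `|s|%:nng @[s --> t%:num^'+] --> v t.

Lemma right_continuous_dyadic v (t : time) : right_continuous v ->
  v (dyadic n (slot n t).+1) @[n --> \oo] --> v t.
Proof.
move=> rv; apply/cvgrPdist_le => e e0.
move/cvgrPdist_le: (rv t) => /(_ _ e0) h.
have {h} /(near_right_time t (fun r => `|v t - v r| <= e))[dlt d0 H] := h.
have [z zE] : exists z : time, z%:num = t%:num + dlt.
  by exists `|t%:num + dlt|%:nng; rewrite /= ger0_norm// addr_ge0// ltW.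
have tz : t < z by rewrite -num_lt zE ltrDl.
apply: filterS (dyadic_slotS_near tz) => n nz.
by apply: H; [exact: dyadic_slotS|rewrite -zE num_lt].
Qed.

(** Dyadic times are dense. *)
Lemma right_continuous_eq (u v : time -> R) : right_continuous u -> right_continuous v ->
  (forall n j, u (dyadic n j) = v (dyadic n j)) -> forall t, u t = v t.
Proof.
move=> ru rv uv t; have h := right_continuous_dyadic (t := t) ru.
have := right_continuous_dyadic (t := t) rv.
under eq_cvg do rewrite -uv.
by move=> /(cvg_unique _ h); apply.
Qed.

Lemma right_continuousB u v : right_continuous u -> right_continuous v ->
  right_continuous (fun t => u t - v t).
Proof. by move=> ru rv t; apply: cvgB; [exact: ru|exact: rv]. Qed.

Lemma right_continuousD u v : right_continuous u -> right_continuous v ->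
  right_continuous (fun t => u t + v t).
Proof. by move=> ru rv t; apply: cvgD; [exact: ru|exact: rv]. Qed.

Lemma right_continuousZ (k : R) u : right_continuous u ->
  right_continuous (fun t => k * u t).
Proof. by move=> ru t; apply: cvgM; [exact: cvg_cst|exact: ru]. Qed.

Lemma right_continuous_cst (k : R) : right_continuous (fun=> k).
Proof. by move=> t; exact: cvg_cst. Qed.

Lemma right_continuous_sum n (u : 'I_n -> time -> R) : (forall i, right_continuous (u i)) ->
  right_continuous (fun t => \sum_i u i t).
Proof.
elim: n u => [|n IH] u ru; first by under eq_fun do rewrite big_ord0; exact: right_continuous_cst.
under eq_fun do rewrite big_ord_recr/=.
by apply: right_continuousD => //; apply: IH.
Qed.

Lemma right_continuous_min (c : time) u : right_continuous u ->
  right_continuous (fun t => u (Num.min c t)).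
Proof.
move=> ru t; have [ct|tc] := leP c t.
  apply: cvg_near_cst; apply/(near_right_time t (fun r => u (Num.min c r) = u c)).
  by exists 1 => // s ts _; rewrite min_l// (le_trans ct)// ltW.
apply: cvg_trans (ru t); apply: near_eq_cvg.
apply/(near_right_time t (fun r => u r = u (Num.min c r))).
exists (c%:num - t%:num); first by rewrite subr_gt0 num_lt.
by move=> s ts; rewrite addrC subrK num_lt => /ltW sc; rewrite min_r.
Qed.

Lemma cadlagB (u v : time -> R) : cadlag u -> cadlag v -> cadlag (fun t => u t - v t).
Proof.
move=> [ru lu] [rv lv]; split; first exact: right_continuousB.
by move=> t t0; apply: is_cvgB; [exact: lu|exact: lv].
Qed.

Lemma cadlagD (u v : time -> R) : cadlag u -> cadlag v -> cadlag (fun t => u t + v t).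
Proof.
move=> [ru lu] [rv lv]; split; first exact: right_continuousD.
by move=> t t0; apply: is_cvgD; [exact: lu|exact: lv].
Qed.

End right_continuity.

Section complex_integral.
Context d (T : measurableType d) (R : realType) (P : probability T R).
Variable F : {nonneg R} -> set (set T).
Hypothesis hF : usual_conditions P F.
Variable p : R.
Hypothesis hp : 1 <= p.
Local Notation time := {nonneg R}.

Definition re_part (Y : time -> T -> R[i]) : time * T -> R := fun rw => Re (Y rw.1 rw.2).
Definition im_part (Y : time -> T -> R[i]) : time * T -> R := fun rw => Im (Y rw.1 rw.2).

(** Restricting a predictable process to the times up to [t] keeps it
    predictable. *)
Lemma local_lpred (f : time * T -> R) : rmeas (predictable_sets F) f ->
  (forall t, exists M : R, forall r w, r <= t -> `|f (r, w)| <= M) -> loc_bounded_predictable F f.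
Proof.
move=> mf bf t; split.
  have [m1 _] := bpred_upto hF t (bpred1 F).
  rewrite (_ : upto t f = fun rw => f rw * upto t (fun=> 1) rw).
    exact: measurable_funM.
  by apply/funext => rw; rewrite /upto mul1r.
have [M MP] := bf t; exists (Num.max M 0) => -[r w]; rewrite /upto.
have [rt|tr] := leP r t; last by rewrite /= mulr0 normr0 le_max lexx orbT.
by rewrite /= mulr1 le_max MP.
Qed.

Lemma Pbct_lpred (Y : process T R) : Pbct F Y -> loc_bounded_predictable F (re_part Y) /\ loc_bounded_predictable F (im_part Y).
Proof.
move=> [/(@measurable_wrtP R _) [mr mi] bY]; split; apply: local_lpred => // t;
  have [M MP] := bY t; exists M => r w rt; apply: le_trans (MP r w rt).
  exact: Re_le_normc.
exact: Im_le_normc.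
Qed.

Lemma sup_norm_leD (u v : time -> T -> R) (t : time) (a b : R) :
  sup_norm_le P p u t a -> sup_norm_le P p v t b ->
  sup_norm_le P p (fun s w => u s w + v s w) t (a + b).
Proof.
move=> [S [mS Sa Su]] [S' [mS' Sb Sv]]; exists (fun w => S w + S' w); split.
- exact: measurable_funD.
- exact: (pnormD_le hp mS mS').
- apply: filterS2 Su Sv => w h h' s st; rewrite (le_trans (ler_normD _ _))// lerD//;
    [exact: h|exact: h'].
Qed.

Lemma sup_norm_leB (u v : time -> T -> R) (t : time) (a b : R) :
  sup_norm_le P p u t a -> sup_norm_le P p v t b ->
  sup_norm_le P p (fun s w => u s w - v s w) t (a + b).
Proof.
move=> hu [S [mS Sb Sv]]; apply: sup_norm_leD => //; exists S; split => //.
by apply: filterS Sv => w h s st; rewrite normrN; exact: h.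
Qed.

(** Real steps as combinations of half-lines. Any index type is allowed for
    the cells, so that the same statement serves real and imaginary parts. *)
Lemma lpred_steps (J : Type) (r : seq J) (A0 : T -> R) (A : J -> T -> R) (s t : J -> time) :
  (rmeas (F 0%:nng) A0 /\ exists M : R, forall w, `|A0 w| <= M) ->
  (forall j, s j < t j /\ rmeas (F (s j)) (A j) /\ exists M : R, forall w, `|A j w| <= M) ->
  loc_bounded_predictable F (fun rw => at0 A0 rw + \sum_(j <- r) A j rw.2 * (s j < rw.1 <= t j)%R%:R) /\
  forall U I, is_regular_integral P F p U I -> forall x, {ae P, forall w,
    I (fun rw => at0 A0 rw + \sum_(j <- r) A j rw.2 * (s j < rw.1 <= t j)%R%:R) x w =
    \sum_(j <- r) A j w * (U (Num.min (t j) x) w - U (Num.min (s j) x) w)}.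
Proof.
move=> [mA0 [M0 A0M]] hA; elim: r => [|j r [lY IH]].
  set Y := fun _ => _; have -> : Y = at0 A0.
    by apply/funext => rw; rewrite /Y big_nil addr0.
  split; first by apply: (bpred_lpred hF); exact: (bpred_at0 hF mA0 A0M).
  by move=> U I HI x; apply: filterS (ri_at0 HI x mA0 A0M) => w ->; rewrite big_nil.
set Y' := fun _ => _ in lY IH; set Y := fun _ => _.
have [sjt [mA [M AM]]] := hA j.
have mA' := rmeasF_le hF (ltW sjt) mA.
have l1 := bpred_lpred hF (bpred_after hF mA AM).
have l2 := bpred_lpred hF (bpred_after hF mA' AM).
have -> : Y = fun rw => (Y' rw + 1 * after (s j) (A j) rw) + -1 * after (t j) (A j) rw.
  apply/funext => -[y w]; rewrite /Y /Y' big_cons /after/= mul1r mulN1r.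
  have [ty|yt] := ltP (t j) y.
    by rewrite andbF mulr0 add0r (lt_trans sjt ty) mulr1 addrK.
  by rewrite andbT mulr0 subr0 addrA [LHS]addrAC.
have l3 := lpred_lin 1 lY l1; split; first exact: lpred_lin.
move=> U I HI x; apply: filterS3 (ae_and (ri_lin HI (-1) x l3 l2) (ri_lin HI 1 x lY l1))
  (IH U I HI x) (ae_and (ri_step HI x mA AM) (ri_step HI x mA' AM)).
move=> w [-> ->] -> [-> ->]; rewrite big_cons mul1r mulN1r; ring.
Qed.

Lemma step_funE (e : step_data R (T -> R[i])) r w : step_fun e r w =
  (if r == 0%:nng then ef0 e w else 0) + \sum_i ef i w * (es i < r <= et (s := e) i)%R%:R.
Proof.
rewrite /step_fun; have -> : forall (f g : T -> R[i]), (f + g) w = f w + g w by [].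
congr (_ + _); first by case: ifP.
rewrite fct_sumE (big_mkcond (fun i => _ < _ <= _)); apply: eq_bigr => i _.
by case: ifP; rewrite ?mulr1 ?mulr0.
Qed.

End complex_integral.

(** * Complex integrals from two real integrators *)

Section complex_integrator.
Context d (T : measurableType d) (R : realType) (P : probability T R).
Variable F : {nonneg R} -> set (set T).
Hypothesis hF : usual_conditions P F.
Variable p : R.
Hypothesis hp : 1 <= p.
Local Notation time := {nonneg R}.

Lemma measurable_mfun (f : {mfun T >-> R[i]}) :
  measurable_fun setT (fun w => Re (f w)) /\ measurable_fun setT (fun w => Im (f w)).
Proof. by apply/(@measurable_ReIm R _ T f); exact: measurable_funPT. Qed.

Lemma process_of (Z : time -> T -> R[i]) :
  (forall t, measurable_fun setT (fun w => Re (Z t w)) /\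
     measurable_fun setT (fun w => Im (Z t w))) ->
  exists Y : process T R, forall t w, Y t w = Z t w.
Proof.
move=> mZ; have mZ' t : measurable_fun setT (Z t) by apply/measurable_ReIm; exact: mZ.
by exists (fun t => mfun_Sub (mem_set (mZ' t))).
Qed.

Lemma indistinguishable_right_continuous (Y Z : time -> T -> R[i]) :
  (forall w, right_continuous (fun t => Re (Y t w)) /\ right_continuous (fun t => Im (Y t w))) ->
  (forall w, right_continuous (fun t => Re (Z t w)) /\ right_continuous (fun t => Im (Z t w))) ->
  (forall t, {ae P, forall w, Y t w = Z t w}) -> indistinguishable P Y Z.
Proof.
move=> rY rZ YZ.
have := ae_foralln (fun n => ae_foralln (fun j => YZ (dyadic n j))).
apply: filterS => w h t; have [rYr rYi] := rY w; have [rZr rZi] := rZ w.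
apply: complex_eq.
  by apply: (right_continuous_eq rYr rZr) => n j; rewrite h.
by apply: (right_continuous_eq rYi rZi) => n j; rewrite h.
Qed.

Lemma rcll_right_continuous (f : time -> R[i]) : rcll f ->
  right_continuous (fun t => Re (f t)) /\ right_continuous (fun t => Im (f t)).
Proof. by move=> /rcllP[[h _] [h' _]]. Qed.

Lemma step_integral_right_continuous (X : process T R) (e : step_data R (T -> R[i])) w :
  rcll (X ^~ w) ->
  right_continuous (fun t => Re (classical_step_integral X e t w)) /\
  right_continuous (fun t => Im (classical_step_integral X e t w)).
Proof.
move=> /rcll_right_continuous[hr hi]; split.
  under eq_fun do rewrite Re_sum; apply: right_continuous_sum => i.
  under eq_fun do rewrite ReM; apply: right_continuousB; apply: right_continuousZ.
    under eq_fun do rewrite ReB.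
    by apply: right_continuousB; [exact: right_continuous_min hr|exact: right_continuous_min hr].
  under eq_fun do rewrite ImB.
  by apply: right_continuousB; [exact: right_continuous_min hi|exact: right_continuous_min hi].
under eq_fun do rewrite Im_sum; apply: right_continuous_sum => i.
under eq_fun do rewrite ImM; apply: right_continuousD; apply: right_continuousZ.
  under eq_fun do rewrite ImB.
  by apply: right_continuousB; [exact: right_continuous_min hi|exact: right_continuous_min hi].
under eq_fun do rewrite ReB.
by apply: right_continuousB; [exact: right_continuous_min hr|exact: right_continuous_min hr].
Qed.

Lemma bounded_rv_parts t (f : T -> R[i]) : bounded_rv F t f ->
  (rmeas (F t) (fun w => Re (f w)) /\ exists M : R, forall w, `|Re (f w)| <= M) /\
  (rmeas (F t) (fun w => Im (f w)) /\ exists M : R, forall w, `|Im (f w)| <= M).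
Proof.
move=> [/(@measurable_wrtP R T)[mr mi] [M fM]]; split; split => //; exists M => w;
  apply: le_trans (fM w); [exact: Re_le_normc|exact: Im_le_normc].
Qed.

Lemma step_parts (Y : process T R) (e : step_data R (T -> R[i])) :
  (forall t w, Y t w = step_fun e t w) ->
  re_part Y = (fun rw => at0 (fun w => Re (ef0 e w)) rw +
    \sum_i Re (ef i rw.2) * (es i < rw.1 <= et (s := e) i)%R%:R) /\
  im_part Y = (fun rw => at0 (fun w => Im (ef0 e w)) rw +
    \sum_i Im (ef i rw.2) * (es i < rw.1 <= et (s := e) i)%R%:R).
Proof.
move=> YE; split; apply/funext => -[r w]; rewrite /re_part /im_part /= YE step_funE /at0/=.
  rewrite ReD Re_sum; congr (_ + _); first by case: ifP; rewrite ?mulr1 ?mulr0.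
  by apply: eq_bigr => i _; rewrite ReM; case: (_ && _); rewrite /= ?mulr0 ?subr0 ?mulr1.
rewrite ImD Im_sum; congr (_ + _); first by case: ifP; rewrite ?mulr1 ?mulr0.
by apply: eq_bigr => i _; rewrite ImM; case: (_ && _); rewrite /= ?mulr0 ?add0r ?mulr1.
Qed.

Lemma lpred_rmeas (f : time * T -> R) : loc_bounded_predictable F f -> rmeas (predictable_sets F) f.
Proof.
move=> lf; apply: (@measurable_fun_cvg _ (g_sigma_algebraType (predictable_sets F)) R setT
  (fun n => upto `|n%:R|%:nng f)) => [n|].
  by case: (lf `|n%:R|%:nng).
move=> -[r w] _; apply: cvg_near_cst; exists (Num.truncn r%:num).+1 => // n /= rn.
rewrite /upto/= (_ : (r <= _) = true) ?mulr1//.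
by rewrite -num_le/= ger0_norm// (le_trans (ltW (truncnS_gt _)))// ler_nat.
Qed.

Lemma lpred_Pbct (Y : process T R) : loc_bounded_predictable F (re_part Y) -> loc_bounded_predictable F (im_part Y) -> Pbct F Y.
Proof.
move=> lr li; split.
  by apply/(@measurable_wrtP R _); split; exact: lpred_rmeas.
move=> t; have [_ [M MP]] := lr t; have [_ [N NP]] := li t; exists (M + N) => s w st.
apply: le_trans (normc_le_ReIm _) _; apply: lerD.
  by have := MP (s, w); rewrite /upto/= st mulr1.
by have := NP (s, w); rewrite /upto/= st mulr1.
Qed.

(** The integral of [Y] against [X] has real part [I (Re Y) - K (Im Y)] and
    imaginary part [I (Im Y) + K (Re Y)], where [I] and [K] are regular
    integrals against [U] and [V]. *)
Theorem complex_integrator (X0 : {mfun T >-> R[i]}) (U V : time -> T -> R) :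
  integrator P F p U -> integrator P F p V ->
  exists X : process T R,
    (forall t, {ae P, forall w, X t w = X0 w + (U t w +i* V t w)%C}) /\
    classical_integrator P F p%:E X.
Proof.
move=> HU HV.
have [I HI] := regular_integral_exists hF hp HU.
have [K HK] := regular_integral_exists hF hp HV.
pose cplx (Y : process T R) t w : R[i] :=
  ((I (re_part Y) t w - K (im_part Y) t w) +i* (I (im_part Y) t w + K (re_part Y) t w))%C.
have aI Y t : loc_bounded_predictable F Y -> measurable_fun setT (I Y t).
  by move=> lY; apply: (rmeasF_measurable hF (t := t)); exact: (ri_adapted HI).
have aK Y t : loc_bounded_predictable F Y -> measurable_fun setT (K Y t).
  by move=> lY; apply: (rmeasF_measurable hF (t := t)); exact: (ri_adapted HK).
have /choice[Ic IcE] : forall Y : process T R, exists Z : process T R,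
    Pbct F Y -> forall t w, Z t w = cplx Y t w.
  move=> Y; have [bY|nY] := pselect (Pbct F Y); last by exists Y.
  have [lr li] := Pbct_lpred hF bY.
  have [|Z ZE] := @process_of (cplx Y); last by exists Z.
  move=> t; split.
    by apply: measurable_funB; [exact: aI|exact: aK].
  by apply: measurable_funD; [exact: aI|exact: aK].
have rI Y w : cadlag (I Y ^~ w) by exact: (ri_cadlag HI).
have rK Y w : cadlag (K Y ^~ w) by exact: (ri_cadlag HK).
have rcplx Y w : rcll (cplx Y ^~ w).
  by apply/rcllP; split => /=; [exact: cadlagB|exact: cadlagD].
have [z zE] : exists z : time, z = 0%:nng by exists 0%:nng.
have N1 (w : T) : `|1 : R| <= 1 by rewrite normr1.
have m1 : rmeas (F z) (fun=> 1 : R) by exact: measurable_cst.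
have l1 : loc_bounded_predictable F (after z (fun=> 1)).
  by apply: (bpred_lpred hF); exact: (bpred_after hF m1 N1).
have [m0r m0i] := measurable_mfun X0.
(* The process itself is recovered as the integral of the indicator of ]0, oo[
   and so has regular paths. *)
pose Xc t w := X0 w + (I (after z (fun=> 1)) t w +i* K (after z (fun=> 1)) t w)%C.
have [|X XE] := @process_of Xc.
  move=> t; split.
    by under eq_fun do rewrite ReD /=; apply: measurable_funD => //; exact: aI.
  by under eq_fun do rewrite ImD /=; apply: measurable_funD => //; exact: aK.
have zmin t : Num.min z t = z by rewrite min_l// zE -num_le/=.
have XU t : {ae P, forall w, X t w = X0 w + (U t w +i* V t w)%C}.
  apply: filterS3 (ae_and (ri_step HI t m1 N1) (ri_step HK t m1 N1)) (int_zero HU) (int_zero HV).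
  move=> w [h h'] u0 v0; rewrite XE /Xc h h' !zmin !mul1r zE u0 v0 !subr0.
  by [].
have rX w : rcll (X ^~ w).
  under eq_fun do rewrite XE; apply/rcllP; split.
    under eq_fun do rewrite ReD /=; apply: cadlagD; [exact: cadlag_cst|exact: rI].
  under eq_fun do rewrite ImD /=; apply: cadlagD; [exact: cadlag_cst|exact: rK].
exists X; split => //; exists Ic; split.
- move=> Y bY; have [lr li] := Pbct_lpred hF bY.
  have E t : Ic Y t = cplx Y t :> (T -> R[i]) by apply/funext => w; exact: IcE.
  split.
  + move=> t; apply/(@measurable_wrtP R T); rewrite E; split.
      by apply: measurable_funB; [exact: (ri_adapted HI)|exact: (ri_adapted HK)].
    by apply: measurable_funD; [exact: (ri_adapted HI)|exact: (ri_adapted HK)].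
  + by move=> w; under eq_fun do rewrite IcE//; exact: rcplx.
  + move=> t; have [C1 _ s1] := ri_sup HI t lr; have [C2 _ s2] := ri_sup HI t li.
    have [C3 _ s3] := ri_sup HK t lr; have [C4 _ s4] := ri_sup HK t li.
    apply: (@le_lt_trans _ _ ((C1 + C4) + (C2 + C3))%:E); last exact: ltry.
    have -> : running_sup (Ic Y) t = running_sup (cplx Y) t.
      by apply/funext => w; congr ereal_sup; apply: eq_imagel => s _; rewrite IcE.
    apply: (Lnorm_running_sup hp) => //.
    * move=> s; split.
        by apply: measurable_funB; [exact: aI|exact: aK].
      by apply: measurable_funD; [exact: aI|exact: aK].
    * exact: sup_norm_leB.
    * exact: sup_norm_leD.
- move=> Y e [A0 Ae] YE.
  have [A0r A0i] := bounded_rv_parts A0.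
  have Aer i : es i < et (s := e) i /\ rmeas (F (es i)) (fun w => Re (ef i w)) /\
      exists M : R, forall w, `|Re (ef i w)| <= M.
    by have [st /bounded_rv_parts[]] := Ae i.
  have Aei i : es i < et (s := e) i /\ rmeas (F (es i)) (fun w => Im (ef i w)) /\
      exists M : R, forall w, `|Im (ef i w)| <= M.
    by have [st /bounded_rv_parts[]] := Ae i.
  have [ER EI] := step_parts YE.
  have [lr SR] := lpred_steps (P := P) hF p (index_enum _) A0r Aer.
  have [li SI] := lpred_steps (P := P) hF p (index_enum _) A0i Aei.
  have IR := SR _ _ HI; have II := SI _ _ HI.
  have KR := SR _ _ HK; have KI := SI _ _ HK.
  rewrite -ER in lr IR KR; rewrite -EI in li II KI.
  have bY : Pbct F Y by exact: lpred_Pbct.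
  apply: indistinguishable_right_continuous.
  + by move=> w; apply: rcll_right_continuous; under eq_fun do rewrite IcE//; exact: rcplx.
  + by move=> w; exact: step_integral_right_continuous.
  move=> t.
  have XUt : {ae P, forall w, forall i : 'I_(esize e), X (Num.min (et i) t) w = X0 w +
      (U (Num.min (et i) t) w +i* V (Num.min (et i) t) w)%C}.
    by apply: filter_forall => i; exact: XU.
  have XUs : {ae P, forall w, forall i : 'I_(esize e), X (Num.min (es i) t) w = X0 w +
      (U (Num.min (es i) t) w +i* V (Num.min (es i) t) w)%C}.
    by apply: filter_forall => i; exact: XU.
  apply: filterS3 (ae_and (IR t) (II t)) (ae_and (KR t) (KI t)) (ae_and XUt XUs).
  move=> w [hIR hII] [hKR hKI] [hXt hXs]; rewrite IcE// /cplx hIR hII hKR hKI.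
  apply: complex_eq => /=.
    rewrite /classical_step_integral Re_sum -sumrB; apply: eq_bigr => i _.
    by rewrite hXt hXs ReM ReB ImB !ReD !ImD /=; ring.
  rewrite /classical_step_integral Im_sum -big_split; apply: eq_bigr => i _ /=.
  by rewrite hXt hXs ImM ReB ImB !ReD !ImD /=; ring.
- move=> Yn Y bYn bY [YnY Ynb] t.
  have [lr li] := Pbct_lpred hF bY.
  have lrn n := (Pbct_lpred hF (bYn n)).1; have lin n := (Pbct_lpred hF (bYn n)).2.
  have br s : exists M : R, forall n (rw : time * T), rw.1 <= s -> `|re_part (Yn n) rw| <= M.
    have [M MP] := Ynb s; exists M => n [r w] /= rs.
    by apply: le_trans (MP n r w rs); exact: Re_le_normc.
  have bi s : exists M : R, forall n (rw : time * T), rw.1 <= s -> `|im_part (Yn n) rw| <= M.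
    have [M MP] := Ynb s; exists M => n [r w] /= rs.
    by apply: le_trans (MP n r w rs); exact: Im_le_normc.
  have cr rw : re_part (Yn n) rw @[n --> \oo] --> re_part Y rw.
    by have /cvg_ReIm[] := YnY rw.1 rw.2.
  have ci rw : im_part (Yn n) rw @[n --> \oo] --> im_part Y rw.
    by have /cvg_ReIm[] := YnY rw.1 rw.2.
  apply/cvge0P; first by move=> n; exact: Lnorm_ge0.
  move=> e e0; have e4 : 0 < e / 4 by rewrite divr_gt0.
  have [N1' h1] := ri_dct HI lrn lr br cr t e4.
  have [N2 h2] := ri_dct HI lin li bi ci t e4.
  have [N3 h3] := ri_dct HK lrn lr br cr t e4.
  have [N4 h4] := ri_dct HK lin li bi ci t e4.
  exists (maxn (maxn N1' N2) (maxn N3 N4)) => n; rewrite !geq_max => /andP[/andP[n1 n2] /andP[n3 n4]].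
  have -> : running_sup (fun s w => Ic (Yn n) s w - Ic Y s w) t =
      running_sup (fun s w => cplx (Yn n) s w - cplx Y s w) t.
    by apply/funext => w; congr ereal_sup; apply: eq_imagel => s _; rewrite !IcE.
  have -> : e = (e / 4 + e / 4) + (e / 4 + e / 4) by field.
  apply: (Lnorm_running_sup hp).
  + move=> w; apply/rcllP; split.
      under eq_fun do rewrite ReB /=; apply: cadlagB; exact: cadlagB.
    under eq_fun do rewrite ImB /=; apply: cadlagB; exact: cadlagD.
  + move=> s; split.
      under eq_fun do rewrite ReB /=.
      by apply: measurable_funB; apply: measurable_funB; (exact: aI || exact: aK).
    under eq_fun do rewrite ImB /=.
    by apply: measurable_funB; apply: measurable_funD; (exact: aI || exact: aK).
  + rewrite (_ : (fun s w => Re (cplx (Yn n) s w - cplx Y s w)) = (fun s w =>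
      (I (re_part (Yn n)) s w - I (re_part Y) s w) -
      (K (im_part (Yn n)) s w - K (im_part Y) s w))).
      exact: (sup_norm_leB hp (h1 n n1) (h4 n n4)).
    by apply/funext => s; apply/funext => w; rewrite ReB /=; ring.
  + rewrite (_ : (fun s w => Im (cplx (Yn n) s w - cplx Y s w)) = (fun s w =>
      (I (im_part (Yn n)) s w - I (im_part Y) s w) +
      (K (re_part (Yn n)) s w - K (re_part Y) s w))).
      exact: (sup_norm_leD hp (h2 n n2) (h3 n n3)).
    by apply/funext => s; apply/funext => w; rewrite ImB /=; ring.
Qed.

End complex_integrator.

(** * Classes of random variables and operator norms *)

Section random_variable_classes.
Context d (T : measurableType d) (R : realType) (P : probability T R).
Local Notation L0 := (L0 P).
Implicit Types x y : L0.

Lemma measurable_normc_repr x : measurable_fun setT (fun w => normc (repr x w)).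
Proof.
have /(@measurable_ReIm R _ T)[mr mi] := @measurable_funPT _ _ _ _ (repr x).
exact: measurable_normc.
Qed.

Lemma repr_add x y : {ae P, forall w, repr (x + y) w = repr x w + repr y w}.
Proof. exact: (L0_repr_class P (rv_add (repr x) (repr y))). Qed.

Lemma repr_opp x : {ae P, forall w, repr (- x) w = - repr x w}.
Proof. exact: (L0_repr_class P (rv_opp (repr x))). Qed.

Lemma repr_sub x y : {ae P, forall w, repr (x - y) w = repr x w - repr y w}.
Proof. by apply: filterS2 (repr_add x (- y)) (repr_opp y) => w -> ->. Qed.

Lemma repr_zero : {ae P, forall w, repr (0 : L0) w = 0}.
Proof. exact: (L0_repr_class P (cst 0)). Qed.

Lemma repr_mul y x : {ae P, forall w, repr (mult_op y x) w = repr y w * repr x w}.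
Proof. exact: (L0_repr_class P (rv_mul (repr y) (repr x))). Qed.

Lemma repr_sum (I : Type) (r : seq I) (Q : pred I) (f : I -> L0) :
  {ae P, forall w, repr (\sum_(i <- r | Q i) f i) w = \sum_(i <- r | Q i) repr (f i) w}.
Proof.
elim: r => [|i r IH].
  by rewrite big_nil; apply: filterS repr_zero => w ->; rewrite big_nil.
rewrite big_cons; case: ifPn => Qi.
  apply: filterS2 (repr_add (f i) (\sum_(j <- r | Q j) f j)) IH => w -> ->.
  by rewrite big_cons Qi.
by apply: filterS IH => w ->; rewrite big_cons (negbTE Qi).
Qed.

Lemma L0_eq x y : {ae P, forall w, repr x w = repr y w} -> x = y.
Proof. by move=> xy; rewrite -(L0_reprK x) -(L0_reprK y); apply/L0_classP. Qed.

Lemma Lpnorm_ge0 q x : (0 <= Lpnorm q x)%E. Proof. exact: Lnorm_ge0. Qed.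

(** For all exponents at once, the infinite one included. *)
Lemma Lpnorm_scale q x y (c : R) : (1 <= q)%E -> 0 <= c ->
  {ae P, forall w, normc (repr x w) <= c * normc (repr y w)} ->
  (Lpnorm q x <= c%:E * Lpnorm q y)%E.
Proof.
move=> q1 c0 xy; have mx := measurable_normc_repr x; have my := measurable_normc_repr y.
have P1 : (0 < P setT)%E by rewrite probability_setT lte01.
case: q q1 => [r r1| _|//].
  have r1' : 1 <= r by rewrite -lee_fin.
  rewrite -[c in leRHS]ger0_norm// /Lpnorm -[Lnorm _ _ _]/(pnorm P r _) -pnormZ//.
  apply: pnorm_mono => //; first exact: measurable_funM.
  by apply: filterS xy => w h; rewrite !ger0_norm ?mulr_ge0 ?normc_ge0.
rewrite /Lpnorm unlock P1 -ess_supZl//; apply: le_ess_sup.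
apply: filterS xy => w h /=; rewrite -EFinM lee_fin !ger0_norm ?mulr_ge0 ?normc_ge0//.
Qed.

Lemma Lpnorm_mono q x y : (1 <= q)%E ->
  {ae P, forall w, normc (repr x w) <= normc (repr y w)} -> (Lpnorm q x <= Lpnorm q y)%E.
Proof.
move=> q1 xy; rewrite -[leRHS]mul1e; apply: Lpnorm_scale => //.
by apply: filterS xy => w; rewrite mul1r.
Qed.

Lemma Lpnorm_opp q x : (1 <= q)%E -> Lpnorm q (- x) = Lpnorm q x.
Proof.
move=> q1; apply/eqP; rewrite eq_le; apply/andP; split; apply: Lpnorm_mono => //;
  by apply: filterS (repr_opp x) => w ->; rewrite normcN.
Qed.

Lemma Lpnorm_const q (f : {mfun T >-> R[i]}) (c : R) : (1 <= q)%E -> 0 <= c ->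
  (forall w, normc (f w) <= c) -> (Lpnorm q (L0_class P f) <= c%:E)%E.
Proof.
move=> q1 c0 fc; have P1 : (0 < P setT)%E by rewrite probability_setT lte01.
have fc' : {ae P, forall w, normc (repr (L0_class P f) w) <= c}.
  by apply: filterS (L0_repr_class P f) => w ->.
have mx := measurable_normc_repr (L0_class P f).
case: q q1 => [r r1| _|//].
  have r1' : 1 <= r by rewrite -lee_fin.
  rewrite /Lpnorm -[Lnorm _ _ _]/(pnorm P r _).
  rewrite -[c]ger0_norm// -(pnorm_cst P r1') //; apply: pnorm_mono => //.
  by apply: filterS fc' => w h; rewrite !ger0_norm ?normc_ge0.
rewrite /Lpnorm unlock P1; apply/ess_supP; apply: filterS fc' => w h /=.
by rewrite lee_fin ger0_norm// normc_ge0.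
Qed.

Lemma Lpnorm_eq0 q x : (1 <= q)%E -> Lpnorm q x = 0%E -> {ae P, forall w, repr x w = 0}.
Proof.
move=> q1 x0; have mx := measurable_normc_repr x.
have q0 : (0 < q)%E by apply: lt_le_trans q1; exact: lte01.
have mx' : measurable_fun setT (EFin \o (fun w => normc (repr x w))).
  exact/measurable_EFinP.
have := Lnorm_eq0_eq0 mx' q0 x0; apply: filterS => w /(_ I) /= [h].
by apply: ComplexField.Normc.eq0_normc.
Qed.

Lemma op_norm_le q (A : operator P) (c : R) : (1 <= q)%E -> 0 <= c ->
  (forall x, {ae P, forall w, normc (repr (A x) w) <= c * normc (repr x w)}) ->
  (op_norm q A <= c%:E)%E.
Proof.
move=> q1 c0 H; apply: ge_ereal_sup => _ [x x1 <-].
apply: le_trans (Lpnorm_scale q1 c0 (H x)) _.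
by rewrite -[leRHS]mule1; apply: lee_wpmul2l; rewrite ?lee_fin.
Qed.

Lemma op_norm_mult_le q y (c : R) : (1 <= q)%E -> 0 <= c ->
  {ae P, forall w, normc (repr y w) <= c} -> (op_norm q (mult_op y) <= c%:E)%E.
Proof.
move=> q1 c0 yc; apply: op_norm_le => // x.
apply: filterS2 (repr_mul y x) yc => w -> h; rewrite normcM ler_wpM2r//; exact: normc_ge0.
Qed.

Lemma random_variable_of (f : T -> R[i]) :
  measurable_fun setT (fun w => Re (f w)) -> measurable_fun setT (fun w => Im (f w)) ->
  exists g : {mfun T >-> R[i]}, forall w, g w = f w.
Proof.
move=> mr mi; have mf : measurable_fun setT f by apply/measurable_ReIm.
by exists (mfun_Sub (mem_set mf)).
Qed.

(** Test the operator on the normalised indicator of the set where the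
    multiplier is at least [c + e]: if this set were not null, the norm would
    be at least [c + e]. *)
Lemma op_norm_mult_bound q y (c : R) : (1 <= q)%E -> 0 <= c ->
  (op_norm q (mult_op y) <= c%:E)%E -> {ae P, forall w, normc (repr y w) <= c}.
Proof.
move=> q1 c0 yc.
suff H n : {ae P, forall w, normc (repr y w) < c + n.+1%:R^-1}.
  apply: filterS (ae_foralln H) => w h; apply/ler_addgt0Pr => e e0.
  apply: (@le_trans _ _ (c + (Num.truncn e^-1).+1%:R^-1)); first exact/ltW/h.
  rewrite lerD2l -[leRHS]invrK lef_pV2 ?posrE ?invr_gt0//.
  exact/ltW/truncnS_gt.
set e : R := n.+1%:R^-1; have e0 : 0 < e by rewrite invr_gt0.
(* The set on which the bound fails by [e], and multiples [ind k] of its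
   indicator. *)
pose A := [set w | c + e <= normc (repr y w)].
have mA : measurable A.
  have := measurable_normc_repr y; move=> /(_ measurableT `[c + e, +oo[%classic).
  rewrite setTI => /(_ (measurable_itv _)); congr measurable.
  by apply/seteqP; split => w /=; rewrite in_itv/= andbT.
have /choice[rv rvE] : forall k : R, exists g : {mfun T >-> R[i]},
    forall w, g w = (k * \1_A w)%:C%C.
  move=> k; apply: random_variable_of => /=; last exact: measurable_cst.
  by apply: measurable_funM; [exact: measurable_cst|exact: measurable_indic].
pose ind k := L0_class P (rv k).
have indE k : {ae P, forall w, repr (ind k) w = (k * \1_A w)%:C%C}.
  by apply: filterS (L0_repr_class P (rv k)) => w ->; exact: rvE.
have nrm (k : R) w : normc (k * \1_A w)%:C%C = `|k| * \1_A w.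
  rewrite normcE /= expr0n/= addr0 sqrtr_sqr normrM indicE.
  by case: (_ \in _); rewrite ?normr1 ?normr0.
have a1 : (Lpnorm q (ind 1%R) <= 1)%E.
  apply: Lpnorm_const => // w; rewrite rvE nrm.
  by rewrite normr1 mul1r indicE; case: (_ \in _).
have a0 := Lpnorm_ge0 q (ind 1%R).
have [aE|aN] := eqVneq (Lpnorm q (ind 1%R)) 0%E.
  apply: filterS2 (Lpnorm_eq0 q1 aE) (indE 1) => w -> /(congr1 (@complex.Re R)) /= h.
  rewrite ltNge; apply/negP => h'; have wA : w \in A by rewrite inE.
  by move/eqP: h; rewrite indicE wA mulr1 eq_sym oner_eq0.
exfalso; have afin : Lpnorm q (ind 1%R) \is a fin_num.
  by rewrite ge0_fin_numE// (le_lt_trans a1)// ltry.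
set a := fine (Lpnorm q (ind 1%R)); have aE : Lpnorm q (ind 1%R) = a%:E by rewrite fineK.
have a_gt0 : 0 < a by rewrite -lte_fin -aE lt0e aN a0.
have n1 : (Lpnorm q (ind a^-1%R) <= 1)%E.
  have h : {ae P, forall w, normc (repr (ind a^-1%R) w) <= a^-1 * normc (repr (ind 1%R) w)}.
    apply: filterS2 (indE a^-1) (indE 1) => w -> ->.
    by rewrite !nrm gtr0_norm ?invr_gt0// normr1 mul1r.
  apply: le_trans (Lpnorm_scale q1 _ h) _; first by rewrite invr_ge0 ltW.
  by rewrite aE -EFinM mulVf ?gt_eqF.
have n2 : (Lpnorm q (mult_op y (ind a^-1%R)) <= c%:E)%E.
  by apply: le_trans yc; apply: ereal_sup_ubound; exists (ind a^-1%R).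
have ce : 0 < c + e by rewrite ltr_wpDl.
have h : {ae P, forall w, normc (repr (ind 1%R) w) <=
    a / (c + e) * normc (repr (mult_op y (ind a^-1%R)) w)}.
  apply: filterS3 (indE 1) (indE a^-1) (repr_mul y (ind a^-1%R)) => w -> h1 ->.
  rewrite h1 normcM !nrm normr1 mul1r (gtr0_norm (x := a^-1)) ?invr_gt0//.
  have [wA|wA] := boolP (w \in A); last by rewrite indicE (negbTE wA) !mulr0.
  have yA : c + e <= normc (repr y w) by move: wA; rewrite inE.
  rewrite indicE wA mulr1.
  have -> : a / (c + e) * (normc (repr y w) * a^-1) = normc (repr y w) / (c + e).
    by field; rewrite !gt_eqF.
  by rewrite ler_pdivlMr// mul1r.
have h2 : 0 <= a / (c + e) by rewrite divr_ge0// ltW.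
have := Lpnorm_scale q1 h2 h; rewrite aE => h3.
have : (a%:E <= (a / (c + e))%:E * c%:E)%E.
  by apply: le_trans h3 _; apply: lee_wpmul2l; rewrite ?lee_fin.
rewrite -EFinM lee_fin mulrAC ler_pdivlMr// ler_pM2l// gerDl.
by rewrite leNgt e0.
Qed.

End random_variable_classes.

(** * From noncommutative to classical integrators *)

Section parts.
Context {R : realType}.
Variable pr : R[i] -> R.
Hypothesis hpr : pr = @complex.Re R \/ pr = @complex.Im R.

Lemma part_sub z1 z2 : pr (z1 - z2) = pr z1 - pr z2.
Proof. by case: hpr => ->; [exact: ReB|exact: ImB]. Qed.

Lemma part_scale (k : R) z : pr (k%:C%C * z) = k * pr z.
Proof. by case: hpr => ->; rewrite ?ReM ?ImM /= mul0r ?subr0 ?addr0. Qed.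

Lemma part_sum (I : Type) (r : seq I) (Q : pred I) (f : I -> R[i]) :
  pr (\sum_(i <- r | Q i) f i) = \sum_(i <- r | Q i) pr (f i).
Proof. by case: hpr => ->; [exact: Re_sum|exact: Im_sum]. Qed.

Lemma part_le z : `|pr z| <= normc z.
Proof. by case: hpr => ->; [exact: Re_le_normc|exact: Im_le_normc]. Qed.

Lemma measurable_part d (T : measurableType d) (f : {mfun T >-> R[i]}) :
  measurable_fun setT (fun w => pr (f w)).
Proof. by have [] := measurable_mfun f; case: hpr => ->. Qed.

Lemma rmeas_part (U : pointedType) (G : set (set U)) (f : U -> R[i]) :
  measurable_wrt G f -> rmeas G (fun w => pr (f w)).
Proof. by move=> /(@measurable_wrtP R U)[]; case: hpr => ->. Qed.

End parts.

Section nc_integrator_bounds.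
Context d (T : measurableType d) (R : realType) (P : probability T R).
Variable F : {nonneg R} -> set (set T).
Hypothesis hF : usual_conditions P F.
Variables (p : R) (q : \bar R).
Hypotheses (hp : 1 <= p) (hq : (1 <= q)%E).
Local Notation time := {nonneg R}.
Local Notation L0 := (L0 P).

Lemma bounded_rv_class t (f : T -> R[i]) : bounded_rv F t f ->
  exists2 y : L0, Lp_at F +oo%E t y & {ae P, forall w, repr y w = f w}.
Proof.
move=> [mf [M fM]]; have := mf => /(@measurable_wrtP R T)[mr mi].
have [g gE] := random_variable_of (rmeasF_measurable hF mr) (rmeasF_measurable hF mi).
exists (L0_class P g); last by apply: filterS (L0_repr_class P g) => w ->; exact: gE.
split; last first.
  by exists g => //; rewrite (_ : (g : T -> R[i]) = f)//; apply/funext.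
have M0 : 0 <= M by exact: le_trans (normc_ge0 _) (fM point).
rewrite /Lp/=; apply: (@le_lt_trans _ _ M%:E); last exact: ltry.
by apply: Lpnorm_const => //; [exact: leey|move=> w; rewrite gE].
Qed.

Lemma op_norm_ge0 (A : operator P) : (0 <= op_norm q A)%E.
Proof.
apply: (@le_trans _ _ (Lpnorm q (A 0))); first exact: Lpnorm_ge0.
apply: ereal_sup_ubound; exists 0 => //=.
apply: (@Lpnorm_const _ _ _ _ q (cst 0)) => // w.
by rewrite normc0.
Qed.

Lemma step_op_at (e : step_data R (operator P)) (s : time) (x : L0) :
  (step_fun e s : operator P) x = (if s == 0%:nng then ef0 e x else 0) +
    \sum_(i | es i < s <= et (s := e) i) (ef i : operator P) x.
Proof.
rewrite /step_fun; have -> : forall (f g : operator P), (f + g) x = f x + g x by [].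
congr (_ + _); first by case: ifP.
by rewrite fct_sumE.
Qed.

Lemma mult_op0 (x : L0) : {ae P, forall w, repr (mult_op (0 : L0) x) w = 0}.
Proof. by apply: filterS2 (repr_mul 0 x) (repr_zero P) => w -> ->; rewrite mul0r. Qed.

(** The cells of a grid are disjoint. *)
Lemma sum_cells_le1 n (u : nat -> time) (s : time) : (forall j, u j <= u j.+1) ->
  \sum_(i < n) (u i < s <= u i.+1)%R%:R <= 1 :> R.
Proof.
move=> und; have -> : \sum_(i < n) (u i < s <= u i.+1)%R%:R =
    (u 0%N < s)%R%:R - (u n < s)%R%:R :> R; last first.
  by case: (_ < s); case: (_ < s); rewrite /=; lra.
elim: n => [|n IH]; first by rewrite big_ord0 subrr.
rewrite big_ord_recr/= IH.
have [us|su] := ltP (u n) s; last first.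
  by rewrite (le_gtF (le_trans su (und n))) /= subr0 addr0.
by rewrite leNgt; case: (u n.+1 < s); rewrite /=; ring.
Qed.

(** Elementary transforms of [X] are noncommutative integrals. The integrand
    has norm at most [M], since the cells are disjoint. *)
Lemma grid_step (X : process T R) n (u : nat -> time) (c : nat -> T -> R) (M : R) :
  (forall j, u j <= u j.+1) -> (forall j, rmeas (F (u j)) (c j)) ->
  (forall j w, `|c j w| <= M) ->
  exists e : step_data R (operator P), [/\ step_admissible (mult_alg F) e,
    forall s x, {ae P, forall w, normc (repr ((step_fun e s : operator P) x) w) <= M * normc (repr x w)} &
    forall t, {ae P, forall w, repr (nc_step_integral (Lp_path P X) e t) w =
      \sum_(i < n) (c i w)%:C%C * (X (Num.min (u i.+1) t) w - X (Num.min (u i) t) w)} ].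
Proof.
move=> und mc cM; have M0 : 0 <= M by exact: le_trans (normr_ge0 _) (cM 0%N point).
(* Step intervals must not be degenerate. Where the grid stands still the cell
   is replaced by a longer one that carries the coefficient 0. *)
pose c' j w : R := (u j < u j.+1)%R%:R * c j w.
have /choice[y yP] : forall j, exists y : L0, Lp_at F +oo%E (u j) y /\
    {ae P, forall w, repr y w = (c' j w)%:C%C}.
  move=> j; have [|y y1 y2] := @bounded_rv_class (u j) (fun w => (c' j w)%:C%C); last by exists y.
  split.
    apply/(@measurable_wrtP R T); split => /=; last exact: measurable_cst.
    by apply: measurable_funM; [exact: measurable_cst|exact: mc].
  exists M => w; rewrite normcE /= expr0n/= addr0 sqrtr_sqr normrM.
  by case: (_ < _); rewrite ?normr1 ?normr0 ?mul1r ?mul0r.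
have [nxt nxtE] : exists nxt : time -> time, forall s, s < nxt s.
  by exists (fun s => `|s%:num + 1|%:nng) => s; rewrite -num_lt/= ger0_norm ?addr_ge0// ltrDl.
pose e : step_data R (operator P) := @StepData R (operator P) n (mult_op (0 : L0)) (fun i => u i)
  (fun i => if u i < u i.+1 then u i.+1 else nxt (u i)) (fun i => mult_op (y i)).
exists e; split.
- split.
    have [|y0 h1 h2] := @bounded_rv_class (0%:nng : time) (fun=> 0).
      split; last by exists 0 => w; rewrite normc0.
      by apply/(@measurable_wrtP R T); split; exact: measurable_cst.
    exists y0 => //; congr mult_op; apply: L0_eq.
    by apply: filterS2 h2 (repr_zero P) => w -> ->.
  move=> i /=; split; last by exists (y i) => //; have [] := yP i.
  by case: ifP.
- move=> s x; rewrite step_op_at /=.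
  set S := \sum_(i | _) _.
  have h0 : {ae P, forall w, repr (if s == 0%:nng then mult_op 0 x else 0) w = 0}.
    by case: ifP => _; [exact: mult_op0|exact: repr_zero].
  have h1 : {ae P, forall w, forall i : 'I_n, repr (mult_op (y i) x) w = (c' i w)%:C%C * repr x w}.
    apply: filter_forall => i; have [_ yi] := yP i.
    by apply: filterS2 (repr_mul (y i) x) yi => w -> ->.
  apply: filterS3 (ae_and h0 h1) (repr_add (if s == 0%:nng then mult_op 0 x else 0) S)
    (repr_sum (index_enum _) (fun i : 'I_n => u i < s <= (if u i < u i.+1 then u i.+1 else nxt (u i)))
      (fun i => mult_op (y i) x)) => w [hw0 hw1] -> ->.
  rewrite hw0 add0r big_mkcond/=.
  rewrite (eq_bigr (fun i : 'I_n => ((u i < s <= u i.+1)%R%:R * c i w)%:C%C * repr x w)); last first.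
    move=> i _; rewrite hw1 /c'.
    have [uu|uu] := ltP (u i) (u i.+1); first by case: (_ && _); rewrite ?mul1r ?mul0r.
    rewrite mul0r; have -> : (u i < s <= u i.+1) = false.
      by apply/negbTE/negP => /andP[h /(lt_le_trans h)]; rewrite ltNge uu.
    by rewrite !mul0r; case: ifP.
  rewrite -mulr_suml normcM ler_wpM2r ?normc_ge0//.
  have -> : \sum_(i < n) ((u i < s <= u i.+1)%R%:R * c i w)%:C%C =
      (\sum_(i < n) (u i < s <= u i.+1)%R%:R * c i w)%:C%C :> R[i] by rewrite rmorph_sum.
  rewrite normcE /= expr0n/= addr0 sqrtr_sqr (le_trans (ler_norm_sum _ _ _))//.
  apply: (@le_trans _ _ (\sum_(i < n) (u i < s <= u i.+1)%R%:R * M)).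
    by apply: ler_sum => i _; rewrite normrM normr_nat ler_wpM2l.
  by rewrite -mulr_suml ler_piMl// sum_cells_le1.
- move=> t; rewrite /nc_step_integral /=.
  pose D i := Lp_path P X (Num.min (if u i < u i.+1 then u i.+1 else nxt (u i)) t) -
    Lp_path P X (Num.min (u i) t).
  have h1 : {ae P, forall w, forall i : 'I_n, repr (mult_op (y i) (D i)) w =
      (c i w)%:C%C * (X (Num.min (u i.+1) t) w - X (Num.min (u i) t) w)}.
    apply: filter_forall => i; have [_ yi] := yP i.
    have [x1 x2] : {ae P, forall w, repr (Lp_path P X (Num.min (u i.+1) t)) w =
        X (Num.min (u i.+1) t) w} /\ {ae P, forall w, repr (Lp_path P X (Num.min (u i) t)) w =
        X (Num.min (u i) t) w} by split; exact: L0_repr_class.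
    apply: filterS3 (ae_and (repr_mul (y i) (D i)) yi) (repr_sub _ _ : {ae P, forall w, repr (D i) w = _})
      (ae_and x1 x2) => w [-> ->] -> [h2 h3].
    rewrite h3 /c'; have [uu|uu] := ltP (u i) (u i.+1); first by rewrite h2 mul1r.
    have -> : u i.+1 = u i by apply/eqP; rewrite eq_le uu und.
    by rewrite mul0r mul0r subrr mulr0.
  apply: filterS2 h1 (repr_sum (index_enum _) xpredT (fun i : 'I_n => mult_op (y i) (D i))) => w hw ->.
  by apply: eq_bigr => i _; exact: hw.
Qed.

Lemma transform_bound_scale V t (C : R) n (u : nat -> time) (c : nat -> T -> R) (M : R) :
  (forall r, measurable_fun setT (V r)) -> 0 <= C -> transform_bound P F p V t C ->
  (forall j, u j <= u j.+1) -> u n <= t ->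
  (forall j, rmeas (F (u j)) (c j)) -> (forall j w, `|c j w| <= M) ->
  pnorm P p (fun w => \sum_(j < n) c j w * (V (u j.+1) w - V (u j) w)) <=e C * M.
Proof.
move=> mV C0 bV und unt mc cM.
have M0 : 0 <= M by exact: le_trans (normr_ge0 _) (cM 0%N point).
move: M0; rewrite le_eqVlt => /predU1P[M0|M0].
  rewrite (_ : (fun w => _) = (fun=> 0)); first by rewrite (pnorm0 P hp) lee_fin -M0 mulr0.
  apply/funext => w; rewrite big1// => j _.
  by have := cM j w; rewrite -M0 normr_le0 => /eqP ->; rewrite mul0r.
rewrite (_ : (fun w => _) = (fun w => M * \sum_(j < n) (M^-1 * c j w) *
   (V (u j.+1) w - V (u j) w))); last first.
  apply/funext => w; rewrite mulr_sumr; apply: eq_bigr => j _.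
  by rewrite !mulrA divff ?gt_eqF// mul1r.
rewrite mulrC -[X in _ <=e X * _](gtr0_norm M0); apply: pnormZ_le => //.
  apply: measurable_sum => j; apply: measurable_funM; last exact: measurable_funB.
  by apply: measurable_funM => //; exact: (rmeasF_measurable hF (mc j)).
apply: (bV n u (fun j w => M^-1 * c j w)) => //.
- by move=> j; apply: measurable_funM; [exact: measurable_cst|exact: mc].
- by move=> j w; rewrite normrM gtr0_norm ?invr_gt0// ler_pdivrMl// mulr1.
Qed.

Section one_process.
Variables (X : process T R) (J : (time -> operator P) -> time -> L0).
Hypothesis HJ : nc_integral F p%:E q (Lp_path P X) J.

Lemma elementary_nc_integrand (e : step_data R (operator P)) :
  step_admissible (mult_alg F) e -> nc_integrands F q (step_fun e).
Proof. by move=> he S [_ HS]; apply: HS; exists e. Qed.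

(** The integral of the constant 1 on ]0, z] is [X - X 0] up to time [z]; it
    inherits adaptedness and right continuity from the range of the integral.
    *)
Lemma nc_increment (z : time) : exists K : time -> L0,
  (forall s, s <= z -> {ae P, forall w, repr (K s) w = X s w - X 0%:nng w}) /\ Rap_nc F p%:E K.
Proof.
case: HJ => HR HE _.
have [z0 z0E] : exists z0 : time, z0 = 0%:nng by exists 0%:nng.
pose u (j : nat) : time := if j is 0%N then z0 else z.
have und j : u j <= u j.+1 by case: j => [|j] //=; rewrite z0E -num_le/=.
have m1 j : rmeas (F (u j)) (fun=> 1 : R) by exact: measurable_cst.
have N1 (j : nat) (w : T) : `|1 : R| <= 1 by rewrite normr1.
have [e [he _ eI]] := grid_step X 1 und m1 N1.
exists (J (step_fun e)); split; last by apply: HR; exact: elementary_nc_integrand.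
move=> s sz; rewrite HE//; apply: filterS (eI s) => w ->.
rewrite big_ord_recr big_ord0 /= add0r mul1r min_r// min_l// z0E//.
by rewrite -num_le/=.
Qed.

Variable pr : R[i] -> R.
Hypothesis hpr : pr = @complex.Re R \/ pr = @complex.Im R.

(** Otherwise there are normalised transforms of L^p norm larger than [n + 1]
    for each [n]. Divided by [n + 1], their integrands tend to 0 locally
    boundedly while the norms of their integrals stay above 1. *)
Lemma nc_transform_bound t : exists2 C : R, 0 <= C &
  transform_bound P F p (fun s w => pr (X s w)) t C.
Proof.
have mX r : measurable_fun setT (fun w => pr (X r w)) by exact: measurable_part.
apply: contrapT => /forall2NP H.
have /choice[f fP] : forall n : nat, exists f : nat * (nat -> time) * (nat -> T -> R),
    [/\ forall j, f.1.2 j <= f.1.2 j.+1, f.1.2 f.1.1 <= t,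
      forall j, rmeas (F (f.1.2 j)) (f.2 j), forall j w, `|f.2 j w| <= 1 &
      ~ pnorm P p (fun w => \sum_(j < f.1.1) f.2 j w *
        (pr (X (f.1.2 j.+1) w) - pr (X (f.1.2 j) w))) <=e n.+1%:R].
  move=> n; have [//|] := H n.+1%:R.
  move=> /existsNP[m /existsNP[u /existsNP[c /not_implyP[h1 /not_implyP[h2
    /not_implyP[h3 /not_implyP[h4 h5]]]]]]].
  by exists (m, u, c).
pose u n := (f n).1.2; pose m n := (f n).1.1; pose c n := (f n).2.
have nn n : 0 < n.+1%:R^-1 :> R by rewrite invr_gt0.
pose c' n j w := n.+1%:R^-1 * c n j w.
have /choice[e eP] : forall n, exists e : step_data R (operator P),
   [/\ step_admissible (mult_alg F) e,
    forall s x, {ae P, forall w, normc (repr ((step_fun e s : operator P) x) w) <=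
      n.+1%:R^-1 * normc (repr x w)} &
    forall t, {ae P, forall w, repr (nc_step_integral (Lp_path P X) e t) w =
      \sum_(i < m n) (c' n i w)%:C%C * (X (Num.min (u n i.+1) t) w - X (Num.min (u n i) t) w)} ].
  move=> n; have [h1 h2 h3 h4 _] := fP n; apply: grid_step => //.
    by move=> j; apply: measurable_funM; [exact: measurable_cst|exact: h3].
  by move=> j w; rewrite /c' normrM (gtr0_norm (nn n)) -[leRHS]mulr1 ler_wpM2l ?h4// ltW.
have [z0 z0E] : exists z0 : time, z0 = 0%:nng by exists 0%:nng.
have z1 (j : nat) : z0 <= z0 by [].
have m0 (j : nat) : rmeas (F z0) (fun=> 0 : R) by exact: measurable_cst.
have N0 (j : nat) (w : T) : `|0 : R| <= 0 by rewrite normr0.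
(* The empty step process is the zero integrand to which the rescaled ones
   converge. *)
have [e0 [he0 e0n e0I]] := @grid_step X 0 (fun=> z0) (fun _ _ => 0) 0 z1 m0 N0.
have [HR HE HC] := HJ.
have cv : locally_bounded_cvg q (fun n => step_fun (e n)) (step_fun e0).
  split=> s.
    apply/cvge0P => [n|eps eps0]; first exact: op_norm_ge0.
    exists (Num.truncn eps^-1) => n Nn.
    apply: (@le_trans _ _ (n.+1%:R^-1 : R)%:E); last first.
      rewrite lee_fin -[leRHS]invrK lef_pV2 ?posrE ?invr_gt0//.
      by rewrite (le_trans (ltW (truncnS_gt _)))// ler_nat.
    apply: op_norm_le => //.
    move=> x; have [_ en _] := eP n.
    apply: filterS3 (en s x) (e0n s x) (repr_sub ((step_fun (e n) s : operator P) x)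
      ((step_fun e0 s : operator P) x)) => w h1 h2 h3.
    rewrite [X in normc X](_ : _ = repr ((step_fun (e n) s : operator P) x) w
      - repr ((step_fun e0 s : operator P) x) w)//.
    move: h2; rewrite mul0r => h2.
    rewrite (le_trans (normcD _ _))// normcN -[leRHS]addr0 lerD//.
  apply: (@le_lt_trans _ _ 1%E); last exact: ltry.
  apply: ge_ereal_sup => _ [[n r] _ <-] /=; apply: op_norm_le => // x.
  have [_ en _] := eP n; apply: filterS (en r x) => w h; apply: le_trans h _.
  by rewrite ler_wpM2r ?normc_ge0// invf_le1// ler1n.
have := HC _ _ (fun n => elementary_nc_integrand (let: And3 h _ _ := eP n in h))
  (elementary_nc_integrand he0) cv t.
move=> /(cvge0_near ltr01)[N _ /(_ N (leqnn N)) /= hN].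
have [h1 h2 h3 h4] := fP N; apply.
have [heN enN eI] := eP N.
have hN1 : Lpnorm p%:E (J (step_fun (e N)) t - J (step_fun e0) t) <=e 1.
  by apply: le_trans hN; apply: ereal_sup_ubound; exists t => /=.
rewrite (HE _ heN) (HE _ he0) in hN1.
have mS : measurable_fun setT (fun w => \sum_(j < m N) c' N j w *
    (pr (X (u N j.+1) w) - pr (X (u N j) w))).
  apply: measurable_sum => j; apply: measurable_funM; last exact: measurable_funB.
  by apply: measurable_funM => //; exact: (rmeasF_measurable hF (h3 j)).
have umono : {homo u N : i j / (i <= j)%N >-> i <= j} by exact/nondecreasing_seqP.
have uNt j : (j <= m N)%N -> Num.min (u N j) t = u N j.
  by move=> jm; rewrite min_l// (le_trans (umono _ _ jm)).
have bound : pnorm P p (fun w => \sum_(j < m N) c' N j w *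
    (pr (X (u N j.+1) w) - pr (X (u N j) w))) <=e 1.
  apply: le_trans hN1; apply: pnorm_mono => //; first exact: measurable_normc_repr.
  apply: filterS3 (eI t) (e0I t) (repr_sub (nc_step_integral (Lp_path P X) (e N) t)
    (nc_step_integral (Lp_path P X) e0 t)) => w hw hw0 hws.
  rewrite [leRHS]ger0_norm ?normc_ge0// hws hw0 big_ord0 subr0 hw.
  apply: le_trans (part_le hpr _); rewrite part_sum//.
  rewrite le_eqVlt; apply/orP; left; apply/eqP; congr `|_|; apply: eq_bigr => j _.
  by rewrite part_scale// part_sub// !uNt// ltnW.
have := pnormZ_le hp N.+1%:R mS bound; rewrite normr_nat mulr1; apply: le_trans.
rewrite le_eqVlt; apply/orP; left; apply/eqP; congr (pnorm P p _); apply/funext => w.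
rewrite mulr_sumr; apply: eq_bigr => j _.
by rewrite /c' !mulrA divff ?pnatr_eq0// mul1r.
Qed.

Theorem nc_real_integrator : integrator P F p (fun t w => pr (X t w - X 0%:nng w)).
Proof.
have mX r : measurable_fun setT (fun w => pr (X r w)) by exact: measurable_part.
have mU r : measurable_fun setT (fun w => pr (X r w - X 0%:nng w)).
  by under eq_fun do rewrite part_sub//; exact: measurable_funB.
split.
- move=> t; have [K [KE [Kad _ _]]] := nc_increment t.
  have [_ [f mf Kf]] := Kad t.
  apply: (rmeasF_ae hF _ (rmeas_part hpr mf)).
  apply: filterS2 (KE t (lexx _)) (L0_repr_class P f) => w <-.
  by rewrite -Kf => ->.
- by apply: nearW => w; rewrite subrr -(subrr (0 : R[i])) part_sub// subrr.
- move=> t e e0.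
  have [z zE] : exists z : time, z%:num = t%:num + 1.
    by exists `|t%:num + 1|%:nng; rewrite /= ger0_norm// addr_ge0.
  have [K [KE [_ Kr _]]] := nc_increment z.
  have h : \forall r \near t%:num^'+, Lpnorm p%:E (K `|r|%:nng - K t) <=e e.
    by apply: cvge0_near (Kr t).
  have {h} /(near_right_time t (fun s => Lpnorm p%:E (K s - K t) <=e e))[dlt d0 H] := h.
  exists (Num.min dlt 1) => [|s ts sd]; first by rewrite lt_min d0 ltr01.
  move: ts; rewrite le_eqVlt => /predU1P[->|ts].
    rewrite (_ : _ \- _ = fun=> 0); first by rewrite (pnorm0 P hp) lee_fin ltW.
    by apply/funext => w /=; rewrite subrr.
  have sz : s <= z.
    by rewrite -num_le zE (le_trans (ltW sd))// lerD2l ge_min lexx orbT.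
  have tz : t <= z by exact: le_trans (ltW ts) sz.
  have sd' : s%:num < t%:num + dlt.
    by apply: lt_le_trans sd _; rewrite lerD2l ge_min lexx.
  apply: le_trans (H s ts sd'); apply: pnorm_mono => //.
  + exact: measurable_funB.
  + exact: measurable_normc_repr.
  apply: filterS3 (KE s sz) (KE t tz) (repr_sub (K s) (K t)) => w h1 h2 h3.
  rewrite [leRHS]ger0_norm ?normc_ge0//= h3 h1 h2 -part_sub//; exact: part_le.
- move=> t; have [C C0 bC] := nc_transform_bound t; exists C => //.
  move=> n u c M und unt mc cM.
  rewrite (_ : (fun w => _) = (fun w => \sum_(j < n) c j w *
      (pr (X (u j.+1) w) - pr (X (u j) w)))).
    by apply: (transform_bound_scale (V := fun s w => pr (X s w)) mX C0 bC).
  apply/funext => w; apply: eq_bigr => j _; rewrite !part_sub//.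
  by congr (_ * _); ring.
Qed.

End one_process.

Theorem nc_integrator_modification (X : process T R) :
  nc_integrator F p%:E q (Lp_path P X) ->
  exists X' : process T R, modification P X' X /\ classical_integrator P F p%:E X'.
Proof.
move=> [J HJ].
have HU := nc_real_integrator HJ (or_introl erefl).
have HV := nc_real_integrator HJ (or_intror erefl).
have [X' [XX' IX']] := complex_integrator hF hp (X 0%:nng) HU HV.
exists X'; split => // t; apply: filterS (XX' t) => w ->.
apply: complex_eq; first by rewrite ReD /= ReB; ring.
by rewrite ImD /= ImB; ring.
Qed.

End nc_integrator_bounds.

(** * Predictable processes *)

Section predictable_processes.
Context d (T : measurableType d) (R : realType) (P : probability T R).
Variable F : {nonneg R} -> set (set T).
Hypothesis hF : usual_conditions P F.
Local Notation time := {nonneg R}.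
Local Notation predictable_fun := (rmeas (predictable_sets F)).

(** Sections of the generating rectangles at time [s] are known at time [s],
    and taking sections commutes with the set operations. *)
Lemma predictable_section (A : set (time * T)) (s : time) :
  <<s predictable_sets F>> A -> F s [set w | A (s, w)].
Proof.
have [F0 FC FU] := filtration_sigma hF s.
suff : <<s predictable_sets F>> `<=` [set A | F s [set w | A (s, w)]] by apply.
apply: smallest_sub.
- split.
  + by rewrite /= (_ : [set w | _] = set0)//.
  + by move=> B FB /=; have := FC _ FB; congr (F s); apply/seteqP; split => w //= -[].
  + move=> B FB /=; rewrite (_ : [set w | _] = \bigcup_i [set w | B i (s, w)]) //.
    exact: FU.
move=> _ [[B FB ->]|[a [b [B [ab FB ->]]]]] /=.
  have [->|s0] := eqVneq s 0%:nng.
    rewrite (_ : [set w | _] = B)//; apply/seteqP; split => w /=; last by [].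
    by case.
  rewrite (_ : [set w | _] = set0)//; apply/seteqP; split => w //= -[/eqP].
  by rewrite (negbTE s0).
have [asb|nasb] := boolP (a < s <= b).
  rewrite (_ : [set w | _] = B); last by apply/seteqP; split => w /=; [case|].
  by apply: (filtration_sub hF) FB; apply: ltW; case/andP: asb.
rewrite (_ : [set w | _] = set0)//; apply/seteqP; split => w /=; last by [].
by rewrite ?(negbTE nasb); case.
Qed.

Lemma predictable_adapted (Y : time * T -> R) s : predictable_fun Y ->
  rmeas (F s) (fun w => Y (s, w)).
Proof.
move=> /rmeasP mY; apply/(rmeasFP hF) => B mB.
exact: (predictable_section (A := Y @^-1` B)) (mY B mB).
Qed.

(** A deterministic, left-continuous, hence predictable, and locally bounded
    function of time that dominates [c m] for an integer [m] at or after the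
    present time. *)
Definition envelope (c : nat -> R) (r : time) : R :=
  c 0%N + \sum_(k < (Num.truncn r%:num).+1) c k.+1 * (k%:R < r%:num)%R%:R.

Lemma envelope_ge (c : nat -> R) (r : time) : (forall k, 0 <= c k) ->
  exists2 m : nat, r%:num <= m%:R & c m <= envelope c r.
Proof.
move=> c0; have S0 n : 0 <= \sum_(k < n) c k.+1 * (k%:R < r%:num)%R%:R.
  by apply: sumr_ge0 => k _; rewrite mulr_ge0.
have r0 : 0 <= r%:num by exact: ge0.
move: (r0); rewrite le_eqVlt => /predU1P[rE|rgt0].
  by exists 0%N; rewrite -?rE// /envelope lerDl; exact: S0.
have pick (k : nat) : (k < (Num.truncn r%:num).+1)%N -> k%:R < r%:num ->
    c k.+1 <= envelope c r.
  move=> kn kr; apply: (@le_trans _ _ (\sum_(k < (Num.truncn r%:num).+1) c k.+1 * (k%:R < r%:num)%R%:R)); last by rewrite lerDr.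
  rewrite (bigD1 (Ordinal kn))//= kr mulr1 lerDl; apply: sumr_ge0 => i _.
  by rewrite mulr_ge0.
have /andP[t1 t2] := truncn_itv r0; set k := Num.truncn _ in t1 t2 pick.
move: t1; rewrite le_eqVlt => /predU1P[kE|kr].
  have k0 : (0 < k)%N by rewrite -(ltr_nat R) kE.
  exists k; first by rewrite kE.
  rewrite -(prednK k0); apply: pick; first by rewrite prednK// ltnW.
  by rewrite -kE ltr_nat prednK.
by exists k.+1; [exact: ltW|exact: pick].
Qed.

Lemma envelope_ge0 c r : (forall k, 0 <= c k) -> 0 <= envelope c r.
Proof. by move=> c0; have [m _] := envelope_ge r c0; exact: le_trans. Qed.

Lemma envelope_le c (r t : time) : (forall k, 0 <= c k) -> r <= t ->
  envelope c r <= c 0%N + \sum_(k < (Num.truncn t%:num).+1) c k.+1.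
Proof.
move=> c0 rt; rewrite lerD2l.
have kt : (Num.truncn r%:num <= Num.truncn t%:num)%N by apply: le_truncn; rewrite num_le.
rewrite -(big_mkord xpredT (fun k => c k.+1 * (k%:R < r%:num)%R%:R)).
rewrite -(big_mkord xpredT (fun k => c k.+1)) [leRHS](@big_cat_nat _ _ _ (Num.truncn r%:num).+1)//=.
rewrite -[leLHS]addr0 lerD//; last by apply: sumr_ge0.
by apply: ler_sum => k _; rewrite ler_piMr//; case: (_ < _).
Qed.

Lemma predictable_envelope c : (forall k, 0 <= c k) ->
  predictable_fun (fun rw => envelope c rw.1).
Proof.
move=> c0; have N1 (w : T) : `|1 : R| <= 1 by rewrite normr1.
have [nt ntE] : exists nt : nat -> time, forall k, (nt k)%:num = k%:R.
  by exists (fun k => `|k%:R|%:nng) => k; rewrite /= ger0_norm.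
pose f n (rw : time * T) : R := c 0%N + \sum_(k < n) c k.+1 * after (nt k) (fun=> 1) rw.
have mf n : predictable_fun (f n).
  apply: measurable_funD; first exact: measurable_cst.
  apply: measurable_sum => k; apply: measurable_funM; first exact: measurable_cst.
  have m1 : rmeas (F (nt k)) (fun=> 1 : R) by exact: measurable_cst.
  by have [] := bpred_after hF m1 N1.
apply: (@measurable_fun_cvg _ (g_sigma_algebraType (predictable_sets F)) R setT f) => // -[r w] _.
apply: cvg_near_cst; exists (Num.truncn r%:num).+1 => // n /= rn.
rewrite /f /envelope; congr (_ + _).
rewrite -(big_mkord xpredT (fun k => c k.+1 * after (nt k) (fun=> 1) (r, w))).
rewrite (@big_cat_nat _ _ _ (Num.truncn r%:num).+1)//= [X in _ + X]big_nat [X in _ + X]big1 ?addr0.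
  rewrite big_mkord; apply: eq_bigr => k _; rewrite /after/= mul1r.
  by rewrite -num_lt ntE.
move=> k /andP[rk _]; rewrite /after/= mul1r -num_lt ntE ltNge.
have -> : r%:num <= k%:R by rewrite (le_trans (ltW (truncnS_gt _)))// ler_nat.
by rewrite mulr0.
Qed.

Lemma predictable_clamp (a b : time * T -> R) : predictable_fun a -> predictable_fun b ->
  predictable_fun (fun rw => clamp (a rw) (b rw)).
Proof.
move=> ma mb; apply: measurable_maxr; first exact: measurable_minr.
exact: measurableT_comp.
Qed.

Lemma clamp_id (x b : R) : `|x| <= b -> clamp x b = x.
Proof.
by rewrite ler_norml => /andP[h1 h2]; rewrite /clamp (min_l h2) max_l.
Qed.

(** Truncating at the envelope makes the limit locally bounded without
    changing it where it is already below the envelope. *)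
Lemma predictable_limit (a : nat -> time * T -> R) (c : nat -> R) : (forall k, 0 <= c k) ->
  (forall n, predictable_fun (a n)) ->
  exists2 b : time * T -> R, predictable_fun b /\ (forall rw, `|b rw| <= envelope c rw.1) &
    forall rw l, a n rw @[n --> \oo] --> l -> `|l| <= envelope c rw.1 -> b rw = l.
Proof.
move=> c0 ma; exists (fun rw => clamp (rlim (a ^~ rw)) (envelope c rw.1)).
  split; last by move=> rw; apply: norm_clamp; exact: envelope_ge0.
  apply: predictable_clamp; last exact: predictable_envelope.
  exact: (@measurable_rlim R _ (g_sigma_algebraType (predictable_sets F))).
by move=> rw l al lc; rewrite (rlimE al) clamp_id.
Qed.

(** Truncate at the envelope and restrict to the predictable set where the
    truncated sequence converges to 0. At points where the sequence is bounded
    and tends to 0 nothing changes; elsewhere convergence is forced. *)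
Lemma predictable_null_sequence (a : nat -> time * T -> R) (c : nat -> R) :
  (forall k, 0 <= c k) -> (forall n, predictable_fun (a n)) ->
  exists b : nat -> time * T -> R, [/\ forall n, predictable_fun (b n),
    forall n rw, `|b n rw| <= envelope c rw.1, forall rw, b n rw @[n --> \oo] --> 0 &
    forall rw, (forall n, `|a n rw| <= envelope c rw.1) -> a n rw @[n --> \oo] --> 0 ->
      forall n, b n rw = a n rw].
Proof.
move=> c0 ma; pose e n rw := clamp (a n rw) (envelope c rw.1).
have me n : predictable_fun (e n).
  by apply: predictable_clamp => //; exact: predictable_envelope.
have ec n rw : `|e n rw| <= envelope c rw.1 by apply: norm_clamp; exact: envelope_ge0.
(* Convergence to 0 is the vanishing of the upper limit of the moduli, which
   is a predictable condition. *)
pose L rw := limn_esup (fun n => (`|e n rw|)%:E).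
pose G : set (time * T) := L @^-1` [set 0%E].
have mG : <<s predictable_sets F>> G.
  have mL : measurable_fun [set: g_sigma_algebraType (predictable_sets F)] L.
    apply: measurable_fun_limn_esup => n; apply/measurable_EFinP.
    by apply: measurableT_comp => //; exact: me.
  by have := mL measurableT [set 0%E] (emeasurable_set1 _); rewrite setTI.
exists (fun n rw => e n rw * \1_G rw); split.
- move=> n; apply: measurable_funM; first exact: me.
  by apply: (@measurable_indic _ (g_sigma_algebraType (predictable_sets F))).
- move=> n rw; rewrite normrM -[leRHS]mulr1 ler_pM// indicE.
  by case: (_ \in _); rewrite ?normr1 ?normr0.
- move=> rw; rewrite indicE; have [rG|rG] := boolP (rw \in G); last first.
    by under eq_cvg do rewrite mulr0; exact: cvg_cst.
  under eq_cvg do rewrite mulr1; apply/norm_cvg0P.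
  have LG : L rw = 0%E by exact: (set_mem rG).
  have /fine_cvgP[_] : (`|e n rw|)%:E @[n --> \oo] --> 0%E.
    by apply: limn_esup_le_cvg; [rewrite -/(L rw) LG|move=> n; rewrite lee_fin].
  exact.
move=> rw ac a0 n; have eE m : e m rw = a m rw by rewrite /e clamp_id.
rewrite eE indicE mem_set ?mulr1//; rewrite /G /L/=.
have h : (`|e n rw|)%:E @[n --> \oo] --> 0%E.
  apply: cvg_EFin; first exact: nearW.
  under eq_cvg do rewrite /= eE.
  exact/norm_cvg0P.
by have [_ ->] := cvg_limn_einf_sup h.
Qed.

End predictable_processes.

(** * Representation of noncommutative integrands *)

Section representation.
Context d (T : measurableType d) (R : realType) (P : probability T R).
Variable F : {nonneg R} -> set (set T).
Hypothesis hF : usual_conditions P F.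
Variables (p : R) (q : \bar R).
Hypotheses (hp : 1 <= p) (hq : (1 <= q)%E).
Local Notation time := {nonneg R}.
Local Notation L0 := (L0 P).

Lemma mult_op_inj (y y' : L0) : mult_op y = mult_op y' -> y = y'.
Proof.
move=> yy; pose one := L0_class P (cst 1).
have h (z : L0) : {ae P, forall w, repr (mult_op z one) w = repr z w}.
  by apply: filterS2 (repr_mul z one) (L0_repr_class P (cst 1)) => w -> ->; rewrite mulr1.
by apply: L0_eq; apply: filterS2 (h y) (h y') => w <- <-; rewrite yy.
Qed.

Lemma mult_opB (y y' : L0) : mult_op y - mult_op y' = mult_op (y - y') :> operator P.
Proof.
apply/funext => x; apply: L0_eq.
apply: filterS3 (repr_sub (mult_op y x) (mult_op y' x)) (repr_mul (y - y') x)
  (ae_and (repr_sub y y') (ae_and (repr_mul y x) (repr_mul y' x))).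
move=> w h1 -> [-> [h2 h3]]; rewrite mulrBl -h2 -h3 -h1; done.
Qed.

(** Norm convergence of multiplication operators is essentially uniform
    convergence of the multipliers. *)
Lemma mult_op_cvg (yn : nat -> L0) (y : L0) :
  op_norm q (mult_op (yn n) - mult_op y) @[n --> \oo] --> 0%E ->
  {ae P, forall w, repr (yn n) w @[n --> \oo] --> repr y w}.
Proof.
move=> h; have ek (k : nat) : 0 < k.+1%:R^-1 :> R by rewrite invr_gt0.
have /choice[N NP] : forall k : nat, exists N, forall n, (N <= n)%N ->
    op_norm q (mult_op (yn n) - mult_op y) <=e k.+1%:R^-1.
  by move=> k; have [N _ NP] := cvge0_near (ek k) h; exists N => n; exact: NP.
have H : {ae P, forall w, forall k n, (N k <= n)%N -> normc (repr (yn n - y) w) <= k.+1%:R^-1}.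
  apply: ae_foralln => k; apply: ae_foralln => n.
  have [Nn|_] := leqP (N k) n; last exact: nearW.
  have := NP k n Nn; rewrite mult_opB => /(op_norm_mult_bound hq (ltW (ek k))).
  by apply: filterS => w.
have Hs : {ae P, forall w, forall n, repr (yn n - y) w = repr (yn n) w - repr y w}.
  by apply: ae_foralln => n; exact: repr_sub.
apply: filterS2 H Hs => w Hw Hsw; apply/cvg_normcP => e e0.
exists (N (Num.truncn e^-1)) => // n /= Nn; rewrite -Hsw.
apply: le_trans (Hw _ _ Nn) _; rewrite -[leRHS]invrK lef_pV2 ?posrE ?invr_gt0//.
exact/ltW/truncnS_gt.
Qed.

(** Setting the multiplier to 0 where it exceeds its essential supremum gives
    a version that is bounded everywhere, as classical step processes require.
    *)
Lemma mult_alg_bounded t (A : operator P) : mult_alg F t A ->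
  exists f y, [/\ bounded_rv F t f, A = mult_op y & {ae P, forall w, repr y w = f w}].
Proof.
move=> [y [yoo [f0 mf0 yE]] <-].
have yfin : Lpnorm +oo%E y \is a fin_num by rewrite ge0_fin_numE ?Lpnorm_ge0.
pose M := fine (Lpnorm +oo%E y).
have yM : {ae P, forall w, normc (repr y w) <= M}.
  have P1 : (0 < P setT)%E by rewrite probability_setT lte01.
  have : (Lpnorm +oo%E y <= M%:E)%E by rewrite fineK.
  rewrite /Lpnorm unlock P1 => /ess_supP; apply: filterS => w /=.
  by rewrite lee_fin ger0_norm// normc_ge0.
have M0 : 0 <= M by rewrite fine_ge0// Lpnorm_ge0.
pose f w := if normc (f0 w) <= M then f0 w else 0.
have [mr mi] := (measurable_wrtP (F t) (f0 : T -> R[i])).1 mf0.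
have mn : rmeas (F t) (fun w => normc (f0 w)).
  exact: (@measurable_normc _ (g_sigma_algebraType (F t)) R (f0 : T -> R[i])).
have mle : measurable_fun [set: g_sigma_algebraType (F t)]
    (fun w : g_sigma_algebraType (F t) => normc (f0 (w : T)) <= M).
  by apply: measurable_fun_ler => //; exact: measurable_cst.
exists f, y; split => //.
  split; last first.
    by exists M => w; rewrite /f; case: ifP => // _; rewrite normc0.
  apply/(@measurable_wrtP R T); split.
    rewrite (_ : (fun w => _) = (fun w => if normc (f0 w) <= M then Re (f0 w) else 0)).
      by apply: (measurable_fun_ifT mle) => //; exact: measurable_cst.
    by apply/funext => w; rewrite /f; case: ifP.
  rewrite (_ : (fun w => _) = (fun w => if normc (f0 w) <= M then Im (f0 w) else 0)).
    by apply: (measurable_fun_ifT mle) => //; exact: measurable_cst.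
  by apply/funext => w; rewrite /f; case: ifP.
have yf : {ae P, forall w, repr y w = f0 w} by rewrite yE; exact: L0_repr_class.
by apply: filterS2 yf yM => w; rewrite /f => -> ->.
Qed.

(** Bounded versions of the coefficients turn a step operator into a classical
    step process with the same integral. *)
Lemma elementary_representation (e : step_data R (operator P)) :
  step_admissible (mult_alg F) e ->
  exists (e' : step_data R (T -> R[i])) (Y : process T R),
  [/\ step_admissible (bounded_rv F) e', forall t w, Y t w = step_fun e' t w, Pbct F Y,
    step_fun e = mult_process P Y &
    forall (X : process T R) t, {ae P, forall w,
      repr (nc_step_integral (Lp_path P X) e t) w = classical_step_integral X e' t w}].
Proof.
move=> [A0 Ae]; have [f0 [y0 [b0 E0 yf0]]] := mult_alg_bounded A0.
have /choice[f fP] : forall i : 'I_(esize e), exists f : T -> R[i], exists y : L0,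
    [/\ bounded_rv F (es i) f,
    ef i = mult_op y & {ae P, forall w, repr y w = f w}].
  by move=> i; have [_ /mult_alg_bounded] := Ae i.
have /choice[y yP] := fP.
pose e' : step_data R (T -> R[i]) := @StepData R (T -> R[i]) (esize e) f0 (fun i : 'I_(esize e) => es i)
  (fun i : 'I_(esize e) => et i) f.
have ae' : step_admissible (bounded_rv F) e'.
  by split => //= i; split; [have [] := Ae i|have [] := yP i].
have mRe t g : bounded_rv F t g -> measurable_fun setT (fun w => Re (g w)) /\
    measurable_fun setT (fun w => Im (g w)).
  move=> /bounded_rv_parts[[mr _] [mi _]].
  by split; [exact: (rmeasF_measurable hF mr)|exact: (rmeasF_measurable hF mi)].
have [|Y YE] := @process_of _ T R (fun t => step_fun e' t).
  move=> t; under eq_fun do rewrite step_funE ReD Re_sum.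
  under [X in _ /\ measurable_fun _ X]eq_fun do rewrite step_funE ImD Im_sum.
  have [m0r m0i] := mRe _ _ b0.
  split; apply: measurable_funD.
  - by case: (t == _) => //; exact: measurable_cst.
  - apply: measurable_sum => i; under eq_fun do rewrite ReM.
    have [mr mi] := mRe _ _ (let: And3 h _ _ := yP i in h).
    by apply: measurable_funB; apply: measurable_funM => //; exact: measurable_cst.
  - by case: (t == _) => //; exact: measurable_cst.
  - apply: measurable_sum => i; under eq_fun do rewrite ImM.
    have [mr mi] := mRe _ _ (let: And3 h _ _ := yP i in h).
    by apply: measurable_funD; apply: measurable_funM => //; exact: measurable_cst.
exists e', Y; split => //.
- have [A0r A0i] := bounded_rv_parts b0.
  have Aer i : es i < et (s := e') i /\ rmeas (F (es i)) (fun w => Re (ef (s := e') i w)) /\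
      exists M : R, forall w, `|Re (ef (s := e') i w)| <= M.
    by have [st /bounded_rv_parts[]] := ae'.2 i.
  have Aei i : es i < et (s := e') i /\ rmeas (F (es i)) (fun w => Im (ef (s := e') i w)) /\
      exists M : R, forall w, `|Im (ef (s := e') i w)| <= M.
    by have [st /bounded_rv_parts[]] := ae'.2 i.
  have [ER EI] := step_parts YE.
  have [lr _] := lpred_steps (P := P) hF p (index_enum _) A0r Aer.
  have [li _] := lpred_steps (P := P) hF p (index_enum _) A0i Aei.
  by apply: lpred_Pbct; rewrite ?ER ?EI.
- apply/funext => s; apply/funext => x; rewrite step_op_at; apply: L0_eq.
  set S := \sum_(i | _) _.
  have h0 : {ae P, forall w, repr (if s == 0%:nng then (ef0 e : operator P) x else 0) w =
      (if s == 0%:nng then f0 w else 0) * repr x w}.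
    case: ifP => _; last by apply: filterS (repr_zero P) => w ->; rewrite mul0r.
    by rewrite E0; apply: filterS2 (repr_mul y0 x) yf0 => w -> ->.
  have h1 : {ae P, forall w, forall i : 'I_(esize e), repr ((ef i : operator P) x) w = f i w * repr x w}.
    apply: filter_forall => i; have [_ -> yi] := yP i.
    by apply: filterS2 (repr_mul (y i) x) yi => w -> ->.
  apply: filterS3 (ae_and h0 h1) (ae_and (repr_add (if s == 0%:nng then (ef0 e : operator P) x else 0) S)
    (repr_sum (index_enum _) (fun i : 'I_(esize e) => es i < s <= et i)
      (fun i : 'I_(esize e) => (ef i : operator P) x)))
    (ae_and (repr_mul (L0_class P (Y s)) x) (L0_repr_class P (Y s))).
  move=> w [hw0 hw1] [-> ->] [-> ->]; rewrite hw0 YE step_funE mulrDl; congr (_ + _).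
  rewrite mulr_suml [LHS]big_mkcond; apply: eq_bigr => i _ /=.
  by rewrite hw1; case: ifP => _; rewrite ?mulr1 ?mulr0 ?mul0r.
- move=> X t; rewrite /nc_step_integral.
  pose D (i : 'I_(esize e)) := Lp_path P X (Num.min (et i) t) - Lp_path P X (Num.min (es i) t).
  have h1 : {ae P, forall w, forall i : 'I_(esize e), repr ((ef i : operator P) (D i)) w = f i w *
      (X (Num.min (et i) t) w - X (Num.min (es i) t) w)}.
    apply: filter_forall => i; have [_ -> yi] := yP i.
    apply: filterS3 (ae_and (repr_mul (y i) (D i)) yi)
      (repr_sub (Lp_path P X (Num.min (et i) t)) (Lp_path P X (Num.min (es i) t)))
      (ae_and (L0_repr_class P (X (Num.min (et i) t))) (L0_repr_class P (X (Num.min (es i) t)))).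
    by move=> w [-> ->]; rewrite /D => -> [-> ->].
  apply: filterS2 h1 (repr_sum (index_enum _) xpredT (fun i : 'I_(esize e) => (ef i : operator P) (D i))) => w hw ->.
  by apply: eq_bigr => i _; exact: hw.
Qed.

Lemma Pbct_locally_bounded (Y : process T R) : Pbct F Y ->
  locally_bounded_op F q (mult_process P Y).
Proof.
move=> [mY bY]; split.
  move=> s; exists s, (L0_class P (Y s)) => //; split.
    have [M MP] := bY s; have M0 : 0 <= M.
      by apply: le_trans (normc_ge0 _) (MP s point (lexx _)).
    apply: (@le_lt_trans _ _ M%:E); last exact: ltry.
    by apply: Lpnorm_const => //; [exact: leey|move=> w; exact: MP].
  exists (Y s) => //; have [mr mi] := (measurable_wrtP _ _).1 mY.
  by apply/(@measurable_wrtP R T); split;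
    [exact: (@predictable_adapted _ _ _ _ _ hF (re_part Y) s mr)|
     exact: (@predictable_adapted _ _ _ _ _ hF (im_part Y) s mi)].
move=> t; have [M MP] := bY t; have M0 : 0 <= M.
  by apply: le_trans (normc_ge0 _) (MP t point (lexx _)).
apply: (@le_lt_trans _ _ M%:E); last exact: ltry.
apply: ge_ereal_sup => _ [s st <-]; apply: op_norm_mult_le => //.
by apply: filterS (L0_repr_class P (Y s)) => w ->; exact: MP.
Qed.

(** Bounds on [0, k] for all integers [k], in the form required by [envelope].
    *)
Lemma local_op_bound (g : time -> \bar R) :
  (forall t, (ereal_sup [set g s | s in [set s | s <= t]%R] < +oo)%E) -> (forall s, (0 <= g s)%E) ->
  exists c : nat -> R, (forall k, 0 <= c k) /\
    forall k (s : time), s%:num <= k%:R -> g s <=e c k.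
Proof.
move=> gfin g0; have [nt ntE] : exists nt : nat -> time, forall k, (nt k)%:num = k%:R.
  by exists (fun k => `|k%:R|%:nng) => k; rewrite /= ger0_norm.
pose S k := ereal_sup [set g s | s in [set s | s <= nt k]%R].
have gS k s : s%:num <= k%:R -> (g s <= S k)%E.
  by move=> sk; apply: ereal_sup_ubound; exists s => //=; rewrite -num_le ntE.
have S0 k : (0 <= S k)%E by apply: le_trans (g0 (nt k)) (gS k _ _); rewrite ntE.
exists (fun k => fine (S k)); split; first by move=> k; exact: fine_ge0.
by move=> k s sk; rewrite fineK ?gS// ge0_fin_numE ?gfin.
Qed.

(** At each time the limit operator is the multiplication by the almost sure
    limit of the [Yn], which is bounded by the norm of the operator, hence by
    the envelope; so the predictable limit of [predictable_limit] is a version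
    of it at all times. *)
Lemma representation_closed (Yn : nat -> process T R) (H : time -> operator P) :
  (forall n, Pbct F (Yn n)) -> locally_bounded_op F q H ->
  (forall t, op_norm q (mult_process P (Yn n) t - H t) @[n --> \oo] --> 0%E) ->
  exists2 Y : process T R, Pbct F Y & H = mult_process P Y.
Proof.
move=> bYn [Hmult Hsup] cvH.
have /choice[y yP] : forall t, exists y : L0, H t = mult_op y.
  by move=> t; have [s [y _ <-]] := Hmult t; exists y.
have [c [c0 cP]] := local_op_bound Hsup (fun s => op_norm_ge0 hq (H s)).
have mYn n := (measurable_wrtP _ _).1 (bYn n).1.
(* Real and imaginary parts are handled separately; both moduli are below that
   of the complex number, so that one envelope serves both. *)
have [br [mbr brc] brE] := predictable_limit hF c0 (fun n => (mYn n).1).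
have [bi [mbi bic] biE] := predictable_limit hF c0 (fun n => (mYn n).2).
have lp f : rmeas (predictable_sets F) f -> (forall rw, `|f rw| <= envelope c rw.1) ->
    loc_bounded_predictable F f.
  move=> mf fc; apply: (local_lpred hF) => // t.
  exists (c 0%N + \sum_(k < (Num.truncn t%:num).+1) c k.+1) => r w rt.
  by apply: le_trans (fc (r, w)) _; exact: envelope_le.
have [|Y YE] := @process_of _ T R (fun t w => (br (t, w) +i* bi (t, w))%C).
  move=> t; split => /=; apply: (rmeasF_measurable hF (t := t)).
    exact: (@predictable_adapted _ _ _ _ _ hF br t mbr).
  exact: (@predictable_adapted _ _ _ _ _ hF bi t mbi).
exists Y.
  apply: lpred_Pbct.
    rewrite (_ : re_part Y = br); first exact: lp.
    by apply/funext => -[r w]; rewrite /re_part/= YE.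
  rewrite (_ : im_part Y = bi); first exact: lp.
  by apply/funext => -[r w]; rewrite /im_part/= YE.
apply/funext => t; rewrite yP /mult_process; congr mult_op; apply: L0_eq.
have [m tm cm] := envelope_ge t c0.
have yc : {ae P, forall w, normc (repr (y t) w) <= envelope c t}.
  apply: (op_norm_mult_bound hq (envelope_ge0 t c0)); rewrite -yP.
  by apply: le_trans (cP m t tm) _; rewrite lee_fin.
have cv : {ae P, forall w, repr (L0_class P (Yn n t)) w @[n --> \oo] --> repr (y t) w}.
  by apply: mult_op_cvg; rewrite -yP; exact: cvH.
have hn : {ae P, forall w, forall n, repr (L0_class P (Yn n t)) w = Yn n t w}.
  by apply: ae_foralln => n; exact: L0_repr_class.
apply: filterS3 cv (ae_and hn yc) (L0_repr_class P (Y t)) => w cw [hw yw] ->.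
have {cw} /cvg_ReIm[cr ci] : Yn n t w @[n --> \oo] --> repr (y t) w.
  by move: cw; under eq_cvg do rewrite hw.
rewrite YE; apply: complex_eq => /=.
  rewrite (brE (t, w) _ cr)//; apply: le_trans yw; exact: Re_le_normc.
rewrite (biE (t, w) _ ci)//; apply: le_trans yw; exact: Im_le_normc.
Qed.

(** The representable families contain the elementary ones and are closed
    under locally bounded convergence, and the integrands form the smallest
    such class. *)
Theorem nc_integrands_representation (H : time -> operator P) : nc_integrands F q H ->
  locally_bounded_op F q H /\ exists2 Y : process T R, Pbct F Y & H = mult_process P Y.
Proof.
move=> HH; pose S := [set H | locally_bounded_op F q H /\
  exists2 Y : process T R, Pbct F Y & H = mult_process P Y].
suff : S H by [].
apply: HH; split; first split.
- by move=> G [].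
- move=> Hn G SHn lG [cvH _]; split=> //.
  have /choice[Yn YnP] : forall n, exists Y : process T R, Pbct F Y /\ Hn n = mult_process P Y.
    by move=> n; have [_ [Y bY HY]] := SHn n; exists Y.
  apply: (@representation_closed Yn) => // [n|t]; first by have [] := YnP n.
  have E n : mult_process P (Yn n) = Hn n by have [_ ->] := YnP n.
  by under eq_cvg do rewrite E; exact: cvH.
move=> _ [e he ->]; have [e' [Y [_ _ bY eY _]]] := elementary_representation he.
by split; [rewrite eY; exact: Pbct_locally_bounded|exists Y].
Qed.

Lemma nc_integrands_closed (Hn : nat -> time -> operator P) (H : time -> operator P) :
  (forall n, nc_integrands F q (Hn n)) -> locally_bounded_op F q H ->
  locally_bounded_cvg q Hn H -> nc_integrands F q H.
Proof. by move=> hn lH cH S HS; apply: (HS.1.2 Hn) => // n; exact: hn. Qed.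

End representation.

(** * From classical to noncommutative integrators *)

Section classical_to_nc.
Context d (T : measurableType d) (R : realType) (P : probability T R).
Variable F : {nonneg R} -> set (set T).
Hypothesis hF : usual_conditions P F.
Variables (p : R) (q : \bar R).
Hypotheses (hp : 1 <= p) (hq : (1 <= q)%E).
Local Notation time := {nonneg R}.
Local Notation L0 := (L0 P).

Lemma Lpnorm_classB (f g : {mfun T >-> R[i]}) :
  Lpnorm p%:E (L0_class P f - L0_class P g) = pnorm P p (fun w => normc (f w - g w)).
Proof.
have [fr fi] := measurable_mfun f; have [gr gi] := measurable_mfun g.
apply: pnorm_ae => //; first exact: measurable_normc_repr.
  apply: measurable_normc.
    by under eq_fun do rewrite ReB; exact: measurable_funB.
  by under eq_fun do rewrite ImB; exact: measurable_funB.
apply: filterS3 (repr_sub (L0_class P f) (L0_class P g)) (L0_repr_class P f)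
  (L0_repr_class P g) => w h hf hg.
by rewrite /= h hf hg.
Qed.

Lemma Lpnorm_sub_le (x y z : L0) (a b : R) : Lpnorm p%:E (x - y) <=e a ->
  Lpnorm p%:E (y - z) <=e b -> Lpnorm p%:E (x - z) <=e a + b.
Proof.
move=> h1 h2; have m := @measurable_normc_repr _ T R P.
apply: le_trans (pnormD_le hp (m (x - y)) (m (y - z)) h1 h2).
apply: pnorm_mono => //; first exact: measurable_funD.
apply: filterS3 (repr_sub x y) (repr_sub y z) (repr_sub x z) => w /= -> -> ->.
rewrite !ger0_norm ?addr_ge0 ?normc_ge0//.
by rewrite -(subrKA (repr y w)) normcD.
Qed.

(** The running supremum may be infinite on a null set; its finite part is a
    real majorant in L^p. *)
Lemma Rap_majorant (Z : process T R) t : Rap_classical P F p%:E Z ->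
  exists S : T -> R, [/\ measurable_fun setT S, (pnorm P p S < +oo)%E &
    {ae P, forall w, forall s, s <= t -> normc (Z s w) <= S w}].
Proof.
move=> [_ rZ supZ]; set f := running_sup Z t.
have mf : measurable_fun setT f.
  by apply: measurable_running_sup => // s; exact: measurable_mfun.
have p0 : 0 < p by apply: lt_le_trans hp.
have f0 w : (0 <= f w)%E.
  apply: (@le_trans _ _ (normc (Z t w))%:E); first by rewrite lee_fin normc_ge0.
  by apply: ereal_sup_ubound; exists t => //=.
have ffin : {ae P, forall w, f w \is a fin_num}.
  have : P.-integrable setT (fun w => (`|f w| `^ p)%E).
    apply/integrableP; split.
      by apply: (measurableT_comp (measurable_poweR p)); exact: measurableT_comp.
    under eq_integral do rewrite gee0_abs ?poweR_ge0//.
    by rewrite -poweR_Lnorm ?gt_eqF//; exact: poweR_lty (supZ t).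
  move=> /(integrable_ae measurableT); apply: filterS => w /(_ I).
  have := f0 w; case: (f w) => [r|_|] //=.
  by rewrite gt_eqF.
exists (fun w => fine (f w)); split.
- exact: (measurableT_comp (fine_measurable measurableT)).
- apply: le_lt_trans (supZ t); apply: Lnorm_mono => //.
    by apply/measurable_EFinP; exact: (measurableT_comp (fine_measurable measurableT)).
  by apply: filterS ffin => w fw; rewrite -/(f w) -[in leRHS](fineK fw).
- apply: filterS ffin => w fw s st; rewrite -lee_fin fineK//.
  by apply: ereal_sup_ubound; exists s.
Qed.

(** Pathwise limits of a process of the classical range, along times in a
    bounded interval, are limits in L^p by dominated convergence. *)
Lemma Rap_sequence_dct (Z : process T R) t (s : nat -> time) (L : {mfun T >-> R[i]}) :
  Rap_classical P F p%:E Z -> (forall n, s n <= t) ->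
  (forall w, Z (s n) w @[n --> \oo] --> L w) ->
  Lpnorm p%:E (L0_class P (Z (s n)) - L0_class P L) @[n --> \oo] --> 0%E.
Proof.
move=> RZ st ZL; have [S [mS Sfin SZ]] := Rap_majorant t RZ.
have mZ n : measurable_fun setT (fun w => normc (Z (s n) w - L w)).
  have [fr fi] := measurable_mfun (Z (s n)); have [gr gi] := measurable_mfun L.
  apply: measurable_normc.
    by under eq_fun do rewrite ReB; exact: measurable_funB.
  by under eq_fun do rewrite ImB; exact: measurable_funB.
under eq_cvg do rewrite Lpnorm_classB.
apply: (pnorm_dct hp mZ (g := fun w => S w + S w)).
- exact: measurable_funD.
- by apply: le_lt_trans (pnormD P hp mS mS) _; rewrite lte_add_pinfty.
- apply: nearW => w; apply/cvgrPdist_le => e e0.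
  have /cvg_normcP := ZL w; move=> /(_ _ e0); apply: filterS => n.
  by rewrite sub0r normrN ger0_norm ?normc_ge0.
- apply: filterS SZ => w h n; rewrite ger0_norm ?normc_ge0//.
  have hL : normc (L w) <= S w.
    apply/ler_addgt0Pr => e e0; have /cvg_normcP := ZL w; move=> /(_ _ e0)[N _ NP].
    have := NP N (leqnn N); rewrite /= => h'.
    rewrite -(subrK (Z (s N) w) (L w)) (le_trans (normcD _ _))// addrC lerD//; first exact: h.
    by rewrite normcB.
  by rewrite (le_trans (normcD _ _))// normcN lerD//; exact: h.
Qed.

(** One-sided limits in L^p are tested on sequences, where [Rap_sequence_dct]
    applies to the pathwise limits. *)
Lemma Rap_classical_nc (Z : process T R) : Rap_classical P F p%:E Z ->
  Rap_nc F p%:E (fun t => L0_class P (Z t)).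
Proof.
move=> RZ; have [aZ rZ _] := RZ; split.
- move=> t; split; last by exists (Z t).
  have [S [mS Sfin SZ]] := Rap_majorant t RZ; apply: le_lt_trans Sfin.
  apply: pnorm_mono => //; first exact: measurable_normc_repr.
  apply: filterS2 SZ (L0_repr_class P (Z t)) => w h /= ->.
  by rewrite ger0_norm ?normc_ge0// (le_trans (h t (lexx _)))// ler_norm.
- move=> t; apply: near_cvge0 => [s|e e0]; first exact: Lpnorm_ge0.
  apply/(near_right_time t (fun s => Lpnorm p%:E (L0_class P (Z s) - L0_class P (Z t)) <=e e)).
  apply: contrapT => /forall2NP H.
  have [z zE] : exists z : time, z%:num = t%:num + 1.
    by exists `|t%:num + 1|%:nng; rewrite /= ger0_norm// addr_ge0.
  have /choice[s sP] : forall n : nat, exists s : time, [/\ t < s, s%:num < t%:num + n.+1%:R^-1 &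
      ~ Lpnorm p%:E (L0_class P (Z s) - L0_class P (Z t)) <=e e].
    move=> n; have [|/existsNP[s /not_implyP[ts /not_implyP[sn h]]]] := H n.+1%:R^-1.
      by rewrite invr_gt0 ltr0n.
    by exists s.
  have sz n : s n <= z.
    have [_ h _] := sP n; rewrite -num_le zE (le_trans (ltW h))// lerD2l.
    by rewrite invf_le1// ler1n.
  have cv w : Z (s n) w @[n --> \oo] --> Z t w.
    apply/cvg_normcP => e' e'0; have [rw _] := rZ w.
    have /cvg_normcP := rw t; move=> /(_ _ e'0) h.
    have {h} /(near_right_time t (fun s => normc (Z s w - Z t w) <= e'))[dlt d0 hd] := h.
    exists (Num.truncn dlt^-1) => // n /= Nn; have [ts sn _] := sP n; apply: hd => //.
    apply: lt_le_trans sn _; rewrite lerD2l -[leRHS]invrK lef_pV2 ?posrE ?invr_gt0//.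
    by rewrite (le_trans (ltW (truncnS_gt _)))// ler_nat.
  have [N _ NP] := cvge0_near e0 (Rap_sequence_dct RZ sz cv).
  by have [_ _] := sP N; apply; exact: NP (leqnn N).
- move=> t t0.
  have [lo loE] : exists lo : nat -> time, forall n, (lo n)%:num = t%:num * (1 - n.+1%:R^-1).
    exists (fun n => `|t%:num * (1 - n.+1%:R^-1)|%:nng) => n.
    rewrite /= ger0_norm// mulr_ge0// subr_ge0 invf_le1// ?ler1n//.
  have lot n : lo n < t.
    by rewrite -num_lt loE -[ltRHS]mulr1 ltr_pM2l// ltrBlDr ltrDl invr_gt0.
  have lo_large (s : time) : s < t -> \forall n \near \oo, s < lo n.
    move=> st; have d0 : 0 < 1 - s%:num / t%:num.
      by rewrite subr_gt0 ltr_pdivrMr// mul1r num_lt.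
    exists (Num.truncn (1 - s%:num / t%:num)^-1) => // n /= Nn.
    rewrite -num_lt loE mulrC -ltr_pdivrMr// ltrBrDr -ltrBrDl.
    have : (1 - s%:num / t%:num)^-1 < n.+1%:R.
      by apply: lt_le_trans (truncnS_gt _) _; rewrite ler_nat.
    by move=> h; rewrite -[ltRHS]invrK ltf_pV2 ?posrE ?invr_gt0.
  (* Every sequence squeezed between [lo n] and [t] approaches [t] from the
     left. *)
  have seq_cvg (s : nat -> time) w (l : R[i]) : (forall n, lo n <= s n) -> (forall n, s n < t) ->
      (Z `|r|%:nng w @[r --> t%:num^'-] --> l) -> Z (s n) w @[n --> \oo] --> l.
    move=> los stt /cvg_normcP h; apply/cvg_normcP => e e0.
    have := h _ e0 => /(@near_left_time R t (fun s => normc (Z s w - l) <= e) t0)[r rt hr].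
    apply: filterS (lo_large r rt) => n rn; apply: hr => //; exact: lt_le_trans (los n).
  have /choice[l lP] : forall w, exists l : R[i], Z `|r|%:nng w @[r --> t%:num^'-] --> l.
    by move=> w; have [_ h] := rZ w; exact: h.
  have locv w : Z (lo n) w @[n --> \oo] --> l w by exact: seq_cvg (lP w).
  have [||L LE] := @random_variable_of _ T R l.
  + apply: (@measurable_fun_cvg _ T R setT (fun n w => Re (Z (lo n) w))).
      by move=> n; have [] := measurable_mfun (Z (lo n)).
    by move=> w _; have /cvg_ReIm[] := locv w.
  + apply: (@measurable_fun_cvg _ T R setT (fun n w => Im (Z (lo n) w))).
      by move=> n; have [] := measurable_mfun (Z (lo n)).
    by move=> w _; have /cvg_ReIm[] := locv w.
  exists (L0_class P L).
    have [S [mS Sfin SZ]] := Rap_majorant t RZ; apply: le_lt_trans Sfin.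
    apply: pnorm_mono => //; first exact: measurable_normc_repr.
    apply: filterS2 SZ (L0_repr_class P L) => w h /= ->.
    rewrite ger0_norm ?normc_ge0// LE (le_trans _ (ler_norm _))//.
    apply/ler_addgt0Pr => e e0; have /cvg_normcP := locv w; move=> /(_ _ e0)[N _ NP].
    have := NP N (leqnn N); rewrite /= => h'.
    rewrite -(subrK (Z (lo N) w) (l w)) (le_trans (normcD _ _))// addrC lerD//.
      by apply: h; exact: ltW.
    by rewrite normcB.
  apply: near_cvge0 => [s|e e0]; first exact: Lpnorm_ge0.
  apply/(@near_left_time R t (fun s => Lpnorm p%:E (L0_class P (Z s) - L0_class P L) <=e e) t0).
  apply: contrapT => /forall2NP H.
  have /choice[s sP] : forall n : nat, exists s : time, [/\ lo n < s, s < t &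
      ~ Lpnorm p%:E (L0_class P (Z s) - L0_class P L) <=e e].
    move=> n; have [//|/existsNP[s /not_implyP[ts /not_implyP[sn h]]]] := H (lo n).
    by exists s.
  have cv w : Z (s n) w @[n --> \oo] --> L w.
    by rewrite LE; apply: seq_cvg (lP w) => n; have [h1 h2 _] := sP n => //; exact: ltW.
  have st n : s n <= t by have [_ /ltW] := sP n.
  have [N _ NP] := cvge0_near e0 (Rap_sequence_dct RZ st cv).
  by have [_ _] := sP N; apply; exact: NP (leqnn N).
Qed.

Section one_integral.
Variables (X : process T R) (I : process T R -> process T R).
Hypothesis HI : classical_integral P F p%:E X I.
Hypothesis Hmod : forall Y Z : process T R, Pbct F Y -> Pbct F Z -> modification P Y Z ->
  indistinguishable P (I Y) (I Z).

Lemma representatives_agree (Y Z : process T R) : Pbct F Y -> Pbct F Z ->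
  mult_process P Y = mult_process P Z -> forall t, L0_class P (I Y t) = L0_class P (I Z t).
Proof.
move=> bY bZ YZ t; apply/L0_classP.
have : indistinguishable P (I Y) (I Z).
  apply: Hmod => // s; apply/L0_classP; apply: mult_op_inj.
  exact: (congr1 (fun H => H s) YZ).
by apply: filterS => w; apply.
Qed.

(** At each time the differences [Yn - Y] tend to 0 and are bounded, almost
    surely; [predictable_null_sequence] corrects them on a set with null
    sections so that both properties hold everywhere. *)
Lemma modified_sequence (Yn : nat -> process T R) (Y : process T R) :
  (forall n, Pbct F (Yn n)) -> Pbct F Y ->
  locally_bounded_cvg q (fun n => mult_process P (Yn n)) (mult_process P Y) ->
  exists Yn' : nat -> process T R, [/\ forall n, Pbct F (Yn' n),
    forall n, modification P (Yn n) (Yn' n) & bounded_pointwise_cvg Yn' Y].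
Proof.
move=> bYn bY [cvH supH].
have g0 s : (0 <= ereal_sup (range (fun n => op_norm q (mult_process P (Yn n) s))))%E.
  apply: le_trans (op_norm_ge0 hq (mult_process P (Yn 0%N) s)) _.
  by apply: ereal_sup_ubound; exists 0%N.
have gfin t : (ereal_sup [set ereal_sup (range (fun n => op_norm q (mult_process P (Yn n) s)))
    | s in [set s | s <= t]%R] < +oo)%E.
  apply: le_lt_trans (supH t); apply: ge_ereal_sup => _ [s st <-].
  apply: ge_ereal_sup => _ [n _ <-]; apply: ereal_sup_ubound; exists (n, s) => //=.
have [c1 [c10 c1P]] := local_op_bound gfin g0.
have [_ lH] := Pbct_locally_bounded hF hq bY.
have [c2 [c20 c2P]] := local_op_bound lH (fun s => op_norm_ge0 hq (mult_process P Y s)).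
(* The envelope bounds the differences: one part for the sequence, one for the
   limit. *)
pose c k := c1 k + c2 k; have c0 k : 0 <= c k by exact: addr_ge0.
have mYn n := (measurable_wrtP _ _).1 (bYn n).1.
have mY := (measurable_wrtP _ _).1 bY.1.
have mr n : rmeas (predictable_sets F) (fun rw => re_part (Yn n) rw - re_part Y rw).
  by apply: measurable_funB; [exact: (mYn n).1|exact: mY.1].
have mi n : rmeas (predictable_sets F) (fun rw => im_part (Yn n) rw - im_part Y rw).
  by apply: measurable_funB; [exact: (mYn n).2|exact: mY.2].
have [br [mbr brc br0 brE]] := predictable_null_sequence hF c0 mr.
have [bi [mbi bic bi0 biE]] := predictable_null_sequence hF c0 mi.
have lp f : rmeas (predictable_sets F) f -> (forall rw, `|f rw| <= envelope c rw.1) ->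
    loc_bounded_predictable F f.
  move=> mf fc; apply: (local_lpred hF) => // t.
  exists (c 0%N + \sum_(k < (Num.truncn t%:num).+1) c k.+1) => r w rt.
  by apply: le_trans (fc (r, w)) _; exact: envelope_le.
have [lr li] := Pbct_lpred hF bY.
have /choice[Yn' YE] : forall n, exists Z : process T R, forall t w,
    Z t w = Y t w + (br n (t, w) +i* bi n (t, w))%C.
  move=> n; apply: (@process_of _ T R (fun t w => Y t w + (br n (t, w) +i* bi n (t, w))%C)) => t.
  have [m1 m2] := measurable_mfun (Y t); split.
    under eq_fun do rewrite ReD /=; apply: measurable_funD => //.
    apply: (rmeasF_measurable hF (t := t)).
    exact: (@predictable_adapted _ _ _ _ _ hF (br n) t (mbr n)).
  under eq_fun do rewrite ImD /=; apply: measurable_funD => //.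
  apply: (rmeasF_measurable hF (t := t)).
  exact: (@predictable_adapted _ _ _ _ _ hF (bi n) t (mbi n)).
exists Yn'; split.
- move=> n; apply: lpred_Pbct.
    rewrite (_ : re_part (Yn' n) = fun rw => re_part Y rw + 1 * br n rw).
      by apply: lpred_lin => //; exact: lp.
    by apply/funext => -[r w]; rewrite /re_part/= YE ReD /= mul1r.
  rewrite (_ : im_part (Yn' n) = fun rw => im_part Y rw + 1 * bi n rw).
    by apply: lpred_lin => //; exact: lp.
  by apply/funext => -[r w]; rewrite /im_part/= YE ImD /= mul1r.
- move=> n t; have [m tm cm] := envelope_ge t c0.
  have cv : {ae P, forall w, repr (L0_class P (Yn n t)) w @[n --> \oo] --> repr (L0_class P (Y t)) w}.
    by apply: (mult_op_cvg hq); exact: cvH.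
  have hn : {ae P, forall w, forall n, repr (L0_class P (Yn n t)) w = Yn n t w}.
    by apply: ae_foralln => k; exact: L0_repr_class.
  have hb : {ae P, forall w, forall n, normc (repr (L0_class P (Yn n t)) w) <= c1 m}.
    apply: ae_foralln => k; apply: (op_norm_mult_bound hq (c10 m)).
    apply: le_trans (c1P m t tm); apply: ereal_sup_ubound; by exists k.
  have hY : {ae P, forall w, normc (repr (L0_class P (Y t)) w) <= c2 m}.
    by apply: (op_norm_mult_bound hq (c20 m)); exact: c2P.
  apply: filterS3 cv (ae_and hn (L0_repr_class P (Y t))) (ae_and hb hY) => w + [h1 h2] [h3 h4].
  rewrite h2; under eq_cvg do rewrite h1; move=> /cvg_ReIm[cr ci].
  have bnd k : normc (Yn k t w - Y t w) <= envelope c t.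
    rewrite (le_trans (normcD _ _))// normcN (le_trans _ cm)// -h2 -h1.
    by apply: lerD.
  have zr : re_part (Yn k) (t, w) - re_part Y (t, w) @[k --> \oo] --> 0.
    by rewrite -(subrr (re_part Y (t, w))); apply: cvgB => //; exact: cvg_cst.
  have zi : im_part (Yn k) (t, w) - im_part Y (t, w) @[k --> \oo] --> 0.
    by rewrite -(subrr (im_part Y (t, w))); apply: cvgB => //; exact: cvg_cst.
  rewrite YE; apply: complex_eq.
    rewrite ReD /= (brE (t, w) _ zr); first by rewrite /re_part/=; ring.
    by move=> k; rewrite /re_part/= -ReB (le_trans (Re_le_normc _))//; exact: bnd.
  rewrite ImD /= (biE (t, w) _ zi); first by rewrite /im_part/=; ring.
  by move=> k; rewrite /im_part/= -ImB (le_trans (Im_le_normc _))//; exact: bnd.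
- split=> [t w|t].
    under eq_cvg do rewrite YE; apply/cvg_ReIm; split.
      rewrite -[X in _ --> X]addr0; under eq_cvg do rewrite ReD /=.
      by apply: cvgD; [exact: cvg_cst|exact: br0].
    rewrite -[X in _ --> X]addr0; under eq_cvg do rewrite ImD /=.
    by apply: cvgD; [exact: cvg_cst|exact: bi0].
  have [M MP] := bY.2 t.
  pose B := c 0%N + \sum_(k < (Num.truncn t%:num).+1) c k.+1.
  exists (M + (B + B)) => n s w st; rewrite YE (le_trans (normcD _ _))// lerD//; first exact: MP.
  have eB : envelope c s <= B by exact: envelope_le.
  rewrite (le_trans (normc_le_ReIm _))//= lerD//.
    exact: le_trans (brc n (s, w)) eB.
  exact: le_trans (bic n (s, w)) eB.
Qed.

(** The integral of [H] is the path of classes of [I Y] for any representation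
    of [H] by a process [Y] of [Pbct]; the choice does not matter by
    [representatives_agree]. *)
Theorem classical_nc_integral : exists J0 : (time -> operator P) -> time -> L0,
  nc_integral F p%:E q (Lp_path P X) J0 /\
  forall Y : process T R, Pbct F Y -> nc_integrands F q (mult_process P Y) ->
    forall t, J0 (mult_process P Y) t = L0_class P (I Y t).
Proof.
have [HR HE HC] := HI.
have /choice[rep repP] : forall H : time -> operator P, exists Y : process T R,
    nc_integrands F q H -> Pbct F Y /\ H = mult_process P Y.
  move=> H; have [hH|nH] := pselect (nc_integrands F q H).
    by have [_ [Y bY HY]] := nc_integrands_representation hF p hq hH; exists Y.
  by exists X.
pose J0 H t := L0_class P (I (rep H) t).
have J0E (Y : process T R) : Pbct F Y -> nc_integrands F q (mult_process P Y) ->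
    forall t, J0 (mult_process P Y) t = L0_class P (I Y t).
  by move=> bY hY t; have [b e] := repP _ hY; apply: representatives_agree.
exists J0; split => //; split.
- by move=> H /repP[b _]; apply: Rap_classical_nc; exact: HR.
- move=> e he.
  have [e' [Y [he' YE bY eY eX]]] := elementary_representation hF p he.
  have hY : nc_integrands F q (mult_process P Y).
    by rewrite -eY; exact: elementary_nc_integrand.
  rewrite eY; apply/funext => t; rewrite (J0E Y bY hY); apply: L0_eq.
  apply: filterS3 (HE Y e' he' YE) (eX X t) (L0_repr_class P (I Y t)) => w h -> ->.
  exact: h.
- move=> Hn H hHn hH cvH.
  have bYn n := (repP _ (hHn n)).1; have eYn n := (repP _ (hHn n)).2.
  have [bY eY] := repP _ hH.
  have [|Yn' [bYn' modY cvY]] := @modified_sequence (fun n => rep (Hn n)) (rep H) bYn bY.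
    rewrite -eY (_ : (fun n => mult_process P (rep (Hn n))) = Hn)//.
    by apply/funext => n; rewrite -eYn.
  move=> t; have := HC Yn' (rep H) bYn' bY cvY t.
  have S0 n : (0 <= ereal_sup [set Lpnorm p%:E (J0 (Hn n) s - J0 H s)%R | s in [set s | s <= t]%R])%E.
    apply: (@le_trans _ _ (Lpnorm p%:E (J0 (Hn n) t - J0 H t)%R)); first exact: Lpnorm_ge0.
    by apply: ereal_sup_ubound; exists t => //=.
  move=> /cvge0P h; apply/cvge0P => // e e0.
  have [|N NP] := h _ e e0; first by move=> n; exact: Lnorm_ge0.
  exists N => n Nn; apply: le_trans (NP n Nn).
  apply: ge_ereal_sup => _ [s st <-].
  have -> : J0 (Hn n) s = L0_class P (I (Yn' n) s).
    apply/L0_classP; have := Hmod (bYn n) (bYn' n) (modY n).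
    by apply: filterS => w; apply.
  rewrite Lpnorm_classB.
  have [_ r1 _] := HR _ (bYn' n); have [_ r2 _] := HR _ bY.
  have rr w : rcll (fun s => I (Yn' n) s w - I (rep H) s w).
    have /rcllP[a1 a2] := r1 w; have /rcllP[b1 b2] := r2 w; apply/rcllP; split.
      by under eq_fun do rewrite ReB; exact: cadlagB.
    by under eq_fun do rewrite ImB; exact: cadlagB.
  have mm u : measurable_fun setT (fun w => Re (I (Yn' n) u w - I (rep H) u w)) /\
      measurable_fun setT (fun w => Im (I (Yn' n) u w - I (rep H) u w)).
    have [fr fi] := measurable_mfun (I (Yn' n) u); have [gr gi] := measurable_mfun (I (rep H) u).
    split; first by under eq_fun do rewrite ReB; exact: measurable_funB.
    by under eq_fun do rewrite ImB; exact: measurable_funB.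
  apply: Lnorm_mono; first exact: lt_le_trans hp.
  + by apply/measurable_EFinP; have [m1 m2] := mm s; exact: measurable_normc.
  + exact: (measurable_running_sup (Y := fun s w => I (Yn' n) s w - I (rep H) s w)).
  apply: nearW => w /=; apply: (@le_trans _ _ (normc (I (Yn' n) s w - I (rep H) s w))%:E).
    by rewrite lee_fin ger0_norm ?normc_ge0.
  apply: le_trans (lee_abs _); apply: ereal_sup_ubound; exists s => //.
Qed.

End one_integral.

(** The integrands on which two integrals agree contain the elementary ones
    and are closed under locally bounded convergence. *)
Lemma nc_integral_unique (x : time -> L0) (J J' : (time -> operator P) -> time -> L0) :
  nc_integral F p%:E q x J -> nc_integral F p%:E q x J' ->
  forall H, nc_integrands F q H -> J H = J' H.
Proof.
move=> [HR HE HC] [HR' HE' HC'] H hH.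
pose S := [set H | nc_integrands F q H /\ J H = J' H].
suff [] : S H by [].
apply: hH; split; first split.
- by move=> G [hG _]; have [] := nc_integrands_representation hF p hq hG.
- move=> Hn G SHn lG cvG.
  have hn n := (SHn n).1.
  have hG : nc_integrands F q G := nc_integrands_closed hn lG cvG.
  split => //; apply/funext => t.
  have small (e : R) : 0 < e -> Lpnorm p%:E (J G t - J' G t) <=e e.
    move=> e0; have e2 : 0 < e / 2 by rewrite divr_gt0.
    have [N1 _ N1P] := cvge0_near e2 (HC Hn G hn hG cvG t).
    have [N2 _ N2P] := cvge0_near e2 (HC' Hn G hn hG cvG t).
    pose n := maxn N1 N2; have [_ eJ] := SHn n.
    rewrite [e]splitr; apply: (@Lpnorm_sub_le _ (J (Hn n) t)).
      rewrite -Lpnorm_opp// opprB; apply: le_trans (N1P n (leq_maxl _ _)).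
      by apply: ereal_sup_ubound; exists t => //=.
    rewrite eJ; apply: le_trans (N2P n (leq_maxr _ _)).
    by apply: ereal_sup_ubound; exists t => //=.
  have z : Lpnorm p%:E (J G t - J' G t) = 0%E.
    apply/eqP; rewrite eq_le Lpnorm_ge0 andbT; apply/lee_addgt0Pr => e e0.
    by rewrite add0e small.
  have p1 : (1 <= p%:E)%E by rewrite lee_fin.
  apply: L0_eq; apply: filterS2 (Lpnorm_eq0 p1 z) (repr_sub (J G t) (J' G t)) => w ->.
  by move=> /esym/eqP; rewrite subr_eq0 => /eqP.
move=> _ [e he ->]; split; first exact: elementary_nc_integrand.
by rewrite HE// HE'.
Qed.

End classical_to_nc.

Unset Implicit Arguments.

Theorem theorem2p44 (d : measure_display) (T : measurableType d) (R : realType)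
    (P : probability T R) (F : {nonneg R} -> set (set T))
    (hF : usual_conditions P F)
    (p : R) (hp : 1 <= p) (q : \bar R) (hq : (1 <= q)%E)
    (X : process T R) (hX : forall t, Lp p%:E (Lp_path P X t)) :
  (nc_integrator F p%:E q (Lp_path P X) ->
     exists X' : process T R,
       modification P X' X /\ classical_integrator P F p%:E X') /\
  (forall I : process T R -> process T R,
     classical_integral P F p%:E X I ->
     (forall Y Z : process T R, Pbct F Y -> Pbct F Z -> modification P Y Z ->
        indistinguishable P (I Y) (I Z)) ->
     nc_integrator F p%:E q (Lp_path P X) /\
     forall J : ({nonneg R} -> operator P) -> {nonneg R} -> L0 P,
       nc_integral F p%:E q (Lp_path P X) J ->
       forall H : {nonneg R} -> operator P, nc_integrands F q H ->
         (exists2 Y : process T R, Pbct F Y & H = mult_process P Y) /\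
         (forall Y : process T R, Pbct F Y -> H = mult_process P Y ->
            forall t : {nonneg R}, J H t = L0_class P (I Y t))).
Proof.
split; first exact: nc_integrator_modification.
move=> I HI Hmod; have [J0 [HJ0 J0E]] := classical_nc_integral hF hp hq HI Hmod.
split; first by exists J0.
move=> J HJ H hH; split; first by have [] := nc_integrands_representation hF p hq hH.
move=> Y bY HY t; rewrite (nc_integral_unique hF hp hq HJ HJ0 hH) HY.
by apply: J0E; rewrite -?HY.
Qed.
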